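(* Let $\mathfrak{g}$ be a semisimple complex Lie algebra with Weyl group $W$, and let $\mathcal{T}(0)$ be the category of tilting modules in the principal block $\mathcal{O}(0)$ of the BGG category $\mathcal{O}$. Set $$B(0)=\{\bar g_i^x(T(y))\mid x,y\in W,\ x\geq y,\ i=1,2,\dots,(T(y):\Delta(x))\}.$$ Then every morphism in the additive category $\mathcal{T}(0)$ is obtained from $B(0)$ by taking direct sums, duals and compositions (and $\mathbb{C}$-linear combinations).
   Context: $\mathfrak{h}\subset\mathfrak{b}\subset\mathfrak{g}$ are a Cartan and a Borel subalgebra, $\cdot$ is the dot action of $W$ on $\mathfrak{h}^*$, $\leq$ is the Bruhat order on $W$. For $w\in W$ write $\Delta(w)$ for the Verma module with highest weight $w\cdot0$ and $T(w)$ for the indecomposable tilting module in $\mathcal{O}$ with highest weight $w\cdot0$. (A tilting module in $\mathcal{O}$ is one having both a Verma filtration and a dual Verma filtration.) $\mathcal{T}(0)$ is the additive category whose indecomposable objects are the $T(w)$, $w\in W$. $(Q:\Delta(x))$ is the multiplicity of $\Delta(x)$ in a Verma filtration of the tilting module $Q$; it equals $\dim\mathrm{Hom}_{\mathcal{O}}(\Delta(x),Q)$. For a tilting module $Q$ in $\mathcal{O}(0)$ and $x\in W$ choose a basis $g_1^x(Q),\dots,g_s^x(Q)$ of $\mathrm{Hom}_{\mathcal{O}}(\Delta(x),Q)$ and for each $i$ an extension $\bar g_i^x(Q)\in\mathrm{Hom}_{\mathcal{O}}(T(x),Q)$ of $g_i^x(Q)$ along $\Delta(x)\subset T(x)$ (for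 $Q=T(x)$ choose $\mathrm{id}_{T(x)}$). Duals: $\mathcal{O}$ has its standard contravariant duality $M\mapsto M^\vee$ fixing simple modules; each $T(w)$ is self-dual. Choosing symmetric isomorphisms $\phi_w:T(w)\to T(w)^\vee$ and extending to isomorphisms $\phi_Q:Q\to Q^\vee$ for all $Q\in\mathcal{T}(0)$ via decompositions into indecomposables, the dual of $f\in\mathrm{Hom}_{\mathcal{O}}(Q,P)$ is $f^\dagger=\phi_Q^{-1}\circ f^\vee\circ\phi_P\in\mathrm{Hom}_{\mathcal{O}}(P,Q)$. *)

(* Defs.v *)
From HB Require Import structures.
From mathcomp Require Import all_boot all_order all_algebra.
From mathcomp Require Import all_classical reals.
From mathcomp Require Export complex.

Set Implicit Arguments.
Unset Strict Implicit.
Unset Printing Implicit Defensive.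

Import GRing.Theory.
Local Open Scope ring_scope.

Record lieAlgebra (F : fieldType) := LieAlgebra {
  lie_sort :> vectType F;
  brk : lie_sort -> lie_sort -> lie_sort;
  brk_linl : forall y, linear (fun x => brk x y);
  brk_linr : forall x, linear (brk x);
  brk_alt : forall x, brk x x = 0;
  brk_jacobi : forall x y z,
    brk x (brk y z) + brk y (brk z x) + brk z (brk x y) = 0 }.

Section Subalgebras.
Variables (F : fieldType) (L : lieAlgebra F).
Implicit Types U V h b : {vspace L}.

Definition brkv U V : {vspace L} :=
  <<[seq brk x y | x <- vbasis U, y <- vbasis V]>>%VS.

Definition subalgebra U := (brkv U U <= U)%VS.
Definition ideal U := (brkv fullv U <= U)%VS.
Definition solvable U := exists n, iter n (fun V => brkv V V) U = 0%VS.

Definition semisimple := forall U, ideal U -> solvable U -> U = 0%VS.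

Definition ad_diagonalizable (t : L) :=
  exists2 X : seq L, basis_of fullv X &
    forall x, x \in X -> exists c : F, brk t x = c *: x.

Definition cartan h :=
  [/\ brkv h h = 0%VS,
      forall x, (forall t, t \in h -> brk t x = 0) -> x \in h
    & forall t, t \in h -> ad_diagonalizable t].

Definition borel b :=
  [/\ subalgebra b, solvable b
    & forall U, subalgebra U -> solvable U -> (b <= U)%VS -> U = b].

(* The anti-involution of L which defines the duality on category O.  That it
   exchanges the root spaces of opposite roots follows from tau = id on h. *)
Definition transposition h (tau : L -> L) :=
  [/\ linear tau, forall x y, tau (brk x y) = brk (tau y) (tau x),
      involutive tau & forall t, t \in h -> tau t = t].

End Subalgebras.

(* The dual space of h. *)
Notation hdual h := 'Hom(subvs_of h, _^o).

Section Weyl.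
Variables (F : fieldType) (L : lieAlgebra F) (h b : {vspace L}).
Local Notation hd := 'Hom(subvs_of h, F^o).

Definition root_vec (alpha : hd) (x : L) :=
  forall t : subvs_of h, brk (vsval t) x = (alpha t : F) *: x.

Definition is_root (alpha : hd) :=
  alpha != 0 /\ exists2 x, x != 0 & root_vec alpha x.

Definition is_coroot (alpha : hd) (t : subvs_of h) :=
  alpha t = 2%:R /\
  exists e f, [/\ root_vec alpha e, root_vec (- alpha) f & vsval t = brk e f].

Definition reflection (alpha : hd) (t : subvs_of h) (la : hd) : hd :=
  la - (la t : F) *: alpha.

Inductive is_reflection : (hd -> hd) -> Prop :=
| IsReflection alpha t :
    is_root alpha -> is_coroot alpha t -> is_reflection (reflection alpha t).

(* Reflections are involutions, so the monoid they generate is a group. *)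
Inductive weyl_pred : (hd -> hd) -> Prop :=
| Weyl_id : weyl_pred id
| Weyl_refl s w : is_reflection s -> weyl_pred w -> weyl_pred (s \o w).

Record weyl := Weyl { weyl_fun :> hd -> hd; weylP : weyl_pred weyl_fun }.

Definition pos_root (alpha : hd) :=
  is_root alpha /\ forall x, root_vec alpha x -> x \in b.

Definition simple_root (alpha : hd) :=
  pos_root alpha /\
  ~ exists beta gamma,
      [/\ pos_root beta, pos_root gamma & alpha = beta + gamma].

Inductive simple_word : nat -> (hd -> hd) -> Prop :=
| SimpleWord0 : simple_word 0 id
| SimpleWordS n alpha t w :
    simple_root alpha -> is_coroot alpha t -> simple_word n w ->
    simple_word n.+1 (reflection alpha t \o w).

Definition has_length (w : weyl) n :=
  simple_word n w /\ forall m, simple_word m w -> (n <= m)%N.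

Definition bruhat_arrow (y z : weyl) :=
  (exists2 s, is_reflection s & z = s \o y :> (hd -> hd)) /\
  exists m n, [/\ has_length y m, has_length z n & (m < n)%N].

(* bruhat x z means x <= z; the identity is the least element. *)
Inductive bruhat : weyl -> weyl -> Prop :=
| BruhatRefl x : bruhat x x
| BruhatStep x y z : bruhat x y -> bruhat_arrow y z -> bruhat x z.

Definition rho : hd :=
  (2%:R^-1 : F) *: \sum_(alpha \in [set a | pos_root a]%classic) alpha.

Definition dot (w : hd -> hd) (la : hd) : hd := w (la + rho) - rho.

Definition weight_le (mu la : hd) :=
  exists2 s : seq hd, forall beta, beta \in s -> pos_root beta &
    la - mu = \sum_(beta <- s) beta.

End Weyl.

Record gmod (F : fieldType) (L : lieAlgebra F) := GMod {
  gmod_sort :> lmodType F;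
  act : L -> gmod_sort -> gmod_sort;
  act_linl : forall v, linear (fun x => act x v);
  act_linr : forall x, linear (act x);
  act_brk : forall x y v, act (brk x y) v = act x (act y v) - act y (act x v) }.

Section Modules.
Variables (F : fieldType) (L : lieAlgebra F).
Implicit Types M N : gmod L.

Definition is_hom M N (f : M -> N) :=
  linear f /\ forall x v, f (act x v) = act x (f v).

Definition is_iso M N (f : M -> N) := is_hom f /\ bijective f.

Definition short_exact (A M B : gmod L) (i : A -> M) (p : M -> B) :=
  [/\ is_hom i /\ injective i, is_hom p, forall v, exists u, p u = v
    & forall v, p v = 0 <-> exists u, i u = v].

Definition submodule M (A : M -> Prop) :=
  [/\ A 0, forall (a : F) u v, A u -> A v -> A (a *: u + v)
    & forall x v, A v -> A (act x v)].

Definition trivial_sub M (A : M -> Prop) := forall v, A v -> v = 0.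

Definition simple_mod M :=
  (exists v : M, v != 0) /\
  forall A : M -> Prop, submodule A -> trivial_sub A \/ forall v, A v.

Definition indecomposable M :=
  (exists v : M, v != 0) /\
  forall A B : M -> Prop, submodule A -> submodule B ->
    (forall v, A v -> B v -> v = 0) ->
    (forall v, exists a b, [/\ A a, B b & v = a + b]) ->
    trivial_sub A \/ trivial_sub B.

Definition subquotient N M :=
  exists (X : gmod L) (i : X -> M) (p : X -> N),
    [/\ is_hom i, injective i, is_hom p & forall v, exists u, p u = v].

Definition generates M (s : seq M) :=
  forall A : M -> Prop, submodule A -> (forall u, u \in s -> A u) ->
  forall v, A v.

Definition in_span M (s : seq M) (v : M) :=
  exists c : nat -> F, v = \sum_(i < size s) c i *: s`_i.

Lemma zero_act_linr (x : L) : linear (fun _ : 'rV[F]_0 => 0 : 'rV[F]_0).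
Proof. by move=> a u v; rewrite scaler0 addr0. Qed.

Lemma zero_act_linl (v : 'rV[F]_0) : linear (fun _ : L => 0 : 'rV[F]_0).
Proof. by move=> a x y; rewrite scaler0 addr0. Qed.

Lemma zero_act_brk (x y : L) (v : 'rV[F]_0) : 0 = 0 - 0 :> 'rV[F]_0.
Proof. by rewrite subr0. Qed.

Definition gzero : gmod L :=
  @GMod F L 'rV[F]_0 (fun _ _ => 0) zero_act_linl zero_act_linr zero_act_brk.

Section Product.
Variables M N : gmod L.

Definition prod_act (x : L) (v : (M * N)%type) : (M * N)%type :=
  (act x v.1, act x v.2).

Lemma prod_act_linl v : linear (fun x => prod_act x v).
Proof. by move=> a x y; congr pair; rewrite /= act_linl. Qed.

Lemma prod_act_linr x : linear (prod_act x).
Proof. by move=> a u v; congr pair; rewrite /= act_linr. Qed.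

Lemma prod_act_brk x y v :
  prod_act (brk x y) v = prod_act x (prod_act y v) - prod_act y (prod_act x v).
Proof. by congr pair; rewrite /= act_brk. Qed.

Definition gprod : gmod L :=
  @GMod F L (M * N)%type prod_act prod_act_linl prod_act_linr prod_act_brk.

End Product.

End Modules.

Arguments gzero {F L}.

Section CategoryO.
Variables (F : fieldType) (L : lieAlgebra F) (h b : {vspace L}).
Variable tau : L -> L.
Local Notation hd := 'Hom(subvs_of h, F^o).
Implicit Types (M N : gmod L) (la mu : hd).

Definition weight_vec M la (v : M) :=
  forall t : subvs_of h, act (vsval t) v = (la t : F) *: v.

(* brkv b b is the nilradical of the Borel subalgebra b. *)
Definition singular_vec M la (v : M) :=
  weight_vec la v /\ forall x, x \in brkv b b -> act x v = 0.

Definition has_highest_weight M la :=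
  (exists2 v : M, v != 0 & weight_vec la v) /\
  forall mu (v : M), v != 0 -> weight_vec mu v -> weight_le b mu la.

Definition highest_weight_module M la :=
  exists v : M, [/\ v != 0, singular_vec la v & generates [:: v]].

(* The module induced from the one-dimensional b-module of weight la: it
   represents the functor sending N to its singular vectors of weight la. *)
Definition is_verma la M :=
  exists v : M, [/\ v != 0, singular_vec la v &
    forall N (u : N), singular_vec la u ->
      exists f : M -> N, [/\ is_hom f, f v = u &
        forall f' : M -> N, is_hom f' -> f' v = u -> f' =1 f]].

Definition in_O M :=
  [/\ exists s : seq M, generates s,
      forall v : M, exists2 s : seq M,
        forall u, u \in s -> exists la, weight_vec la u &
        v = \sum_(u <- s) u
    & forall v : M, exists2 s : seq M, in_span s v &
        forall x u, x \in brkv b b -> u \in s -> in_span s (act x u)].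

Definition principal_block M :=
  in_O M /\
  forall N, simple_mod N -> subquotient N M ->
    exists w : weyl h, highest_weight_module N (dot b w 0).

(* The underlying space of the dual of M, as a set of functions on M: the
   direct sum of the dual spaces of the weight spaces of M. *)
Definition in_dual M (f : M -> F) :=
  linear_for *%R f /\
  exists S : seq hd, forall la (v : M), weight_vec la v -> la \notin S -> f v = 0.

(* phi is an isomorphism of N onto the dual of M; an element x of L acts on the
   dual of M by sending f to v |-> f (tau x v). *)
Definition dual_iso N M (phi : N -> M -> F) :=
  [/\ forall n, in_dual (phi n),
      forall m, linear_for *%R (fun n => phi n m),
      forall x n m, phi (act x n) m = phi n (act (tau x) m),
      forall n n', phi n =1 phi n' -> n = n'
    & forall f, in_dual f -> exists n, phi n =1 f].

Definition is_dual_verma la M :=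
  exists D : gmod L, is_verma la D /\ exists phi : M -> D -> F, dual_iso phi.

(* flag P M s: M has a finite filtration by submodules whose successive
   quotients satisfy P for the respective weights in s, from the top down. *)
Inductive flag (P : hd -> gmod L -> Prop) : gmod L -> seq hd -> Prop :=
| Flag0 M : (forall v : M, v = 0) -> flag P M [::]
| FlagS (A M B : gmod L) (i : A -> M) (p : M -> B) la s :
    short_exact i p -> flag P A s -> P la B -> flag P M (la :: s).

Definition tilting M :=
  [/\ in_O M, exists s, flag is_verma M s & exists s, flag is_dual_verma M s].

Definition verma_mult M la (m : nat) :=
  exists2 s, flag is_verma M s & m = count_mem la s.

Definition tilting0 M := tilting M /\ principal_block M.

Definition hom_basis M N (n : nat) (e : 'I_n -> M -> N) :=
  (forall i, is_hom (e i)) /\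
  forall f : M -> N, is_hom f ->
    exists! c : {ffun 'I_n -> F}, f = fun v => \sum_i c i *: e i v.

End CategoryO.

Section Generation.
Variables (F : fieldType) (L : lieAlgebra F) (W : Type) (T : W -> gmod L).

Fixpoint dsum (s : seq W) : gmod L :=
  if s is w :: s' then gprod (T w) (dsum s') else gzero.

Fixpoint dsum_cat (s s' : seq W) : dsum s -> dsum s' -> dsum (s ++ s') :=
  match s return dsum s -> dsum s' -> dsum (s ++ s') with
  | [::] => fun _ u' => u'
  | w :: s1 => fun u u' => (u.1, dsum_cat u.2 u')
  end.

Fixpoint dsum_fst (s s' : seq W) : dsum (s ++ s') -> dsum s :=
  match s return dsum (s ++ s') -> dsum s with
  | [::] => fun _ => 0
  | w :: s1 => fun u => (u.1, dsum_fst u.2)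
  end.

Fixpoint dsum_snd (s s' : seq W) : dsum (s ++ s') -> dsum s' :=
  match s return dsum (s ++ s') -> dsum s' with
  | [::] => fun u => u
  | w :: s1 => fun u => dsum_snd u.2
  end.

Definition dsum_map (s t s' t' : seq W) (f : dsum s -> dsum t)
    (f' : dsum s' -> dsum t') (u : dsum (s ++ s')) : dsum (t ++ t') :=
  dsum_cat (f (dsum_fst u)) (f' (dsum_snd u)).

Variable phi : forall w, T w -> T w -> F.
Arguments phi {w}.

Fixpoint dsum_phi (s : seq W) : dsum s -> dsum s -> F :=
  match s return dsum s -> dsum s -> F with
  | [::] => fun _ _ => 0
  | w :: s1 => fun u v => phi u.1 v.1 + dsum_phi u.2 v.2
  end.

(* The dual f' of f is determined by dsum_phi o f' = f^\vee o dsum_phi. *)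
Definition is_dagger (s t : seq W) (f : dsum s -> dsum t)
    (f' : dsum t -> dsum s) :=
  forall u v, dsum_phi (f' u) v = dsum_phi u (f v).

Variable B : forall x y, (T x -> T y) -> Prop.

(* A zero map between arbitrary objects is an empty linear combination. *)
Inductive generated : forall s t : seq W, (dsum s -> dsum t) -> Prop :=
| GenBase x y (f : T x -> T y) :
    B f -> @generated [:: x] [:: y] (fun u => (f u.1, 0))
| GenZero s t : @generated s t (fun=> 0)
| GenLin s t (a : F) (f f' : dsum s -> dsum t) :
    generated f -> generated f' -> generated (fun u => a *: f u + f' u)
| GenComp s t r (f : dsum s -> dsum t) (f' : dsum t -> dsum r) :
    generated f -> generated f' -> generated (f' \o f)
| GenSum s t s' t' (f : dsum s -> dsum t) (f' : dsum s' -> dsum t') :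
    generated f -> generated f' -> generated (dsum_map f f')
| GenDual s t (f : dsum s -> dsum t) (f' : dsum t -> dsum s) :
    is_hom f' -> is_dagger f f' -> generated f -> generated f'.

End Generation.

Section Base.
Variables (F : fieldType) (L : lieAlgebra F) (h b : {vspace L}).
Variables (T : weyl h -> gmod L) (d : weyl h -> weyl h -> nat).
Variable gbar : forall x y, 'I_(d x y) -> T x -> T y.

Definition B0 (x y : weyl h) (f : T x -> T y) :=
  bruhat b y x /\
  exists m (i : 'I_(d x y)),
    [/\ verma_mult b (T y) (dot b x 0) m, (i < m)%N & f = gbar i].

End Base.

(* Main.v *)
(** The theorem is reduced to four facts about modules with finite-dimensional
weight spaces.

Linkage.  Call LP(la, N) the property that a vector of weight la which is
singular modulo N can be corrected by an element of N to a singular one; it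
replaces the vanishing of Ext^1 from a Verma module of highest weight la to N.
By induction along simple reflections, a nonzero singular vector of weight
z.0 in Delta(c) forces c <= z, and LP(z.0, Delta(c)) holds unless c <= z.
The induction passes from z to s z inside the localization of a Verma
module at the lowering operator f of the simple root, where f becomes
invertible and divides singular vectors; e is compared with f through
functionals that are nilpotent for e or f, and ordinary sl2-theory handles
the f-nilpotent quotients Delta(c) / Delta(s c).

Duality.  LP(la, N) always holds for N a dual Verma module, hence for tilting
modules and for the duals of modules with a Verma flag.  Therefore every
linear map from the top weight space of T(w) to singular vectors of such a
module extends to a homomorphism.  With Fitting's lemma the top weight
space of T(w) is a line, and T(w) splits off a tilting module in the principal
block as soon as w.0 is a weight of maximal level; this gives the
decompositions.

Multiplicities.  If Delta(z) occurs in T(y) and no Delta(c) with c < z does,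
then the generator of Delta(z) lifts to a singular vector on which a singular
functional does not vanish, so T(z) is a summand of T(y) and z = y; in general
y <= z by induction.  The number of maps Delta(z) -> T(y) is at most the
multiplicity, because singular functionals vanish on n^- T(y).

Homomorphisms.  Given f : T(x) -> T(y), treat the weights z.0 by decreasing level.
On the weight space of z.0 the map f has the form q |-> sum_i phi(q, a_i) g_i(v_z)
with a_i singular in T(x), and there it agrees, up to the scalar phi(v_z, v_z),
with sum_i gbar_i o h_i^dagger where h_i : T(z) -> T(x) extends v_z |-> a_i.
Subtracting these maps kills f on all weights of the form z.0, hence f. *)

Require Import Defs.
From HB Require Import structures.
From mathcomp Require Import all_boot all_order all_algebra.
From mathcomp Require Import all_classical reals complex.
From mathcomp Require Import ring zify.

Set Implicit Arguments.
Unset Strict Implicit.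
Unset Printing Implicit Defensive.

Import Order.TTheory GRing.Theory Num.Theory.
Local Open Scope ring_scope.

(** * Linear algebra and modules over a Lie algebra *)

(** Verma modules are given only by their universal property, with no enveloping algebra or PBW
    basis behind them, and semisimplicity only as the absence of solvable ideals. So even the
    injectivity of a lowering operator on a Verma module has to be proved. Maps out of a Verma
    module come from singular vectors, hence a claim about it is tested by exhibiting a singular
    vector in a tailored target. The targets are localizations, realised by $\mathbb{Z}$-indexed
    sequences with $z_K$ in the role of $a^Km$, and Hom spaces from nilpotent functionals into a
    module with a vector $n$ that is invariant up to a submodule $N_1$; weight bounds then supply
    enough functionals. The root system is recovered from traces: roots without an sl2-triple span
    an ideal in the radical of the trace form, which a graded Engel argument makes zero. The level
    of a weight is its value at the sum of the positive coroots, a positive integer on each positive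
    root. Extensions are never classified: only the lifting of a single singular vector is used, a
    property that passes to direct summands and extensions. *)

Section LinearReflection.
Variables (F : fieldType) (V : lmodType F).

Inductive lexp := LV of nat | L0 | LA of lexp & lexp | LN of lexp | LS of F & lexp.

Fixpoint leval (env : seq V) e : V :=
  match e with
  | LV n => nth 0 env n
  | L0 => 0
  | LA a b => leval env a + leval env b
  | LN a => - leval env a
  | LS c a => c *: leval env a
  end.

Fixpoint lcoef k e : F :=
  match e with
  | LV n => if eqn n k then 1 else 0
  | L0 => 0
  | LA a b => lcoef k a + lcoef k b
  | LN a => - lcoef k a
  | LS c a => c * lcoef k a
  end.

Fixpoint lcoefs_eq n e1 e2 : Prop :=
  if n is m.+1 then lcoef m e1 = lcoef m e2 /\ lcoefs_eq m e1 e2 else True.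

Lemma leval_coef env e : leval env e = \sum_(k < size env) lcoef k e *: nth 0 env k.
Proof.
elim: e => [n||a IHa b IHb|a IHa|c a IHa] /=; rewrite ?IHa ?IHb.
- have [le|lt] := leqP (size env) n.
    rewrite nth_default// big1// => k _; case: (@eqnP n k) => [E|]; last by rewrite scale0r.
    by have := ltn_ord k; rewrite -E ltnNge le.
  rewrite (bigD1 (Ordinal lt))//= (introT (@eqnP n n) erefl) scale1r big1 ?addr0// => k /eqP kn.
  case: (@eqnP n k) => [E|]; last by rewrite scale0r.
  by case: kn; apply: val_inj.
- by rewrite big1// => k _; rewrite scale0r.
- by rewrite -big_split; apply: eq_bigr => k _; rewrite scalerDl.
- by rewrite -sumrN; apply: eq_bigr => k _; rewrite scaleNr.
- by rewrite scaler_sumr; apply: eq_bigr => k _; rewrite scalerA.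
Qed.

(** Comparing coefficients is sufficient only: the atoms need not be linearly independent. *)
Lemma leval_eq env e1 e2 : lcoefs_eq (size env) e1 e2 -> leval env e1 = leval env e2.
Proof.
move=> H; rewrite !leval_coef; apply: eq_bigr => k _; congr (_ *: _).
move: (nat_of_ord k) (ltn_ord k) => {k} k.
elim: (size env) H => // n IH /= [E H]; rewrite ltnS leq_eqVlt => /predU1P[->//|].
exact: IH.
Qed.
End LinearReflection.

Ltac lmem x env :=
  lazymatch env with
  | nil => constr:(false)
  | cons x _ => constr:(true)
  | cons _ ?e => lmem x e
  end.
Ltac lidx x env :=
  lazymatch env with
  | cons x _ => constr:(O)
  | cons _ ?e => let n := lidx x e in constr:(S n)
  end.
Ltac latoms t env :=
  lazymatch t with
  | (?a + ?b)%R => let e := latoms a env in latoms b e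
  | (- ?a)%R => latoms a env
  | (_ *: ?a)%R => latoms a env
  | 0%R => env
  | _ => lazymatch lmem t env with true => env | false => constr:(cons t env) end
  end.
Ltac lreify F t env :=
  lazymatch t with
  | (?a + ?b)%R =>
      let a' := lreify F a env in let b' := lreify F b env in constr:(@LA F a' b')
  | (- ?a)%R => let a' := lreify F a env in constr:(@LN F a')
  | (?c *: ?a)%R => let a' := lreify F a env in constr:(@LS F c a')
  | 0%R => constr:(@L0 F)
  | _ => let n := lidx t env in constr:(@LV F n)
  end.
(* Decides equations between linear combinations of atoms, by ring on coefficients. *)
Ltac lmod F :=
  lazymatch goal with
  | |- @eq ?T ?t1 ?t2 =>
    let env := latoms t1 (@nil T) in
    let env := latoms t2 env in
    let e1 := lreify F t1 env in
    let e2 := lreify F t2 env in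
    refine (@leval_eq F _ env e1 e2 _);
    cbn [lcoefs_eq size lcoef eqn]; repeat (split; [try ring|]); try exact I
  end.

Section LinearPredicates.
Variables (F : fieldType) (V : lmodType F).
Implicit Types (P Q : V -> Prop).

Definition subspace P := P 0 /\ forall (a : F) u v, P u -> P v -> P (a *: u + v).

Section One.
Variables (P : V -> Prop) (sP : subspace P).
Lemma sub0 : P 0. Proof. by case: sP. Qed.
Lemma subZD a u v : P u -> P v -> P (a *: u + v).
Proof. by case: sP => _; apply. Qed.
Lemma subD u v : P u -> P v -> P (u + v).
Proof. by move=> /(subZD 1)/[apply]; rewrite scale1r. Qed.
Lemma subZ a u : P u -> P (a *: u).
Proof. by move=> /(subZD a)/(_ sub0); rewrite addr0. Qed.
Lemma subN u : P u -> P (- u).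
Proof. by rewrite -scaleN1r; apply: subZ. Qed.
Lemma subB u v : P u -> P v -> P (u - v).
Proof. by move=> Pu /subN; apply: subD. Qed.
Lemma sub_sum I (r : seq I) (p : pred I) (f : I -> V) :
  (forall i, p i -> P (f i)) -> P (\sum_(i <- r | p i) f i).
Proof. by move=> H; elim/big_ind: _ => //; [exact: sub0|exact: subD]. Qed.
Lemma sub_sum_seq (I : eqType) (r : seq I) (f : I -> V) :
  (forall i, i \in r -> P (f i)) -> P (\sum_(i <- r) f i).
Proof. by move=> H; rewrite big_seq; apply: sub_sum. Qed.
Lemma subZ_inv a u : a != 0 -> P (a *: u) -> P u.
Proof. by move=> a0 /(subZ a^-1); rewrite scalerA mulVf// scale1r. Qed.
End One.

Lemma subspaceD P Q : subspace P -> subspace Q ->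
  subspace (fun v => exists p q, [/\ P p, Q q & v = p + q]).
Proof.
move=> sP sQ; split; first by exists 0, 0; rewrite addr0; split=> //; exact: sub0.
move=> a u v [p [q [Pp Qq ->]]] [p' [q' [Pp' Qq' ->]]].
exists (a *: p + p'), (a *: q + q'); split; [exact: subZD|exact: subZD|].
by rewrite scalerDr addrACA.
Qed.

(** Zorn's lemma on the subspaces meeting [P] only in zero: a vector outside [P + Q] could be
    adjoined to a maximal [Q]. *)
Lemma complement_ex P : subspace P -> exists Q, [/\ subspace Q,
  (forall v, P v -> Q v -> v = 0) & forall v, exists p q, [/\ P p, Q q & v = p + q]].
Proof.
move=> sP.
pose G (Q : set V) := subspace Q /\ forall v, P v -> Q v -> v = 0.
have [|Q [HQ Qmax]] := @Zorn_bigcup V (fun Q => Q = set0 \/ G Q).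
  move=> A AG tot.
  have [[X [AX [x Xx]]]|nX] := pselect (exists X, A X /\ exists x, X x); last first.
    left; apply/seteqP; split=> // x [X AX Xx]; case: nX; exists X; split=> //; by exists x.
  right; have GX Y : A Y -> (exists y, Y y) -> G Y.
    by move=> /AG [->|//] [y]. 
  have G0 Y y : A Y -> Y y -> G Y by move=> AY Yy; apply: GX => //; exists y.
  split.
    split; first by exists X => //; have [[? _] _] := G0 _ _ AX Xx.
    move=> a u v [Y1 AY1 Yu] [Y2 AY2 Yv].
    have [S12|S21] := tot _ _ AY1 AY2.
      by exists Y2 => //; have [[_ H] _] := G0 _ _ AY2 Yv; apply: H => //; exact: S12.
    by exists Y1 => //; have [[_ H] _] := G0 _ _ AY1 Yu; apply: H => //; exact: S21.
  by move=> v Pv [Y AY Yv]; have [_] := G0 _ _ AY Yv; apply.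
case: HQ => [Q0|[sQ Q0]].
- case: (Qmax [set 0]%classic).
    by rewrite Q0; split=> // /(_ 0); apply.
  by right; split; [split=> // a u v /= -> ->; rewrite scaler0 addr0|].
- exists Q; split=> // v.
  apply: contrapT => nv.
  pose Q' : set V := [set w | exists p q, [/\ Q p, (exists a, q = a *: v) & w = p + q]]%classic.
  have sL : subspace (fun q => exists a, q = a *: v).
    split; first by exists 0; rewrite scale0r.
    by move=> a u w [b ->] [c ->]; exists (a * b + c); rewrite scalerDl scalerA.
  apply: (Qmax Q'); last first.
    right; split; first exact: subspaceD.
    move=> w Pw [p [q [Qp [a qa] wE]]]; have [a0|a0] := eqVneq a 0.
      by move: wE; rewrite qa a0 scale0r addr0 => wE; apply: Q0 => //; rewrite wE.
    case: nv; exists (a^-1 *: w), (a^-1 *: (- p)); split.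
    - exact: subZ.
    - by apply: subZ => //; exact: subN.
    - by rewrite -scalerDr wE [p + q]addrC addrK qa scalerA mulVf ?scale1r.
  split=> [w Qw|H].
    exists w, 0; rewrite addr0; split=> //; first by exists 0; rewrite scale0r.
  apply: nv; exists 0, v; rewrite add0r; split=> //; first exact: sub0.
  apply: H; exists 0, v; rewrite add0r; split=> //; first exact: sub0.
  by exists 1; rewrite scale1r.
Qed.

End LinearPredicates.

Section GmodBasics.
Variables (F : fieldType) (L : lieAlgebra F).

Section Act.
Variable M : gmod L.
HB.instance Definition _ (x : L) := GRing.isLinear.Build F M M *:%R (@act F L M x) (act_linr x).
Implicit Types (x y : L) (u v : M).

Lemma act0r x : act x (0 : M) = 0. Proof. exact: linear0. Qed.
Lemma actDr x u v : act x (u + v) = act x u + act x v. Proof. exact: linearD. Qed.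
Lemma actNr x u : act x (- u) = - act x u. Proof. exact: linearN. Qed.
Lemma actBr x u v : act x (u - v) = act x u - act x v. Proof. exact: linearB. Qed.
Lemma actZr x a u : act x (a *: u) = a *: act x u. Proof. exact: linearZ. Qed.
Lemma act_sumr x I (r : seq I) p (f : I -> M) :
  act x (\sum_(i <- r | p i) f i) = \sum_(i <- r | p i) act x (f i).
Proof. exact: linear_sum. Qed.
Lemma actDl x y v : act (x + y) v = act x v + act y v.
Proof. by have /= := act_linl v 1 x y; rewrite !scale1r. Qed.
Lemma act0l v : act (0 : L) v = 0.
Proof. by apply: (addrI (act 0 v)); rewrite -actDl !addr0. Qed.
Lemma actZl a x v : act (a *: x) v = a *: act x v.
Proof. by have /= := act_linl v a x 0; rewrite act0l !addr0. Qed.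
Lemma actNl x v : act (- x) v = - act x v.
Proof. by rewrite -[- x]scaleN1r actZl scaleN1r. Qed.
Lemma act_suml I (r : seq I) p (f : I -> L) v :
  act (\sum_(i <- r | p i) f i) v = \sum_(i <- r | p i) act (f i) v.
Proof. by elim/big_rec2: _ => [|i u w _ <-]; [exact: act0l|exact: actDl]. Qed.
Lemma act_comm x y v : act x (act y v) = act y (act x v) + act (brk x y) v.
Proof. by rewrite act_brk addrC subrK. Qed.
End Act.

Section Bracket.
Implicit Types x y z : L.
Lemma brkDl x y z : brk (x + y) z = brk x z + brk y z :> L.
Proof. by have /= := @brk_linl _ L z 1 x y; rewrite !scale1r. Qed.
Lemma brkDr x y z : brk z (x + y) = brk z x + brk z y :> L.
Proof. by have /= := @brk_linr _ L z 1 x y; rewrite !scale1r. Qed.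
Lemma brk0l x : brk 0 x = 0 :> L.
Proof. by apply: (addrI (brk 0 x)); rewrite -brkDl !addr0. Qed.
Lemma brk0r x : brk x 0 = 0 :> L.
Proof. by apply: (addrI (brk x 0)); rewrite -brkDr !addr0. Qed.
Lemma brkZl a x y : brk (a *: x) y = a *: brk x y :> L.
Proof. by have /= := @brk_linl _ L y a x 0; rewrite brk0l !addr0. Qed.
Lemma brkZr a x y : brk x (a *: y) = a *: brk x y :> L.
Proof. by have /= := @brk_linr _ L x a y 0; rewrite brk0r !addr0. Qed.
Lemma brkNl x y : brk (- x) y = - brk x y :> L.
Proof. by rewrite -[- x]scaleN1r brkZl scaleN1r. Qed.
Lemma brkNr x y : brk x (- y) = - brk x y :> L.
Proof. by rewrite -[- y]scaleN1r brkZr scaleN1r. Qed.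
Lemma brkC x y : brk x y = - brk y x :> L.
Proof.
apply/eqP; rewrite -addr_eq0; apply/eqP.
by have := @brk_alt _ L (x + y); rewrite brkDl !brkDr !brk_alt add0r addr0.
Qed.
Lemma brk_brk x y z : brk (brk x y) z = brk x (brk y z) - brk y (brk x z) :> L.
Proof.
have := @brk_jacobi _ L x y z; rewrite (brkC z (brk x y)) (brkC z x) brkNr => /eqP.
by rewrite subr_eq0 => /eqP.
Qed.
End Bracket.

Definition adj : gmod L :=
  @GMod F L L (@brk F L) (@brk_linl F L) (@brk_linr F L) brk_brk.

Section Hom.
Variables (M N : gmod L) (f : M -> N) (hf : is_hom f).
Lemma homD u v : f (u + v) = f u + f v.
Proof. by have /= := hf.1 1 u v; rewrite !scale1r. Qed.
Lemma hom0 : f 0 = 0.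
Proof. by apply: (addrI (f 0)); rewrite -homD !addr0. Qed.
Lemma homZ a u : f (a *: u) = a *: f u.
Proof. by have /= := hf.1 a u 0; rewrite hom0 !addr0. Qed.
Lemma homN u : f (- u) = - f u.
Proof. by rewrite -[- u]scaleN1r homZ scaleN1r. Qed.
Lemma homB u v : f (u - v) = f u - f v.
Proof. by rewrite homD homN. Qed.
Lemma hom_act x u : f (act x u) = act x (f u). Proof. exact: hf.2. Qed.
Lemma hom_sum I (r : seq I) p (g : I -> M) :
  f (\sum_(i <- r | p i) g i) = \sum_(i <- r | p i) f (g i).
Proof. by elim/big_rec2: _ => [|i u w _ <-]; [exact: hom0|exact: homD]. Qed.
Lemma hom_inj : (forall u, f u = 0 -> u = 0) -> injective f.
Proof. by move=> H u v fuv; apply/eqP; rewrite -subr_eq0; apply/eqP/H; rewrite homB fuv subrr. Qed.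
End Hom.

Lemma hom_comp (M N P : gmod L) (f : M -> N) (g : N -> P) : is_hom f -> is_hom g -> is_hom (g \o f).
Proof. by move=> [lf af] [lg ag]; split=> [a u v|x v] /=; rewrite ?lf ?lg ?af ?ag. Qed.
Implicit Types M N : gmod L.
Lemma hom_id M : is_hom (@id M). Proof. by []. Qed.
Lemma hom_lin M N (f g : M -> N) a : is_hom f -> is_hom g -> is_hom (fun v => a *: f v + g v).
Proof.
move=> hf hg; split=> [b u v|x v].
  by rewrite (hf.1) (hg.1) !scalerDr !scalerA [b * a]mulrC addrACA.
by rewrite (hf.2) (hg.2) actDr actZr.
Qed.
Lemma hom_zero M N : is_hom (fun _ : M => 0 : N).
Proof. by split=> [a u v|x v]; rewrite ?scaler0 ?addr0 ?act0r. Qed.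
Lemma hom_sumf M N I (r : seq I) (p : pred I) (f : I -> M -> N) :
  (forall i, p i -> is_hom (f i)) -> is_hom (fun v => \sum_(i <- r | p i) f i v).
Proof.
move=> H; split=> [a u v|x v].
  by rewrite scaler_sumr -big_split /=; apply: eq_bigr => i /H [->].
by rewrite act_sumr; apply: eq_bigr => i /H [_ ->].
Qed.

Section Submodules.
Variables (M : gmod L).
Implicit Types (P Q : M -> Prop).
Lemma submodule_sub P : submodule P -> subspace P. Proof. by case. Qed.
Lemma submodule_act P x v : submodule P -> P v -> P (act x v).
Proof. by case=> _ _; apply. Qed.
Lemma submodule_ker N (f : M -> N) : is_hom f -> submodule (fun v => f v = 0).
Proof.
move=> hf; split=> [|a u v fu fv|x v fv]; first exact: hom0.
  by rewrite homD// homZ// fu fv scaler0 addr0.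
by rewrite hom_act// fv act0r.
Qed.
Lemma submodule_pre (N : gmod L) (f : M -> N) (Q : N -> Prop) :
  is_hom f -> submodule Q -> submodule (fun v => Q (f v)).
Proof.
move=> hf [Q0 QD QA]; split=> [|a u v fu fv|x v fv]; first by rewrite (hom0 hf).
  by rewrite (homD hf) (homZ hf); apply: QD.
by rewrite (hom_act hf); apply: QA.
Qed.
Lemma submodule_im (N : gmod L) (f : N -> M) : is_hom f -> submodule (fun v => exists u, f u = v).
Proof.
move=> hf; split=> [|a _ _ [u <-] [v <-]|x _ [u <-]]; first by exists 0; rewrite hom0.
  by exists (a *: u + v); rewrite (hf.1).
by exists (act x u); rewrite hom_act.
Qed.
Lemma submoduleI P Q : submodule P -> submodule Q -> submodule (fun v => P v /\ Q v).
Proof.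
move=> [P0 PD PA] [Q0 QD QA]; split=> [//|a u v [? ?] [? ?]|x v [? ?]]; split; auto.
Qed.
Definition gen (s : M -> Prop) (v : M) := forall P, submodule P -> (forall u, s u -> P u) -> P v.
Lemma gen_sub s : submodule (gen s).
Proof.
split=> [P sP _|a u v Hu Hv P sP sH|x v Hv P sP sH].
- exact: sub0 (submodule_sub sP).
- by case: (sP) => _ + _; apply; [apply: Hu|apply: Hv].
- by case: (sP) => _ _; apply; apply: Hv.
Qed.
Lemma gen_in s u : s u -> gen s u. Proof. by move=> su P _; apply. Qed.
End Submodules.

Section SubGmod.
Variables (M : gmod L) (P : M -> Prop).
(* The unused argument lets the module structure be inferred from the type. *)
Definition subm_pred (_ : submodule P) : {pred M} := fun v => `[< P v >].
Lemma subm_predP h : GRing.subsemimod_closed (subm_pred h).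
Proof.
have sP := submodule_sub h; split; first split.
- by apply/asboolP; exact: sub0.
- by move=> u v /asboolP Pu /asboolP Pv; apply/asboolP; exact: subD.
- by move=> a u /asboolP Pu; apply/asboolP; exact: subZ.
Qed.
HB.instance Definition _ h := GRing.isSubmodClosed.Build F M (subm_pred h) (subm_predP h).
Record subm (h : submodule P) := Subm { subm_val : M; _ : subm_val \in subm_pred h }.
Variable h : submodule P.
HB.instance Definition _ := [isSub for @subm_val h].
HB.instance Definition _ := [Choice of subm h by <:].
HB.instance Definition _ := [SubChoice_isSubLmodule of subm h by <:].

Lemma subm_valP (v : subm h) : P (\val v).
Proof. exact/asboolP/(valP v). Qed.
Definition subm_mk (v : M) (Pv : P v) : subm h := Subm (asboolT Pv).
Definition subm_act (x : L) (v : subm h) : subm h :=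
  subm_mk (submodule_act x h (subm_valP v)).
Lemma subm_act_linl v : linear (fun x => subm_act x v).
Proof. by move=> a x y; apply: val_inj; rewrite /= actDl actZl. Qed.
Lemma subm_act_linr x : linear (subm_act x).
Proof. by move=> a u v; apply: val_inj; rewrite /= actDr actZr. Qed.
Lemma subm_act_brk x y v :
  subm_act (brk x y) v = subm_act x (subm_act y v) - subm_act y (subm_act x v).
Proof. by apply: val_inj; rewrite /= act_brk. Qed.
Definition subg : gmod L :=
  @GMod F L (subm h) subm_act subm_act_linl subm_act_linr subm_act_brk.
Definition sinc (v : subg) : M := subm_val v.
Lemma sinc_hom : is_hom sinc. Proof. by []. Qed.
Lemma sinc_inj : injective sinc. Proof. exact: val_inj. Qed.
Lemma sincP v : P (sinc v). Proof. exact: subm_valP. Qed.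
Definition smk (v : M) (Pv : P v) : subg := subm_mk Pv.
Lemma sub_corestr (N : gmod L) (f : N -> M) : is_hom f -> (forall u, P (f u)) ->
  exists2 f' : N -> subg, is_hom f' & forall u, sinc (f' u) = f u.
Proof.
move=> hf Pf; exists (fun u => smk (Pf u)) => //; split=> [a u v|x v]; apply: val_inj => /=.
  exact: hf.1.
exact: hf.2.
Qed.
End SubGmod.

Section QuotGmod.
Variables (M : gmod L) (U : M -> Prop) (hU : submodule U).

(* The quotient is realised on a linear complement of U. *)
Lemma quot_proj_ex : exists p : M -> M,
  [/\ linear p, forall v, p (p v) = p v & forall v, p v = 0 <-> U v].
Proof.
have sU := submodule_sub hU.
have [Q [sQ UQ0 UQ]] := complement_ex sU.
have /choice[p pP] : forall v, exists q, Q q /\ U (v - q).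
  by move=> v; have [u [q [Uu Qq ->]]] := UQ v; exists q; rewrite addrK.
have uniq v q : Q q -> U (v - q) -> q = p v.
  have [Qp Up] := pP v; move=> Qq Uq; apply/eqP; rewrite -subr_eq0; apply/eqP/UQ0.
    by have := subB sU Up Uq; congr U; lmod F.
  exact: subB.
exists p; split=> [a u v|v|v].
- apply/esym/uniq; first by apply: subZD => //; apply: (pP _).1.
  rewrite opprD addrACA -scalerBr; apply: subZD => //; apply: (pP _).2.
- apply/esym/uniq; first exact: (pP _).1.
  by rewrite subrr; apply: sub0.
- split=> [p0|Uv]; first by have [_] := pP v; rewrite p0 subr0.
  by apply/esym/uniq; [apply: sub0|rewrite subr0].
Qed.

Definition quot_proj := sval (cid quot_proj_ex).
Lemma quot_projP : [/\ linear quot_proj, forall v, quot_proj (quot_proj v) = quot_proj v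
  & forall v, quot_proj v = 0 <-> U v].
Proof. exact: svalP (cid quot_proj_ex). Qed.
HB.instance Definition _ :=
  GRing.isLinear.Build F M M *:%R quot_proj (let: And3 h _ _ := quot_projP in h).
Local Notation p := quot_proj.
Lemma quot_projK v : p (p v) = p v. Proof. by have [] := quot_projP. Qed.
Lemma quot_proj0 v : p v = 0 <-> U v. Proof. by have [] := quot_projP. Qed.

Definition quot_pred (_ : submodule U) : {pred M} := fun v => p v == v.
Lemma quot_predP h : GRing.subsemimod_closed (quot_pred h).
Proof.
split; first split.
- by apply/eqP; rewrite linear0.
- by move=> u v /eqP pu /eqP pv; apply/eqP; rewrite linearD /= pu pv.
- by move=> a u /eqP pu; apply/eqP; rewrite linearZ /= pu.
Qed.
HB.instance Definition _ h := GRing.isSubmodClosed.Build F M (quot_pred h) (quot_predP h).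
Record quotm := Quotm { quotm_val : M; _ : quotm_val \in quot_pred hU }.
HB.instance Definition _ := [isSub for quotm_val].
HB.instance Definition _ := [Choice of quotm by <:].
HB.instance Definition _ := [SubChoice_isSubLmodule of quotm by <:].
Lemma quotm_mkP v : p v \in quot_pred hU.
Proof. by apply/eqP; exact: quot_projK. Qed.
Definition qpi0 (v : M) : quotm := Quotm (quotm_mkP v).
Definition quot_act (x : L) (v : quotm) := qpi0 (act x (\val v)).
Lemma quot_proj_act x v : p (act x (p v)) = p (act x v).
Proof.
apply/eqP; rewrite -subr_eq0 -linearB -actBr; apply/eqP.
apply: (quot_proj0 _).2; apply: submodule_act => //.
by apply: (quot_proj0 _).1; rewrite linearB /= quot_projK subrr.
Qed.
Lemma quot_act_linl v : linear (fun x => quot_act x v).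
Proof. by move=> a x y; apply: val_inj; rewrite /= actDl actZl linearP. Qed.
Lemma quot_act_linr x : linear (quot_act x).
Proof. by move=> a u v; apply: val_inj; rewrite /= actDr actZr linearP. Qed.
Lemma quot_act_brk x y v :
  quot_act (brk x y) v = quot_act x (quot_act y v) - quot_act y (quot_act x v).
Proof. by apply: val_inj; rewrite /= act_brk linearB !quot_proj_act. Qed.
Definition quog : gmod L :=
  @GMod F L quotm quot_act quot_act_linl quot_act_linr quot_act_brk.
Definition qpi (v : M) : quog := qpi0 v.
Lemma qpi_hom : is_hom qpi.
Proof.
split=> [a u v|x v]; apply: val_inj; first exact: linearP.
by rewrite /= quot_proj_act.
Qed.
Lemma qpi_surj (w : quog) : exists v, qpi v = w.
Proof. by case: w => v vP; exists v; apply: val_inj; apply/eqP. Qed.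
Lemma qpi0P v : qpi v = 0 <-> U v.
Proof.
rewrite -quot_proj0; split=> [/(congr1 \val)//|p0]; exact: val_inj.
Qed.
Lemma qpi_eq u v : qpi u = qpi v <-> U (u - v).
Proof.
rewrite -qpi0P (homB qpi_hom); split=> [->|/eqP]; first by rewrite subrr.
by rewrite subr_eq0 => /eqP.
Qed.
End QuotGmod.

Lemma factor_surj (M N Q : gmod L) (p : M -> Q) (f : M -> N) :
  is_hom p -> (forall w, exists v, p v = w) -> is_hom f -> (forall v, p v = 0 -> f v = 0) ->
  exists2 f' : Q -> N, is_hom f' & forall v, f' (p v) = f v.
Proof.
move=> hp sp hf pf; have [r rP] := choice sp.
have E v w : p v = p w -> f v = f w.
  move=> pvw; apply/eqP; rewrite -subr_eq0 -(homB hf); apply/eqP/pf.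
  by rewrite (homB hp) pvw subrr.
exists (fun w => f (r w)); last by move=> v; apply: E; rewrite rP.
split=> [a u v|x v].
  by rewrite -(hf.1); apply: E; rewrite (hp.1) !rP.
by rewrite -(hf.2); apply: E; rewrite (hp.2) !rP.
Qed.

Section LinearSeparation.
Variable V : lmodType F.
(** The functional reads off the coefficient of [v] in the decomposition along [P], the line of [v]
    and a complement of their sum. *)
Lemma separate (P : V -> Prop) v : subspace P -> ~ P v ->
  exists xi : V -> F, [/\ linear_for *%R xi, forall u, P u -> xi u = 0 & xi v = 1].
Proof.
move=> sP nPv.
have sL : subspace (fun q => exists a : F, q = a *: v).
  split; first by exists 0; rewrite scale0r.
  by move=> a u w [b ->] [c ->]; exists (a * b + c); rewrite scalerDl scalerA.
have [Q [sQ PQ0 PQ]] := complement_ex (subspaceD sP sL).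
have /choice[c cP] : forall w, exists a, exists2 q, Q q & P (w - a *: v - q).
  move=> w; have [_ [q [[p [_ [Pp [a ->] ->]]] Qq ->]]] := PQ w.
  exists a, q => //; have -> // : p + a *: v + q - a *: v - q = p by lmod F.
have uniq w a q : Q q -> P (w - a *: v - q) -> a = c w.
  move=> Qq Pa; have [q' Qq' Pc] := cP w.
  have PE : P ((w - c w *: v - q') - (w - a *: v - q)) by apply: subB.
  have E : (w - c w *: v - q') - (w - a *: v - q) + (c w - a) *: v = q - q'.
    lmod F.
  have E0 : q - q' = 0.
    apply: PQ0; last exact: subB.
    by exists ((w - c w *: v - q') - (w - a *: v - q)), ((c w - a) *: v); split=> //; exists (c w - a).
  apply/eqP; apply: contraT => ac; case: nPv.
  have : P ((c w - a) *: v).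
    by move: E; rewrite E0 => /eqP; rewrite addr_eq0 -eqr_oppLR => /eqP <-; apply: subN.
  by apply: subZ_inv => //; rewrite subr_eq0 eq_sym.
exists c; split=> [a u w|u Pu|].
- have [q Qq Pq] := cP u; have [q' Qq' Pq'] := cP w.
  apply/esym/(uniq _ _ (a *: q + q')); first exact: subZD.
  have := subZD sP a Pq Pq'; congr P.
  by lmod F.
- by apply/esym/(uniq _ _ 0); [exact: sub0|rewrite scale0r !subr0].
- by apply/esym/(uniq _ _ 0); [exact: sub0|rewrite scale1r subrr subr0; apply: sub0].
Qed.
End LinearSeparation.
End GmodBasics.

(** * Representations of sl2 *)

Section Nilpotency.
Variables (F : fieldType) (L : lieAlgebra F).

Definition adnil (a : L) := forall x, exists D, iter D (brk a) x = 0.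

Section InModule.
Variables (M : gmod L) (a : L).

Lemma iter_act0 N : iter N (act a) (0 : M) = 0.
Proof. by elim: N => //= N ->; rewrite act0r. Qed.
Lemma iter_actD N (u v : M) : iter N (act a) (u + v) = iter N (act a) u + iter N (act a) v.
Proof. by elim: N => //= N ->; rewrite actDr. Qed.
Lemma iter_actZ N c (u : M) : iter N (act a) (c *: u) = c *: iter N (act a) u.
Proof. by elim: N => //= N ->; rewrite actZr. Qed.
Lemma iter_act_sub (U : M -> Prop) N v : submodule U -> U v -> U (iter N (act a) v).
Proof. by move=> sU Uv; elim: N => //= N; apply: submodule_act. Qed.
Lemma iter_act_le (U : M -> Prop) N N' v : submodule U -> (N <= N')%N ->
  U (iter N (act a) v) -> U (iter N' (act a) v).
Proof. by move=> sU /subnK <-; rewrite iterD; apply: iter_act_sub. Qed.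

(** By Leibniz, $a^{D+N}xv$ is a combination of terms $(\mathrm{ad}\,a)^i(x)\,a^jv$ with $i+j=D+N$,
    so $i\ge D$ or $j\ge N$. The induction on [D + N] avoids the binomial coefficients. *)
Lemma iter_act_brk (U : M -> Prop) D N x v : submodule U ->
  iter D (brk a) x = 0 -> U (iter N (act a) v) -> U (iter (D + N) (act a) (act x v)).
Proof.
move=> sU; move: {2}(D + N)%N (leqnn (D + N)) => n; elim: n D N x v => [|n IH] D N x v.
  by rewrite leqn0 addn_eq0 => /andP[/eqP-> /eqP->] /= -> _; rewrite act0l; case: sU.
case: D => [|D]; first by move=> _ /= -> _; rewrite act0l; rewrite iter_act0; case: sU.
case: N => [|N].
  by move=> _ _ Uv; apply: (iter_act_sub _ sU); apply: (submodule_act _ sU).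
rewrite addSn ltnS iterSr [iter N.+1 _ _]iterSr => le Dx Nv.
rewrite -[(D + N.+1).+1]addSn addSn iterSr act_comm iter_actD.
have sU' := submodule_sub sU; apply: (subD sU').
  by rewrite -addSnnS; apply: IH => //; [rewrite addSnnS|rewrite iterSr].
by apply: IH => //; rewrite iterSr.
Qed.

(** Ad-nilpotency of [a] makes the [a]-saturation of a submodule stable under all of [L]. For the
    zero submodule this gives the vectors on which [a] is nilpotent. *)
Lemma satur_sub (U : M -> Prop) : adnil a -> submodule U ->
  submodule (fun v => exists N, U (iter N (act a) v)).
Proof.
move=> nil sU; have sU' := submodule_sub sU; split=> [|c u v [N Nu] [N' Nv]|x v [N Nv]].
- by exists 0%N; case: sU.
- exists (N + N')%N; rewrite iter_actD iter_actZ; apply: subZD => //.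
    by apply: iter_act_le Nu; rewrite ?leq_addr.
  by apply: iter_act_le Nv; rewrite ?leq_addl.
- have [D Dx] := nil x; exists (D + N)%N; exact: iter_act_brk.
Qed.

Lemma zero_sub : submodule (fun v : M => v = 0).
Proof. by split=> [//|c u v -> ->|x v ->]; rewrite ?scaler0 ?addr0 ?act0r. Qed.

Lemma nil_sub : adnil a -> submodule (fun v : M => exists N, iter N (act a) v = 0).
Proof. by move=> nil; apply: (satur_sub nil zero_sub). Qed.
End InModule.

Lemma hom_iter (M N : gmod L) (f : M -> N) a k v : is_hom f ->
  f (iter k (act a) v) = iter k (act a) (f v).
Proof. by move=> hf; elim: k => //= k <-; rewrite hom_act. Qed.

End Nilpotency.

Section Sl2.
Variables (F : numFieldType) (L : lieAlgebra F).

Definition sl2t (e f hh : L) :=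
  [/\ brk e f = hh, brk hh e = 2%:R *: e & brk hh f = - (2%:R *: f)].

Lemma sl2t_swap e f hh : sl2t e f hh -> sl2t f e (- hh).
Proof. by case=> ef he hf; split; rewrite ?brkNl ?he ?hf ?opprK// brkC ef. Qed.

Section Module.
Variables (M : gmod L) (e f hh : L) (tr : sl2t e f hh).
Implicit Types (v z : M) (c : F).
Local Notation E := (act e).
Local Notation D := (act f).
Local Notation wt c v := (act hh v = c *: v).

Lemma sl2_wtE c v k : wt c v -> wt (c + (k.*2)%:R) (iter k E v).
Proof.
case: tr => _ he _ wv; elim: k => [|k IH] /=; first by rewrite addr0.
rewrite act_comm IH he actZl actZr doubleS -addn2 natrD.
lmod F.
Qed.
Lemma sl2_wtD c v k : wt c v -> wt (c - (k.*2)%:R) (iter k D v).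
Proof.
case: tr => _ _ hf wv; elim: k => [|k IH] /=; first by rewrite subr0.
rewrite act_comm IH hf actNl actZl actZr doubleS -addn2 natrD.
lmod F.
Qed.

Lemma sl2_ED c v k : wt c v ->
  E (iter k.+1 D v) = (k.+1%:R * (c - k%:R)) *: iter k D v + iter k.+1 D (E v).
Proof.
case: (tr) => ef _ _ wv; elim: k => [|k IH] /=.
  by rewrite act_comm ef wv subr0 mul1r addrC.
rewrite act_comm -/(iter k.+1 D v) IH ef (sl2_wtD k.+1 wv) actDr actZr /=.
rewrite -addnn natrD; lmod F.
Qed.

Lemma sl2_DE c v k : wt c v ->
  D (iter k.+1 E v) = - (k.+1%:R * (c + k%:R)) *: iter k E v + iter k.+1 E (D v).
Proof.
case: (tr) => ef _ _ wv; elim: k => [|k IH] /=.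
  by rewrite act_comm brkC ef actNl wv addr0 mul1r addrC scaleNr.
rewrite act_comm -/(iter k.+1 E v) IH brkC ef actNl (sl2_wtE k.+1 wv) actDr actZr /=.
rewrite -addnn natrD; lmod F.
Qed.

(** The scalar is the product of the factors $(m+1)(c-m)$, $i\le m<i+j$, produced by [sl2_ED]. *)
Lemma sl2_hw c v i j : wt c v -> E v = 0 -> exists a,
  iter j E (iter (j + i) D v) = a *: iter i D v /\
  ((forall k, (i <= k < j + i)%N -> c != k%:R) -> a != 0).
Proof.
move=> wv Ev; elim: j => [|j [a [aE an]]] /=; first by exists 1; rewrite scale1r oner_neq0.
exists ((j + i).+1%:R * (c - (j + i)%:R) * a); split.
  rewrite -iterS iterSr -iterS (sl2_ED _ wv) Ev iter_act0 addr0 iter_actZ aE.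
  by rewrite scalerA.
move=> H; rewrite !mulf_neq0// ?pnatr_eq0//.
  by rewrite subr_eq0 H// leq_addl /= addSn.
by apply: an => k /andP[ik kji]; apply: H; rewrite ik addSn ltnW.
Qed.

Lemma sl2_kerED c v k N : wt c v -> iter k E v = 0 -> iter (k + N) E (iter N D v) = 0.
Proof.
move=> wv; elim: N c v k wv => [|N IH] c v k wv kv; first by rewrite addn0.
rewrite addnS -addSn iterSr; apply: (IH (c - 2%:R)).
  by have := sl2_wtD 1 wv.
have := sl2_DE k wv; by rewrite [iter k.+1 E v]iterS kv !act0r scaler0 add0r.
Qed.
End Module.

Section Finite.
Variables (M : gmod L) (e f hh : L) (tr : sl2t e f hh).
Implicit Types (v z : M) (c : F).
Local Notation E := (act e).
Local Notation D := (act f).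
Local Notation wt c v := (act hh v = c *: v).

(** Local nilpotency of $f$ replaces finite dimension. Descending on [N], the vector $y=f^Nz$ is
    killed by $f$ and has weight $-(k+2N)$, so $f^{k+2N}e^{k+2N}y$ is a nonzero multiple of $y$,
    while $e^{k+2N}y=0$. *)
Lemma sl2_injE (k : nat) N z : wt (- k%:R) z -> iter k E z = 0 -> iter N D z = 0 -> z = 0.
Proof.
move=> wz kz; elim: N => // N IH DN; apply: IH.
set y := iter N D z.
have wy : act (- hh) y = (k + N.*2)%:R *: y.
  by rewrite actNl (sl2_wtD tr N wz) -scaleNr natrD opprB opprK addrC.
have [a [aE an]] := sl2_hw (sl2t_swap tr) 0 (k + N.*2) wy DN.
have a0 : a != 0 by apply: an => i; rewrite addn0 eqr_nat => /andP[_]; rewrite ltn_neqAle eq_sym => /andP[].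
have kE : iter (k + N.*2) E y = 0.
  by rewrite -addnn addnA addnC iterD (sl2_kerED tr N wz kz) iter_act0.
move: aE; rewrite addn0 kE iter_act0 /=.
by move/esym/eqP; rewrite scaler_eq0 (negbTE a0) => /eqP.
Qed.

(** If $y=e^Nz$ is killed by $e$, a multiple of $f^Ny$ has the same image as [z] under $e^N$.
    Subtracting it lowers [N], and $f^Ny$ itself is a multiple of $e^kf^{k+N}y$. *)
Lemma sl2_surjE (k N : nat) z : wt k%:R z -> iter N E z = 0 ->
  exists2 z', wt (- k%:R) z' & iter k E z' = z.
Proof.
elim: N z => [|N IH] z wz /=; first by move=> ->; exists 0; rewrite ?act0r ?scaler0 ?iter_act0.
move=> EN; set y := iter N E z.
pose c : F := k%:R + N.*2%:R; have wy : wt c y := sl2_wtE tr N wz.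
have cE : c = (k + N.*2)%:R by rewrite natrD.
have [a [aE an]] := sl2_hw tr 0 N wy EN.
have [b [bE bn]] := sl2_hw tr N k wy EN.
have a0 : a != 0 by apply: an => i /andP[_]; rewrite addn0 cE eqr_nat => ?; apply/eqP; lia.
have b0 : b != 0 by apply: bn => i /andP[_]; rewrite cE eqr_nat => ?; apply/eqP; lia.
have wN : wt k%:R (iter N D y) by have := sl2_wtD tr N wy; rewrite /c addrK.
have [||z1 wz1 z1E] := IH (z - a^-1 *: iter N D y).
- by rewrite actBr actZr wz wN; lmod F.
- by move: aE; rewrite addn0 /= -scaleNr addrC iter_actD iter_actZ => ->; rewrite scalerA mulNr mulVf// scaleN1r addNr.
exists (z1 + (a^-1 * b^-1) *: iter (k + N) D y).
  rewrite actDr actZr wz1; have -> := sl2_wtD tr (k + N) wy.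
  have -> : c - (k + N).*2%:R = - k%:R by rewrite /c -!addnn !natrD; ring.
  by lmod F.
rewrite iter_actD iter_actZ z1E bE scalerA -mulrA mulVf// mulr1; lmod F.
Qed.

Lemma sl2_hw_nat c N z : z != 0 -> wt c z -> E z = 0 -> iter N D z = 0 ->
  exists2 k : nat, c = k%:R & iter k.+1 D z = 0.
Proof.
move=> z0 wz Ez; elim: N => [/= zz|N IH DN]; first by rewrite zz eqxx in z0.
have [/IH//|n0] := eqVneq (iter N D z) 0.
exists N => //; have := sl2_ED tr N wz; rewrite DN Ez iter_act0 addr0 act0r => /esym/eqP.
by rewrite scaler_eq0 (negbTE n0) orbF mulf_eq0 pnatr_eq0 subr_eq0 => /eqP.
Qed.
End Finite.

Section Integral.
Variables (M : gmod L) (e f hh : L) (tr : sl2t e f hh).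
Hypothesis nilE : forall v : M, exists N, iter N (act e) v = 0.
Hypothesis nilD : forall v : M, exists N, iter N (act f) v = 0.

(** The top of the $e$-string of [z] is a highest weight vector on which $f$ is nilpotent, so its
    weight is a natural number; [c] differs from it by an even integer. *)
Lemma sl2_int c (z : M) : z != 0 -> act hh z = c *: z -> exists m : int, c = m%:~R.
Proof.
move=> z0 wz; have [N EN] := nilE z.
have [k k0 kS] : exists2 k, iter k (act e) z != 0 & act e (iter k (act e) z) = 0.
  elim: N EN => [/= zz|N IH EN]; first by rewrite zz eqxx in z0.
  by have [/IH//|n0] := eqVneq (iter N (act e) z) 0; exists N.
have [N' DN] := nilD (iter k (act e) z).
have [m cm _] := sl2_hw_nat tr k0 (sl2_wtE tr k wz) kS DN.
exists (m%:Z - (k.*2)%:Z); rewrite rmorphB /= -!pmulrn -cm addrK//.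
Qed.
End Integral.
End Sl2.

(** * Weights *)

Section Eigencomponents.
Variables (F : fieldType) (V : lmodType F) (I : Type) (W : eqType) (ev : W -> I -> F).
Variable (A : I -> V -> V).
Hypothesis evI : forall w w', w != w' -> exists i, ev w i != ev w' i.
Hypothesis linA : forall i, linear (A i).
Implicit Types (s : seq (W * V)).

Definition eigen w v := forall i, A i v = ev w i *: v.

Lemma opD i u v : A i (u + v) = A i u + A i v.
Proof. by have := linA i 1 u v; rewrite !scale1r. Qed.
Lemma op0 i : A i 0 = 0.
Proof. by apply: (addrI (A i 0)); rewrite -opD !addr0. Qed.
Lemma op_sum i J (r : seq J) p (g : J -> V) :
  A i (\sum_(j <- r | p j) g j) = \sum_(j <- r | p j) A i (g j).
Proof. by elim/big_rec2: _ => [|j u w _ <-]; [exact: op0|exact: opD]. Qed.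

Lemma eigen_sub w : subspace (eigen w).
Proof.
split=> [i|a u v eu ev' i]; first by rewrite op0 scaler0.
by rewrite linA eu ev' scalerDr !scalerA mulrC.
Qed.

Definition all_eigen s := forall p, p \in s -> eigen p.1 p.2.

(** The component is extracted by applying $(A_i-m_i)/(w_i-m_i)$ once for each other eigenvalue $m$,
    with $i$ separating $m$ from $w$. Each of these operators preserves [P]. *)
Lemma eigen_comp (P : V -> Prop) s w : subspace P -> (forall i v, P v -> P (A i v)) ->
  all_eigen s -> P (\sum_(p <- s) p.2) -> P (\sum_(p <- s | p.1 == w) p.2).
Proof.
move=> sP stP; pose ms := [seq p.1 | p <- s & p.1 != w].
have : forall p, p \in s -> p.1 \in w :: ms.
  move=> p ps; rewrite inE; case: eqVneq => //= pw.
  by apply/mapP; exists p; rewrite ?mem_filter ?pw.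
have : w \notin ms by apply/negP => /mapP[p]; rewrite mem_filter => /andP[/eqP pw _] /esym.
clearbody ms; elim: ms s => [|m ms IH] s.
  move=> _ sw es Ps; rewrite (_ : \sum_(p <- s | _) _ = \sum_(p <- s) p.2)//.
  by rewrite big_seq_cond [RHS]big_seq; apply: eq_bigl => p; case ps: (p \in s) => //=; have := sw _ ps; rewrite inE => ->.
rewrite inE negb_or => /andP[wm wms] sw es Ps.
have [i wi] := evI wm.
pose c p := (ev p i - ev m i) / (ev w i - ev m i).
have d0 : ev w i - ev m i != 0 by rewrite subr_eq0.
pose s' := [seq (p.1, c p.1 *: p.2) | p <- s & p.1 != m].
have -> : \sum_(p <- s | p.1 == w) p.2 = \sum_(p <- s' | p.1 == w) p.2.
  rewrite big_map big_filter_cond; apply: eq_big => [p|p /eqP -> /=].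
    by case: eqP => [->|]; rewrite ?wm ?andbF.
  by rewrite /c divff// scale1r.
apply: (IH s') => //.
- move=> _ /mapP[p + ->]; rewrite mem_filter => /andP[pm /sw] /=.
  by rewrite !inE (negbTE pm).
- move=> _ /mapP[p + ->]; rewrite mem_filter => /andP[pm /es ep] /=.
  exact: (subZ (eigen_sub _) _ ep).
have -> : \sum_(p <- s') p.2 = (ev w i - ev m i)^-1 *: (A i (\sum_(p <- s) p.2) - ev m i *: \sum_(p <- s) p.2).
  rewrite big_map big_filter op_sum scaler_sumr -sumrB scaler_sumr big_mkcond /=.
  rewrite big_seq [RHS]big_seq; apply: eq_bigr => p ps.
  rewrite (es _ ps) -scalerBl scalerA /c mulrC; case: eqP => [->|//].
  by rewrite subrr mulr0 scale0r.
by apply: subZ => //; apply: subB => //; [apply: stP|apply: subZ].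
Qed.

Lemma big_fst_undup s : \sum_(p <- s) p.2 =
  \sum_(w <- undup (map fst s)) \sum_(p <- s | p.1 == w) p.2.
Proof.
rewrite (exchange_big_dep xpredT)//= big_seq [RHS]big_seq; apply: eq_bigr => p ps.
rewrite (eq_bigl (pred1 p.1)); last by move=> w; rewrite eq_sym.
by rewrite -big_filter filter_pred1_uniq ?undup_uniq ?mem_undup ?map_f// big_seq1.
Qed.

Lemma eigen_dec (P : V -> Prop) s v : subspace P -> (forall i v, P v -> P (A i v)) ->
  all_eigen s -> v = \sum_(p <- s) p.2 -> P v ->
  exists s', [/\ uniq (map fst s'), all_eigen s', forall p, p \in s' -> P p.2,
    v = \sum_(p <- s') p.2 & {subset map fst s' <= map fst s}].
Proof.
move=> sP stP es vE Pv.
exists [seq (w, \sum_(p <- s | p.1 == w) p.2) | w <- undup (map fst s)].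
have E : [seq p.1 | p <- [seq (w, \sum_(p <- s | p.1 == w) p.2) | w <- undup [seq i.1 | i <- s]]]
  = undup [seq i.1 | i <- s] by rewrite -map_comp map_id.
split.
- by rewrite E undup_uniq.
- move=> _ /mapP[w _ ->] /=; rewrite big_seq_cond.
  by apply: (sub_sum (eigen_sub w)) => p /andP[/es + /eqP <-].
- by move=> _ /mapP[w _ ->] /=; apply: eigen_comp => //; rewrite -vE.
- by rewrite big_map vE -big_fst_undup.
- by rewrite E => w; rewrite mem_undup.
Qed.

End Eigencomponents.

Section Weights.
Variables (F : fieldType) (L : lieAlgebra F) (h : {vspace L}).
Local Notation hd := 'Hom(subvs_of h, F^o).

Lemma hd_neq (la mu : hd) : la != mu -> exists t : subvs_of h, (la t : F) != mu t.
Proof.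
move=> /eqP N; apply: contrapT => H; apply: N; apply/lfunP => t.
by apply/eqP; apply: contraT => n; case: H; exists t.
Qed.

Lemma mk_hd (c : subvs_of h -> F) : (forall a s t, c (a *: s + t) = a * c s + c t) ->
  exists la : hd, forall t, la t = c t.
Proof.
move=> lc.
pose c' : {linear subvs_of h -> F^o} :=
  HB.pack (c : subvs_of h -> F^o) (GRing.isLinear.Build F (subvs_of h) F^o *:%R c lc).
by exists (linfun c') => t; rewrite lfunE.
Qed.

Section InModule.
Variable M : gmod L.
Implicit Types (v : M) (la mu : hd).

Lemma weight_sub la : subspace (fun v : M => weight_vec la v).
Proof.
split=> [t|a u v wu wv t]; first by rewrite act0r scaler0.
by rewrite actDr actZr wu wv scalerDr !scalerA mulrC.
Qed.
Lemma weight0 la : weight_vec la (0 : M). Proof. exact: (sub0 (weight_sub la)). Qed.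

Lemma weight_uniq la mu v : v != 0 -> weight_vec la v -> weight_vec mu v -> la = mu.
Proof.
move=> v0 lv mv; apply/lfunP => t; have := lv t; rewrite mv => /eqP.
by rewrite -subr_eq0 -scalerBl scaler_eq0 (negbTE v0) orbF subr_eq0 eq_sym => /eqP.
Qed.

Lemma weight_act (al la : hd) x v : root_vec al x -> weight_vec la v -> weight_vec (al + la) (act x v).
Proof.
by move=> rx wv t; rewrite act_comm wv rx actZl actZr lfunE /= addrC scalerDl.
Qed.

Definition wdec (s : seq (hd * M)) := forall p, p \in s -> weight_vec p.1 p.2.
Definition wmod := forall v, exists2 s, wdec s & v = \sum_(p <- s) p.2.

Lemma wcomp (P : M -> Prop) s la : subspace P -> (forall t : subvs_of h, forall v, P v -> P (act (vsval t) v)) ->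
  wdec s -> P (\sum_(p <- s) p.2) -> P (\sum_(p <- s | p.1 == la) p.2).
Proof.
exact: (@eigen_comp F M (subvs_of h) _ (fun (la : hd) t => la t) (fun t => act (vsval t)) hd_neq (fun t => act_linr _)).
Qed.

Lemma wdec_in (P : M -> Prop) s v : subspace P -> (forall t : subvs_of h, forall v, P v -> P (act (vsval t) v)) ->
  wdec s -> v = \sum_(p <- s) p.2 -> P v ->
  exists s', [/\ uniq (map fst s'), wdec s', forall p, p \in s' -> P p.2,
    v = \sum_(p <- s') p.2 & {subset map fst s' <= map fst s}].
Proof.
exact: (@eigen_dec F M (subvs_of h) _ (fun (la : hd) t => la t) (fun t => act (vsval t)) hd_neq (fun t => act_linr _)).
Qed.

Lemma wdec_comp0 s la : wdec s -> \sum_(p <- s) p.2 = 0 -> \sum_(p <- s | p.1 == la) p.2 = 0.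
Proof.
move=> ws s0; apply: (wcomp (P := fun v => v = 0)) => //.
  by split=> // a u v -> ->; rewrite scaler0 addr0.
by move=> t v ->; rewrite act0r.
Qed.

Lemma wdec_wv s la v : wdec s -> weight_vec la v -> v = \sum_(p <- s) p.2 ->
  v = \sum_(p <- s | p.1 == la) p.2.
Proof.
move=> ws wv vE.
have := @wdec_comp0 ((la, - v) :: s) la; rewrite !big_cons /= eqxx -vE addNr.
move=> H; apply/eqP; rewrite eq_sym -subr_eq0 addrC; apply/eqP/H => // p.
rewrite inE => /predU1P[->/=|]; last exact: ws.
exact: (subN (weight_sub la) wv).
Qed.

Lemma submodule_h (P : M -> Prop) : submodule P -> forall t : subvs_of h, forall v, P v -> P (act (vsval t) v).
Proof. by move=> sP t v; apply: submodule_act. Qed.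
End InModule.

Lemma hom_weight (M N : gmod L) (f : M -> N) (la : hd) v : is_hom f -> weight_vec la v -> weight_vec la (f v).
Proof. by move=> hf wv t; rewrite -hom_act// wv homZ. Qed.

Lemma hom_inj_weight (M N : gmod L) (f : M -> N) (la : hd) v : is_hom f -> injective f ->
  weight_vec la (f v) -> weight_vec la v.
Proof. by move=> hf inj wv t; apply: inj; rewrite hom_act// wv homZ. Qed.
End Weights.

(** * Roots of a semisimple Lie algebra *)

Section CartanDecomposition.
Variables (F : fieldType) (L : lieAlgebra F) (h : {vspace L}).
Local Notation hd := 'Hom(subvs_of h, F^o).
Hypothesis hcart : cartan h.

Lemma cartan_abel s t : s \in h -> t \in h -> brk s t = 0.
Proof.
case: hcart => ab _ _ sh th.
have : forall u v : L, u \in h -> v \in h -> brk u v \in brkv h h.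
  move=> u v uh vh; rewrite (coord_vbasis uh) (coord_vbasis vh).
  have -> : brk (\sum_i coord (vbasis h) i u *: (vbasis h)`_i) (\sum_i coord (vbasis h) i v *: (vbasis h)`_i)
     = \sum_i coord (vbasis h) i u *: \sum_j coord (vbasis h) j v *: brk (vbasis h)`_i (vbasis h)`_j.
    have := @act_suml F L (adj L) _ (index_enum 'I_(\dim h)) xpredT.
    rewrite /= => ->; apply: eq_bigr => i _; rewrite brkZl; congr (_ *: _).
    have := @act_sumr F L (adj L) (vbasis h)`_i _ (index_enum 'I_(\dim h)) xpredT.
    by move=> /= ->; apply: eq_bigr => j _; rewrite brkZr.
  apply: memv_suml => i _; apply: memvZ; apply: memv_suml => j _; apply: memvZ.
  by apply: memv_span; apply: allpairs_f; apply: mem_nth; rewrite size_tuple.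
by move=> /(_ s t sh th); rewrite ab memv0 => /eqP.
Qed.

(** The operators are diagonalized one at a time; refining by a further one keeps the earlier
    eigenvectors because elements of [h] commute. *)
Lemma ad_eigen_dec (ts : seq L) (x : L) : {subset ts <= h} -> exists2 s : seq L,
  x = \sum_(u <- s) u & forall u, u \in s -> forall t, t \in ts -> exists c : F, brk t u = c *: u.
Proof.
elim: ts x => [|t ts IH] x tsh; first by exists [:: x] => //; rewrite big_seq1.
have [s -> sP] := IH x (fun t' t'h => tsh _ (mem_behead (s := t :: ts) t'h)).
have th : t \in h by apply: tsh; rewrite mem_head.
have [_ _ /(_ t th) [X bX eX]] := hcart.
have step u : (forall t', t' \in ts -> exists c : F, brk t' u = c *: u) -> exists2 s' : seq L,
    u = \sum_(u <- s') u & forall u, u \in s' -> forall t', t' \in t :: ts -> exists c : F, brk t' u = c *: u.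
  move=> uP.
  have /choice[c cP] : forall i : 'I_(size X), exists c : F, brk t X`_i = c *: X`_i.
    by move=> i; apply: eX; apply: mem_nth.
  pose s0 := [seq (c i, coord (in_tuple X) i u *: X`_i) | i <- index_enum 'I_(size X)].
  have uE : u = \sum_(p <- s0) p.2.
    rewrite big_map [LHS](coord_basis (X := in_tuple X) bX (memvf u)).
    by apply: eq_bigr => i _.
  (* [P] collects the vectors sharing the eigenvalues of [u]. It is stable under $\mathrm{ad}\,t$ by
     commutativity, so the components of [u] inherit these eigenvalues. *)
  pose P (v : L) := forall t', t' \in ts -> forall c : F, brk t' u = c *: u -> brk t' v = c *: v.
  have [|||||s' [us es Ps sE _]] := @eigen_dec F L unit F (fun c _ => c) (fun _ => brk t) _ (fun=> brk_linr t) P s0 u _ _ _ uE.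
  - by move=> w w' ww'; exists tt.
  - split=> [t' _ c' _|a v w Pv Pw t' t's c' cu]; first by rewrite brk0r scaler0.
    by rewrite brkDr brkZr (Pv _ t's _ cu) (Pw _ t's _ cu) scalerDr !scalerA mulrC.
  - move=> _ v Pv t' t's c' cu; rewrite [brk t' _](_ : _ = brk t (brk t' v)).
      by rewrite (Pv _ t's _ cu) brkZr.
    have := @act_comm F L (adj L) t' t v => /= ->.
    rewrite (@cartan_abel t' t) ?brk0l ?addr0//; apply: tsh; by rewrite inE t's orbT.
  - by move=> _ /mapP[i _ ->] _ /=; rewrite brkZr cP !scalerA mulrC.
  - by move=> t' t's c' ->.
  exists (map snd s'); first by rewrite big_map.
  move=> _ /mapP[p ps ->] t'; rewrite inE => /predU1P[->|t's].
    by exists p.1; apply: (es _ ps tt).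
  have [c' cu] := uP _ t's; exists c'; exact: (Ps _ ps).
elim: s sP {x} => [|u s IHs] sP; first by exists [::].
have [|s1 s1E s1P] := IHs; first by move=> v vs; apply: sP; rewrite inE vs orbT.
have [|s2 s2E s2P] := step u; first by apply: sP; rewrite mem_head.
exists (s2 ++ s1); first by rewrite big_cat big_cons -s2E -s1E.
by move=> v; rewrite mem_cat => /orP[/s2P|/s1P].
Qed.

Lemma joint_root (u : L) : (forall t, t \in vbasis h -> exists c : F, brk t u = c *: u) ->
  exists al : hd, root_vec al u.
Proof.
move=> H; have [->|u0] := eqVneq u 0.
  by exists 0 => t; rewrite brk0r scaler0.
have /choice[c cP] : forall t : subvs_of h, exists c : F, brk (vsval t) u = c *: u.
  move=> t; have /choice[c cP] : forall i : 'I_(\dim h), exists c : F, brk (vbasis h)`_i u = c *: u.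
    by move=> i; apply: H; apply: mem_nth; rewrite size_tuple.
  exists (\sum_i coord (vbasis h) i (vsval t) * c i); rewrite {1}(coord_vbasis (subvsP t)).
  have := @act_suml F L (adj L) _ (index_enum 'I_(\dim h)) xpredT.
  by move=> /= ->; rewrite scaler_suml; apply: eq_bigr => i _; rewrite brkZl cP scalerA.
have [a s t|al alE] := mk_hd (c := c); last by exists al => t; rewrite alE cP.
apply/eqP; rewrite -subr_eq0; have : (c (a *: s + t) - (a * c s + c t)) *: u = 0.
  by rewrite scalerBl -cP linearP brkDl brkZl !cP scalerDl scalerA subrr.
by move/eqP; rewrite scaler_eq0 (negbTE u0) orbF.
Qed.

Lemma adj_wmod : wmod h (adj L).
Proof.
move=> x; have [s -> sP] := @ad_eigen_dec (vbasis h) x (fun t tb => vbasis_mem tb).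
elim: s sP => [|u s IH] sP; first by exists [::]; rewrite ?big_nil.
have [|s1 s1P s1E] := IH; first by move=> v vs; apply: sP; rewrite inE vs orbT.
rewrite big_cons s1E; have [|al ru] := @joint_root u; first by apply: sP; rewrite mem_head.
by exists ((al, u) :: s1); [move=> p; rewrite inE => /predU1P[->//|/s1P]|rewrite big_cons].
Qed.

(** Only weights occurring in the decomposition of a basis of [L] are possible. *)
Lemma weights_finite : exists2 l : seq hd, uniq l &
  forall al, al \in l <-> exists2 x : L, x != 0 & root_vec al x.
Proof.
have /choice[s sP] : forall i : 'I_(\dim {:L}), exists s : seq (hd * adj L),
    wdec s /\ (vbasis {:L})`_i = \sum_(p <- s) p.2.
  by move=> i; have [s] := adj_wmod (vbasis {:L})`_i; exists s.
pose l0 := undup (flatten [seq map fst (s i) | i <- enum 'I_(\dim {:L})]).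
exists [seq al <- l0 | `[< exists2 x : L, x != 0 & root_vec al x >]].
  by rewrite filter_uniq// undup_uniq.
move=> al; rewrite mem_filter; split=> [/andP[/asboolP]//|[x x0 rx]].
apply/andP; split; first by apply/asboolP; exists x.
apply: contraT => nal; case/negP: x0; apply/eqP.
pose s0 := flatten [seq [seq (p.1, coord (vbasis {:L}) i x *: p.2 : adj L) | p <- s i] | i <- enum 'I_(\dim {:L})].
have xE : (x : adj L) = \sum_(p <- s0) p.2.
  rewrite big_flatten /= big_map big_enum /= [LHS](coord_vbasis (memvf x)).
  apply: eq_bigr => i _; rewrite big_map /= (proj2 (sP i)) scaler_sumr; exact: eq_bigr.
have ws : wdec s0.
  move=> p /flattenP[_ /mapP[i _ ->] /mapP[q qs ->]] /=.
  by apply: (subZ (weight_sub _ _)); apply: (proj1 (sP i)).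
rewrite (wdec_wv ws (rx : weight_vec al (x : adj L)) xE) big_seq_cond big1// => p /andP[ps /eqP pal].
case/negP: nal; rewrite -pal mem_undup; move: ps => /flattenP[_ /mapP[i _ ->] /mapP[q qs ->]] /=.
by apply/flattenP; exists (map fst (s i)); [apply: map_f; rewrite mem_enum|apply: map_f].
Qed.
End CartanDecomposition.

Section VspaceOfPredicate.
Variables (F : fieldType) (V : vectType F).

(** A subspace inside [P] of maximal dimension already exhausts it. This passes from predicates to
    objects with a dimension. *)
Lemma vspace_of (P : V -> Prop) : subspace P -> exists U : {vspace V}, forall v, v \in U <-> P v.
Proof.
move=> sP; pose Q n := `[< exists2 U : {vspace V}, \dim U = n & forall v, v \in U -> P v >].
have Q0 : exists n, Q n.
  by exists 0%N; apply/asboolP; exists 0%VS; rewrite ?dimv0// => v; rewrite memv0 => /eqP ->; apply: sub0.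
have Qb n : Q n -> (n <= \dim {:V})%N by move=> /asboolP[U <- _]; apply: dimvS; apply: subvf.
have [_ /asboolP[U <- UP] Umax] := ex_maxnP Q0 Qb.
exists U => v; split=> [/UP//|Pv]; apply: contraT => vU.
suff /Umax : Q (\dim (U + <[v]>)).
  move=> le; case/negP: vU; rewrite memvE.
  have /eqP {1}-> : U == (U + <[v]>)%VS by rewrite eqEdim addvSl.
  exact: addvSr.
apply/asboolP; exists (U + <[v]>)%VS => // w /memv_addP[u uU [_ /vlineP[a ->] ->]].
by apply: subD => //; [apply: UP|apply: subZ].
Qed.

End VspaceOfPredicate.

Section BracketSpaces.
Variables (F : fieldType) (L : lieAlgebra F).
Implicit Types (U V W : {vspace L}).

Lemma mem_brkv U V x y : x \in U -> y \in V -> brk x y \in brkv U V.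
Proof.
move=> xU yV; rewrite (coord_vbasis xU) (coord_vbasis yV).
have := @act_suml F L (adj L) _ (index_enum 'I_(\dim U)) xpredT => /= ->.
apply: memv_suml => i _; rewrite brkZl; apply: memvZ.
have := @act_sumr F L (adj L) (vbasis U)`_i _ (index_enum 'I_(\dim V)) xpredT => /= ->.
apply: memv_suml => j _; rewrite brkZr; apply: memvZ.
by apply: memv_span; apply: allpairs_f; apply: mem_nth; rewrite size_tuple.
Qed.

Lemma brkv_sub U V W : (forall x y, x \in U -> y \in V -> brk x y \in W) -> (brkv U V <= W)%VS.
Proof.
move=> H; apply/span_subvP => _ /allpairsP[[x y] [/= xU yV ->]].
by apply: H; apply: vbasis_mem.
Qed.

Lemma abelian_ideal0 U : semisimple L -> (forall x u, u \in U -> brk x u \in U) ->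
  (forall u v, u \in U -> v \in U -> brk u v = 0) -> U = 0%VS.
Proof.
move=> ss ideal ab; apply: ss.
  by apply: brkv_sub => x y _; apply: ideal.
exists 1%N; apply/eqP; rewrite -subv0; apply: brkv_sub => x y xU yU.
by rewrite ab// mem0v.
Qed.

Lemma center0 (x : L) : semisimple L -> (forall y : L, brk y x = 0) -> x = 0.
Proof.
move=> ss xc; have /eqP : <[x]>%VS = 0%VS.
  apply: abelian_ideal0 => // [y _ /vlineP[a ->]|_ v /vlineP[a ->] _].
    by rewrite brkZr xc scaler0 mem0v.
  by rewrite brkZl brkC xc oppr0 scaler0.
by rewrite -subv0 => /subvP/(_ x (memv_line x)); rewrite memv0 => /eqP.
Qed.
End BracketSpaces.

Import passmx.

(** * Traces of linear endomorphisms *)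

Section Trace.
Variables (F : numClosedFieldType) (V : vectType F).
Local Notation vb := (vbasis {:V}).

Definition ltr (phi : 'End(V)) : F := \tr (mxof vb vb phi).

Lemma ltr_lin a phi psi : ltr (a *: phi + psi) = a * ltr phi + ltr psi.
Proof. by rewrite /ltr linearP mxtraceD mxtraceZ. Qed.

Lemma ltrC phi psi : ltr (phi \o psi)%VF = ltr (psi \o phi)%VF.
Proof. by rewrite /ltr !(@mxof_comp _ _ _ _ vb vb vb)// ?vbasisP// mxtrace_mulC. Qed.

Lemma ltr_basis (X : (\dim {:V}).-tuple V) phi : basis_of {:V} X ->
  ltr phi = \tr (mxof X X phi).
Proof.
move=> bX; have bv : basis_of {:V} vb := vbasisP _.
have E : mxof X X phi = mxof X vb \1 *m (mxof vb vb phi *m mxof vb X \1).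
  rewrite -(@mxof_comp _ _ _ _ vb vb X)// -(@mxof_comp _ _ _ _ X vb X)//.
  by rewrite comp_lfun1l comp_lfun1r.
rewrite E mxtrace_mulC -mulmxA -(@mxof_comp _ _ _ _ vb X vb)// comp_lfun1l.
by rewrite mxof1 ?(basis_free bv)// mulmx1.
Qed.

Lemma ltr_eigen (X : (\dim {:V}).-tuple V) (phi : 'End(V)) (d : 'I_(\dim {:V}) -> F) : basis_of {:V} X ->
  (forall i : 'I_(\dim {:V}), phi X`_i = d i *: X`_i) -> ltr phi = \sum_i d i.
Proof.
move=> bX H; rewrite (ltr_basis _ bX); apply: eq_bigr => i _.
by rewrite !mxE /= vecof_delta H linearZ /= coord_free ?(basis_free bX)// eqxx mulr1.
Qed.

(** All eigenvalues vanish, so the characteristic polynomial is a power of the indeterminate, and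
    its second coefficient, minus the trace, is zero. *)
Lemma mxtrace_nilp n (A : 'M[F]_n) k : (forall v : 'rV_n, iter k (mulmxr A) v = 0) -> \tr A = 0.
Proof.
case: n A => [|n] A nil; first by rewrite /mxtrace big_ord0.
have [rs Ers] := closed_field_poly_normal (char_poly A).
have r0 r : r \in rs -> r = 0.
  move=> rrs; have : root (char_poly A) r.
    by rewrite Ers rootZ ?root_prod_XsubC// (monicP (char_poly_monic A)) oner_neq0.
  rewrite -eigenvalue_root_char => /eigenvalueP[v vA v0].
  have iterE m : iter m (mulmxr A) v = r ^+ m *: v.
    elim: m => [|m IH] /=; first by rewrite expr0 scale1r.
    by rewrite IH -scalemxAl vA scalerA -exprSr.
  by have /eqP := nil v; rewrite iterE scaler_eq0 (negbTE v0) orbF expf_eq0 => /andP[_ /eqP].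
have : char_poly A = 'X^(size rs).
  rewrite Ers (monicP (char_poly_monic A)) scale1r.
  elim: rs r0 {Ers} => [|r rs IH] r0; first by rewrite big_nil.
  rewrite big_cons IH; last by move=> x xs; apply: r0; rewrite inE xs orbT.
  by rewrite (r0 r (mem_head _ _)) subr0 -exprS.
move=> E; have szE : size rs = n.+1.
  by have := size_char_poly A; rewrite E size_polyXn => -[].
have := @char_poly_trace F n.+1 A isT; rewrite E coefXn szE eqn_leq /= ltnn andbF.
by move=> /eqP; rewrite eq_sym oppr_eq0 => /eqP.
Qed.

Lemma ltr_nilp (phi : 'End(V)) k : (forall v, iter k phi v = 0) -> ltr phi = 0.
Proof.
move=> nil; apply: (@mxtrace_nilp _ _ k) => v.
have bv : basis_of {:V} vb := vbasisP _.
suff E w : iter k (mulmxr (mxof vb vb phi)) (rVof vb w) = rVof vb (iter k phi w).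
  by rewrite -[v](vecofK bv) E nil linear0.
by elim: k {nil} => //= k ->; rewrite (rVof_app _ bv).
Qed.
End Trace.

Section RootVectors.
Variables (F : numClosedFieldType) (L : lieAlgebra F) (h : {vspace L}).
Local Notation hd := 'Hom(subvs_of h, F^o).
Hypotheses (hss : semisimple L) (hcart : cartan h).
Implicit Types (al be ga : hd) (x y z : L).

Definition rts0 : seq hd := s2val (cid2 (weights_finite hcart)).
Lemma rts0_uniq : uniq rts0. Proof. exact: (s2valP (cid2 (weights_finite hcart))). Qed.
Lemma rts0P al : al \in rts0 <-> exists2 x : L, x != 0 & root_vec al x.
Proof. exact: (s2valP' (cid2 (weights_finite hcart))). Qed.
Definition rts : seq hd := [seq al <- rts0 | al != 0].
Lemma rts_uniq : uniq rts. Proof. exact/filter_uniq/rts0_uniq. Qed.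
Lemma rtsP al : al \in rts <-> is_root al.
Proof.
rewrite mem_filter; split=> [/andP[a0 /rts0P]|[a0 /rts0P ?]]; first by split.
by rewrite a0.
Qed.

Lemma cartan_h x : x \in h <-> root_vec (0 : hd) x.
Proof.
case: (hcart) => _ cent _; split=> [xh t|rx].
  by rewrite lfunE scale0r; apply: cartan_abel (subvsP t) xh.
apply: cent => t th; have := rx (vsproj h t); rewrite vsprojK// => ->.
by rewrite lfunE scale0r.
Qed.

Lemma root_vecD al x y : root_vec al x -> root_vec al y -> root_vec al (x + y).
Proof. exact: (subD (@weight_sub _ _ _ (adj L) al)). Qed.
Lemma root_vecZ al c x : root_vec al x -> root_vec al (c *: x).
Proof. exact: (subZ (@weight_sub _ _ _ (adj L) al)). Qed.
Lemma root_vecN al x : root_vec al x -> root_vec al (- x).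
Proof. exact: (subN (@weight_sub _ _ _ (adj L) al)). Qed.
Lemma root_vec_brk al be x y : root_vec al x -> root_vec be y -> root_vec (al + be) (brk x y).
Proof. exact: (@weight_act _ _ _ (adj L)). Qed.
Lemma root_vec_h al x (t : subvs_of h) : root_vec al x -> brk x (vsval t) = - ((al t : F) *: x).
Proof. by move=> rx; rewrite brkC rx. Qed.

(* Shifting weights by a nonzero al infinitely often would give infinitely many roots. *)
Lemma shift_nil (g : L -> L) al : al != 0 -> (forall x y, g (x + y) = g x + g y) ->
  (forall be x, root_vec be x -> root_vec (be + al) (g x)) ->
  forall x, iter (size rts0).+1 g x = 0.
Proof.
move=> a0 gD gr x; set n := (size rts0).+1.
have g0 : g 0 = 0 by apply: (addrI (g 0)); rewrite -gD !addr0.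
have itD : forall k y z, iter k g (y + z) = iter k g y + iter k g z.
  by elim=> // k IH y z /=; rewrite IH gD.
have it0 k : iter k g 0 = 0 by elim: k => //= k ->.
have itr be y k : root_vec be y -> root_vec (be + al *+ k) (iter k g y).
  by move=> ry; elim: k => [|k IH] /=; rewrite ?addr0// mulrSr addrA; apply: gr.
have wv0 be y : root_vec be y -> iter n g y = 0.
  move=> ry; apply/eqP; apply: contraT => yn.
  have nz k : (k <= n)%N -> iter k g y != 0.
    by move=> /subnK E; apply: contra yn => /eqP z0; rewrite -E iterD z0 it0.
  have : uniq [seq be + al *+ k | k <- iota 0 n].
    rewrite map_inj_uniq ?iota_uniq// => i j /addrI /eqP.
    rewrite -!scaler_nat -subr_eq0 -scalerBl scaler_eq0 (negbTE a0) orbF subr_eq0.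
    by rewrite eqr_nat => /eqP.
  move=> us; have := @uniq_leq_size _ _ rts0 us; rewrite size_map size_iota ltnn; apply.
  move=> ga /mapP[k]; rewrite mem_iota add0n => /andP[_ kn] ->.
  by apply/rts0P; exists (iter k g y); [apply: nz; apply: ltnW|apply: itr].
have [s ws ->] := adj_wmod hcart x.
elim: s ws => [|p s IH] ws; first by rewrite big_nil it0.
rewrite big_cons itD IH; last by move=> q qs; apply: ws; rewrite inE qs orbT.
by rewrite addr0; apply: (wv0 p.1); apply: ws; rewrite mem_head.
Qed.

Lemma root_adnil al x : al != 0 -> root_vec al x -> adnil x.
Proof.
move=> a0 rx y; exists (size rts0).+1; apply: (shift_nil a0); first by move=> ? ?; rewrite brkDr.
by move=> be z rz; rewrite addrC; apply: root_vec_brk.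
Qed.

Lemma brk_opp_h al e f : root_vec al e -> root_vec (- al) f -> brk e f \in h.
Proof. by move=> re rf; apply/cartan_h; have := root_vec_brk re rf; rewrite subrr. Qed.

(** If [al] vanishes at $t=[e,f]$, then $t$ acts by one scalar $\beta(t)$ on a whole [al]-string.
    From a vector $w$ killed by $e$ one gets $ef^{j+1}w=(j+1)\beta(t)f^jw$, and nilpotency of $f$
    forces $\beta(t)=0$. So $t$ is central, hence zero. *)
Lemma opp_brk al e f (t : subvs_of h) : al != 0 -> root_vec al e -> root_vec (- al) f ->
  vsval t = brk e f -> al t = 0 -> brk e f = 0.
Proof.
move=> a0 re rf tE at0; apply: center0 => // y; rewrite brkC; apply/eqP; rewrite oppr_eq0; apply/eqP.
suff H be z : root_vec be z -> be t = 0 \/ z = 0.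
  have [s ws ->] := adj_wmod hcart y.
  have := @act_sumr F L (adj L) (brk e f) _ s xpredT snd => /= ->.
  rewrite big_seq big1// => p ps; rewrite -tE; have /= -> := ws _ ps t.
  by case: (H _ _ (ws _ ps)) => ->; rewrite ?scale0r ?scaler0.
move=> rz; have [->|z0] := eqVneq z 0; [by right|left].
have na0 : - al != 0 by rewrite oppr_eq0.
have tact k w : root_vec (be + al *+ k) w -> brk (vsval t) w = be t *: w.
  move=> /(_ t) ->; rewrite lfunE /= -scaler_nat lfunE /=.
  by rewrite at0 scaler0 addr0.
have [k k0 kS] : exists2 k, iter k (brk e) z != 0 & brk e (iter k (brk e) z) = 0.
  have [N] := root_adnil a0 re z.
  elim: N => [/= zz|N IH EN]; first by rewrite zz eqxx in z0.
  by have [/IH//|n0] := eqVneq (iter N (brk e) z) 0; exists N.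
set w := iter k _ z in k0 kS.
have rw : root_vec (be + al *+ k) w.
  rewrite /w; elim: (k) => [|j IH] /=; first by rewrite addr0.
  by rewrite mulrS addrCA; apply: root_vec_brk.
have rF j : root_vec (be + al *+ k - al *+ j) (iter j (brk f) w).
  elim: j => [|j IH] /=; first by rewrite subr0.
  by rewrite mulrS opprD addrCA; apply: root_vec_brk.
have tF j : brk (vsval t) (iter j (brk f) w) = be t *: iter j (brk f) w.
  rewrite (rF j t) !lfunE /= !lfunE /= -![in LHS]scaler_nat !lfunE /= at0 !scaler0 subr0.
  by rewrite addr0.
have EF j : brk e (iter j.+1 (brk f) w) = (j.+1%:R * (be t : F)) *: iter j (brk f) w.
  elim: j => [|j IH] /=.
    by have := @act_comm F L (adj L) e f w => /= ->; rewrite kS brk0r add0r -tE (tF 0%N) mul1r.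
  have := @act_comm F L (adj L) e f (iter j.+1 (brk f) w) => /= ->.
  rewrite IH -tE -/(iter j.+1 (brk f) w) (tF j.+1) brkZr -scalerDl /=.
  by congr (_ *: _); rewrite -[j.+2]addn1 natrD mulrDl mul1r.
have [N] := root_adnil na0 rf w.
elim: N => [/= zz|N IH FN]; first by rewrite zz eqxx in k0.
have [/IH//|n0] := eqVneq (iter N (brk f) w) 0.
have := EF N; rewrite FN brk0r => /esym/eqP.
by rewrite scaler_eq0 (negbTE n0) orbF mulf_eq0 pnatr_eq0 => /eqP.
Qed.

Definition triple al e f (t : subvs_of h) :=
  [/\ root_vec al e, root_vec (- al) f, vsval t = brk e f & al t = 2%:R].

Lemma triple_or al : al != 0 -> (exists e f t, triple al e f t) \/
  (forall e f, root_vec al e -> root_vec (- al) f -> brk e f = 0).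
Proof.
move=> a0; apply: contrapT => /not_orP[nt nb]; apply: nb => e f re rf.
have bh := brk_opp_h re rf; pose t : subvs_of h := vsproj h (brk e f).
have tE : vsval t = brk e f by rewrite /t vsprojK.
have [at0|at0] := eqVneq (al t : F) 0; first exact: (opp_brk a0 re rf tE).
case: nt; exists ((2%:R / (al t : F)) *: e), f, ((2%:R / (al t : F)) *: t); split=> //.
- exact: root_vecZ.
- by rewrite linearZ /= tE brkZl.
- by rewrite linearZ /= [LHS]divfK.
Qed.

Lemma triple_sl2 al e f t : triple al e f t -> sl2t e f (vsval t).
Proof.
case=> re rf tE at2; split=> //; first by rewrite (re t) at2.
by rewrite (rf t) lfunE /= at2 scaleNr.
Qed.

Lemma triple_nz al e f t : triple al e f t -> al != 0.
Proof. by case=> _ _ _; case: eqP => // ->; rewrite lfunE => /esym/eqP; rewrite pnatr_eq0. Qed.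

Lemma triple_ne al e f t : triple al e f t -> e != 0 /\ f != 0.
Proof.
case=> _ _ tE at2.
have ef0 : brk e f != 0.
  apply/eqP => z0; have t0 : t = 0 by apply: subvs_inj; rewrite tE z0 linear0.
  by move/eqP: at2; rewrite t0 linear0 eq_sym pnatr_eq0.
by split; apply: contraNneq ef0 => ->; rewrite ?brk0l ?brk0r.
Qed.

(** After subtracting a suitable multiple of [e], the remainder [y] satisfies $[y,f]=0$ by
    [opp_brk]. Being of weight 2 and killed by $f$, it vanishes by [sl2_injE] for the swapped
    triple. *)
Lemma triple_line al e f t x : triple al e f t -> root_vec al x -> exists c : F, x = c *: e.
Proof.
move=> tr rx; have sl := triple_sl2 tr; case: (tr) => re rf tE at2; have a0 := triple_nz tr.
have bh := brk_opp_h rx rf; pose s : subvs_of h := vsproj h (brk x f).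
have sE : vsval s = brk x f by rewrite /s vsprojK.
(* This scalar makes [al] vanish on $[x-ce,f]$, as [opp_brk] requires. *)
pose c : F := (al s : F) / 2%:R.
exists c; apply/eqP; rewrite -subr_eq0; apply/eqP.
set y := x - c *: e; have ry : root_vec al y by apply: root_vecD => //; apply/root_vecN/root_vecZ.
have yf : brk y f = 0.
  apply: (@opp_brk al y f (s - c *: t)) => //.
    by rewrite linearB linearZ /= sE tE /y brkDl brkNl brkZl scalerN.
  by rewrite linearB linearZ /= at2; apply/eqP; rewrite subr_eq0 [X in _ == X]divfK// pnatr_eq0.
have [N EN] := root_adnil a0 re y.
apply: (@sl2_injE F L (adj L) f e _ (sl2t_swap sl) 2 N y).
- by rewrite actNl /= (ry t) at2 scaleNr.
- by rewrite /= [brk f y]brkC yf oppr0 brk0r.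
- exact: EN.
Qed.
End RootVectors.

(** * The Killing form and the existence of sl2-triples *)

Section TraceForm.
Variables (F : numClosedFieldType) (L : lieAlgebra F) (h : {vspace L}).
Local Notation hd := 'Hom(subvs_of h, F^o).
Hypotheses (hss : semisimple L) (hcart : cartan h).
Implicit Types (al be ga : hd) (x y z : L).

HB.instance Definition _ x := GRing.isLinear.Build F L L *:%R (@brk F L x) (@brk_linr F L x).
Definition adl x : 'End(L) := linfun (brk x).
Definition kil x y := ltr (adl x \o adl y)%VF.

Lemma adlE x y : adl x y = brk x y. Proof. by rewrite lfunE. Qed.
Lemma adl_brk x y : adl (brk x y) = (adl x \o adl y)%VF - (adl y \o adl x)%VF.
Proof. by apply/lfunP => z; rewrite !(add_lfunE, opp_lfunE, scale_lfunE, comp_lfunE, adlE) brk_brk. Qed.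
Lemma adl_lin a x y : adl (a *: x + y) = a *: adl x + adl y.
Proof. by apply/lfunP => z; rewrite !(add_lfunE, opp_lfunE, scale_lfunE, comp_lfunE, adlE) brkDl brkZl. Qed.

Lemma kilC x y : kil x y = kil y x. Proof. exact: ltrC. Qed.
Lemma kil_linl a x y z : kil (a *: x + y) z = a * kil x z + kil y z.
Proof.
rewrite /kil -ltr_lin adl_lin; congr ltr; apply/lfunP => w.
by rewrite !(add_lfunE, opp_lfunE, scale_lfunE, comp_lfunE, adlE).
Qed.
Lemma kilZr a x z : kil x (a *: z) = a * kil x z.
Proof.
have k0 y : kil 0 y = 0.
  by have := kil_linl 1 0 0 y; rewrite scaler0 addr0 mul1r => /eqP; rewrite -subr_eq0 opprD addrA subrr sub0r oppr_eq0 => /eqP.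
by rewrite kilC -[a *: z]addr0 kil_linl k0 addr0 kilC.
Qed.
Lemma kil_linr a x y z : kil z (a *: x + y) = a * kil z x + kil z y.
Proof. by rewrite !(kilC z) kil_linl. Qed.

Lemma kil_inv x y z : kil (brk x y) z = kil x (brk y z).
Proof.
have D phi psi : ltr (phi - psi) = ltr phi - ltr psi.
  by rewrite addrC -scaleN1r ltr_lin mulN1r addrC.
rewrite /kil !adl_brk.
have -> : (((adl x \o adl y)%VF - (adl y \o adl x)%VF) \o adl z)%VF
   = ((adl x \o adl y) \o adl z)%VF - (adl y \o (adl x \o adl z))%VF.
  by apply/lfunP => w; rewrite !(add_lfunE, opp_lfunE, scale_lfunE, comp_lfunE, adlE).
have -> : (adl x \o ((adl y \o adl z)%VF - (adl z \o adl y)%VF))%VF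
   = ((adl x \o adl y) \o adl z)%VF - ((adl x \o adl z) \o adl y)%VF.
  by apply/lfunP => w; rewrite !(add_lfunE, opp_lfunE, scale_lfunE, comp_lfunE, adlE) brkDr brkNr.
by rewrite !D; congr (_ - _); rewrite ltrC.
Qed.

(** The product of the two adjoint maps shifts every weight by the nonzero [al + be], so it is
    nilpotent. *)
Lemma kil_shift al be x y : root_vec al x -> root_vec be y -> al + be != 0 -> kil x y = 0.
Proof.
move=> rx ry ab0; apply: (@ltr_nilp _ _ _ (size (rts0 hcart)).+1) => v.
have E w : (adl x \o adl y)%VF w = brk x (brk y w) by rewrite lfunE /= !adlE.
apply: (@shift_nil _ _ _ hcart (fun w => (adl x \o adl y)%VF w) (al + be)) => //.
  by move=> u w; rewrite linearD.
by move=> ga z rz; rewrite E addrC -addrA; apply: root_vec_brk => //; apply: root_vec_brk.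
Qed.

(** By [triple_or] a nonzero weight without an sl2-triple is bad; weights that are no roots are bad
    vacuously. The goal is that no root is bad. *)
Definition bad al := al != 0 /\ forall e f, root_vec al e -> root_vec (- al) f -> brk e f = 0.

(** Only the component of [y] of weight [-al] can pair with [x]. There the two adjoint maps commute
    and that of [x] is nilpotent, so their product is nilpotent. *)
Lemma bad_kil al x y : bad al -> root_vec al x -> kil x y = 0.
Proof.
move=> [a0 ab] rx; have [s ws ->] := adj_wmod hcart y.
elim: s ws => [|p s IH] ws.
  by rewrite big_nil -[0](scale0r x) kilZr mul0r.
have := kil_linr 1 p.2 (\sum_(q <- s) q.2) x; rewrite scale1r mul1r big_cons => ->.
rewrite IH => [|q qs]; last by apply: ws; rewrite inE qs orbT.
rewrite addr0; have wp : root_vec p.1 p.2 by apply: ws; rewrite mem_head.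
have [E|] := eqVneq (al + p.1) 0; last exact: kil_shift.
have pE : p.1 = - al by apply/eqP; rewrite -addr_eq0 addrC E.
rewrite pE in wp; have xp := ab _ _ rx wp.
apply: (@ltr_nilp _ _ _ (size (rts0 hcart)).+1) => v.
have xyC w : brk x (brk p.2 w) = brk p.2 (brk x w).
  by have := @act_comm F L (adj L) x p.2 w => /= ->; rewrite xp brk0l addr0.
have itE k w : iter k (fun w => (adl x \o adl p.2)%VF w) w = iter k (brk p.2) (iter k (brk x) w).
  elim: k => //= k ->; rewrite lfunE /= !adlE xyC; congr (brk _ _).
  by elim: k (iter k (brk x) w) => //= j IHj u; rewrite xyC IHj.
rewrite itE; have -> : iter (size (rts0 hcart)).+1 (brk x) v = 0.
  apply: (shift_nil hcart a0); first by move=> ? ?; rewrite brkDr.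
  by move=> be z rz; rewrite addrC; apply: root_vec_brk.
exact: (@iter_act0 F L (adj L)).
Qed.

Lemma triple_nilE al e f t : triple al e f t ->
  (forall v : adj L, exists N, iter N (act e) v = 0) /\ (forall v : adj L, exists N, iter N (act f) v = 0).
Proof.
move=> tr; have a0 := triple_nz tr; case: tr => re rf _ _; split.
  exact: (root_adnil hcart a0 re).
by apply: (root_adnil hcart _ rf); rewrite oppr_eq0.
Qed.

(** Invariance gives $\mathrm{kil}(t,t)=2\,\mathrm{kil}(e,f)$, and $\mathrm{kil}(t,t)$ is the sum of
    the squares of the integral eigenvalues of $\mathrm{ad}\,t$, not all zero because $[t,e]=2e$. *)
Lemma triple_kil al e f t : triple al e f t -> kil e f != 0.
Proof.
move=> tr; have sl := triple_sl2 tr; have [e0 f0] := triple_ne tr.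
have [nE nD] := triple_nilE tr.
suff tt : kil (vsval t) (vsval t) != 0.
  apply: contra_neq tt => ef0; case: tr => re rf tE at2.
  by rewrite [X in kil X _]tE kil_inv brkC (rf t) -scaleNr kilZr ef0 mulr0.
have [_ _ /(_ _ (subvsP t)) [X bX eX]] := hcart.
have szX : size X == \dim {:L} by apply/eqP/esym; exact: (@size_basis _ _ _ _ (in_tuple X) bX).
pose XT : (\dim {:L}).-tuple L := Tuple szX.
have Xn (i : 'I_(\dim {:L})) : XT`_i != 0.
  by apply: (free_not0 (basis_free bX)); apply: mem_nth; rewrite (eqP szX).
have /choice[m mP] : forall i : 'I_(\dim {:L}), exists m : int, brk (vsval t) XT`_i = m%:~R *: XT`_i.
  move=> i; have [|c cE] := eX XT`_i; first by apply: mem_nth; rewrite (eqP szX).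
  by have [m cm] := sl2_int sl nE nD (Xn i) cE; exists m; rewrite cE cm.
rewrite /kil (@ltr_eigen _ _ XT _ (fun i => (m i ^+ 2)%:~R))//; last first.
  by move=> i; rewrite lfunE /= !adlE mP brkZr mP scalerA -intrM.
rewrite -(rmorph_sum (intmul 1)) /= intr_eq0 psumr_eq0; last by move=> i _; rewrite sqr_ge0.
apply/negP => /allP H.
have t0 v : brk (vsval t) v = 0.
  rewrite (coord_basis (X := XT) bX (memvf v)).
  have := @act_sumr F L (adj L) (vsval t) _ (index_enum 'I_(\dim {:L})) xpredT => /= ->.
  rewrite big1// => i _; rewrite brkZr mP; have /= := H i (mem_index_enum _).
  by rewrite sqrf_eq0 => /eqP ->; rewrite mulr0z scale0r scaler0.
case: tr => re rf tE at2; move: (re t); rewrite t0 at2 => /esym/eqP.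
by rewrite scaler_eq0 pnatr_eq0 (negbTE e0).
Qed.

Definition badsum (v : L) := exists2 s : seq (hd * L),
  forall p, p \in s -> bad p.1 /\ root_vec p.1 p.2 & v = \sum_(p <- s) p.2.

Lemma badsum_sub : subspace badsum.
Proof.
split; first by exists [::]; rewrite ?big_nil.
move=> a _ _ [s sP ->] [s' sP' ->].
exists ([seq (p.1, a *: p.2) | p <- s] ++ s'); last by rewrite big_cat big_map scaler_sumr.
move=> p; rewrite mem_cat => /orP[/mapP[q /sP [? ?] ->]|/sP'//]; split=> //.
exact: root_vecZ.
Qed.

(** If [be + al] had a triple, $[y,x]$ would be a multiple of its [e]. The Killing form pairs
    $[y,x]$ with [f] to zero, since [x] is in the radical, but does not pair [e] with [f] to zero;
    so the multiple is zero. *)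
Lemma bad_add al be x y : bad al -> root_vec al x -> root_vec be y -> badsum (brk y x).
Proof.
move=> ba rx ry; have [->|yx0] := eqVneq (brk y x) 0; first exact: sub0 badsum_sub.
have ryx : root_vec (be + al) (brk y x) := root_vec_brk ry rx.
suff b : bad (be + al).
  by exists [:: (be + al, brk y x)]; rewrite ?big_seq1// => p; rewrite inE => /eqP ->.
have ab0 : be + al != 0.
  apply: contra_neq yx0 => E; have bE : be = - al by apply/eqP; rewrite -addr_eq0 E.
  by rewrite brkC (ba.2 x y) ?oppr0// -bE.
case: (triple_or hss hcart ab0) => [[e [f [t tr]]]|H]; last by split.
have [c E] := triple_line hss hcart tr ryx; case/eqP: yx0; rewrite E.
have : kil (brk y x) f = 0 by rewrite brkC -scaleN1r kilC kilZr kilC kil_inv (bad_kil _ ba rx) mulr0.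
rewrite E kilC kilZr => /eqP; rewrite mulf_eq0 kilC (negbTE (triple_kil tr)) orbF => /eqP ->.
by rewrite scale0r.
Qed.

Lemma badsum_ideal y v : badsum v -> badsum (brk y v).
Proof.
move=> [s sP ->]; have [s' ws' ->] := adj_wmod hcart y.
have := @act_suml F L (adj L) _ s' xpredT snd => /= ->.
apply: (sub_sum_seq badsum_sub) => q qs'.
have := @act_sumr F L (adj L) q.2 _ s xpredT snd => /= ->.
apply: (sub_sum_seq badsum_sub) => p ps.
by have [bp rp] := sP _ ps; apply: bad_add bp rp (ws' _ qs').
Qed.

Lemma badsum_hom al x : badsum x -> x != 0 -> root_vec al x -> al != 0.
Proof.
move=> [s sP xE] x0 rx; have ws : wdec (M := adj L) s by move=> p /sP[].
have E := wdec_wv ws (rx : weight_vec al (x : adj L)) xE.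
apply: contra_neq x0 => a0; rewrite E big_seq_cond big1// => p /andP[ps /eqP pa].
by have [[+ _] _] := sP _ ps; rewrite pa a0 eqxx.
Qed.

(* A graded form of Engel's theorem. *)
Lemma graded_engel n (K : {vspace L}) (P U : L -> Prop) : (\dim K <= n)%N ->
  (forall x, x \in K -> badsum x) -> (forall x y, x \in K -> y \in K -> brk x y \in K) ->
  (forall t x, t \in h -> x \in K -> brk t x \in K) ->
  subspace P -> (forall t x, t \in h -> P x -> P (brk t x)) -> (forall x y, x \in K -> P y -> P (brk x y)) ->
  subspace U -> (forall t x, t \in h -> U x -> U (brk t x)) -> (forall x y, x \in K -> U y -> U (brk x y)) ->
  (exists v, P v /\ ~ U v) ->
  exists al v, [/\ root_vec al v, P v, ~ U v & forall x, x \in K -> U (brk x v)].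
Proof.
have hompick (P' U' : L -> Prop) : subspace P' -> (forall t x, t \in h -> P' x -> P' (brk t x)) ->
    subspace U' -> (exists v, P' v /\ ~ U' v) -> exists al v, [/\ root_vec al v, P' v & ~ U' v].
  move=> sP hP sU [v [Pv nUv]]; have [s ws vE] := adj_wmod hcart v.
  have [|s' [us ws' Ps vE' _]] := @wdec_in F L h (adj L) P' s v sP _ ws vE Pv.
    by move=> t w; apply: hP; apply: subvsP.
  apply: contrapT => nex; apply: nUv; rewrite vE'; apply: (sub_sum_seq sU) => p ps.
  by apply: contrapT => nUp; apply: nex; exists p.1, p.2; split; [apply: ws'|apply: Ps|].
elim: n K P U => [|n IH] K P U dK bK KK hK sP hP KP sU hU KU ex.
  have K0 : K = 0%VS by apply/eqP; rewrite -dimv_eq0 -leqn0.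
  have [al [v [rv Pv nUv]]] := hompick P U sP hP sU ex.
  exists al, v; split=> // x; rewrite K0 memv0 => /eqP ->; rewrite brk0l; exact: sub0.
have [K0|Kn0] := eqVneq K 0%VS.
  have [al [v [rv Pv nUv]]] := hompick P U sP hP sU ex.
  exists al, v; split=> // x; rewrite K0 memv0 => /eqP ->; rewrite brk0l; exact: sub0.
(* [K'] will be a proper [h]-stable subalgebra of [K] of maximal dimension. The induction hypothesis
   for [K'] acting on [K] modulo [K'] gives a weight vector [x] normalizing [K']. *)
pose Q m := `[< exists K' : {vspace L}, [/\ \dim K' = m, (K' <= K)%VS, K' != K,
   (forall x y, x \in K' -> y \in K' -> brk x y \in K') & (forall t x, t \in h -> x \in K' -> brk t x \in K')] >].
have Q0 : exists m, Q m.
  exists 0%N; apply/asboolP; exists 0%VS; rewrite dimv0 sub0v eq_sym Kn0; split=> //.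
    by move=> x y; rewrite !memv0 => /eqP -> _; rewrite brk0l.
  by move=> t x _; rewrite !memv0 => /eqP ->; rewrite brk0r.
have Qb m : Q m -> (m <= \dim K)%N by move=> /asboolP[K' [<- /dimvS]].
have [_ /asboolP[K' [<- sK' nK' KK' hK']] Kmax] := ex_maxnP Q0 Qb.
have dK' : (\dim K' < \dim K)%N.
  by rewrite ltn_neqAle dimvS// andbT; apply: contra nK' => /eqP d; rewrite eqEdim sK' d /=.
have K'K x : x \in K' -> x \in K by move/subvP: sK'; apply.
have vsub (V : {vspace L}) : subspace (fun x => x \in V).
  by split; [exact: mem0v|move=> a u v uV vV; rewrite memvD ?memvZ].
have [||||ga [x [rx xK xK' Kx]]] := IH K' (fun x => x \in K) (fun x => x \in K') _ _ KK' hK' (vsub K) hK _ (vsub K') hK' KK'.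
- by rewrite -ltnS (leq_trans dK').
- by move=> y /K'K; apply: bK.
- by move=> y z /K'K; apply: KK.
- apply: contrapT => nex; case/eqP: nK'; apply/eqP; rewrite eqEsubv sK'; apply/subvP => v vK.
  by apply: contraT => vK'; case: nex; exists v; split=> //; apply/negP.
have KE : (K' + <[x]>)%VS = K.
  apply/eqP; apply: contraT => nE.
  have sub : (K' + <[x]> <= K)%VS by rewrite subv_add sK' -memvE.
  have /Kmax : Q (\dim (K' + <[x]>)).
    apply/asboolP; exists (K' + <[x]>)%VS; split=> //.
      move=> _ _ /memv_addP[y yK [_ /vlineP[a ->] ->]] /memv_addP[z zK [_ /vlineP[c ->] ->]].
      apply: (subvP (addvSl _ _)); rewrite brkDl !brkDr !brkZl !brkZr brk_alt !scaler0 addr0.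
      rewrite [brk x z]brkC; apply: memvD; first by apply: memvD; [exact: KK'|apply: memvZ; exact: Kx].
      by apply: memvZ; rewrite memvN; exact: Kx.
    move=> t _ th /memv_addP[y yK [_ /vlineP[a ->] ->]]; rewrite brkDr brkZr.
    have := rx (vsproj h t); rewrite vsprojK// => ->; apply: memv_add; first exact: hK'.
    by rewrite !memvZ// memv_line.
  rewrite leqNgt ltnNge; case/negP; apply/negP => le; case: xK'; rewrite memvE.
  have /eqP {1}-> : K' == (K' + <[x]>)%VS by rewrite eqEdim addvSl.
  exact: addvSr.
(* As [K] is [K'] plus the line of [x], it remains to apply [x] to the vectors that [K'] sends into
   [U]. The weight of [x] is nonzero by [badsum_hom], so [x] is nilpotent; the last power leading
   outside [U] gives the vector. *)
pose P' v := P v /\ forall k, k \in K' -> U (brk k v).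
have sP' : subspace P'.
  split; first by split=> [|k _]; rewrite ?brk0r; exact: sub0.
  move=> a u v [Pu Ku] [Pv Kv]; split=> [|k kK]; first exact: subZD.
  by rewrite brkDr brkZr; apply: subZD; [|apply: Ku|apply: Kv].
have hP' t v : t \in h -> P' v -> P' (brk t v).
  move=> th [Pv Kv]; split=> [|k kK]; first exact: hP.
  have := @act_comm F L (adj L) k t v => /= ->; apply: subD => //; first by apply: hU => //; apply: Kv.
  by rewrite [brk k t]brkC brkNl; apply: subN => //; apply: Kv; apply: hK'.
have x0 : x != 0 by apply: contra_not_neq xK' => ->; apply: mem0v.
have ga0 : ga != 0 by apply: badsum_hom x0 rx; apply: bK.
have [|al [v [rv [Pv Kv] nUv]]] := hompick P' U sP' hP' sU.
  have [||||al [v [rv Pv nUv Kv]]] := IH K' P U _ _ KK' hK' sP hP _ sU hU _ ex.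
  - by rewrite -ltnS (leq_trans dK').
  - by move=> y /K'K; apply: bK.
  - by move=> y z /K'K; apply: KP.
  - by move=> y z /K'K; apply: KU.
  by exists v; split.
have xP' w : P' w -> P' (brk x w).
  move=> [Pw Kw]; split=> [|k kK]; first exact: KP.
  have := @act_comm F L (adj L) k x w => /= ->; apply: subD => //; first by apply: KU => //; apply: Kw.
  by apply: Kw; apply: Kx.
have [N xN] := root_adnil hcart ga0 rx v.
have [j jn jS] : exists2 j, ~ U (iter j (brk x) v) & U (iter j.+1 (brk x) v).
  elim: N xN => [/= vv|N IHN xN]; first by case: nUv; rewrite vv; apply: sub0.
  have [/IHN//|n0] := pselect (iter N (brk x) v = 0).
  elim: N xN {IHN n0} => [|N IHN] xN; first by exists 0%N => //; rewrite xN; apply: sub0.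
  have [UN|nU] := pselect (U (iter N.+1 (brk x) v)); last by exists N.+1 => //; rewrite xN; apply: sub0.
  have [m /asboolP Um Umin] := ex_minnP (ex_intro (fun m => `[< U (iter m (brk x) v) >]) N.+1 (asboolT UN)).
  case: m Um Umin => [|m] Um Umin; first by case: nUv.
  by exists m => // Um'; have := Umin m (asboolT Um'); rewrite ltnn.
have Pj : P' (iter j (brk x) v) by elim: (j) => [//|i IHi] /=; apply: xP'.
exists (al + ga *+ j), (iter j (brk x) v); split=> //; last 1 first.
- move=> k; rewrite -KE => /memv_addP[y yK [_ /vlineP[a ->] ->]].
  by rewrite brkDl brkZl addrC; apply: subZD => //; apply: Pj.2.
- elim: (j) => [|i IHi] /=; first by rewrite addr0.
  by rewrite mulrS addrCA; apply: root_vec_brk.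
- exact: Pj.1.
Qed.

(** The bad vectors form an ideal of [L]. If it were nonzero, [graded_engel] would give it a nonzero
    centre, which is an abelian ideal of [L]. *)
Lemma badsum0 v : badsum v -> v = 0.
Proof.
move=> bv; apply: contrapT => /eqP v0.
have hbad t w : t \in h -> badsum w -> badsum (brk t w) by move=> _; apply: badsum_ideal.
have [K KP] := vspace_of badsum_sub.
have s0 : subspace (fun v : L => v = 0) by split=> // a u w -> ->; rewrite scaler0 addr0.
have [|||||||al [w [rw bw w0 Kw]]] := @graded_engel (\dim K) K badsum (fun v => v = 0) (leqnn _) _ _ _ badsum_sub hbad _ s0.
- by move=> x /KP.
- by move=> x y /KP _ /KP yK; apply/KP/badsum_ideal.
- by move=> t x _ /KP yK; apply/KP/badsum_ideal.
- by move=> x y _; apply: badsum_ideal.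
- by move=> t x _ ->; rewrite brk0r.
- by move=> x y _ ->; rewrite brk0r.
- by exists v; split=> //; apply/eqP.
pose Zc z := badsum z /\ forall k, badsum k -> brk k z = 0.
have sZ : subspace Zc.
  split; first by split=> [|k _]; [exact: sub0 badsum_sub|rewrite brk0r].
  move=> a y z [by' Ky] [bz Kz]; split; first exact: subZD badsum_sub _ _ _ by' bz.
  by move=> k bk; rewrite brkDr brkZr Ky// Kz// scaler0 addr0.
have [Z ZP] := vspace_of sZ.
have : Z = 0%VS.
  apply: abelian_ideal0 hss _ _ => [x u /ZP[bu Ku]|u u' /ZP[bu Ku] /ZP[bu' Ku']]; last exact: Ku'.
  apply/ZP; split=> [|k bk]; first exact: badsum_ideal.
  have := @act_comm F L (adj L) k x u => /= ->; rewrite Ku// brk0r add0r Ku//.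
  by rewrite brkC -scaleN1r; apply: (subZ badsum_sub); apply: badsum_ideal.
move=> Z0; apply: w0; apply/eqP; rewrite -memv0 -Z0; apply/ZP; split=> // k bk.
by apply: Kw; apply/KP.
Qed.

Lemma root_triple al : is_root al -> exists e f t, triple al e f t.
Proof.
move=> [a0 [x x0 rx]]; case: (triple_or hss hcart a0) => // H; case/eqP: x0.
by apply: badsum0; exists [:: (al, x)]; rewrite ?big_seq1// => p; rewrite inE => /eqP ->.
Qed.
End TraceForm.

Section Evaluation.
Variables (F : fieldType) (L : lieAlgebra F) (h : {vspace L}).
Local Notation hd := 'Hom(subvs_of h, F^o).
Implicit Types (la mu : hd) (s t : subvs_of h) (a : F).

(* Evaluation of weights with values in F rather than in the module F^o. *)
Lemma ev0 t : ((0 : hd) t : F) = 0. Proof. by rewrite lfunE. Qed.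
Lemma evD la mu t : ((la + mu) t : F) = (la t : F) + (mu t : F).
Proof. by rewrite add_lfunE. Qed.
Lemma evN la t : ((- la) t : F) = - (la t : F). Proof. by rewrite opp_lfunE. Qed.
Lemma evZ a la t : ((a *: la) t : F) = a * (la t : F). Proof. by rewrite scale_lfunE. Qed.
Lemma evMn la n t : ((la *+ n) t : F) = n%:R * (la t : F).
Proof. by rewrite -scaler_nat evZ. Qed.
Lemma ev_sum I (r : seq I) p (f : I -> hd) t :
  ((\sum_(i <- r | p i) f i) t : F) = \sum_(i <- r | p i) (f i t : F).
Proof. by rewrite sum_lfunE. Qed.
Lemma evt0 la : (la 0 : F) = 0. Proof. by rewrite linear0. Qed.
Lemma evtD la s t : (la (s + t) : F) = (la s : F) + (la t : F). Proof. by rewrite linearD. Qed.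
Lemma evtN la t : (la (- t) : F) = - (la t : F). Proof. by rewrite linearN. Qed.
Lemma evtZ a la t : (la (a *: t) : F) = a * (la t : F). Proof. by rewrite linearZ. Qed.
Lemma evt_sum I (r : seq I) p (f : I -> subvs_of h) la :
  (la (\sum_(i <- r | p i) f i) : F) = \sum_(i <- r | p i) (la (f i) : F).
Proof. by rewrite linear_sum. Qed.
End Evaluation.
Definition evE := (ev0, evD, evN, evZ, evMn, evt0, evtD, evtN, evtZ).

(** * Coroots, reflections and an invariant form *)

Section RootSystem.
Variables (F : numClosedFieldType) (L : lieAlgebra F) (h : {vspace L}).
Local Notation hd := 'Hom(subvs_of h, F^o).
Hypotheses (hss : semisimple L) (hcart : cartan h).
Implicit Types (al be ga la mu : hd) (x y z : L) (s t : subvs_of h).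

Lemma triple_choice : exists g : hd -> L * L * subvs_of h,
  forall al, is_root al -> triple al (g al).1.1 (g al).1.2 (g al).2.
Proof.
have /choice[g gP] : forall al, exists g : L * L * subvs_of h, is_root al -> triple al g.1.1 g.1.2 g.2.
  move=> al; have [/(root_triple hss hcart)[e [f [t tr]]]|nr] := pselect (is_root al).
    by exists (e, f, t).
  by exists (0, 0, 0).
by exists g.
Qed.
Definition trf := sval (cid triple_choice).
Definition re al := (trf al).1.1.
Definition rf al := (trf al).1.2.
Definition cor al : subvs_of h := (trf al).2.
Lemma rtriple al : is_root al -> triple al (re al) (rf al) (cor al).
Proof. exact: (svalP (cid triple_choice)). Qed.

Lemma corr2 al : is_root al -> al (cor al) = 2%:R.
Proof. by case/rtriple. Qed.

Lemma rsl2 al : is_root al -> sl2t (re al) (rf al) (vsval (cor al)).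
Proof. by move/rtriple/triple_sl2. Qed.

Lemma cor_is_coroot al : is_root al -> is_coroot al (cor al).
Proof. by case/rtriple => r1 r2 tE a2; split=> //; exists (re al), (rf al). Qed.

Lemma root_neq0 al : is_root al -> al != 0. Proof. by case. Qed.

Lemma root_opp al : is_root al -> is_root (- al).
Proof.
move=> ra; have tr := rtriple ra; have [_ f0] := triple_ne tr.
split; first by rewrite oppr_eq0 root_neq0.
by exists (rf al) => //; case: tr.
Qed.

Lemma triple_opp al e f t : triple al e f t -> triple (- al) f e (- t).
Proof.
case=> r1 r2 tE a2; split=> //; first by rewrite opprK.
  by rewrite linearN /= tE brkC opprK.
by rewrite lfunE /= linearN /= opprK.
Qed.

Lemma root_line al x : is_root al -> root_vec al x -> exists c : F, x = c *: re al.
Proof. by move/rtriple/(triple_line hss hcart); apply. Qed.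

Lemma coroot_uniq al t : is_root al -> is_coroot al t -> t = cor al.
Proof.
move=> ra [a2 [e [f [r1 r2 tE]]]].
have [c eE] := root_line ra r1.
have [c' fE] := triple_line hss hcart (triple_opp (rtriple ra)) r2.
have [_ _ cE _] := rtriple ra.
have tc : t = (c * c') *: cor al.
  by apply: subvs_inj; rewrite linearZ /= cE tE eE fE brkZl brkZr scalerA.
have /eqP : (c * c' - 1) * (2%:R : F) = 0.
  move: a2; rewrite tc linearZ /= (corr2 ra) => E.
  by rewrite mulrBl mul1r [X in X - _]E subrr.
by rewrite mulf_eq0 pnatr_eq0 orbF subr_eq0 => /eqP cc; rewrite tc cc scale1r.
Qed.

Lemma cor_opp al : is_root al -> cor (- al) = - cor al.
Proof.
move=> ra; apply/esym/coroot_uniq; first exact: root_opp.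
have [r1 r2 tE a2] := triple_opp (rtriple ra).
by split=> //; exists (rf al), (re al).
Qed.

Lemma rnil al : is_root al -> adnil (re al) /\ adnil (rf al).
Proof.
move=> ra; have [r1 r2 _ _] := rtriple ra; have a0 := root_neq0 ra.
by split; [apply: (root_adnil hcart a0)|apply: (@root_adnil _ _ _ hcart (- al)); rewrite ?oppr_eq0].
Qed.

Lemma root_int al be : is_root al -> is_root be -> exists m : int, be (cor al) = m%:~R.
Proof.
move=> ra [_ [x x0 rx]]; have [nE nF] := rnil ra.
exact: (@sl2_int F L (adj L) _ _ _ (rsl2 ra) nE nF _ x x0 (rx (cor al))).
Qed.

Lemma root_vec_iter al be f x j : root_vec be x -> root_vec (- al) f ->
  root_vec (be - al *+ j) (iter j (brk f) x).
Proof.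
move=> rx rf'; elim: j => [|j IH] /=; first by rewrite subr0.
by rewrite mulrS opprD addrCA; apply: root_vec_brk.
Qed.

Lemma weight_string al be (k j : nat) x : is_root al -> x != 0 -> root_vec be x ->
  be (cor al) = k%:R -> (j <= k)%N -> iter j (brk (rf al)) x != 0.
Proof.
move=> ra x0 rx bk jk; have [nE nF] := rnil ra.
apply: contra_neq x0 => j0; have [N EN] := nE x.
apply: (@sl2_injE F L (adj L) _ _ _ (sl2t_swap (rsl2 ra)) k N x _ _ EN).
  by rewrite actNl /= (rx (cor al)) bk scaleNr.
by rewrite -(subnK jk) iterD j0; exact: (@iter_act0 F L (adj L)).
Qed.

Lemma string_down al be (k j : nat) : is_root al -> is_root be -> be (cor al) = k%:R ->
  (j <= k)%N -> be - al *+ j != 0 -> is_root (be - al *+ j).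
Proof.
move=> ra [_ [x x0 rx]] bk jk b0; split=> //; exists (iter j (brk (rf al)) x).
  exact: weight_string rx bk jk.
by apply: root_vec_iter => //; have [] := rtriple ra.
Qed.

(** The root string of [be] reaches the reflected weight by a power of $f$, or of $e$ when the
    pairing is negative. *)
Lemma root_refl al be : is_root al -> is_root be -> is_root (reflection al (cor al) be).
Proof.
move=> ra rb; have [m bm] := root_int ra rb; rewrite /reflection bm.
have nz : be - (m%:~R : F) *: al != 0.
  apply/eqP => /eqP; rewrite subr_eq0 => /eqP E; move: bm; rewrite E evE (corr2 ra) => /eqP.
  rewrite -subr_eq0 -[X in _ - X]mulr1 -mulrBr mulf_eq0 subr_eq0 (eqr_nat F 2 1) orbF => m0.
  by case: rb; rewrite E (eqP m0) scale0r eqxx.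
case: m bm nz => k bm nz.
  by move: nz; rewrite -pmulrn scaler_nat => nz; apply: (string_down ra rb bm (leqnn k)).
have bk : be (cor (- al)) = k.+1%:R by rewrite cor_opp// linearN /= bm NegzE mulrNz opprK.
have E : - ((Negz k)%:~R : F) *: al = al *+ k.+1 by rewrite NegzE mulrNz opprK scaler_nat.
move: nz; rewrite -scaleNr E => nz.
have := string_down (root_opp ra) rb bk (leqnn _); rewrite mulNrn opprK; exact.
Qed.

(** A nonzero $x$ of weight $2\alpha$ has $f^4x\neq0$, yet $fx$ is a multiple of $e$ and $f^3e=0$.
    For higher multiples $fx=0$ by induction, although $x$ has positive sl2-weight. *)
Lemma root_nmul al j : is_root al -> (1 < j)%N -> ~ is_root (al *+ j).
Proof.
move=> ra; have [r1 r2 cE a2] := rtriple ra; have [nE nF] := rnil ra.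
case: j => [|[|j]]// _; elim: j => [|j IH] [b0 [x x0 rx]].
  have rfx : root_vec al (brk (rf al) x).
    by have := root_vec_brk r2 rx; rewrite mulr2n addKr.
  have [c E] := root_line ra rfx.
  have := @weight_string al (al *+ 2) 4 4 x ra x0 rx; rewrite leqnn /= E => H.
  have E4 : ((al *+ 2) (cor al) : F) = 4%:R by rewrite evMn a2 -natrM.
  case/eqP: (H E4 isT); rewrite brkZr [brk (rf al) (re al)]brkC -cE scalerN !(brkNr, brkZr) (root_vec_h (cor al) r2).
  by rewrite !evE a2 !(brkNr, brkZr) brk_alt !(scaler0, oppr0).
have rfx : root_vec (al *+ j.+2) (brk (rf al) x).
  by have := root_vec_brk r2 rx; rewrite mulrS addKr.
have aj0 : al *+ j.+2 != 0 by rewrite -scaler_nat scaler_eq0 pnatr_eq0 (negbTE (root_neq0 ra)).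
have fx0 : brk (rf al) x = 0.
  by apply: contrapT => /eqP fx0; apply: IH; split=> //; exists (brk (rf al) x).
have := @weight_string al (al *+ j.+3) (j.+3 * 2) 1 x ra x0 rx; rewrite /= fx0 eqxx => H.
suff: false by []. 
by apply: H; rewrite ?evMn ?a2 ?natrM//; lia.
Qed.

Lemma root_sep t : (forall be, is_root be -> be t = 0) -> t = 0.
Proof.
move=> H; apply: subvs_inj; rewrite linear0; apply: center0 => // y.
rewrite brkC; apply/eqP; rewrite oppr_eq0; apply/eqP.
have [s ws ->] := adj_wmod hcart y.
have := @act_sumr F L (adj L) (vsval t) _ s xpredT snd => /= ->.
rewrite big_seq big1// => p /ws wp; have /= -> := wp t.
have [->|p0] := eqVneq p.2 0; first by rewrite scaler0.
have [->|p10] := eqVneq p.1 0; first by rewrite lfunE scale0r.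
by rewrite H ?scale0r//; split=> //; exists p.2.
Qed.

Lemma reflection_lin al t : linear (reflection al t).
Proof. by move=> a u v; rewrite /reflection !evE; lmod F. Qed.

Lemma reflectionK al t : al t = 2%:R -> involutive (reflection al t).
Proof.
by move=> a2 la; rewrite /reflection !evE a2; lmod F.
Qed.

(** The composite of the two reflections translates [be] by a multiple of [ga], and iterating it
    would give infinitely many roots. Hence the coroots agree on all roots, which separate the
    points of [h]. *)
Lemma serre_uniq ga t1 t2 : ga != 0 -> ga t1 = 2%:R -> ga t2 = 2%:R ->
  (forall be, is_root be -> is_root (reflection ga t1 be)) ->
  (forall be, is_root be -> is_root (reflection ga t2 be)) -> t1 = t2.
Proof.
move=> g0 g1 g2 H1 H2; apply/eqP; rewrite -subr_eq0; apply/eqP/root_sep => be rb.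
rewrite linearB /=; apply/eqP; apply: contraT => c0; set c : F := be t2 - be t1.
have {}c0 : c != 0 by rewrite -opprB oppr_eq0 in c0.
have E mu : reflection ga t1 (reflection ga t2 mu) = mu + (mu t2 - mu t1) *: ga.
  by rewrite /reflection !evE g1; lmod F.
have R k : is_root (be + (c * k%:R) *: ga).
  elim: k => [|k IH]; first by rewrite mulr0 scale0r addr0.
  have := H1 _ (H2 _ IH); rewrite E !evE g1 g2 -natr1.
  by congr is_root; rewrite /c; lmod F.
have : uniq [seq be + (c * k%:R) *: ga | k <- iota 0 (size (rts hcart)).+1].
  rewrite map_inj_uniq ?iota_uniq// => i j /addrI /eqP.
  rewrite -subr_eq0 -scalerBl scaler_eq0 (negbTE g0) orbF subr_eq0 => /eqP /(mulfI c0) /eqP.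
  by rewrite eqr_nat => /eqP.
move=> us; have := @uniq_leq_size _ _ (rts hcart) us; rewrite size_map size_iota ltnn; apply.
by move=> mu /mapP[k _ ->]; apply/rtsP.
Qed.

Definition crefl al t : subvs_of h := t - (al t : F) *: cor al.
Lemma crefl_pair al la t : (reflection al (cor al) la) t = la (crefl al t).
Proof.
by rewrite /reflection /crefl; apply: (etrans (y := (la t : F) - la (cor al) * al t)); rewrite !evE//; ring.
Qed.

Lemma cor_refl al be : is_root al -> is_root be ->
  cor (reflection al (cor al) be) = crefl al (cor be).
Proof.
move=> ra rb; have rg := root_refl ra rb; have K := reflectionK (corr2 ra).
apply: (@serre_uniq (reflection al (cor al) be)).
- exact: root_neq0.
- exact: corr2.
- by rewrite -crefl_pair K corr2.
- by move=> mu; apply: root_refl.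
move=> mu rm.
have -> : reflection (reflection al (cor al) be) (crefl al (cor be)) mu =
    reflection al (cor al) (reflection be (cor be) (reflection al (cor al) mu)).
  rewrite {1}/reflection -crefl_pair [reflection be _ _]/reflection.
  set c := (X in _ - X *: _); pose m := reflection al (cor al) mu.
  transitivity (- c *: reflection al (cor al) be + reflection al (cor al) m).
    by rewrite K; lmod F.
  by rewrite -(reflection_lin al (cor al)); congr (reflection _ _ _); rewrite addrC scaleNr.
by do 3 apply: root_refl => //.
Qed.

Lemma refl_pair al be la : is_root al -> is_root be ->
  (reflection al (cor al) la) (cor (reflection al (cor al) be)) = la (cor be).
Proof.
move=> ra rb; rewrite cor_refl// -crefl_pair reflectionK//; exact: corr2.
Qed.

(** An invariant form built from the coroots, so that its positivity on roots follows at once from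
    the integrality of the pairings. *)
Definition bil la mu : F := \sum_(de <- rts hcart) (la (cor de) : F) * (mu (cor de) : F).

Lemma perm_refl al : is_root al -> perm_eq (map (reflection al (cor al)) (rts hcart)) (rts hcart).
Proof.
move=> ra; have inj := can_inj (reflectionK (corr2 ra)).
apply: uniq_perm; rewrite ?map_inj_uniq ?rts_uniq// => be; apply/idP/idP.
  by move=> /mapP[ga /rtsP rg ->]; apply/rtsP/root_refl.
move=> /rtsP rb; apply/mapP; exists (reflection al (cor al) be).
  exact/rtsP/root_refl.
by rewrite reflectionK//; exact: corr2.
Qed.

Lemma bil_refl al la mu : is_root al ->
  bil (reflection al (cor al) la) (reflection al (cor al) mu) = bil la mu.
Proof.
move=> ra; rewrite /bil -(perm_big _ (perm_refl ra)) /= big_map big_seq [RHS]big_seq.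
by apply: eq_bigr => de /rtsP rd; rewrite !refl_pair.
Qed.

Lemma bil_linl a la mu nu : bil (a *: la + mu) nu = a * bil la nu + bil mu nu.
Proof.
rewrite /bil mulr_sumr -big_split; apply: eq_bigr => de _ /=.
by rewrite !evE; ring.
Qed.
Lemma bilC la mu : bil la mu = bil mu la.
Proof. by apply: eq_bigr => de _; rewrite mulrC. Qed.
Lemma bil_linr a la mu nu : bil nu (a *: la + mu) = a * bil nu la + bil nu mu.
Proof. by rewrite !(bilC nu) bil_linl. Qed.

Lemma bil_gt0 al : is_root al -> 0 < bil al al.
Proof.
move=> ra; rewrite /bil (bigD1_seq al) ?rts_uniq//=; last exact/rtsP.
rewrite (corr2 ra); apply: ltr_wpDr; last by rewrite -natrM ltr0n.
rewrite big_seq_cond; apply: sumr_ge0 => de /andP[/rtsP rd _].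
by have [m ->] := root_int rd ra; rewrite -intrM ler0z -expr2 sqr_ge0.
Qed.

Lemma bil_pair al be : is_root al -> (be (cor al) : F) * bil al al = 2%:R * bil be al.
Proof.
move=> ra; have := bil_refl be al ra.
rewrite {2}/reflection (corr2 ra).
have -> : al - (2%:R : F) *: al = (-1) *: al + 0 by lmod F.
have b0 nu : bil nu 0 = 0 by rewrite /bil big1// => de _; rewrite evE mulr0.
rewrite bil_linr b0 addr0 /reflection addrC -scaleNr bil_linl => E.
have E' : (be (cor al) : F) * bil al al - bil be al = bil be al by rewrite -[RHS]E; ring.
by rewrite -[LHS](subrK (bil be al)) E'; ring.
Qed.

Lemma pair_sign al be : is_root al -> is_root be ->
  (0 < (al (cor be) : F)) = (0 < (be (cor al) : F)).
Proof.
move=> ra rb; rewrite -(pmulr_lgt0 _ (bil_gt0 rb)) -[RHS](pmulr_lgt0 _ (bil_gt0 ra)).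
by rewrite !bil_pair// bilC.
Qed.

End RootSystem.

(** * Positive roots *)

Section WeightSums.
Variables (F : numClosedFieldType) (L : lieAlgebra F) (h : {vspace L}).
Local Notation hd := 'Hom(subvs_of h, F^o).

Definition wsum (Q : hd -> Prop) (x : L) := exists2 s : seq (hd * L),
  forall p, p \in s -> Q p.1 /\ root_vec p.1 p.2 & x = \sum_(p <- s) p.2.

Lemma wsum_sub Q : subspace (wsum Q).
Proof.
split; first by exists [::]; rewrite ?big_nil.
move=> a _ _ [s sP ->] [s' sP' ->].
exists ([seq (p.1, a *: p.2) | p <- s] ++ s'); last by rewrite big_cat big_map scaler_sumr.
move=> p; rewrite mem_cat => /orP[/mapP[q /sP [? ?] ->]|/sP'//]; split=> //.
exact: root_vecZ.
Qed.

Lemma wsum1 (Q : hd -> Prop) al x : Q al -> root_vec al x -> wsum Q x.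
Proof. by move=> qa rx; exists [:: (al, x)]; rewrite ?big_seq1// => p; rewrite inE => /eqP ->. Qed.

Lemma wsum_brk (Q1 Q2 Q3 : hd -> Prop) x y :
  (forall al be u v, Q1 al -> Q2 be -> root_vec al u -> root_vec be v -> brk u v = 0 \/ Q3 (al + be)) ->
  wsum Q1 x -> wsum Q2 y -> wsum Q3 (brk x y).
Proof.
move=> H [s sP ->] [s' sP' ->].
have := @act_suml F L (adj L) _ s xpredT snd => /= ->.
apply: (sub_sum_seq (wsum_sub _)) => p /sP [qp rp].
have := @act_sumr F L (adj L) p.2 _ s' xpredT snd => /= ->.
apply: (sub_sum_seq (wsum_sub _)) => q /sP' [qq rq].
have [->|Q3pq] := H _ _ _ _ qp qq rp rq; first exact: sub0 (wsum_sub _).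
by apply: wsum1 Q3pq _; apply: root_vec_brk.
Qed.
End WeightSums.

Section BorelRoots.
Variables (F : numClosedFieldType) (L : lieAlgebra F) (h b : {vspace L}).
Local Notation hd := 'Hom(subvs_of h, F^o).
Hypotheses (hss : semisimple L) (hcart : cartan h) (hb : borel b) (hhb : (h <= b)%VS).
Implicit Types (al be ga la mu : hd) (x y z : L) (s t : subvs_of h).
Local Notation cor := (cor hss hcart).
Local Notation re := (re hss hcart).
Local Notation rf := (rf hss hcart).
Local Notation rts := (rts hcart).
Local Notation pos := (pos_root b).
Local Notation sr al := (reflection al (cor al)).

Lemma brk_b x y : x \in b -> y \in b -> brk x y \in b.
Proof. by case: hb => /subvP sb _ _ xb yb; apply/sb/mem_brkv. Qed.

Lemma pos_root_of al x : is_root al -> x != 0 -> root_vec al x -> x \in b -> pos al.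
Proof.
move=> ra x0 rx xb; split=> // y ry; have [c xE] := root_line hss hcart ra rx.
have [d ->] := root_line hss hcart ra ry; apply: memvZ.
have c0 : c != 0 by apply: contra_neq x0 => c0; rewrite xE c0 scale0r.
by move: (memvZ c^-1 xb); rewrite xE scalerA mulVf// scale1r.
Qed.

Lemma pos_re al : pos al -> re al \in b.
Proof. by case=> ra; apply; case: (rtriple hss hcart ra). Qed.
Lemma cor_b t : vsval t \in b.
Proof. by apply: (subvP hhb); apply: subvsP. Qed.

(** Otherwise [b] contains a whole sl2-triple, which survives in every derived algebra of the
    solvable [b]. *)
Lemma pos_opp al : pos al -> ~ pos (- al).
Proof.
move=> pa pna; have ra := pa.1; have tr := rtriple hss hcart ra; have [e0 _] := triple_ne tr.
case: (hb) => _ [n bn] _; case: (tr) => r1 r2 tE a2.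
suff H m : [/\ re al \in iter m (fun V => brkv V V) b, rf al \in iter m (fun V => brkv V V) b
    & vsval (cor al) \in iter m (fun V => brkv V V) b].
  by have [+ _ _] := H n; rewrite bn memv0 (negbTE e0).
elim: m => [|m [eU fU tU]] /=; first by split; [exact: pos_re|exact: pna.2|exact: cor_b].
have two : (2%:R : F) != 0 by rewrite pnatr_eq0.
split; last by rewrite tE mem_brkv.
  have := mem_brkv tU eU; rewrite (r1 (cor al)) a2 => /(memvZ 2%:R^-1).
  by rewrite scalerA mulVf// scale1r.
have := mem_brkv tU fU; rewrite (r2 (cor al)) evE a2 => /(memvZ (- 2%:R^-1)).
by rewrite scalerA mulNr mulrN opprK mulVf// scale1r.
Qed.

(** On a vector of negative sl2-weight [e] is injective, so the bracket of the two root vectors is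
    nonzero, and it lies in [b]. *)
Lemma pos_add_neg al be : pos al -> pos be -> (be (cor al) : F) < 0 -> pos (al + be).
Proof.
move=> pa pb; have [ra rb] := (pa.1, pb.1); have [m bm] := root_int hss hcart ra rb.
rewrite bm ltrz0; case: m bm => // k; rewrite NegzE => bm _.
have [_ [x x0 rx]] := rb; have [r1 _ _ _] := rtriple hss hcart ra.
have [nE nD] := rnil hss hcart ra.
have ex0 : brk (re al) x != 0.
  apply: contra_neq x0 => ex0; have [N FN] := nD x.
  apply: (@sl2_injE F L (adj L) _ _ _ (rsl2 hss hcart ra) k.+1 N x _ _ FN).
    by rewrite /= (rx (cor al)) bm mulrNz.
  by rewrite iterSr /= ex0; exact: (@iter_act0 F L (adj L)).
have rex := root_vec_brk r1 rx.
have ab0 : al + be != 0.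
  apply/eqP => E; have bE : be = - al by apply/eqP; rewrite -addr_eq0 addrC E.
  by apply: (pos_opp pa); rewrite -bE.
apply: (pos_root_of _ ex0 rex); first by split=> //; exists (brk (re al) x).
by apply: brk_b; [exact: pos_re|exact: pb.2].
Qed.

(** Pairing with the coroot of the first root shows that another summand pairs negatively with it.
    By [pos_add_neg] the two add up to a positive root, which shortens the list. *)
Lemma pos_sum0 (s : seq hd) : (forall al, al \in s -> pos al) -> \sum_(al <- s) al = 0 -> s = [::].
Proof.
move: {2}(size s) (leqnn (size s)) => n; elim: n s => [|n IH] s; first by rewrite leqn0 size_eq0 => /eqP.
case: s => // al s; rewrite ltnS => sz sP; rewrite big_cons => E.
have pa : pos al by apply: sP; rewrite mem_head.
have : exists2 be, be \in s & (be (cor al) : F) < 0.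
  apply: contrapT => nex; have : (0 : F) <= \sum_(be <- s) (be (cor al) : F).
    rewrite big_seq; apply: sumr_ge0 => be bs; have pb : pos be by apply: sP; rewrite inE bs orbT.
    have [m bm] := root_int hss hcart pa.1 pb.1.
    by rewrite bm ler0z leNgt; apply/negP => m0; case: nex; exists be; rewrite // bm ltrz0.
  have := congr1 (fun la : hd => la (cor al) : F) E; rewrite /= evE ev_sum (corr2 hss hcart pa.1) evE => E'.
  rewrite -(lerD2l 2%:R) E' addr0 => /(lt_le_trans (ltr0Sn F 1)).
  by rewrite ltxx.
move=> [be bs neg]; have pb : pos be by apply: sP; rewrite inE bs orbT.
have := IH ((al + be) :: rem be s); rewrite /= size_rem// prednK; last by case: (s) bs.
move=> /(_ sz) H; suff : al + be :: rem be s = [::] by [].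
apply: H => [ga|]; last by rewrite big_cons -addrA; move: E; rewrite (big_rem be bs).
rewrite inE => /predU1P[->|/mem_rem gs]; first exact: pos_add_neg.
by apply: sP; rewrite inE gs orbT.
Qed.

Section SolvableSubalgebra.
Variable S : hd -> Prop.
Hypothesis SD : forall al be, S al -> S be -> S (al + be).
Hypothesis S0 : ~ S 0.

(** It counts the ways of splitting off a root of [S] inside [S]; its growth under addition bounds
    the derived series. *)
Definition Srank al := count (fun de => `[< S de /\ S (al - de) >]) rts.

(** The root [al] itself is counted for [al + be] but not for [al], because zero is not in [S]. *)
Lemma Srank_add al be : is_root al -> S al -> S be -> (Srank al < Srank (al + be)%R)%N.
Proof.
move=> ra Sa Sb; rewrite /Srank.
have sub de : `[< S de /\ S (al - de) >] ==> `[< S de /\ S (al + be - de) >].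
  apply/implyP => /asboolP[Sd Sad]; apply/asboolP; split=> //.
  by have := SD Sad Sb; rewrite addrAC.
have : al \in rts by apply/rtsP.
elim: rts => // de l IH; rewrite inE => /predU1P[<-|al_l] /=; last first.
  have := sub de; have := IH al_l; case: asboolP; case: asboolP => //= _ _; lia.
have -> : `[< S al /\ S (al - al) >] = false by apply/asboolP => -[_]; rewrite subrr.
have -> : `[< S al /\ S (al + be - al) >] = true by apply/asboolP; rewrite addrAC subrr add0r.
rewrite add0n add1n ltnS; apply: sub_count => ga; exact/implyP/sub.
Qed.

Definition Sh al := al = 0 \/ (is_root al /\ S al).
Definition Sk k al := [/\ is_root al, S al & (k <= Srank al)%N].

(** Passing to the derived algebra first loses [h]; each further step raises [Srank], which is at
    most the number of roots. *)
Lemma Salg : exists U : {vspace L}, [/\ forall x, x \in U <-> wsum Sh x, subalgebra U & solvable U].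
Proof.
have [U UP] := vspace_of (wsum_sub Sh).
have root_or al be (u v : L) : S (al + be) -> root_vec al u -> root_vec be v -> brk u v = 0 \/ is_root (al + be).
  move=> Sab ru rv; have [->|uv0] := eqVneq (brk u v) 0; [by left|right].
  have := root_vec_brk ru rv => ruv; split; last by exists (brk u v).
  by apply/eqP => E; apply: S0; rewrite -E.
have step0 al be (u v : L) : Sh al -> Sh be -> root_vec al u -> root_vec be v -> brk u v = 0 \/ Sk 0 (al + be).
  move=> [->|[ra Sa]] [->|[rb Sb]] ru rv.
  - by left; apply: (cartan_abel hcart); apply/(cartan_h hcart).
  - by right; rewrite add0r; split.
  - by right; rewrite addr0; split.
  - by have [|r] := root_or _ _ _ _ (SD Sa Sb) ru rv; [left|right; split=> //; exact: SD].
exists U; split=> //.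
  apply: brkv_sub => x y /UP xU /UP yU; apply/UP.
  apply: (wsum_brk _ xU yU) => al be u v sa sb ru rv.
  by have [|[r Sab _]] := step0 _ _ _ _ sa sb ru rv; [left|right; right].
have stepk k al be (u v : L) : Sk k al -> Sk k be -> root_vec al u -> root_vec be v -> brk u v = 0 \/ Sk k.+1 (al + be).
  move=> [ra Sa ka] [rb Sb kb] ru rv; have [|r] := root_or _ _ _ _ (SD Sa Sb) ru rv; [by left|right].
  by split=> //; [exact: SD|exact: leq_ltn_trans ka (Srank_add ra Sa Sb)].
have H k : forall x, x \in iter k.+1 (fun V => brkv V V) U -> wsum (Sk k) x.
  elim: k => [|k IH] x.
    have [V VP] := vspace_of (wsum_sub (Sk 0)); move=> xU; apply/VP; move: x xU; apply/subvP.
    apply: brkv_sub => x y /UP xU /UP yU; apply/VP; exact: wsum_brk step0 xU yU.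
  have [V VP] := vspace_of (wsum_sub (Sk k.+1)); rewrite iterS => xU; apply/VP; move: x xU; apply/subvP.
  apply: brkv_sub => x y /IH xU /IH yU; apply/VP; exact: wsum_brk (stepk k) xU yU.
exists (size rts).+2; apply/eqP; rewrite -subv0; apply/subvP => x /H [s sP ->].
rewrite big_seq big1 ?mem0v// => p /sP [[_ _ le] _].
by have := leq_trans le (count_size _ _); rewrite ltnn.
Qed.
End SolvableSubalgebra.

Lemma b_dec x : x \in b -> exists2 s : seq (hd * L),
  forall p, p \in s -> [/\ root_vec p.1 p.2, p.2 \in b & p.1 = 0 \/ p.2 = 0 \/ pos p.1] & x = \sum_(p <- s) p.2.
Proof.
move=> xb; have [s ws xE] := adj_wmod hcart x.
have sb : subspace (fun y : L => y \in b) by split=> [|a u v ub vb]; rewrite ?mem0v// memvD ?memvZ.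
have [|s' [_ ws' bs' xE' _]] := @wdec_in F L h (adj L) (fun y : L => y \in b) s x sb _ ws xE xb.
  by move=> t v vb; apply: brk_b => //; exact: cor_b.
exists s' => // p ps; split; [exact: ws'|exact: bs'|].
have [->|p10] := eqVneq p.1 0; [by left|right].
have [->|p20] := eqVneq p.2 0; [by left|right].
by apply: (pos_root_of _ p20 (ws' _ ps) (bs' _ ps)); split=> //; exists p.2 => //; apply: ws'.
Qed.

(** If a root [ga] is not positive, the semigroup spanned by [ga] and the positive roots contains
    zero: otherwise [Salg] gives a solvable subalgebra containing [b] and the root space of [ga],
    against maximality. Such relations for [al] and for [-al] combine to a vanishing sum of positive
    roots. *)
Lemma pos_or al : is_root al -> pos al \/ pos (- al).
Proof.
move=> ra; apply: contrapT => /not_orP[na nna].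
pose S ga mu := exists (s : seq hd) (n : nat),
  [/\ forall be, be \in s -> pos be, s != [::] \/ (0 < n)%N & mu = \sum_(be <- s) be + ga *+ n].
have SD ga mu nu : S ga mu -> S ga nu -> S ga (mu + nu).
  move=> [s [n [sP sn ->]]] [s' [n' [sP' _ ->]]]; exists (s ++ s'), (n + n')%N; split.
  - by move=> be; rewrite mem_cat => /orP[/sP|/sP'].
  - by case: sn => [|n0]; [case: (s) => //; left|right; rewrite ltn_addr].
  - by rewrite big_cat mulrnDr addrACA.
have key ga : is_root ga -> ~ pos ga -> S ga 0.
  move=> rg npg; apply: contrapT => S0; apply: npg.
  have [U [UP Ualg Usol]] := Salg (SD ga) S0.
  case: (hb) => _ _ /(_ U Ualg Usol) bmax.
  have : U = b.
    apply: bmax; apply/subvP => x /b_dec[s sP ->]; apply/UP/(sub_sum_seq (wsum_sub _)) => p /sP [rp pb []].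
      by move=> p0; apply: wsum1 rp; left.
    case=> [->|pp]; first exact: sub0 (wsum_sub _).
    apply: wsum1 rp; right; split; first exact: pp.1.
    by exists [:: p.1], 0%N; split=> [be| |]; [rewrite inE => /eqP ->|left|rewrite big_seq1 addr0].
  move=> UE; split=> // x rx; rewrite -UE; apply/UP; apply: wsum1 rx; right; split=> //.
  by exists [::], 1%N; split=> //; [right|rewrite big_nil add0r].
have [s [n [sP sn sE]]] := key _ ra na.
have [s' [n' [sP' sn' sE']]] := key _ (root_opp hss hcart ra) nna.
have n0 : (0 < n)%N.
  rewrite lt0n; apply/eqP => n0; move: sE; rewrite n0 addr0 => /esym /(pos_sum0 sP) s0.
  by move: sn; rewrite s0 n0 => -[].
have n'0 : (0 < n')%N.
  rewrite lt0n; apply/eqP => n'0; move: sE'; rewrite n'0 addr0 => /esym /(pos_sum0 sP') s0.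
  by move: sn'; rewrite s0 n'0 => -[].
have flatE (l : seq hd) k : \sum_(be <- flatten (nseq k l)) be = (\sum_(be <- l) be) *+ k.
  by elim: k => [|k IH] /=; rewrite ?big_nil// big_cat IH mulrS.
have flatP (l : seq hd) k : (forall be, be \in l -> pos be) -> forall be, be \in flatten (nseq k l) -> pos be.
  by move=> lP be /flattenP[l' /nseqP[-> _]]; apply: lP.
have : flatten (nseq n' s) ++ flatten (nseq n s') = [::].
  apply: pos_sum0 => [be|]; first by rewrite mem_cat => /orP[]; apply: flatP.
  move/eqP: sE; rewrite eq_sym addr_eq0 => /eqP sE; move/eqP: sE'; rewrite eq_sym addr_eq0 => /eqP sE'.
  by rewrite big_cat /= !flatE sE sE' !mulNrn opprK -!mulrnA mulnC addNr.
case: n' n'0 sE' {sn'} => // n' _ _; case: s sE {sP sn flatE} => //= sE _.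
move/eqP: sE; rewrite big_nil add0r eq_sym -scaler_nat scaler_eq0 pnatr_eq0 (negbTE (root_neq0 ra)) orbF.
by case: (n) n0.
Qed.

Lemma pos_not_opp al : is_root al -> ~ pos al -> pos (- al).
Proof. by move=> /pos_or[]. Qed.

Definition posr : seq hd := [seq al <- rts | `[< pos al >]].
Lemma posrP al : al \in posr <-> pos al.
Proof.
rewrite mem_filter; split=> [/andP[/asboolP]//|pa]; apply/andP; split; first exact/asboolP.
by apply/rtsP; case: pa.
Qed.
Lemma posr_uniq : uniq posr. Proof. exact/filter_uniq/rts_uniq. Qed.

Lemma pos_sumD (s1 s2 : seq hd) : (forall al, al \in s1 -> pos al) -> (forall al, al \in s2 -> pos al) ->
  \sum_(al <- s1) al = - \sum_(al <- s2) al -> s1 = [::].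
Proof.
move=> P1 P2 E; have : s1 ++ s2 = [::].
  apply: pos_sum0 => [al|]; first by rewrite mem_cat => /orP[/P1|/P2].
  by rewrite big_cat /= E addNr.
by case: s1 {P1 E}.
Qed.

Lemma pos_shift ga de (k : nat) : pos ga -> pos de -> is_root (ga + de *+ k) -> pos (ga + de *+ k).
Proof.
move=> pg pd rgd; have [//|pn] := pos_or rgd.
suff : ga :: nseq k de = [::] by [].
apply: (@pos_sumD _ [:: - (ga + de *+ k)]).
- by move=> al; rewrite inE => /predU1P[->//|/nseqP[-> _]].
- by move=> al; rewrite inE => /eqP ->.
- by rewrite big_seq1 opprK big_cons big_nseq iter_addr_0.
Qed.

Lemma refl_pos_or ga de : pos ga -> pos de -> ~ pos (sr ga de) -> 0 < (de (cor ga) : F).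
Proof.
move=> pg pd np; have [m dm] := root_int hss hcart pg.1 pd.1.
have rr := root_refl hss hcart pg.1 pd.1; rewrite dm ltr0z ltNge; apply/negP => m0; apply: np.
have E : sr ga de = de + ga *+ `|m|%N.
  by rewrite /reflection dm -scaler_nat natr_absz ler0_norm// mulrNz scaleNr.
by rewrite E in rr *; apply: pos_shift.
Qed.

Lemma reflection_neg ga : is_root ga -> sr ga ga = - ga.
Proof. by move=> rg; rewrite /reflection (corr2 hss hcart rg); lmod F. Qed.
Lemma reflectionN ga la : sr ga (- la) = - sr ga la.
Proof. by rewrite /reflection evE; lmod F. Qed.

(** Positive roots that stay positive under the reflection cancel in pairs. The others contribute
    positive terms, and [ga] is one of them. *)
Lemma odd_sum ga (phi : hd -> F) : pos ga -> (forall de, is_root de -> phi (sr ga de) = - phi de) ->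
  (forall de, pos de -> ~ pos (sr ga de) -> 0 < phi de) -> 0 < \sum_(de <- posr) phi de.
Proof.
move=> pg odd pphi; have rg := pg.1; have K := reflectionK (corr2 hss hcart rg).
rewrite (bigID (fun de => `[< pos (sr ga de) >])) /=.
have -> : \sum_(de <- posr | `[< pos (sr ga de) >]) phi de = 0.
  rewrite -big_filter; set l := [seq _ <- _ | _].
  have lP de : de \in l <-> pos de /\ pos (sr ga de).
    rewrite mem_filter; split=> [/andP[/asboolP ? /posrP]//|[? ?]].
    by apply/andP; split; [apply/asboolP|apply/posrP].
  have pl : perm_eq (map (sr ga) l) l.
    have ul : uniq l by apply/filter_uniq/posr_uniq.
    apply: uniq_perm; rewrite ?map_inj_uniq//; first exact: can_inj K.
    move=> de; apply/idP/idP => [/mapP[mu /lP[p1 p2] ->]|/lP[p1 p2]].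
      by apply/lP; rewrite K.
    by apply/mapP; exists (sr ga de); rewrite ?K//; apply/lP; rewrite K.
  have E : \sum_(de <- l) phi de = - \sum_(de <- l) phi de.
    rewrite -{1}(perm_big _ pl) /= big_map -sumrN big_seq [RHS]big_seq.
    by apply: eq_bigr => de /lP[[rd _] _]; rewrite odd.
  by apply/eqP; rewrite -eqNr -E.
rewrite add0r -big_filter (bigD1_seq ga) ?(filter_uniq _ posr_uniq)//=; first last.
  rewrite mem_filter; apply/andP; split; last exact/posrP.
  by rewrite reflection_neg//; apply/asboolP; exact: pos_opp.
apply: ltr_wpDr; last by apply: pphi => //; rewrite reflection_neg//; exact: pos_opp.
rewrite big_seq_cond; apply: sumr_ge0 => de; rewrite mem_filter => /andP[/andP[/asboolP np /posrP pd] _].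
exact/ltW/pphi.
Qed.

(** This is $2\rho^\vee$; values at it serve as the levels of weights. *)
Definition tt0 : subvs_of h := \sum_(de <- posr) cor de.

Lemma pos_tt0 ga : pos ga -> exists k : nat, (ga tt0 : F) = k.+1%:R.
Proof.
move=> pg; have rg := pg.1.
have [m mE] : exists m : int, (ga tt0 : F) = m%:~R.
  rewrite /tt0 evt_sum big_seq; apply: (big_ind (fun c : F => exists m : int, c = m%:~R)).
  - by exists 0.
  - by move=> _ _ [m ->] [m' ->]; exists (m + m'); rewrite rmorphD.
  - by move=> de /posrP pd; apply: root_int => //; case: pd.
have : 0 < (ga tt0 : F).
  rewrite /tt0 evt_sum; apply: (odd_sum (ga := ga)) => // de; last first.
    by move=> pd np; rewrite (pair_sign hss hcart rg pd.1); apply: refl_pos_or.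
  move=> rd; have := refl_pair hss hcart (sr ga ga) rg rd.
  by rewrite reflectionK ?corr2// reflection_neg// evE.
by rewrite mE ltr0z; case: m mE => // -[//|k] kE _; exists k; rewrite -pmulrn.
Qed.

Lemma rhoE : rho h b = (2%:R^-1 : F) *: \sum_(de <- posr) de :> hd.
Proof.
rewrite /rho; congr (_ *: _); rewrite (fsbig_seq _ _ posr_uniq).
have -> // : [set a | pos a]%classic = [set` posr]%classic.
by apply/seteqP; split=> al /= /posrP.
Qed.

Lemma rho_pos ga : pos ga -> 0 < (rho h b (cor ga) : F).
Proof.
move=> pg; have rg := pg.1; rewrite rhoE evE ev_sum mulr_gt0 ?invr_gt0 ?ltr0n//.
apply: (odd_sum (ga := ga)) => // de; last by move=> pd; apply: refl_pos_or.
by move=> rd; rewrite /reflection !evE (corr2 hss hcart rg); ring.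
Qed.

Local Notation simple := (simple_root b).

Lemma simple_sum al : pos al -> exists s : seq hd, [/\ s != [::], (forall be, be \in s -> simple be) & al = \sum_(be <- s) be].
Proof.
move=> pa; have [k ak] := pos_tt0 pa.
move: {2}k (leqnn k) => n; elim: n k al pa ak => [|n IH] k al pa ak kn.
  exists [:: al]; split=> // [de|]; last by rewrite big_seq1.
  rewrite inE => /eqP ->; split=> // -[be [ga [pb pg E]]].
  have [[i bi] [j gj]] := (pos_tt0 pb, pos_tt0 pg); move: ak.
  rewrite E evE bi gj -natrD => /eqP; rewrite eqr_nat; lia.
have [[be [ga [pb pg E]]]|ns] := pselect (exists be ga, [/\ pos be, pos ga & al = be + ga]); last first.
  by exists [:: al]; split=> // [be|]; [rewrite inE => /eqP ->|rewrite big_seq1].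
have [[i bi] [j gj]] := (pos_tt0 pb, pos_tt0 pg); move: ak.
rewrite E evE bi gj -natrD => /eqP; rewrite eqr_nat => /eqP ijk.
have [|s [s0 sP ->]] := IH i be pb bi; first by lia.
have [|s' [s0' sP' ->]] := IH j ga pg gj; first by lia.
exists (s ++ s'); split; [by case: (s) s0| |by rewrite big_cat].
by move=> de; rewrite mem_cat => /orP[/sP|/sP'].
Qed.

(** Going down the string, a first negative member would write [al] as the sum of the positive roots
    $\gamma-j\alpha$ and $(j+1)\alpha-\gamma$. *)
Lemma simple_refl al ga : simple al -> pos ga -> ga != al -> pos (sr al ga).
Proof.
move=> [pa sa] pg ga_al; have [ra rg] := (pa.1, pg.1).
apply: contrapT => np; have := refl_pos_or pa pg np.
have [m gm] := root_int hss hcart ra rg; rewrite gm ltr0z; case: m gm => // k gm _.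
apply: np; rewrite -pmulrn in gm; rewrite /reflection gm scaler_nat.
suff H j : (j <= k)%N -> pos (ga - al *+ j) by apply: H.
elim: j => [|j IH] jk; first by rewrite subr0.
have {}IH := IH (ltnW jk).
have nz : ga - al *+ j.+1 != 0.
  rewrite subr_eq0; apply/eqP => E; case: j {IH} jk E => [|j] jk E; first by rewrite E mulr1n eqxx in ga_al.
  by apply: (root_nmul (j := j.+2) hss hcart ra); rewrite // -E.
have rj := string_down ra rg gm jk nz.
apply: contrapT => /(pos_not_opp rj) pn; apply: sa.
by exists (ga - al *+ j), (- (ga - al *+ j.+1)); split=> //; rewrite mulrSr; move: (al *+ j) => x; lmod F.
Qed.

(** Otherwise $(\beta,\beta)$, expanded over the simple summands of one argument, would be at most
    zero. *)
Lemma simple_pair be : pos be -> exists2 al, simple al & 0 < (be (cor al) : F).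
Proof.
move=> pb; have rb := pb.1; have [s [_ sP E]] := simple_sum pb.
apply: contrapT => nex; have := bil_gt0 hss hcart rb.
have -> : bil hss hcart be be = \sum_(al <- s) bil hss hcart be al.
  rewrite {2}E; elim: (s) => [|al s' IH]; first by rewrite !big_nil /bil big1// => de _; rewrite evE mulr0.
  by rewrite !big_cons -IH -[X in bil _ _ _ (X + _)]scale1r bil_linr mul1r.
suff : \sum_(al <- s) bil hss hcart be al <= 0 by move=> /le_lt_trans /[apply]; rewrite ltxx.
rewrite big_seq; apply: sumr_le0 => al /sP sal; have ra := sal.1.1.
have [m bm] := root_int hss hcart ra rb.
have := bil_pair hss hcart be ra; rewrite bm => E2.
have m0 : (m <= 0)%R by rewrite leNgt; apply/negP => m0; apply: nex; exists al; rewrite // bm ltr0z.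
rewrite -(pmulr_rle0 _ (ltr0Sn F 1)) -E2 pmulr_lle0 ?lerz0//; exact: bil_gt0.
Qed.

(** The reflection permutes the positive roots other than [al], so their pairings with the coroot
    cancel. *)
Lemma rho_simple al : simple al -> (rho h b (cor al) : F) = 1.
Proof.
move=> sal; have pa := sal.1; have ra := pa.1; rewrite rhoE evE ev_sum.
suff -> : \sum_(de <- posr) (de (cor al) : F) = 2%:R by rewrite mulVf// pnatr_eq0.
rewrite (bigD1_seq al) ?posr_uniq//=; last exact/posrP.
rewrite (corr2 hss hcart ra) -[RHS]addr0; congr (_ + _).
rewrite -big_filter; set l := [seq _ <- _ | _].
have K := reflectionK (corr2 hss hcart ra).
have lP de : de \in l <-> pos de /\ de != al.
  by rewrite mem_filter; split=> [/andP[? /posrP]//|[? ?]]; apply/andP; split=> //; apply/posrP.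
have st de : pos de /\ de != al -> pos (sr al de) /\ sr al de != al.
  move=> [pd da]; split; first exact: simple_refl.
  apply/eqP => E; have : de = - al by rewrite -[de]K E reflection_neg.
  by move=> dE; apply: (pos_opp pa); rewrite -dE.
have pl : perm_eq (map (sr al) l) l.
  have ul : uniq l by apply/filter_uniq/posr_uniq.
  apply: uniq_perm; rewrite ?map_inj_uniq//; first exact: can_inj K.
  move=> de; apply/idP/idP => [/mapP[mu /lP/st p ->]|/lP/st p]; first exact/lP.
  by apply/mapP; exists (sr al de); rewrite ?K//; apply/lP.
have E : \sum_(de <- l) (de (cor al) : F) = - \sum_(de <- l) (de (cor al) : F).
  rewrite -{1}(perm_big _ pl) /= big_map -sumrN; apply: eq_bigr => de _.
  by rewrite /reflection !evE (corr2 hss hcart ra); ring.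
by apply/eqP; rewrite -eqNr -E.
Qed.
End BorelRoots.

(** * The Weyl group and the Bruhat order *)

Section WeylGroup.
Variables (F : numClosedFieldType) (L : lieAlgebra F) (h b : {vspace L}).
Local Notation hd := 'Hom(subvs_of h, F^o).
Hypotheses (hss : semisimple L) (hcart : cartan h) (hb : borel b) (hhb : (h <= b)%VS).
Implicit Types (al be ga la mu : hd) (w x y z : weyl h).
Local Notation cor := (cor hss hcart).
Local Notation re := (re hss hcart).
Local Notation rf := (rf hss hcart).
Local Notation pos := (pos_root b).
Local Notation simple := (simple_root b).
Local Notation sr al := (reflection al (cor al)).
Local Notation tt0 := (tt0 b hss hcart).
Let pos_opp := @pos_opp F L h b hss hcart hb hhb.
Let pos_or := @pos_or F L h b hss hcart hb hhb.
Let pos_tt0 := @pos_tt0 F L h b hss hcart hb hhb.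
Let simple_refl := @simple_refl F L h b hss hcart hb hhb.
Let corr2 := @corr2 F L h hss hcart.
Let refl_pair := @refl_pair F L h hss hcart.
Let srK al (ra : is_root al) := reflectionK (corr2 ra).
Let srneg := @reflection_neg F L h hss hcart.

Lemma sr_opp al : is_root al -> sr (- al) = sr al.
Proof.
move=> ra; apply/funext => la; rewrite /reflection (cor_opp hss hcart ra) evtN; lmod F.
Qed.

Lemma sr_is al : is_root al -> is_reflection (sr al).
Proof. by move=> ra; apply: IsReflection => //; apply: cor_is_coroot. Qed.

Lemma is_reflP s : is_reflection s -> exists2 be, pos be & s = sr be.
Proof.
case=> al t ra /(coroot_uniq hss hcart ra) ->; have [pa|pa] := pos_or ra; first by exists al.
by exists (- al); rewrite ?sr_opp.
Qed.

Section WeylFunctions.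
Variable w : hd -> hd.
Hypothesis W : weyl_pred w.

Lemma weyl_lin : linear w.
Proof.
elim: W => // s v [al t _ _] _ IH a u u' /=.
by rewrite IH reflection_lin.
Qed.
Lemma weylD la mu : w (la + mu) = w la + w mu.
Proof. by rewrite -[la]scale1r weyl_lin !scale1r. Qed.
Lemma weyl0 : w 0 = 0.
Proof. by apply: (addrI (w 0)); rewrite -weylD !addr0. Qed.
Lemma weylZ a la : w (a *: la) = a *: w la.
Proof. by rewrite -[a *: la]addr0 weyl_lin weyl0 addr0. Qed.
Lemma weylN la : w (- la) = - w la.
Proof. by rewrite -scaleN1r weylZ scaleN1r. Qed.
Lemma weyl_sum I (r : seq I) p (f : I -> hd) :
  w (\sum_(i <- r | p i) f i) = \sum_(i <- r | p i) w (f i).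
Proof. by apply: (big_morph w) => [la mu|]; [exact: weylD|exact: weyl0]. Qed.

Lemma weyl_root ga : is_root ga -> is_root (w ga).
Proof.
move=> rg; elim: W => // s v /is_reflP[be pb ->] _ IH /=; exact: (root_refl hss hcart pb.1 IH).
Qed.

Lemma weyl_pair la ga : is_root ga -> (w la) (cor (w ga)) = la (cor ga).
Proof.
move=> rg; have : is_root (w ga) /\ (w la) (cor (w ga)) = la (cor ga); last by case.
elim: W => // s v /is_reflP[be [rb _] ->] _ [rv IH] /=.
by split; [exact: root_refl|rewrite refl_pair].
Qed.

Lemma weyl_conj ga la : is_root ga -> w (sr ga la) = sr (w ga) (w la).
Proof. by move=> rg; rewrite {2}/reflection weyl_pair// /reflection weylD weylN weylZ. Qed.

Lemma weyl_comp v : weyl_pred v -> weyl_pred (w \o v).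
Proof. by move=> V; elim: W => // s u hs _ IH; apply: (Weyl_refl hs IH). Qed.
End WeylFunctions.

Lemma weyl_refl be : is_root be -> weyl_pred (sr be).
Proof. by move=> rb; apply: (Weyl_refl (sr_is rb) (Weyl_id h)). Qed.

Lemma weyl_inv w0 : weyl_pred w0 -> exists v : hd -> hd, [/\ weyl_pred v, cancel w0 v & cancel v w0].
Proof.
elim=> [|s w /is_reflP[be [rb _] ->] _ [v [V c1 c2]]]; first by exists id; split=> //; apply: Weyl_id.
exists (v \o sr be); split.
- by apply: weyl_comp => //; apply: weyl_refl.
- by move=> la /=; rewrite srK.
- by move=> la /=; rewrite c2 srK.
Qed.

Lemma sw_weyl n (w : hd -> hd) : simple_word b n w -> weyl_pred w.
Proof.
elim=> [|m al t v sal ct _ IH]; first exact: Weyl_id.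
by apply: Weyl_refl => //; apply: IsReflection => //; apply: sal.1.1.
Qed.

Lemma sw_cons n al (w : hd -> hd) : simple al -> simple_word b n w -> simple_word b n.+1 (sr al \o w).
Proof. by move=> sal W; apply: SimpleWordS => //; apply: cor_is_coroot; apply: sal.1.1. Qed.

Lemma sw_cat n m (v w : hd -> hd) : simple_word b n v -> simple_word b m w -> simple_word b (n + m) (v \o w).
Proof. by move=> V W; elim: V => // k al t u sal ct _ IH; apply: (SimpleWordS sal ct IH). Qed.

Lemma sw_snoc n (w : hd -> hd) : simple_word b n.+1 w -> exists u al, [/\ simple_word b n u, simple al & w = u \o sr al].
Proof.
elim: n w => [|n IH] w W; inversion W as [|? al t w' sal ct W']; subst.
  inversion W'; subst; exists id, al; split=> //.
  by rewrite (coroot_uniq hss hcart sal.1.1 ct).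
have [u [ga [U sga ->]]] := IH _ W'.
by exists (reflection al t \o u), ga; split=> //; apply: SimpleWordS.
Qed.

(** Letters are stripped from the left, carrying [be] along as a positive root. Since it ends at the
    negative root [ga], it must at some point equal the simple root of the next letter, and that
    letter is deleted. *)
Lemma strong_exch n (w : hd -> hd) be ga : simple_word b n w -> pos be -> pos (- ga) -> w ga = be ->
  exists2 m, (m < n)%N & simple_word b m (sr be \o w).
Proof.
move=> W; elim: W be ga => [|k al t v sal ct V IH] be ga pb png E.
  by case: (pos_opp pb); rewrite -E.
have ra := sal.1.1; move: E; rewrite (coroot_uniq hss hcart ra ct) /= => E.
have {}E : v ga = sr al be by rewrite -E srK.
have [->|ne] := eqVneq be al.
  exists k => //; suff -> : sr al \o (sr al \o v) = v by [].
  by apply/funext => la /=; rewrite srK.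
have [m mk M] := IH _ _ (simple_refl sal pb ne) png E.
exists m.+1 => //; suff -> : sr be \o (sr al \o v) = sr al \o (sr (sr al be) \o v) by apply: sw_cons.
apply/funext => la /=; rewrite (weyl_conj (weyl_refl ra)) ?srK//.
by apply: root_refl => //; case: pb.
Qed.

(** Write $w=us_\alpha=s_{w\alpha}u$. As $w\alpha$ is positive, the exchange condition applied to
    $u$ gives a shorter word for $w$ itself. *)
Lemma pos_id n (w : hd -> hd) : simple_word b n w -> (forall ga, pos ga -> pos (w ga)) -> w = id.
Proof.
move: {2}n (leqnn n) => N; elim: N n w => [|N IH] n w nN W P.
  by move: W; rewrite (_ : n = 0)%N; [move=> W; inversion W|lia].
case: n nN W => [|n] nN W; first by inversion W.
have [u [al [U sal wE]]] := sw_snoc W; have ra := sal.1.1; have UW := sw_weyl U.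
have E : u (- al) = w al by rewrite wE /= srneg.
have [|m mn M] := strong_exch U (P _ sal.1) _ E; first by rewrite opprK; exact: sal.1.
have wE' : w = sr (w al) \o u.
  apply/funext => la /=; rewrite -E -(weyl_conj UW); last exact: root_opp.
  by rewrite sr_opp// wE.
by rewrite -wE' in M; apply: (IH m) => //; lia.
Qed.

(** Conjugation by a simple reflection that pairs positively with [be] lowers the level of the
    root. *)
Lemma refl_word be : pos be -> exists n, simple_word b n (sr be).
Proof.
move=> pb; have [k bk] := pos_tt0 pb; move: {2}k (leqnn k) => n.
elim: n k be pb bk => [|n IH] k be pb bk kn.
all: have [al sal] := simple_pair hss hcart hb hhb pb.
all: have ra := sal.1.1; have [m am] := root_int hss hcart ra pb.1; rewrite am ltr0z => m0.
all: have [->|ne] := eqVneq be al; first by exists 1%N; apply: (sw_cons sal (SimpleWord0 h b)).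
all: have pc := simple_refl sal pb ne; have [i ci] := pos_tt0 pc; have [j aj] := pos_tt0 sal.1.
all: have ik : (i < k)%N; first (
  move: ci; rewrite /reflection evE evN evZ am bk aj; case: m m0 am => // m m0 _;
  rewrite -pmulrn => /eqP; rewrite subr_eq -!natrM -natrD eqr_nat => /eqP; nia).
  by lia.
have [m' W'] := IH i _ pc ci (leq_trans ik kn).
exists (1 + (m' + 1))%N.
have -> : sr be = (sr al \o id) \o (sr (sr al be) \o (sr al \o id)).
  apply/funext => la /=; rewrite (weyl_conj (weyl_refl ra)) ?srK//.
  by apply: root_refl => //; case: pb.
have S1 := sw_cons sal (SimpleWord0 h b).
exact: sw_cat S1 (sw_cat W' S1).
Qed.

Lemma weyl_word (w : hd -> hd) : weyl_pred w -> exists n, simple_word b n w.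
Proof.
elim=> [|s v /is_reflP[be pb ->] _ [n V]]; first by exists 0; apply: SimpleWord0.
by have [m M] := refl_word pb; exists (m + n)%N; apply: sw_cat.
Qed.

Lemma has_len w : exists n, has_length b w n.
Proof.
have ex : exists n, `[< simple_word b n w >].
  by have [n W] := weyl_word (weylP w); exists n; apply/asboolP.
exists (ex_minn ex); case: ex_minnP => n /asboolP W mn; split=> // m M; apply: mn; exact/asboolP.
Qed.

Lemma weyl_eq x y : (forall la, x la = y la) -> x = y.
Proof.
case: x y => f p [g q] /= /funext E; case: _ / E q => q; congr Weyl; exact: Prop_irrelevance.
Qed.

Definition wid : weyl h := Weyl (Weyl_id h).

(* junk value if be is not a root *)
Definition srm be w : weyl h :=
  if pselect (is_root be) is left rb then Weyl (Weyl_refl (sr_is rb) (weylP w)) else w.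

Lemma srmE be w la : is_root be -> srm be w la = sr be (w la).
Proof. by move=> rb; rewrite /srm; case: pselect. Qed.

Lemma srmK be w : is_root be -> srm be (srm be w) = w.
Proof. by move=> rb; apply: weyl_eq => la; rewrite !srmE// srK. Qed.

(** A step of the Bruhat order expressed by roots: $y^{-1}\beta$ is positive. Being free of lengths,
    it behaves well under multiplication by a simple reflection. *)
Definition garrow y z := exists be ga, [/\ pos be, pos ga, y ga = be & z = srm be y].

Inductive Br : weyl h -> weyl h -> Prop :=
| Br0 x : Br x x
| BrS x y z : Br x y -> garrow y z -> Br x z.

Lemma Br_trans x y z : Br x y -> Br y z -> Br x z.
Proof. by move=> xy yz; elim: yz x xy => // u v v' _ IH a x xy; apply: BrS a; apply: IH. Qed.

Lemma Br1 x y : garrow x y -> Br x y. Proof. exact/BrS/Br0. Qed.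

Lemma garrow_bruhat y z : garrow y z -> bruhat_arrow b y z.
Proof.
move=> [be [ga [pb pg E zE]]]; have rb := pb.1; split.
  by exists (sr be); [exact: sr_is|apply/funext => la; rewrite zE srmE].
have [[m [Wm mP]] [n [Wn nP]]] := (has_len y, has_len z); exists m, n; split=> //.
have [||k kn K] := strong_exch Wn pb (_ : pos (- (- ga))); first by rewrite opprK.
  by rewrite zE srmE// (weylN (weylP y)) E reflectionN srneg// opprK.
apply: leq_ltn_trans kn; apply: mP; suff <- : sr be \o z = y by [].
by apply/funext => la /=; rewrite zE srmE// srK.
Qed.

Lemma Br_bruhat x y : Br x y -> bruhat b x y.
Proof. by elim=> [z|u v z _ IH /garrow_bruhat a]; [exact: BruhatRefl|exact: BruhatStep a]. Qed.

Definition up al w := exists2 ga, pos ga & w ga = al.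
Definition dn al w := exists2 ga, pos ga & w ga = - al.

Lemma up_or_dn al w : is_root al -> up al w \/ dn al w.
Proof.
move=> ra; have [v [V c1 c2]] := weyl_inv (weylP w).
have [p|p] := pos_or (weyl_root V ra); first by left; exists (v al).
by right; exists (- v al) => //; rewrite (weylN (weylP w)) c2.
Qed.

Lemma up_not_dn al w : up al w -> ~ dn al w.
Proof.
move=> [ga pg E] [de pd E']; have [v [V c1 c2]] := weyl_inv (weylP w).
by apply: (pos_opp pg); rewrite -[- ga]c1 (weylN (weylP w)) E -E' c1.
Qed.

Lemma up_srm al w : is_root al -> up al w -> dn al (srm al w).
Proof. by move=> ra [ga pg E]; exists ga => //; rewrite srmE// E srneg. Qed.
Lemma dn_srm al w : is_root al -> dn al w -> up al (srm al w).
Proof. by move=> ra [ga pg E]; exists ga => //; rewrite srmE// E reflectionN srneg// opprK. Qed.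

Lemma up_garrow al w : pos al -> up al w -> garrow w (srm al w).
Proof. by move=> pa [ga pg E]; exists al, ga. Qed.

Lemma garrow_srm al x y : simple al -> garrow x y -> y = srm al x \/ garrow (srm al x) (srm al y).
Proof.
move=> sal [be [ga [pb pg E yE]]]; have ra := sal.1.1; have rb := pb.1.
have [bea|ne] := eqVneq be al; first by left; rewrite yE bea.
right; exists (sr al be), ga; split=> //; first exact: simple_refl.
  by rewrite srmE// E.
apply: weyl_eq => la; rewrite srmE// yE !srmE//; last exact: root_refl.
by rewrite (weyl_conj (weyl_refl ra)).
Qed.

(** The lifting property. By induction along the chain, sending each element to the larger of the
    two elements of its coset under the simple reflection preserves the order; [mn] is the graph of
    this map. *)
Lemma Br_lift al x y : simple al -> Br x y -> up al x -> up al y -> Br (srm al x) (srm al y).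
Proof.
move=> sal xy; have ra := sal.1.1.
pose mn w w' := (up al w /\ w' = srm al w) \/ (dn al w /\ w' = w).
suff H x' y' : mn x x' -> mn y y' -> Br x' y' by move=> ux uy; apply: H; left.
elim: xy x' y' => {x y} [x|x y z _ IH yz] x' z' mx mz.
  suff -> : x' = z' by apply: Br0.
  by case: mx mz => [[u ->]|[u ->]] [[v ->]|[v ->]] //; [case: (up_not_dn u)|case: (up_not_dn v)].
have [y' my] : exists y', mn y y'.
  by have [u|u] := up_or_dn y ra; [exists (srm al y); left|exists y; right].
apply: Br_trans (IH _ _ mx my) _.
have [zE|a] := garrow_srm sal yz.
  case: my mz => [[u ->]|[u ->]] [[v ->]|[v ->]].
  - by case: (up_not_dn v); rewrite zE; apply: up_srm.
  - by rewrite zE; apply: Br0.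
  - by rewrite zE srmK//; apply: Br0.
  - by case: (up_not_dn (_ : up al z) v); rewrite zE; apply: dn_srm.
case: my mz => [[u ->]|[u ->]] [[v ->]|[v ->]]; [exact: Br1| | |exact: Br1].
  apply: Br_trans (Br1 a) _; rewrite -{2}[z](@srmK al)//; apply: Br1; apply: up_garrow; first exact: sal.1.
  exact: dn_srm.
by apply: Br_trans (Br1 yz) _; apply: Br1; apply: up_garrow v; apply: sal.1.
Qed.

Local Notation rho := (rho h b).

Lemma dn_ex w : w <> wid -> exists2 al, simple al & dn al w.
Proof.
move=> wn; apply: contrapT => nex; apply: wn; apply: weyl_eq => la /=.
have [n W] := weyl_word (weylP w).
suff -> : weyl_fun w = id by [].
apply: (pos_id W) => ga pg; have rg := pg.1.
have [//|pn] := pos_or (weyl_root (weylP w) rg).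
have [s [_ sP E]] := simple_sum hss hcart hb hhb pn; have [v [V c1 c2]] := weyl_inv (weylP w).
have : ga :: map v s = [::]; last by [].
apply: (pos_sum0 hss hcart hb hhb) => [be|].
  rewrite inE => /predU1P[->//|/mapP[al /sP sal ->]].
  have [[de pd <-]|d] := up_or_dn w sal.1.1; first by rewrite c1.
  by case: nex; exists al.
by rewrite big_cons big_map -(weyl_sum V) -E (weylN V) c1 subrr.
Qed.

(** Induction on the length of a word: at a simple descent, which [dn_ex] provides, exchange gives a
    shorter word for the reflected element. *)
Lemma weyl_ind (P : weyl h -> Prop) : P wid ->
  (forall al w, simple al -> dn al w -> P (srm al w) -> P w) -> forall w, P w.
Proof.
move=> P1 PS w; have [n W] := weyl_word (weylP w).
move: {2}n (leqnn n) => N; elim: N n w W => [|N IH] n w W nN.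
all: have [->//|/dn_ex[al sal d]] := pselect (w = wid); have ra := sal.1.1.
all: have [ga pg E] := d.
all: have [||m mn M] := strong_exch W sal.1 (_ : pos (- (- ga))); first by rewrite opprK.
all: try by rewrite (weylN (weylP w)) E opprK.
  by lia.
apply: (PS al) => //; apply: (IH m); last by lia.
suff <- : sr al \o w = srm al w by [].
by apply/funext => la; rewrite srmE.
Qed.

Lemma dotE w : dot b w 0 = w rho - rho. Proof. by rewrite /dot add0r. Qed.

Lemma wrho_pair w al : simple al -> exists m : int, (w rho) (cor al) = m%:~R.
Proof.
move=> sal; suff H v : weyl_pred v -> forall ga, is_root ga ->
    exists m : int, (v rho - rho) (cor ga) = m%:~R.
  have [m] := H _ (weylP w) al sal.1.1; rewrite evD evN (rho_simple hss hcart hb hhb sal) => /eqP.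
  by rewrite subr_eq => /eqP ->; exists (m + 1); rewrite rmorphD.
move=> /weyl_word[n V]; elim: V => [|k be t u sbe ct _ IH] ga rg.
  by exists 0; rewrite subrr ev0.
have rb := sbe.1.1; rewrite (coroot_uniq hss hcart rb ct) /= {1}/reflection.
have [[m E] [j E']] := (IH ga rg, IH be rb); have [c cE] := root_int hss hcart rg rb.
have : (u rho (cor be) : F) = (j + 1)%:~R.
  by move/eqP: E'; rewrite evD evN (rho_simple hss hcart hb hhb sbe) subr_eq => /eqP ->; rewrite rmorphD.
move=> ->; exists (m - (j + 1) * c).
by rewrite addrAC evD evN evZ E cE rmorphB rmorphM.
Qed.

Lemma up_rho al w : simple al -> up al w -> exists k : nat, (w rho) (cor al) = k.+1%:R.
Proof.
move=> sal [ga pg E]; have [m mE] := wrho_pair w sal; move: (mE).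
rewrite -{1}E (weyl_pair (weylP w) _ pg.1) => mE'; have := rho_pos hss hcart hb hhb pg.
by rewrite mE' ltr0z; case: m mE {mE'} => // -[//|k] mE _; exists k; rewrite mE -pmulrn.
Qed.

Lemma srm_rho al w : is_root al -> srm al w rho = w rho - (w rho (cor al) : F) *: al.
Proof. by move=> ra; rewrite srmE. Qed.

Lemma dot_srm al w : is_root al -> dot b (srm al w) 0 = dot b w 0 - (w rho (cor al) : F) *: al.
Proof. by move=> ra; rewrite !dotE srm_rho// addrAC. Qed.

Lemma dot_cor al w : simple al -> (dot b w 0) (cor al) = (w rho (cor al) : F) - 1.
Proof. by move=> sal; rewrite dotE evD evN (rho_simple hss hcart hb hhb sal). Qed.

Lemma dn_rho al w : simple al -> dn al w -> exists k : nat, (w rho) (cor al) = - k.+1%:R.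
Proof.
move=> sal d; have ra := sal.1.1; have [k] := up_rho sal (dn_srm ra d).
rewrite srm_rho// evD evN evZ corr2// => E; exists k.
by rewrite -E; ring.
Qed.

(** Each descent subtracts a positive multiple of a simple root from the weight. *)
Lemma dot_level w : exists k : nat, (dot b w 0 tt0 : F) = - k%:R /\ (k = 0%N -> w = wid).
Proof.
elim/weyl_ind: w => [|al w sal d [k [E _]]]; first by exists 0%N; rewrite dotE subrr ev0 oppr0.
have ra := sal.1.1; have [n nE] := dn_rho sal d; have [m mE] := pos_tt0 sal.1.
exists (k + n.+1 * m.+1)%N; split; last by move/eqP; rewrite addn_eq0 muln_eq0 andbF.
move: E; rewrite dot_srm// evD evN evZ nE mE natrD natrM opprD => <-; ring.
Qed.

(** As $\rho$ pairs positively with all positive coroots, an element fixing $\rho$ keeps positive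
    roots positive, so it is the identity by [pos_id]. *)
Lemma dot_inj x y : dot b x 0 = dot b y 0 -> x = y.
Proof.
rewrite !dotE => /addIr E; have [v [V c1 c2]] := weyl_inv (weylP x).
have U := weyl_comp V (weylP y); have [n N] := weyl_word U.
have Ur : (v \o y) rho = rho by rewrite /= -E c1.
apply: weyl_eq => la; rewrite -[y la]c2; congr (x _).
suff E2 : v \o y = id by rewrite -[RHS]/((v \o y) la) E2.
apply: (pos_id N) => ga pg; have := rho_pos hss hcart hb hhb pg.
have rr := weyl_root U pg.1; have [//|pn] := pos_or rr.
have := rho_pos hss hcart hb hhb pn.
rewrite (cor_opp hss hcart rr) evtN -{1}Ur (weyl_pair U _ pg.1) oppr_gt0 => /lt_trans H /H.
by rewrite ltxx.
Qed.

Lemma dot_finite : exists l : seq hd, forall w, dot b w 0 \in l.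
Proof.
have tup (s : seq hd) n : exists l : seq (seq hd), forall t, size t = n -> {subset t <= s} -> t \in l.
  elim: n => [|n [l lP]]; first by exists [:: [::]] => t /size0nil ->.
  exists [seq a :: t | a <- s, t <- l] => -[//|a t] [sz] sub.
  by apply: allpairs_f; [apply: sub; rewrite mem_head|apply: lP => // c ct; apply: sub; rewrite inE ct orbT].
have [l lP] := tup (rts hcart) (size (posr b hcart)).
exists [seq (2%:R^-1 : F) *: (\sum_(ga <- t) ga) - rho | t <- l] => w.
apply/mapP; exists (map w (posr b hcart)).
  apply: lP; first by rewrite size_map.
  by move=> _ /mapP[ga /posrP[rg _] ->]; apply/rtsP; apply: weyl_root => //; apply: weylP.
by rewrite dotE {1}(rhoE b hcart) (weylZ (weylP w)) (weyl_sum (weylP w)) big_map.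
Qed.

Lemma nplusP (x : L) : x \in brkv b b <-> @wsum F L h pos x.
Proof.
split=> [|[s sP ->]]; last first.
  rewrite big_seq; apply: memv_suml => p /sP [pp rp].
  have t2 : (2%:R : F) != 0 by rewrite pnatr_eq0.
  suff -> : p.2 = 2%:R^-1 *: brk (vsval (cor p.1)) p.2.
    by apply: memvZ; apply: mem_brkv; [exact: cor_b hhb _|exact: pp.2].
  by rewrite (rp (cor p.1)) (corr2 pp.1) scalerA mulVf// scale1r.
have [U UP] := vspace_of (@wsum_sub F L h pos).
move=> xb; apply/UP; move: x xb; apply/subvP; apply: brkv_sub => x y xb yb; apply/UP.
pose Q (al : hd) := al = 0 \/ pos al.
have Qx (z : L) : z \in b -> wsum Q z.
  move=> /(b_dec hss hcart hb hhb)[s sP ->]; apply: (sub_sum_seq (wsum_sub _)) => p /sP[rp _ [p0|[->|pp]]].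
  - by apply: wsum1 rp; left.
  - exact: sub0 (wsum_sub _).
  - by apply: wsum1 rp; right.
apply: wsum_brk (Qx _ xb) (Qx _ yb) => al be u v [->|pa] [->|pb] ru rv.
- by left; apply: (cartan_abel hcart); apply/(cartan_h hcart).
- by right; rewrite add0r.
- by right; rewrite addr0.
have [->|uv0] := eqVneq (brk u v) 0; [by left|right].
have ruv := root_vec_brk ru rv.
have nz : al + be != 0.
  apply/eqP => E; apply: (pos_opp pa); suff <- : be = - al by [].
  by apply/eqP; rewrite -addr_eq0 addrC E.
apply: (pos_root_of hss hcart _ uv0 ruv); first by split=> //; exists (brk u v).
by apply: (brk_b hb); [exact: pa.2|exact: pb.2].
Qed.

(** For simple [al] this is the nilradical of the minimal parabolic subalgebra of [al]. *)
Definition msum al := wsum (fun be => pos be /\ be != al).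

Lemma nplus_split al (x : L) : x \in brkv b b -> exists c : F, exists2 y, msum al y & x = c *: re al + y.
Proof.
have sP : subspace (fun x : L => exists c : F, exists2 y, msum al y & x = c *: re al + y).
  split; first by exists 0, 0; [exact: sub0 (wsum_sub _)|rewrite scale0r addr0].
  move=> a _ _ [c [y my ->]] [c' [y' my' ->]].
  exists (a * c + c'), (a *: y + y'); [exact: (subZD (wsum_sub _))|lmod F].
move=> /nplusP[s sp ->]; apply: (sub_sum_seq sP) => p /sp[pp rp].
have [E|ne] := eqVneq p.1 al.
  rewrite E in rp pp; have [c ->] := root_line hss hcart pp.1 rp; exists c, 0; last by rewrite addr0.
  exact: sub0 (wsum_sub _).
by exists 0, p.2; [apply: wsum1 rp|rewrite scale0r add0r].
Qed.

Lemma msum_nplus al (x : L) : msum al x -> x \in brkv b b.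
Proof. by move=> [s sP E]; apply/nplusP; exists s => // p /sP[[]]. Qed.

Lemma re_nplus al : pos al -> re al \in brkv b b.
Proof. by move=> pa; have [r1 _ _ _] := rtriple hss hcart pa.1; apply/nplusP; exact: wsum1 pa r1. Qed.

Lemma msum_e al (x : L) : simple al -> msum al x -> msum al (brk (re al) x).
Proof.
move=> sal; have pa := sal.1; have ra := pa.1; have [r1 _ _ _] := rtriple hss hcart ra.
apply: (@wsum_brk F L h (eq al)) => [al' be u v <- [pb ne] ru rv|]; last exact: wsum1 r1.
have [->|uv0] := eqVneq (brk u v) 0; [by left|right].
have ruv := root_vec_brk ru rv.
have nz : al + be != 0.
  apply/eqP => E; apply: (pos_opp pa); suff <- : be = - al by [].
  by apply/eqP; rewrite -addr_eq0 addrC E.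
split; last by rewrite -subr_eq0 addrC addKr; apply: root_neq0; case: pb.
apply: (pos_root_of hss hcart _ uv0 ruv); first by split=> //; exists (brk u v).
by apply: (brk_b hb); [exact: pa.2|exact: pb.2].
Qed.

(** If $\beta-\alpha$ were negative, $\alpha=\beta+(\alpha-\beta)$ would not be simple; if it were
    $\alpha$, then $2\alpha$ would be a root. *)
Lemma msum_f al (x : L) : simple al -> msum al x -> msum al (brk (rf al) x).
Proof.
move=> sal; have pa := sal.1; have ra := pa.1; have [_ r2 _ _] := rtriple hss hcart ra.
apply: (@wsum_brk F L h (eq (- al))) => [al' be u v <- [pb ne] ru rv|]; last exact: wsum1 r2.
have [->|uv0] := eqVneq (brk u v) 0; [by left|right].
have ruv := root_vec_brk ru rv; rewrite addrC in ruv *.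
have nz : be - al != 0 by rewrite subr_eq0.
have rr : is_root (be - al) by split=> //; exists (brk u v).
split; last first.
  apply/eqP => E; apply: (root_nmul hss hcart ra (isT : 1 < 2)%N).
  suff -> : al *+ 2 = be by case: pb.
  by rewrite mulr2n -{1}E subrK.
have [//|pn] := pos_or rr; case: sal.2; exists be, (- (be - al)); split=> //; lmod F.
Qed.

Lemma singularP (M : gmod L) la (v : M) : weight_vec la v ->
  (forall be (x : L), pos be -> root_vec be x -> act x v = 0) -> singular_vec b la v.
Proof.
move=> wv H; split=> // x /nplusP[s sP ->]; rewrite act_suml big_seq big1// => p /sP[pp rp].
exact: H pp rp.
Qed.
End WeylGroup.

(** * Dual, shifted and localized modules *)

Section Constructions.
Variables (F : fieldType) (L : lieAlgebra F).

Lemma triv_linl (v : F^o) : linear (fun _ : L => 0 : F^o).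
Proof. by move=> a x y; rewrite scaler0 addr0. Qed.
Lemma triv_linr (x : L) : linear (fun _ : F^o => 0 : F^o).
Proof. by move=> a x' y; rewrite scaler0 addr0. Qed.
Lemma triv_brk (x y : L) (v : F^o) : 0 = 0 - 0 :> F^o.
Proof. by rewrite subr0. Qed.
Definition trivg : gmod L := @GMod F L F^o (fun _ _ => 0) triv_linl triv_linr triv_brk.

(** The twist lets one construction give two modules: the usual Hom module for $x\mapsto-x$, and the
    contravariant dual for [tau] with the trivial module as target. *)
Definition antihom (sg : L -> L) := linear sg /\ forall x y, sg (brk x y) = brk (sg y) (sg x).

Lemma antihom_opp : antihom (@GRing.opp L).
Proof.
split=> [a x y|x y]; first by rewrite scalerN opprD.
by rewrite brkNl brkNr opprK (brkC y x).
Qed.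

Section HomModule.
Variables (sg : L -> L) (hsg : antihom sg) (A N : gmod L).

Definition linm_pred (_ : antihom sg) : {pred (A -> N)} := fun f => `[< linear f >].
Lemma linm_predP k : GRing.subsemimod_closed (linm_pred k).
Proof.
split; first split.
- by apply/asboolP => a u v; rewrite /= scaler0 addr0.
- move=> f g /asboolP lf /asboolP lg; apply/asboolP => a u v; rewrite /= !fctE /= lf lg; lmod F.
- move=> c f /asboolP lf; apply/asboolP => a u v; rewrite /= !fctE /= lf; lmod F.
Qed.
HB.instance Definition _ k := GRing.isSubmodClosed.Build F (A -> N) (linm_pred k) (linm_predP k).
Record linm (k : antihom sg) := Linm { linm_val : A -> N; _ : linm_val \in linm_pred k }.
HB.instance Definition _ := [isSub for @linm_val hsg].
HB.instance Definition _ := [Choice of linm hsg by <:].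
HB.instance Definition _ := [SubChoice_isSubLmodule of linm hsg by <:].

Lemma linmP (f : linm hsg) : linear (linm_val f).
Proof. exact/asboolP/(valP f). Qed.
Definition mklin (f : A -> N) (lf : linear f) : linm hsg := Linm (asboolT lf).
Lemma homg_act_lin (x : L) (f : linm hsg) :
  linear (fun v => act x (linm_val f v) + linm_val f (act (sg x) v)).
Proof. by move=> a u v; rewrite actDr !(linmP f) actDr actZr actZr (linmP f); lmod F. Qed.
Definition homg_act (x : L) (f : linm hsg) : linm hsg := mklin (homg_act_lin x f).

Lemma linm_eq (f g : linm hsg) : (forall v, linm_val f v = linm_val g v) -> f = g.
Proof. by move=> fg; apply: val_inj; apply/funext => v; apply: fg. Qed.

Lemma homg_linl (f : linm hsg) : linear (fun x => homg_act x f).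
Proof.
move=> a x y; apply: linm_eq => v /=; rewrite !fctE /= hsg.1 !actDl !actZl (linmP f); lmod F.
Qed.
Lemma homg_linr x : linear (homg_act x).
Proof. move=> a f g; apply: linm_eq => v /=; rewrite !fctE /= actDr actZr; lmod F. Qed.
Lemma homg_brk x y f : homg_act (brk x y) f = homg_act x (homg_act y f) - homg_act y (homg_act x f).
Proof.
apply: linm_eq => v /=; rewrite !fctE /= act_brk hsg.2 act_brk !actDr.
have -> : linm_val f (act (sg y) (act (sg x) v) - act (sg x) (act (sg y) v)) =
   linm_val f (act (sg y) (act (sg x) v)) - linm_val f (act (sg x) (act (sg y) v)).
  by rewrite addrC -scaleN1r (linmP f) scaleN1r addrC.
lmod F.
Qed.
Definition homg : gmod L := @GMod F L (linm hsg) homg_act homg_linl homg_linr homg_brk.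
Definition hval (f : homg) : A -> N := linm_val f.
Definition hmk (f : A -> N) (lf : linear f) : homg := mklin lf.
Lemma hmkE f (lf : linear f) v : hval (hmk lf) v = f v. Proof. by []. Qed.
Lemma hval_lin f : linear (hval f). Proof. exact: linmP. Qed.
Lemma hval_act x f v : hval (act x f) v = act x (hval f v) + hval f (act (sg x) v).
Proof. by []. Qed.
Lemma hval_eq (f g : homg) : (forall v, hval f v = hval g v) -> f = g.
Proof. exact: linm_eq. Qed.
Lemma hvalZD a (f g : homg) v : hval (a *: f + g) v = a *: hval f v + hval g v.
Proof. by []. Qed.
Lemma hval0 v : hval 0 v = 0. Proof. by []. Qed.
Lemma hvalD (f g : homg) v : hval (f + g) v = hval f v + hval g v. Proof. by []. Qed.
Lemma hvalZ a (f : homg) v : hval (a *: f) v = a *: hval f v. Proof. by []. Qed.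
Lemma hvalN (f : homg) v : hval (- f) v = - hval f v. Proof. by []. Qed.
Lemma hval0r (f : homg) : hval f 0 = 0.
Proof.
have E := hval_lin f 1 0 0; rewrite !scale1r addr0 in E.
by apply: (addrI (hval f 0)); rewrite addr0 -E.
Qed.
Lemma hvalDr (f : homg) u v : hval f (u + v) = hval f u + hval f v.
Proof. by rewrite -[u]scale1r hval_lin !scale1r. Qed.
Lemma hvalZr (f : homg) a v : hval f (a *: v) = a *: hval f v.
Proof. by rewrite -[a *: v]addr0 hval_lin hval0r addr0. Qed.
Lemma hvalNr (f : homg) v : hval f (- v) = - hval f v.
Proof. by rewrite -scaleN1r hvalZr scaleN1r. Qed.
Lemma hval_sum (f : homg) I (r : seq I) p (g : I -> A) :
  hval f (\sum_(i <- r | p i) g i) = \sum_(i <- r | p i) hval f (g i).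
Proof. by apply: (big_morph (hval f)) => [u v|]; [exact: hvalDr|exact: hval0r]. Qed.
End HomModule.
End Constructions.

(** * Formal powers of an ad-nilpotent element and localization *)

Section GeneralizedBinomials.
Variable F : numFieldType.
Definition gbin (K : int) (j : nat) : F := (\prod_(i < j) (K%:~R - i%:R)) / j`!%:R.
Lemma gbin0 K : gbin K 0 = 1. Proof. by rewrite /gbin big_ord0 fact0 divr1. Qed.
Lemma gbin1 K : gbin K 1 = K%:~R. Proof. by rewrite /gbin big_ord1 subr0 divr1. Qed.
Lemma gbin_small (k j : nat) : (k < j)%N -> gbin k j = 0.
Proof. by move=> kj; rewrite /gbin (bigD1 (Ordinal kj)) //= pmulrn subrr mul0r mul0r. Qed.
Lemma gbinS K j : gbin (K + 1) j.+1 = gbin K j.+1 + gbin K j.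
Proof.
rewrite /gbin big_ord_recl [in RHS]big_ord_recr /= factS natrM.
have -> : \prod_(i < j) ((K + 1)%:~R - (bump 0 i)%:R : F) = \prod_(i < j) (K%:~R - i%:R : F).
  by apply: eq_bigr => i _; rewrite rmorphD /= -natr1; ring.
have j0 : (j.+1%:R : F) != 0 by rewrite pnatr_eq0.
have f0 : (j`!%:R : F) != 0 by rewrite pnatr_eq0 -lt0n fact_gt0.
rewrite rmorphD /=; field; rewrite nat1r j0 f0 //.
Qed.
End GeneralizedBinomials.

Section Sequences.
Variables (F : numFieldType) (L : lieAlgebra F) (a : L) (D : nat).
Hypothesis aD : forall x : L, iter D (brk a) x = 0.
Variable M : gmod L.
Local Notation bin := (gbin F).
Local Notation de := (brk a).
Implicit Types (x y : L) (z : int -> M) (K : int).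

(** The entry $z_K$ stands for $a^Km$, and the formula is the commutation rule $a^Kx=\sum_j\binom
    Kj(\mathrm{ad}\,a)^j(x)\,a^{K-j}$, used for negative $K$ as well. *)
Definition sq_act x z : int -> M := fun K => \sum_(j < D) bin K j *: act (iter j de x) (z (K - j%:Z)).
Definition sh z : int -> M := fun K => z (K + 1).

Lemma iter_adZD j c x y : iter j de (c *: x + y) = c *: iter j de x + iter j de y :> L.
Proof. by elim: j => //= j ->; rewrite brk_linr. Qed.

Lemma sq_linl z : linear (fun x => sq_act x z).
Proof.
move=> c x y; apply/funext => K; rewrite /sq_act !fctE scaler_sumr -big_split /=.
by apply: eq_bigr => j _; rewrite iter_adZD actDl actZl; lmod F.
Qed.
Lemma sq_linr x : linear (sq_act x).
Proof.
move=> c z z'; apply/funext => K; rewrite /sq_act !fctE scaler_sumr -big_split /=.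
by apply: eq_bigr => j _; rewrite actDr actZr; lmod F.
Qed.
Lemma sqDr x z z' K : sq_act x (fun K => z K + z' K) K = sq_act x z K + sq_act x z' K.
Proof.
rewrite /sq_act -big_split /=; by apply: eq_bigr => j _; rewrite actDr scalerDr.
Qed.
Lemma sqDl x y z K : sq_act (x + y) z K = sq_act x z K + sq_act y z K.
Proof. by have /(congr1 (fun u : int -> M => u K)) := sq_linl z 1 x y; rewrite !fctE !scale1r. Qed.
Lemma sq0l z K : sq_act 0 z K = 0.
Proof. by apply: (addrI (sq_act 0 z K)); rewrite -sqDl !addr0. Qed.
Lemma sq0r x K : sq_act x (fun=> 0) K = 0.
Proof. by rewrite /sq_act big1// => j _; rewrite act0r scaler0. Qed.

Lemma sq_at0 x z : sq_act x z 0 = act x (z 0).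
Proof.
rewrite /sq_act; case: D aD => [|D'] aD'; first by rewrite big_ord0 (aD' x : x = 0) act0l.
rewrite big_ord_recl gbin0 scale1r subr0 big1 ?addr0// => j _.
by rewrite (gbin_small F (k := 0)) ?scale0r.
Qed.

Lemma sq_recE x z K : sq_act x z (K + 1) =
  \sum_(j < D) bin K j *: act (iter j de x) (z (K - j%:Z + 1)) + sq_act (brk a x) z K.
Proof.
rewrite /sq_act; case: D aD => [|D'] aD'; first by rewrite !big_ord0 addr0.
rewrite big_ord_recl [in RHS]big_ord_recl [X in _ = _ + X]big_ord_recr /=.
rewrite -iterSr aD' act0l scaler0 addr0 !gbin0 !subr0 -[RHS]addrA; congr (_ + _); rewrite addr0.
rewrite -big_split /=; apply: eq_bigr => j _; rewrite /bump /= add1n -iterSr /= gbinS scalerDl.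
by congr (_ *: act _ (z _) + _ *: act _ (z _)); rewrite -addn1 PoszD; ring.
Qed.

Lemma sq_rec x z K : sq_act x z (K + 1) = sq_act x (sh z) K + sq_act (brk a x) z K.
Proof. exact: sq_recE. Qed.

Let defect x y z K := sq_act (brk x y) z K - (sq_act x (sq_act y z) K - sq_act y (sq_act x z) K).

Lemma defect_rec x y z K : defect x y z (K + 1) =
  defect x y (sh z) K + defect (brk a x) y z K + defect x (brk a y) z K.
Proof.
have shE u : sh (sq_act u z) = (fun K => sq_act u (sh z) K + sq_act (brk a u) z K).
  by apply/funext => K'; apply: sq_rec.
rewrite /defect !sq_rec !shE !sqDr.
have -> : brk a (brk x y) = brk (brk a x) y + brk x (brk a y) :> L by rewrite brk_brk subrK.
by rewrite sqDl; lmod F.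
Qed.

Lemma defect_nat (k : nat) x y z : defect x y z k%:Z = 0.
Proof.
elim: k x y z => [|k IH] x y z; first by rewrite /defect !sq_at0 act_brk subrr.
by rewrite -addn1 PoszD defect_rec !IH !addr0.
Qed.

(** Applied to the shifted sequence, [defect_rec] goes down in [K]. Its error terms replace [x] or
    [y] by their bracket with [a], so they die out by ad-nilpotency. *)
Lemma defect_neg (k : nat) x y z : defect x y z (- k%:Z) = 0.
Proof.
have d0l y' z' K : defect 0 y' z' K = 0.
  by rewrite /defect brk0l !sq0l (_ : sq_act 0 z' = fun=> 0) ?sq0r ?subrr//; apply/funext => K'; rewrite sq0l.
have d0r x' z' K : defect x' 0 z' K = 0.
  by rewrite /defect brk0r !sq0l (_ : sq_act 0 z' = fun=> 0) ?sq0r ?subrr//; apply/funext => K'; rewrite sq0l.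
elim: k x y z => [|k IH] x y z; first exact: (defect_nat 0).
suff H n m x' y' z' : iter n de x' = 0 -> iter m de y' = 0 -> defect x' y' z' (- k.+1%:Z) = 0 by apply: H.
move: {2}(n + m)%N (leqnn (n + m)) => s; elim: s n m x' y' z' => [|s IHs] n m x' y' z' nm.
  have -> : n = 0%N by lia.
  by move=> /= ->.
case: n nm => [|n] nm; first by move=> /= ->.
case: m nm => [|m] nm; first by move=> _ /= ->.
rewrite !iterSr => xn ym.
pose z1 K := z' (K - 1).
have zE : z' = sh z1 by apply/funext => K; rewrite /sh /z1 addrK.
have := defect_rec x' y' z1 (- k.+1%:Z).
have -> : - k.+1%:Z + 1 = - k%:Z by rewrite -addn1 PoszD; ring.
rewrite IH -zE.
have -> : defect (brk a x') y' z1 (- k.+1%:Z) = 0 by apply: (IHs n m.+1); rewrite ?iterSr//; lia.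
have -> : defect x' (brk a y') z1 (- k.+1%:Z) = 0 by apply: (IHs n.+1 m); rewrite ?iterSr//; lia.
by rewrite !addr0.
Qed.

Lemma sq_brk x y z : sq_act (brk x y) z = sq_act x (sq_act y z) - sq_act y (sq_act x z).
Proof.
apply/funext => K; rewrite fctE; apply/eqP; rewrite -subr_eq0; apply/eqP.
by case: K => k; [exact: (defect_nat k)|rewrite NegzE; exact: (defect_neg k.+1)].
Qed.

Definition sqg : gmod L := @GMod F L (int -> M) sq_act sq_linl sq_linr sq_brk.

Lemma sq_compat x z K : (forall j : nat, (j < D)%N -> bin K j = 0 \/ z (K - j%:Z + 1) = act a (z (K - j%:Z))) ->
  sq_act x z (K + 1) = act a (sq_act x z K).
Proof.
move=> H; rewrite sq_recE /sq_act act_sumr -big_split /=; apply: eq_bigr => j _.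
have [->|->] := H j (ltn_ord j); first by rewrite !scale0r act0r addr0.
by rewrite -iterSr /= actZr [act a (act (iter j de x) _)]act_comm scalerDr.
Qed.

Lemma sq_a z K : sq_act a z K = act a (z K).
Proof.
rewrite /sq_act; case: D aD => [|D'] aD'; first by rewrite big_ord0 (aD' a : a = 0) act0l.
rewrite big_ord_recl gbin0 scale1r subr0 big1 ?addr0// => j _.
by rewrite iterSr brk_alt (_ : iter j de 0 = 0) ?act0l ?scaler0//; elim: (nat_of_ord j) => //= i ->; rewrite brk0r.
Qed.

(** On these sequences [a] acts as the shift, hence bijectively, even where [a] has a kernel on
    [M]. *)
Definition compat (z : sqg) := forall K, (z : int -> M) (K + 1) = act a ((z : int -> M) K).
Lemma compat_sub : submodule compat.
Proof.
split=> [K|c z z' hz hz' K|x z hz K]; first exact/esym/act0r.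
  change (c *: z (K + 1) + z' (K + 1) = act a (c *: z K + z' K)).
  by rewrite actDr actZr hz hz'.
by apply: sq_compat => j _; right.
Qed.
Definition compg : gmod L := subg compat_sub.
Definition cval (z : compg) : int -> M := sinc z.
Lemma cvalS (z : compg) K : cval z (K + 1) = act a (cval z K). Proof. exact: (sincP z K). Qed.
Lemma cval_act x (z : compg) K : cval (act x z) K = sq_act x (cval z) K. Proof. by []. Qed.
Lemma cval_a (z : compg) K : cval (act a z) K = cval z (K + 1). Proof. by rewrite cvalS cval_act sq_a. Qed.
Lemma cval_eq (z z' : compg) : (forall K, cval z K = cval z' K) -> z = z'.
Proof. by move=> e; apply: sinc_inj; apply/funext. Qed.
Definition cmk (z : int -> M) (hz : forall K, z (K + 1) = act a (z K)) : compg := @smk F L sqg compat compat_sub z hz.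
Lemma cmkE z hz K : cval (@cmk z hz) K = z K. Proof. by []. Qed.
Lemma comp_inj (z : compg) : act a z = 0 -> z = 0.
Proof.
move=> az; apply: cval_eq => K; have /(congr1 (fun z : compg => cval z (K - 1))) := az.
by rewrite cval_a subrK => ->.
Qed.
Lemma comp_surj (z : compg) : exists z' : compg, act a z' = z.
Proof.
have h K : cval z (K - 1 + 1) = act a (cval z (K - 1)) by rewrite cvalS.
have h' K : (fun K => cval z (K - 1)) (K + 1) = act a ((fun K => cval z (K - 1)) K).
  by rewrite /= -h addrAC.
by exists (cmk h'); apply: cval_eq => K; rewrite cval_a cmkE addrK.
Qed.
Definition cev0 (z : compg) : M := cval z 0.
Lemma cev0_hom : is_hom cev0.
Proof. by split=> // x z; rewrite /cev0 cval_act sq_at0. Qed.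
End Sequences.

Section Localization.
Variables (F : numFieldType) (L : lieAlgebra F) (a : L).

Lemma adnil_unif : adnil a -> exists D, forall x : L, iter D (brk a) x = 0.
Proof.
move=> nil; have [D DP] : exists D, forall x, x \in (vbasis {:L} : seq L) -> iter D (brk a) x = 0.
  elim: (vbasis {:L} : seq L) => [|x s [D DP]]; first by exists 0%N.
  have [D' xD'] := nil x; exists (D + D')%N => y; rewrite inE => /predU1P[->|/DP yD].
    by rewrite iterD xD'; elim: D {DP} => //= n ->; rewrite brk0r.
  by rewrite addnC iterD yD; elim: (D') => //= n ->; rewrite brk0r.
have sP : subspace (fun y : adj L => iter D (act a) y = 0).
  by split=> [|c u v u0 v0]; rewrite ?iter_act0// iter_actD iter_actZ u0 v0 scaler0 addr0.
exists D => x; rewrite (coord_vbasis (memvf x)); apply: (sub_sum sP) => i _; apply: (subZ sP).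
by apply: DP; apply: mem_nth; rewrite size_tuple.
Qed.

(** Germs at $+\infty$: eventually compatible sequences modulo eventually zero ones. The shift
    inverts [a], and [m] goes to the sequence $a^Km$, eventually zero exactly when a power of [a]
    kills [m]. *)
Theorem localization (M : gmod L) : adnil a -> exists (N : gmod L) (io : M -> N),
  [/\ is_hom io, forall n : N, act a n = 0 -> n = 0, forall n : N, exists n', act a n' = n,
      forall m, io m = 0 <-> exists k, iter k (act a) m = 0
    & forall n : N, exists k m, iter k (act a) n = io m].
Proof.
move=> /adnil_unif[D aD]; pose S := sqg aD M.
pose ec (z : S) := exists k : nat, forall K : int, k%:Z <= K -> (z : int -> M) (K + 1) = act a ((z : int -> M) K).
pose ez (z : S) := exists k : nat, forall K : int, k%:Z <= K -> (z : int -> M) K = 0.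
(* The action looks back by fewer than [D] indices, so thresholds grow by at most [D]. *)
have far (k : nat) (K : int) (j : nat) : (j < D)%N -> (k + D)%N%:Z <= K -> k%:Z <= K - j%:Z by move=> ? ?; lia.
have ecS : submodule ec.
  split=> [|c z z' [k kz] [k' kz']|x z [k kz]].
  - by exists 0%N => K _; apply/esym/act0r.
  - exists (k + k')%N => K kK; change (c *: z (K + 1) + z' (K + 1) = act a (c *: z K + z' K)).
    by rewrite actDr actZr kz ?kz'//; lia.
  - exists (k + D)%N => K kK; apply: (sq_compat aD) => j jD; right; apply: kz; exact: far kK.
have ezS : submodule ez.
  split=> [|c z z' [k kz] [k' kz']|x z [k kz]].
  - by exists 0%N.
  - exists (k + k')%N => K kK; change (c *: z K + z' K = 0).
    by rewrite kz ?kz' ?scaler0 ?addr0//; lia.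
  - exists (k + D)%N => K kK; rewrite /= /sq_act big1// => j _; rewrite kz ?act0r ?scaler0//.
    exact: far (ltn_ord j) kK.
pose C := subg ecS.
have ezC : submodule (fun z : C => ez (sinc z)) by apply: submodule_pre => //; apply: sinc_hom.
pose N := quog ezC.
pose z0 (m : M) : int -> M := fun K => if K is Posz k then iter k (act a) m else 0.
have z0P m : ec (z0 m) by exists 0%N => -[k|//] _; rewrite -PoszD addn1.
pose i0 m : C := smk ecS (z0P m); pose io m : N := qpi ezC (i0 m).
have z0lin c m m' : z0 (c *: m + m') = c *: z0 m + z0 m'.
  apply/funext => -[k|k]; rewrite !fctE /=; first by rewrite iter_actD iter_actZ.
  by rewrite scaler0 addr0.
have hio : is_hom io.
  split=> [c m m'|x m].
    rewrite /io -(qpi_hom ezC).1; congr (qpi _ _); apply: sinc_inj; exact: z0lin.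
  rewrite /io -(qpi_hom ezC).2; apply/qpi_eq; exists 0%N => -[k|//] _.
  rewrite /= !fctE; apply/eqP; rewrite subr_eq0; apply/eqP.
  elim: k => [|k IH]; first by rewrite (sq_at0 aD).
  rewrite -[LHS]/(act a (z0 (act x m) k)) IH -[k.+1]addn1 PoszD; apply/esym/(sq_compat aD) => j jD.
  (* For [k < j] the binomial coefficient is zero, so the default value 0 of [z0] at negative
     indices does no harm. *)
  case: (ltnP k j) => kj; [by left; apply: gbin_small|right].
  have -> : k%:Z - j%:Z = (k - j)%N%:Z by lia.
  by rewrite -PoszD addn1.
exists N, io; split=> //.
- move=> n; have [c <-] := qpi_surj n; rewrite -(qpi_hom ezC).2 => /qpi0P[k kz].
  apply/qpi0P; have [k' kz'] := sincP c; exists (k + k').+1 => K kK.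
  have -> : K = (K - 1) + 1 by rewrite subrK.
  rewrite kz'; last by lia.
  by have := kz (K - 1); rewrite /= (sq_a aD) => ->//; lia.
- move=> n; have [c <-] := qpi_surj n; have [k kz] := sincP c.
  have hz : ec (fun K => (sinc c : int -> M) (K - 1)).
    by exists k.+1 => K kK; rewrite addrAC kz//; lia.
  exists (qpi ezC (smk ecS hz)); rewrite -(qpi_hom ezC).2; apply/qpi_eq; exists k.+1 => K kK.
  rewrite /= !fctE (sq_a aD) /= -kz; last by lia.
  by rewrite subrK subrr.
- move=> m; split=> [/qpi0P[k kz]|[k km]]; first by exists k; apply: (kz k).
  apply/qpi0P; exists k => -[i|//] ki; rewrite /= -(@subnK k i); last by lia.
  by rewrite iterD km iter_act0.
- move=> n; have [c <-] := qpi_surj n; have [k kz] := sincP c.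
  exists k, ((sinc c : int -> M) k); rewrite -(hom_iter _ _ _ (qpi_hom ezC)); apply/qpi_eq; exists k => -[i|//] ki.
  rewrite /= !fctE; apply/eqP; rewrite subr_eq0; apply/eqP.
  have E j : (sinc (iter j (act a) c) : int -> M) i = iter j (act a) ((sinc c : int -> M) i).
    by elim: j => //= j <-; rewrite (sq_a aD).
  apply: etrans (E k) _.
  elim: (i) (ki) => [|i' IH] ki'.
    by have -> : k = 0%N by lia.
  have [->//|ne] := eqVneq k i'.+1.
  rewrite -[i'.+1]addn1 PoszD kz; last by lia.
  by rewrite -iterSr /= IH ?addn1//; lia.
Qed.
End Localization.

Section WeightModules.
Variables (F : numClosedFieldType) (L : lieAlgebra F) (h : {vspace L}).
Local Notation hd := 'Hom(subvs_of h, F^o).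
Hypotheses (hss : semisimple L) (hcart : cartan h).
Implicit Types (al be ga la mu nu : hd) (x y : L) (t : subvs_of h).

(** * Verma modules *)

Section CyclicWeightModules.
Variables (M : gmod L) (t : subvs_of h) (la : hd) (v : M).
Hypothesis treg : forall be, is_root be -> exists2 m : int, (be t : F) = m%:~R & m != 0.
Hypothesis vw : weight_vec la v.
Hypothesis vgen : forall P : M -> Prop, submodule P -> P v -> forall u, P u.
Hypothesis vtop : forall be x, is_root be -> root_vec be x -> 0 < (be t : F) -> act x v = 0.

Lemma root_decl x : exists2 s : seq (hd * L),
  forall p, p \in s -> root_vec p.1 p.2 /\ (p.1 = 0 \/ is_root p.1) & x = \sum_(p <- s) p.2.
Proof.
have [s ws ->] := adj_wmod hcart x.
exists [seq p <- s | p.2 != 0]; last first.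
  by rewrite big_filter [RHS]big_mkcond; apply: eq_bigr => p _; case: eqVneq.
move=> p; rewrite mem_filter => /andP[p0 /ws wp]; split=> //.
have [->|n0] := eqVneq p.1 0; [by left|right].
by split=> //; exists p.2.
Qed.

(** This replaces the triangular decomposition of the enveloping algebra. In the smallest such
    subspace, the vectors that positive root vectors keep inside it satisfy the same closure
    conditions, so they are all of it and it is a submodule. Signs are taken relative to an
    arbitrary regular [t], because a reflected Borel subalgebra also occurs. *)
Lemma neg_generation (P : M -> Prop) : subspace P -> P v ->
  (forall (s : subvs_of h) u, P u -> P (act (vsval s) u)) ->
  (forall be x u, is_root be -> root_vec be x -> (be t : F) < 0 -> P u -> P (act x u)) ->
  forall u, P u.
Proof.
move=> sP Pv Ph Pn.
pose st (P : M -> Prop) := [/\ subspace P, P v, forall (s : subvs_of h) u, P u -> P (act (vsval s) u)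
  & forall be x u, is_root be -> root_vec be x -> (be t : F) < 0 -> P u -> P (act x u)].
pose P0 u := forall P, st P -> P u.
have s0 : subspace P0.
  by split=> [P' [s _ _ _]|a u u' hu hu' P' sP']; [exact: sub0|have [s _ _ _] := sP'; apply: (subZD s); [exact: hu|exact: hu']].
have st0 : st P0.
  split=> //; first by move=> P' [].
    by move=> s u hu P' sP'; have [_ _ H _] := sP'; apply: H; apply: hu.
  by move=> be x u rb rx neg hu P' sP'; have [_ _ _ H] := sP'; apply: (H be) => //; apply: hu.
have [_ v0 h0 n0] := st0.
pose pt be := is_root be /\ 0 < (be t : F).
pose Q u := P0 u /\ forall be x, pt be -> root_vec be x -> P0 (act x u).
have QP u : Q u -> forall x, P0 (act x u).
  move=> [pu Hu] x; have [s sP' ->] := root_decl x; rewrite act_suml; apply: (sub_sum_seq s0) => p /sP'[rp [p0|rr]].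
    have /(cartan_h hcart) ph : root_vec (0 : hd) p.2 by rewrite -p0.
    by rewrite -[p.2](vsprojK ph); apply: h0.
  have [m mE m0] := treg rr; have [mneg|mpos|m00] := ltrgt0P m.
  - by apply: (Hu p.1) => //; split=> //; rewrite mE ltr0z.
  - by apply: (n0 p.1) => //; rewrite mE ltrz0.
  - by rewrite m00 eqxx in m0.
have Q_all u : P0 u -> Q u.
  move/(_ Q); apply; split.
  - split; first by split=> [|be x _ _]; rewrite ?act0r; apply: (sub0 s0).
    move=> a u1 u2 [p1 q1] [p2 q2]; split=> [|be x ptb rx]; first exact: (subZD s0).
    by rewrite actDr actZr; apply: (subZD s0); [exact: q1 rx|exact: q2 rx].
  - by split=> // be x [rb pb] rx; rewrite (vtop rb rx pb); apply: (sub0 s0).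
  - move=> s u1 q1; split=> [|be x ptb rx]; first by apply: h0; case: q1.
    rewrite act_comm; apply: (subD s0); last exact: QP.
    by apply: h0; apply: q1.2 rx.
  - move=> ga y u1 rg ry neg q1; split=> [|be x ptb rx]; first by apply: (n0 ga) => //; case: q1.
    rewrite act_comm; apply: (subD s0); last exact: QP.
    by apply: (n0 ga) => //; apply: q1.2 rx.
have all0 : forall u, P0 u.
  apply: vgen => //; split=> [|a u1 u2|x u1 /Q_all q]; [exact: (sub0 s0)|exact: (subZD s0)|exact: QP].
by move=> u; apply: all0.
Qed.

Lemma cyclic_dec u : exists c (s : seq (hd * M)), [/\ wdec s,
  forall p, p \in s -> exists k : nat, (la t : F) - (p.1 t : F) = k.+1%:R & u = c *: v + \sum_(p <- s) p.2].
Proof.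
move: u; apply: neg_generation.
- split; first by exists 0, [::]; split=> //; rewrite big_nil scale0r addr0.
  move=> a _ _ [c [s [ws ls ->]]] [c' [s' [ws' ls' ->]]].
  exists (a * c + c'), ([seq (p.1, a *: p.2) | p <- s] ++ s'); split.
  + by move=> p; rewrite mem_cat => /orP[/mapP[q /ws wq ->]|/ws'//]; apply: (subZ (weight_sub _ _)).
  + by move=> p; rewrite mem_cat => /orP[/mapP[q /ls lq ->]|/ls'].
  + have -> : \sum_(p <- [seq (p.1, a *: p.2) | p <- s] ++ s') p.2 =
        a *: (\sum_(p <- s) p.2) + \sum_(p <- s') p.2 by rewrite big_cat big_map scaler_sumr.
    by move: (\sum_(p <- s) p.2) (\sum_(p <- s') p.2) => A B; lmod F.
- by exists 1, [::]; split=> //; rewrite big_nil scale1r addr0.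
- move=> s _ [c [l [wl ll ->]]].
  exists (c * la s), [seq (p.1, act (vsval s) p.2) | p <- l]; split.
  + by move=> _ /mapP[p /wl wp ->] /= s'; rewrite (wp s) actZr (wp s') !scalerA mulrC.
  + by move=> _ /mapP[p /ll lp ->].
  + by rewrite big_map actDr actZr (vw s) scalerA act_sumr.
move=> be x _ rb rx neg [c [l [wl ll ->]]].
exists 0, ((be + la, c *: act x v) :: [seq (be + p.1, act x p.2) | p <- l]).
have [m mE m0] := treg rb; move: neg; rewrite mE ltrz0; case: m mE m0 => // j jE _ _.
split.
- move=> p; rewrite inE => /predU1P[->|/mapP[q /wl wq ->]] /=; last exact: weight_act rx wq.
  by apply: (subZ (weight_sub _ _)); apply: weight_act.
- move=> p; rewrite inE => /predU1P[->|/mapP[q /ll [k kE] ->]] /=.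
    by exists j; rewrite evD jE NegzE mulrNz -pmulrn; ring.
  exists (k + j.+1)%N; rewrite evD jE NegzE mulrNz -pmulrn -addSn natrD -kE; ring.
- by rewrite scale0r add0r big_cons big_map actDr actZr act_sumr.
Qed.

Lemma cyclic_wmod : wmod h M.
Proof.
move=> u; have [c [s [ws _ ->]]] := cyclic_dec u; exists ((la, c *: v) :: s); last by rewrite big_cons.
by move=> p; rewrite inE => /predU1P[->|/ws//]; apply: (subZ (weight_sub _ _)).
Qed.

Lemma cyclic_level mu u : u != 0 -> weight_vec mu u ->
  (mu = la /\ exists c, u = c *: v) \/ exists k : nat, (la t : F) - (mu t : F) = k.+1%:R.
Proof.
move=> u0 wu; have [c [s [ws ls uE]]] := cyclic_dec u.
have ws' : wdec ((la, c *: v) :: s).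
  by move=> p; rewrite inE => /predU1P[->|/ws//]; apply: (subZ (weight_sub _ _)).
have uE' : u = \sum_(p <- (la, c *: v) :: s) p.2 by rewrite big_cons.
have := wdec_wv ws' wu uE'.
have [[p ps pm]|nex] := pselect (exists2 p, p \in s & p.1 = mu).
  by move=> _; right; have [k kE] := ls p ps; exists k; rewrite -pm.
rewrite big_cons /= big_seq_cond big_pred0 ?addr0 => [|p]; last first.
  by apply/negP => /andP[ps /eqP pm]; apply: nex; exists p.
case: eqVneq => [->|_ E]; first by move=> E; left; split=> //; exists c.
by rewrite E eqxx in u0.
Qed.

(** Each negative root vector lowers the level by at least one, so a weight space at depth [k] is
    spanned by words of length at most [k] in finitely many root vectors. *)
Lemma cyclic_finite (mu : hd) : exists l : seq M, forall u, weight_vec mu u -> in_span l u.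
Proof.
have ts be : is_root be -> (be t : F) < 0 -> exists j : nat, (be t : F) = - j.+1%:R.
  by move=> rb; have [m mE m0] := treg rb; rewrite mE ltrz0; case: m mE m0 => // j jE _ _; exists j; rewrite NegzE mulrNz -pmulrn.
pose nr := [seq be : hd <- rts hcart | (be t : F) < 0].
pose step (s : seq M) := [seq act (re hss hcart be) w | be <- nr, w <- s].
(* Putting [v] into each stage makes the lists increasing. *)
pose words n := iter n (fun s => v :: step s) [:: v].
have wS n : {subset words n <= words n.+1}.
  elim: n => [|n IH] w; first by rewrite !inE => ->.
  rewrite inE [in X in _ -> X]inE => /predU1P[->|/allpairsP[[be w'] /= [bn wn ->]]]; first by rewrite eqxx.
  by apply/orP; right; apply: allpairs_f => //; apply: IH.
have wle n m : (n <= m)%N -> {subset words n <= words m}.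
  by move/subnK <-; elim: (m - n)%N => // k IH w /IH /wS.
have wP n w : w \in words n -> exists nu, exists2 k : nat, weight_vec nu w & (la t : F) - (nu t : F) = k%:R /\ w \in words k.
  elim: n w => [|n IH] w.
    by rewrite inE => /eqP ->; exists la, 0%N => //; rewrite subrr mem_head.
  rewrite inE => /predU1P[->|]; first by exists la, 0%N => //; rewrite subrr mem_head.
  move=> /allpairsP[[be w'] /= [bn wn ->]]; move: (bn); rewrite mem_filter => /andP[neg /rtsP rb].
  have [j jE] := ts be rb neg; have [nu [k wnu [kE wk]]] := IH _ wn.
  have [r1 _ _ _] := rtriple hss hcart rb.
  exists (be + nu), (k + j.+1)%N; first exact: weight_act r1 wnu.
  split; first by rewrite evD jE natrD -kE; ring.
  rewrite addnS inE; apply/orP; right; apply: allpairs_f => //; exact: wle (leq_addr _ _) _ wk.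
have span u : exists n (s : seq (F * M)), (forall p, p \in s -> p.2 \in words n) /\ u = \sum_(p <- s) p.1 *: p.2.
  move: u; apply: neg_generation.
  - split; first by exists 0%N, [::]; rewrite big_nil.
    move=> a _ _ [n [s [sP ->]]] [n' [s' [sP' ->]]].
    exists (n + n')%N, ([seq (a * p.1, p.2) | p <- s] ++ s'); split.
      move=> p; rewrite mem_cat => /orP[/mapP[q /sP qn ->]|/sP' qn] /=.
        exact: wle (leq_addr _ _) _ qn.
      exact: wle (leq_addl _ _) _ qn.
    by rewrite big_cat big_map scaler_sumr /=; congr (_ + _); apply: eq_bigr => p _; rewrite scalerA.
  - by exists 0%N, [:: (1, v)]; split=> [p|]; rewrite ?big_seq1 ?scale1r// inE => /eqP ->; rewrite inE.
  - move=> s _ [n [l [lP ->]]].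
    exists n, [seq (p.1 * (if pselect (exists nu, weight_vec nu p.2) is left e then (sval (cid e)) s else 0), p.2) | p <- l].
    split; first by move=> _ /mapP[p /lP pn ->].
    rewrite act_sumr big_map big_seq [RHS]big_seq; apply: eq_bigr => p /lP pn /=.
    rewrite actZr; case: pselect => [e|[]]; first by rewrite (svalP (cid e) s) scalerA.
    by have [nu [k wnu _]] := wP _ _ pn; exists nu.
  - move=> be x _ rb rx neg [n [l [lP ->]]].
    have [c ->] := root_line hss hcart rb rx.
    exists n.+1, [seq (p.1 * c, act (re hss hcart be) p.2) | p <- l]; split.
      move=> _ /mapP[p /lP pn ->] /=; rewrite inE; apply/orP; right; apply: allpairs_f => //.
      by rewrite mem_filter neg; apply/rtsP.
    by rewrite act_sumr big_map; apply: eq_bigr => p _ /=; rewrite actZr actZl scalerA.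
have [[k kE]|nex] := pselect (exists k : nat, (la t : F) - (mu t : F) = k%:R); last first.
  exists [::] => u wu; exists (fun=> 0); rewrite big_ord0; apply/eqP; apply: contrapT => /negP u0.
  have [[E _]|[k kE]] := cyclic_level u0 wu; apply: nex; [by exists 0%N; rewrite E subrr|by exists k.+1].
exists (words k) => u wu.
have sS : subspace (in_span (words k)).
  split; first by exists (fun=> 0); rewrite big1// => i _; rewrite scale0r.
  move=> a _ _ [c ->] [c' ->]; exists (fun i => a * c i + c' i); rewrite scaler_sumr -big_split /=.
  by apply: eq_bigr => i _; rewrite scalerA scalerDl.
have [n [s [sP uE]]] := span u.
pose wt (w : M) : hd := if pselect (exists nu, weight_vec nu w) is left e then sval (cid e) else 0.
have wtP w : w \in words n -> weight_vec (wt w) w.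
  by move=> /wP[nu [k' wnu _]]; rewrite /wt; case: pselect => [e|[]]; [exact: svalP (cid e)|exists nu].
have ws' : wdec [seq (wt p.2, p.1 *: p.2) | p <- s].
  by move=> _ /mapP[p /sP pn ->]; apply: (subZ (weight_sub _ _)); apply: wtP.
have uE' : u = \sum_(p <- [seq (wt p.2, p.1 *: p.2) | p <- s]) p.2 by rewrite big_map.
rewrite (wdec_wv ws' wu uE') big_map big_seq_cond; apply: (sub_sum sS) => p /andP[ps /eqP pm].
have [->|w0] := eqVneq p.2 0; first by rewrite scaler0; apply: (sub0 sS).
have [nu [k' wnu [kE' wk']]] := wP _ _ (sP _ ps).
have numu : nu = mu by rewrite -pm; apply: weight_uniq w0 wnu (wtP _ (sP _ ps)).
have kk : k' = k by apply/eqP; rewrite -(eqr_nat F) -kE -kE' numu.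
rewrite kk in wk'; apply: (subZ sS); exists (fun i => (i == index p.2 (words k))%:R).
rewrite -index_mem in wk'; rewrite (bigD1 (Ordinal wk')) //= eqxx scale1r nth_index ?index_mem -?index_mem//.
rewrite big1 ?addr0// => i ne; rewrite (_ : (i == _ :> nat) = false) ?scale0r//.
by apply/negP => /eqP e; move/eqP: ne; apply; apply: val_inj.
Qed.
End CyclicWeightModules.
End WeightModules.

(** * Pairing with nilpotent functionals *)

Section FunctionalPairing.
Variables (F : fieldType) (L : lieAlgebra F).
Implicit Types (x : L).

Local Notation dual X := (homg (antihom_opp L) X (trivg L)).

Lemma dual_act (X : gmod L) x (xi : dual X) z : hval (act x xi) z = - hval xi (act x z).
Proof. by rewrite hval_act /= add0r actNl hvalNr. Qed.
Lemma dual_iter (X : gmod L) x k (xi : dual X) z :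
  hval (iter k (act x) xi) z = (-1) ^+ k *: hval xi (iter k (act x) z).
Proof.
elim: k z => [|k IH] z; first by rewrite expr0 scale1r.
by rewrite iterS dual_act IH -iterSr exprS -scaleN1r scalerA.
Qed.

(* Functionals on X which vanish on Z and are killed by a power of a; a pairing
   of X with a vector n is a homomorphism modulo any submodule containing L n. *)
Section NilpotentFunctionals.
Variables (a : L) (X : gmod L) (Z : X -> Prop) (N : gmod L) (n : N) (N1 : N -> Prop).
Hypotheses (nila : adnil a) (sZ : submodule Z) (sN1 : submodule N1).
Hypothesis ninj : forall u : N, act a u = 0 -> u = 0.
Hypothesis nN1 : forall x, N1 (act x n).

Definition anul (xi : dual X) := (forall z, Z z -> hval xi z = 0) /\ exists k, iter k (act a) xi = 0.
Lemma anul_sub : submodule anul.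
Proof.
apply: submoduleI; last exact: nil_sub.
split=> [z _|c xi et h1 h2 z Zz|x xi h1 z Zz]; first exact: hval0.
  by rewrite hvalZD h1// h2// scaler0 addr0.
by rewrite dual_act h1 ?oppr0//; apply: (submodule_act _ sZ).
Qed.
Definition anulg := subg anul_sub.
Definition pairW := homg (antihom_opp L) anulg N.
Definition pairing (xi : anulg) (z : X) : F := hval (sinc xi) z.

(** A functional vanishing on [Z] and on the image of $a^k$ is killed by $a^k$ in the dual, so
    linear separation suffices. *)
Lemma anul_separate (z : X) k : (forall de w : X, Z de -> z <> de + iter k (act a) w) ->
  exists xi : anulg, pairing xi z = 1.
Proof.
move=> nz; pose P w := exists p q : X, [/\ Z p, exists x : X, iter k (act a) x = q & w = p + q].
have sI : subspace (fun w => exists x : X, iter k (act a) x = w).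
  split; first by exists 0; rewrite iter_act0.
  by move=> c _ _ [x <-] [y <-]; exists (c *: x + y); rewrite iter_actD iter_actZ.
have sP : subspace P by apply: subspaceD => //; apply: submodule_sub.
have [|xi [lxi xi0 xi1]] := separate sP (v := z).
  by move=> [p [_ [Zp [x <-] zE]]]; case: (nz p x).
have A : anul (hmk (antihom_opp L) (N := trivg L) lxi).
  split=> [de Zd|]; first by apply: xi0; exists de, 0; split; rewrite ?addr0//; exists 0; rewrite iter_act0.
  exists k; apply: hval_eq => w; rewrite dual_iter hval0 hmkE xi0 ?scaler0//.
  by exists 0, (iter k (act a) w); split; [case: sZ|exists w|rewrite add0r].
by exists (smk anul_sub A).
Qed.

(** If [a] kills [psi], then [psi] commutes with [a]; its values are killed by a power of [a], which
    is injective on [N]. *)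
Lemma pairW_inj (psi : pairW) : act a psi = 0 -> psi = 0.
Proof.
move=> a0; apply: hval_eq => xi; rewrite hval0; have [_ [k]] := sincP xi.
have H (et : anulg) : act a (hval psi et) = hval psi (act a et).
  have /(congr1 (fun p : pairW => hval p et)) := a0.
  by rewrite hval_act hval0 actNl hvalNr => /eqP; rewrite subr_eq0 => /eqP.
rewrite -(hom_iter _ _ _ (sinc_hom _)) => /(@sinc_inj _ _ _ _ anul_sub _ 0) xik.
have : iter k (act a) (hval psi xi) = 0.
  rewrite -[RHS](hval0r psi) -xik; elim: (k) xi {xik} => // j IH xi.
  by rewrite !iterSr H IH.
by elim: (k) => //= j IH /ninj.
Qed.

Lemma psi_lin z : linear (fun xi : anulg => pairing xi z *: n).
Proof. by move=> c xi et; rewrite /pairing (hvalZD c (sinc xi)) scalerDl scalerA. Qed.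
Definition psi z : pairW := hmk (antihom_opp L) (psi_lin z).
Lemma psiE z xi : hval (psi z) xi = pairing xi z *: n. Proof. by []. Qed.
Lemma psi_act x z : act x n = 0 -> act x (psi z) = psi (act x z).
Proof.
move=> xn; apply: hval_eq => xi; rewrite hval_act !psiE actZr xn scaler0 add0r actNl /pairing.
by rewrite -[sinc (- _)]/(- act x (sinc xi)) hvalN dual_act opprK.
Qed.
Lemma psi_Z z : Z z -> psi z = 0.
Proof.
move=> Zz; apply: hval_eq => xi; rewrite psiE hval0; have [H _] := sincP xi.
by rewrite /pairing H// scale0r.
Qed.

(** [psi] fails to be a homomorphism only because [n] is not invariant, and this is repaired modulo
    [N1]. Hence the relation, unlike [psi], is stable under [L]. *)
Definition prel (p : pairW) (z : X) := forall xi : anulg, N1 (hval p xi - pairing xi z *: n).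
Lemma prel_psi z : prel (psi z) z.
Proof. by move=> xi; rewrite psiE subrr; case: sN1. Qed.
Lemma prel_sub : submodule (fun p : gprod pairW X => prel p.1 p.2).
Proof.
have s1 := submodule_sub sN1; split=> [xi|c p q hp hq xi|x p hp xi].
- by rewrite /pairing -[hval (0 : gprod _ _).1 xi]/(0 : N) hval0r scale0r subrr; apply: sub0 s1.
- rewrite -[hval (c *: p + q).1 xi]/(c *: hval p.1 xi + hval q.1 xi) /pairing -[(c *: p + q).2]/(c *: p.2 + q.2) hvalDr hvalZr.
  have -> : c *: hval p.1 xi + hval q.1 xi - (c *: hval (sinc xi) p.2 + hval (sinc xi) q.2) *: n =
    c *: (hval p.1 xi - pairing xi p.2 *: n) + (hval q.1 xi - pairing xi q.2 *: n).
    by rewrite /pairing scalerDl -scalerA; lmod F.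
  by apply: (subZD s1).
have h1 := hp (act (- x) xi).
have E : pairing (act (- x) xi) p.2 = pairing xi (act x p.2).
  by rewrite /pairing -[sinc (act _ _)]/(act (- x) (sinc xi)) dual_act actNl hvalNr opprK.
rewrite E in h1.
rewrite -[hval (act x p).1 xi]/(act x (hval p.1 xi) + hval p.1 (act (- x) xi)) -[(act x p).2]/(act x p.2).
rewrite -addrA; apply: (subD s1); last exact: h1.
have -> : act x (hval p.1 xi) = act x (hval p.1 xi - pairing xi p.2 *: n) + pairing xi p.2 *: act x n.
  by rewrite actBr actZr subrK.
by apply: (subD s1); [apply: (submodule_act _ sN1)|apply: (subZ s1)].
Qed.
Lemma prel0 z : ~ N1 n -> prel 0 z -> forall xi, pairing xi z = 0.
Proof.
move=> nn H xi; apply: contrapT => /eqP p0; apply: nn.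
have := H xi; rewrite hval0 sub0r => /(subN (submodule_sub sN1)); rewrite opprK.
exact: (subZ_inv (submodule_sub sN1)).
Qed.
End NilpotentFunctionals.
End FunctionalPairing.

Section VermaModules.
Variables (F : numClosedFieldType) (L : lieAlgebra F) (h b : {vspace L}).
Local Notation hd := 'Hom(subvs_of h, F^o).
Hypotheses (hss : semisimple L) (hcart : cartan h) (hb : borel b) (hhb : (h <= b)%VS).
Implicit Types (al be ga la mu : hd) (x y : L).
Local Notation cor := (cor hss hcart).
Local Notation re := (re hss hcart).
Local Notation rf := (rf hss hcart).
Local Notation simple := (simple_root b).
Local Notation tt0 := (tt0 b hss hcart).
Local Notation sing := (singular_vec b).
Let pos_tt0 := @pos_tt0 F L h b hss hcart hb hhb.

Definition vtop la (D : gmod L) (v : D) :=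
  [/\ v != 0, sing la v, forall P : D -> Prop, submodule P -> P v -> forall u, P u
    & forall (N : gmod L) (u : N), sing la u -> exists2 f : D -> N, is_hom f & f v = u].

Lemma sing0 la (N : gmod L) : sing la (0 : N).
Proof. by split=> [|x _]; [exact: weight0|exact: act0r]. Qed.
Lemma hom_sing (M N : gmod L) (f : M -> N) la u : is_hom f -> sing la u -> sing la (f u).
Proof.
by move=> hf [wu nu]; split=> [|x xb]; [exact: hom_weight wu|rewrite -(hom_act hf) nu ?(hom0 hf)].
Qed.
Lemma hom_inj_sing (M N : gmod L) (f : M -> N) la u : is_hom f -> injective f -> sing la (f u) -> sing la u.
Proof.
move=> hf fi [wu nu]; split=> [|x xb]; first exact: hom_inj_weight wu.
by apply: fi; rewrite (hom_act hf) nu ?(hom0 hf).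
Qed.

(** Uniqueness in the universal property gives generation: the projection to the quotient by a
    submodule containing [v] must agree with the zero map. *)
Lemma verma_top la (D : gmod L) : is_verma b la D -> exists v : D, vtop la v.
Proof.
move=> [v [v0 sv uv]]; exists v; split=> //; last by move=> N u /uv[f [hf fv _]]; exists f.
move=> P sP Pv u; have [f [hf _ uf]] := uv _ (0 : quog sP) (sing0 la _).
apply/(qpi0P sP); rewrite (uf _ (qpi_hom sP)); last exact/qpi0P.
by rewrite -(uf _ (hom_zero _ _)).
Qed.

Lemma pos_reg be : is_root be -> exists2 m : int, (be tt0 : F) = m%:~R & m != 0.
Proof.
case/(pos_or hss hcart hb hhb) => [/pos_tt0[k kE]|/pos_tt0[k]]; first by exists k.+1 => //; rewrite kE pmulrn.
rewrite evN => /(canRL opprK) kE; by exists (- k.+1%:Z) => //; rewrite kE mulrNz pmulrn.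
Qed.

Lemma vtop_pos la (D : gmod L) (v : D) be x : vtop la v -> is_root be -> root_vec be x -> 0 < (be tt0 : F) -> act x v = 0.
Proof.
move=> [_ [_ nv] _ _] rb rx p0; apply: nv; apply/(nplusP hss hcart hb hhb); apply: wsum1 rx.
have [//|/pos_tt0[k]] := pos_or hss hcart hb hhb rb; rewrite evN => E.
by move: p0; rewrite -oppr_lt0 E ltrn0.
Qed.

Section Top.
Variables (la : hd) (D : gmod L) (v : D).
Hypothesis dv : vtop la v.
Lemma vtop_wmod : wmod h D.
Proof. by have [_ [wv _] gv _] := dv; apply: (cyclic_wmod hcart pos_reg wv gv) => be x; exact: (vtop_pos dv). Qed.
Lemma vtop_level mu (u : D) : u != 0 -> weight_vec mu u ->
  (mu = la /\ exists c, u = c *: v) \/ exists k : nat, (la tt0 : F) - (mu tt0 : F) = k.+1%:R.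
Proof. by have [_ [wv _] gv _] := dv; apply: (cyclic_level hcart pos_reg wv gv) => be x; exact: (vtop_pos dv). Qed.
Lemma vtop_finite mu : exists l : seq D, forall u, weight_vec mu u -> in_span l u.
Proof. by have [_ [wv _] gv _] := dv; apply: (cyclic_finite hss hcart pos_reg wv gv) => be x; exact: (vtop_pos dv). Qed.
End Top.

Section SimpleRoot.
Variable al : hd.
Hypothesis sal : simple al.
Local Notation e := (re al).
Local Notation f := (rf al).
Local Notation ms := (@msum F L h b al).
Let ra : is_root al := sal.1.1.
Let tr := rtriple hss hcart ra.
Let tr2 := rsl2 hss hcart ra.

Lemma sing_em (N : gmod L) mu (u : N) : weight_vec mu u -> act e u = 0 ->
  (forall x, ms x -> act x u = 0) -> sing mu u.
Proof.
move=> wu eu mu0; split=> // x /(nplus_split hss hcart hb hhb al)[c [y my ->]].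
by rewrite actDl actZl eu mu0// scaler0 addr0.
Qed.
Lemma sing_e (N : gmod L) mu (u : N) : sing mu u -> act e u = 0.
Proof. by case=> _; apply; apply: re_nplus hss hcart hb hhb _ sal.1. Qed.
Lemma sing_m (N : gmod L) mu (u : N) x : sing mu u -> ms x -> act x u = 0.
Proof. by move=> [_ nu] mx; apply: nu; apply: (msum_nplus hss hcart hb hhb mx). Qed.

Lemma wt_f (N : gmod L) mu (u : N) : weight_vec mu u -> weight_vec (mu - al) (act f u).
Proof. by have [_ r2 _ _] := tr; rewrite addrC; apply: weight_act. Qed.
Lemma wt_e (N : gmod L) mu (u : N) : weight_vec mu u -> weight_vec (mu + al) (act e u).
Proof. by have [r1 _ _ _] := tr; rewrite addrC; apply: weight_act. Qed.
Lemma wt_fn (N : gmod L) mu (u : N) k : weight_vec mu u -> weight_vec (mu - al *+ k) (iter k (act f) u).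
Proof.
move=> wu; elim: k => [|k IH]; first by rewrite subr0.
by rewrite mulrSr opprD addrA; apply: wt_f.
Qed.
Lemma wt_en (N : gmod L) mu (u : N) k : weight_vec mu u -> weight_vec (mu + al *+ k) (iter k (act e) u).
Proof.
move=> wu; elim: k => [|k IH]; first by rewrite addr0.
by rewrite mulrSr addrA; apply: wt_e.
Qed.

Lemma finj_iter (N : gmod L) (a : L) k (u : N) : (forall u : N, act a u = 0 -> u = 0) ->
  iter k (act a) u = 0 -> u = 0.
Proof. by move=> fi; elim: k => //= k IH /fi. Qed.

Lemma finj_wt (N : gmod L) mu (u : N) k : (forall u : N, act f u = 0 -> u = 0) ->
  weight_vec (mu - al *+ k) (iter k (act f) u) -> weight_vec mu u.
Proof.
move=> fi wf t; apply/eqP; rewrite -subr_eq0; apply/eqP; apply: (finj_iter (k := k) fi).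
have E : iter k (act f) (act (vsval t) u) = act (vsval t) (iter k (act f) u) + (k%:R * (al t : F)) *: iter k (act f) u.
  have [_ r2 _ _] := tr; elim: (k) => [|j IH]; first by rewrite mul0r scale0r addr0.
  rewrite iterS IH actDr actZr act_comm [brk f _](root_vec_h t r2) evN iterS -natr1.
  by rewrite actNl actZl; lmod F.
rewrite -scaleN1r iter_actD iter_actZ iter_actZ E wf evD evN evMn; lmod F.
Qed.

Lemma ainj_m (N : gmod L) (a : L) (u : N) : adnil a -> (forall x, ms x -> ms (brk a x)) ->
  (forall u : N, act a u = 0 -> u = 0) -> (forall x, ms x -> act x (act a u) = 0) ->
  forall x, ms x -> act x u = 0.
Proof.
move=> nil ma inj mu x; have [n xn] := nil x; elim: n x xn => [|n IH] x; first by move=> /= ->; rewrite act0l.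
rewrite iterSr => xn mx; apply: inj; rewrite act_comm mu// IH ?addr0//; exact: ma.
Qed.

Lemma m_iter (N : gmod L) (a : L) (u : N) k : (forall x, ms x -> ms (brk a x)) ->
  (forall x, ms x -> act x u = 0) -> forall x, ms x -> act x (iter k (act a) u) = 0.
Proof.
move=> ma mu; elim: k => // k IH x mx.
have := act_comm a x (iter k (act a) u); rewrite IH// act0r [act (brk _ _) _]IH ?addr0; last exact: ma.
by move=> <-.
Qed.

Let msf := @msum_f F L h b hss hcart hb hhb al.

Lemma sing_down (N : gmod L) mu (u : N) k : sing mu u -> (mu (cor al) : F) = k%:R ->
  sing (mu - al *+ k.+1) (iter k.+1 (act f) u).
Proof.
move=> su muk; have [wu _] := su; apply: sing_em; first exact: wt_fn.
  rewrite (sl2_ED tr2 k (wu _)) muk subrr mulr0 scale0r add0r (sing_e su); exact: iter_act0.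
by apply: m_iter => x mx; [exact: msf|exact: sing_m su mx].
Qed.

Lemma finj_e (N : gmod L) (mu : hd) (u : N) k : (forall u : N, act f u = 0 -> u = 0) ->
  weight_vec mu u -> (mu (cor al) : F) = k%:R -> act e (iter k.+1 (act f) u) = 0 -> act e u = 0.
Proof.
move=> fi wu muk; rewrite (sl2_ED tr2 k (wu _)) muk subrr mulr0 scale0r add0r.
exact: finj_iter.
Qed.

Lemma finj_m (N : gmod L) (u : N) k : (forall u : N, act f u = 0 -> u = 0) ->
  (forall x, ms x -> act x (iter k (act f) u) = 0) -> forall x, ms x -> act x u = 0.
Proof.
move=> fi; elim: k => // k IH H; apply: IH; apply: (ainj_m (a := f)) => //.
  by case: (rnil hss hcart ra).
by move=> x; apply: msf.
Qed.

(** Dividing by $f^{k+1}$ undoes the dot action of the simple reflection. Vanishing under [e] is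
    recovered because the scalar in [sl2_ED] is zero at exactly this power, and under [msum] because
    [f] is ad-nilpotent and preserves it. *)
Lemma sing_up (N : gmod L) mu (u : N) k : (forall u : N, act f u = 0 -> u = 0) ->
  (mu (cor al) : F) = k%:R -> sing (mu - al *+ k.+1) (iter k.+1 (act f) u) -> sing mu u.
Proof.
move=> fi muk su; have wu := finj_wt fi su.1; apply: sing_em => //.
  by apply: finj_e fi wu muk _; apply: sing_e su.
by apply: (finj_m (k := k.+1)) => // x mx; apply: sing_m su mx.
Qed.

End SimpleRoot.

Section TrivialQuotient.
Variables (D : gmod L) (v : D).
Hypothesis dv : vtop (0 : hd) v.

(** [N1] is the image of the kernel of the augmentation [ep]. A weight vector killed by [ka] has
    negative level or is zero, so [ep] kills the kernel of [ka], and [n] stays outside [N1]. *)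
Lemma triv_quot (N : gmod L) (n : N) : n != 0 -> sing (0 : hd) n ->
  exists N1, [/\ submodule N1, forall x, N1 (act x n) & ~ N1 n].
Proof.
move=> n0 sn; have [v0 sv gv uv] := dv; have [ka hka kav] := uv _ _ sn.
have s1 : sing (0 : hd) (1 : trivg L).
  by split=> [t|//]; rewrite /= ev0 scale0r.
have [ep hep epv] := uv _ _ s1.
have kep w : ka w = 0 -> ep w = 0.
  move=> kw; have [s ws wE] := vtop_wmod dv w.
  have sK : submodule (fun w => ka w = 0) := submodule_ker hka.
  have sE : subspace (fun w => ep w = 0) := submodule_sub (submodule_ker hep).
  have [s' [_ ws' ks' -> _]] := wdec_in (submodule_sub sK) (submodule_h sK) ws wE kw.
  apply: (sub_sum_seq sE) => p ps; have [->|p0] := eqVneq p.2 0; first exact: sub0 sE.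
  have [[_ [c pE]]|[k kE]] := vtop_level dv p0 (ws' _ ps).
    have := ks' _ ps; rewrite pE (homZ hka) kav => /eqP; rewrite scaler_eq0 (negbTE n0) orbF => /eqP ->.
    by rewrite scale0r; apply: sub0 sE.
  apply/eqP; apply: contrapT => /negP e0.
  have w0 : weight_vec (0 : hd) (ep p.2) by move=> t; rewrite /= ev0 scale0r.
  have E := weight_uniq e0 w0 (hom_weight hep (ws' _ ps)).
  by move/eqP: kE; rewrite -E subrr eq_sym pnatr_eq0.
pose N1 u := exists2 w, ka w = u & ep w = 0.
exists N1; split.
- split; first by exists 0; rewrite ?(hom0 hka) ?(hom0 hep).
    move=> a _ _ [w <- e] [w' <- e']; exists (a *: w + w'); first by rewrite hka.1.
    by rewrite hep.1 e e' scaler0 addr0.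
  by move=> x _ [w <- e]; exists (act x w); [rewrite (hom_act hka)|rewrite (hom_act hep)].
- by move=> x; exists (act x v); [rewrite (hom_act hka) kav|rewrite (hom_act hep)].
move=> [w wn e]; have /kep : ka (w - v) = 0 by rewrite (homB hka) wn kav subrr.
by rewrite (homB hep) e epv sub0r => /eqP; rewrite oppr_eq0 oner_eq0.
Qed.
End TrivialQuotient.
End VermaModules.

Section VermaTools.
Variables (F : numClosedFieldType) (L : lieAlgebra F) (h b : {vspace L}).
Local Notation hd := 'Hom(subvs_of h, F^o).
Hypotheses (hss : semisimple L) (hcart : cartan h) (hb : borel b) (hhb : (h <= b)%VS).
Implicit Types (al be ga la mu : hd) (x : L).
Local Notation cor := (cor hss hcart).
Local Notation re := (re hss hcart).
Local Notation rf := (rf hss hcart).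
Local Notation simple := (simple_root b).
Local Notation tt0 := (tt0 b hss hcart).
Local Notation sing := (singular_vec b).
Local Notation vtop := (@vtop F L h b).
Let pos_tt0 := @pos_tt0 F L h b hss hcart hb hhb.

Lemma wsum_weights_sub (M : gmod L) : submodule (fun u : M => exists2 s : seq (hd * M), wdec s & u = \sum_(p <- s) p.2).
Proof.
split; first by exists [::]; rewrite ?big_nil.
  move=> c _ _ [s ws ->] [s' ws' ->]; exists ([seq (p.1, c *: p.2) | p <- s] ++ s').
    move=> p; rewrite mem_cat => /orP[/mapP[q /ws wq ->]|/ws'//]; exact: (subZ (weight_sub _ _)).
  by rewrite big_cat big_map scaler_sumr.
move=> x _ [s ws ->]; have [l rl ->] := root_decl hcart x.
exists [seq (q.1 + p.1, act q.2 p.2) | q <- l, p <- s].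
  move=> _ /allpairsP[[q p] /= [/rl[rq _] /ws wp ->]]; exact: weight_act.
rewrite big_allpairs_dep act_suml; apply: eq_bigr => q _; exact: act_sumr.
Qed.

Lemma gen_wmod (M : gmod L) mu (v : M) : weight_vec mu v ->
  (forall P : M -> Prop, submodule P -> P v -> forall u, P u) -> wmod h M.
Proof.
move=> wv gv u; apply: (gv _ (wsum_weights_sub M)); exists [:: (mu, v)]; last by rewrite big_seq1.
by move=> p; rewrite inE => /eqP ->.
Qed.

Lemma root_inj_wt be (a : L) (N : gmod L) mu (u : N) : root_vec be a -> (forall u : N, act a u = 0 -> u = 0) ->
  weight_vec (mu + be) (act a u) -> weight_vec mu u.
Proof.
move=> ra inj wa t; apply/eqP; rewrite -subr_eq0; apply/eqP; apply: inj.
rewrite actBr actZr act_comm wa (root_vec_h t ra) actNl actZl evD; lmod F.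
Qed.

Lemma weight_root_iter be (a : L) (N : gmod L) mu (u : N) k : root_vec be a -> weight_vec mu u ->
  weight_vec (mu + be *+ k) (iter k (act a) u).
Proof.
move=> ra wu; elim: k => [|k IH]; first by rewrite addr0.
by rewrite mulrSr addrA addrC; apply: weight_act.
Qed.

Lemma weight_preimage be (a : L) (N : gmod L) (Z : N -> Prop) mu (z x : N) k : root_vec be a -> submodule Z -> wmod h N ->
  weight_vec mu z -> Z (z - iter k (act a) x) ->
  exists2 x', weight_vec (mu - be *+ k) x' & Z (z - iter k (act a) x').
Proof.
move=> ra sZ wN wz; have [s ws ->] := wN x => Zz.
exists (\sum_(p <- s | p.1 == mu - be *+ k) p.2).
  rewrite big_seq_cond; apply: (sub_sum (weight_sub _ _)) => p /andP[ps /eqP <-]; exact: ws.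
have iter_sum (r : seq (hd * N)) (P : pred (hd * N)) :
    iter k (act a) (\sum_(p <- r | P p) p.2) = \sum_(p <- r | P p) iter k (act a) p.2.
  by apply: (big_morph (iter k (act a))) => [u v|]; [exact: iter_actD|exact: iter_act0].
pose s' := (mu, z) :: [seq (p.1 + be *+ k, - iter k (act a) p.2) | p <- s].
have ws' : wdec s'.
  move=> p; rewrite inE => /predU1P[->//|/mapP[q /ws wq ->]].
  by apply: (subN (weight_sub _ _)); apply: weight_root_iter.
have := @wcomp F L h N Z s' mu (submodule_sub sZ) (submodule_h sZ) ws'.
have -> : \sum_(p <- s') p.2 = z - iter k (act a) (\sum_(p <- s) p.2).
  by rewrite big_cons big_map sumrN iter_sum.
move=> /(_ Zz); rewrite big_cons /= eqxx big_map sumrN iter_sum; congr (Z (_ - _)).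
by apply: eq_bigl => p /=; rewrite -subr_eq opprK eq_sym -subr_eq eq_sym.
Qed.

(** The Ore condition for powers of [a]: factors are commuted past [x] one at a time, and each
    commutator lowers [D]. *)
Lemma act_divide (a : L) (M : gmod L) (U : M -> Prop) D N x w : submodule U ->
  iter D (brk a) x = 0 -> U w -> exists2 p, U p & act x (iter (N + D) (act a) w) = iter N (act a) p.
Proof.
move=> sU; elim: D N x w => [|D IHD] N x w; first by move=> /= -> _; exists 0; [case: sU|rewrite act0l iter_act0].
elim: N x w => [|N IHN] x w xD Uw.
  by exists (act x (iter (0 + D.+1) (act a) w)) => //; apply: (submodule_act _ sU); apply: iter_act_sub.
have xD' : iter D (brk a) (brk a x) = 0 by rewrite -iterSr.
have [p Up pE] := IHN x w xD Uw; have [q Uq qE] := IHD N.+1 _ w xD' Uw.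
exists (p - q); first exact: (subB (submodule_sub sU)).
rewrite addSn iterS; have -> : act x (act a (iter (N + D.+1) (act a) w)) =
    act a (act x (iter (N + D.+1) (act a) w)) - act (brk a x) (iter (N + D.+1) (act a) w).
  by rewrite [act a (act x _)]act_comm addrK.
by rewrite pE addnS -addSn qE -iterS -scaleN1r -iter_actZ -iter_actD scaleN1r.
Qed.

Lemma iter_surj (a : L) (M : gmod L) N (w : M) : (forall w : M, exists w', act a w' = w) ->
  exists w', iter N (act a) w' = w.
Proof.
move=> sj; elim: N w => [|N IH] w; first by exists w.
by have [w' <-] := sj w; have [w'' <-] := IH w'; exists w''.
Qed.

Lemma iter_inj (a : L) (M : gmod L) N (u w : M) : (forall u : M, act a u = 0 -> u = 0) ->
  iter N (act a) u = iter N (act a) w -> u = w.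
Proof.
move=> inj E; apply/eqP; rewrite -subr_eq0; apply/eqP; apply: (finj_iter (k := N) inj).
by rewrite -scaleN1r iter_actD iter_actZ E scaleN1r subrr.
Qed.

(** The vectors all of whose quotients by powers of [a] lie in [S] form a submodule, by
    [act_divide]. So only the quotients of the generator have to be checked. *)
Lemma saturation_gen (a : L) (D Z : gmod L) (v : D) (io : D -> Z) (S : Z -> Prop) : adnil a ->
  (forall P : D -> Prop, submodule P -> P v -> forall u, P u) -> is_hom io ->
  (forall u : Z, act a u = 0 -> u = 0) -> (forall u : Z, exists u', act a u' = u) ->
  submodule S -> (forall N z, iter N (act a) z = io v -> S z) ->
  forall N z de, iter N (act a) z = io de -> S z.
Proof.
move=> nil gv hio inj sj sS Sv N z de.
pose S' w := forall N z, iter N (act a) z = w -> S z.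
suff : S' (io de) by apply.
have sS' : submodule S'.
  split=> [N' z' /(finj_iter inj) ->|c u w hu hw N' z' E|x w hw N' z' E]; first by case: sS.
    have [u' u'E] := iter_surj N' u sj; have [w' w'E] := iter_surj N' w sj.
    have -> : z' = c *: u' + w'.
      by apply: (iter_inj (N := N') inj); rewrite iter_actD iter_actZ u'E w'E.
    by apply: (subZD (submodule_sub sS)); [exact: hu u'E|exact: hw w'E].
  have [n xn] := nil x; have [w' w'E] := iter_surj (N' + n) w sj.
  have [p Sp pE] := act_divide N' sS xn (hw _ _ w'E).
  suff -> : z' = p by [].
  by apply: (iter_inj (N := N') inj); rewrite E -w'E.
exact: (gv _ (submodule_pre hio sS') Sv).
Qed.

Lemma iter_pair (a : L) (M N : gmod L) k (p : gprod M N) :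
  iter k (act a) p = (iter k (act a) p.1, iter k (act a) p.2) :> gprod M N.
Proof. by elim: k => [|k IH]; [case: p|rewrite iterS IH]. Qed.

Section Family.
Variable Delta : weyl h -> gmod L.
Hypothesis hD : forall w : weyl h, is_verma b (dot b w 0) (Delta w).
Definition vt w : Delta w := sval (cid (verma_top (hD w))).
Lemma vtP (w : weyl h) : vtop (dot b w 0) (vt w).
Proof. exact: (svalP (cid (verma_top (hD w)))). Qed.
Lemma dot1 : dot b (wid h) 0 = 0. Proof. by rewrite dotE subrr. Qed.
Lemma vt1P : vtop 0 (vt (wid h)). Proof. by rewrite -dot1; apply: vtP. Qed.

Section SimpleRoot.
Variable al : hd.
Hypothesis sal : simple al.
Local Notation e := (re al).
Local Notation f := (rf al).
Let ra : is_root al := sal.1.1.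
Let tr := rtriple hss hcart ra.
Let tr2 := rsl2 hss hcart ra.
Let nile : adnil e. Proof. by case: (rnil hss hcart ra). Qed.
Let nilf : adnil f. Proof. by case: (rnil hss hcart ra). Qed.
Let re1 : root_vec al e. Proof. by case: tr. Qed.
Let rf1 : root_vec (- al) f. Proof. by case: tr. Qed.

(** A preimage of [z] under a high power of [f] would have a weight above the highest one. *)
Lemma vtop_no_fdiv la (D : gmod L) (v : D) mu (z : D) : vtop la v -> weight_vec mu z -> z != 0 ->
  exists k, forall x : D, z <> iter k (act f) x.
Proof.
move=> dv wz z0; have [a aE] := pos_tt0 sal.1.
have [N NE] : exists N : nat, (la tt0 : F) - (mu tt0 : F) = N%:R.
  by have [[-> _]|[k kE]] := vtop_level hss hcart hb hhb dv z0 wz; [exists 0%N; rewrite subrr|exists k.+1].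
exists N.+1 => x zE; have zz : z - iter N.+1 (act f) x = 0 by rewrite -zE subrr.
have [x' wx' /subr0_eq zx'] := weight_preimage rf1 (zero_sub D) (vtop_wmod hss hcart hb hhb dv) wz zz.
have x'0 : x' != 0 by apply: contra_neq z0 => x'0; rewrite zx' x'0 iter_act0.
have H j : (la tt0 : F) - ((mu - (- al) *+ N.+1) tt0 : F) <> j%:R.
  rewrite evD evN evMn evN aE mulrN opprK => /eqP; rewrite opprD addrA NE -natrM subr_eq -natrD eqr_nat; lia.
have [[E _]|[j jE]] := vtop_level hss hcart hb hhb dv x'0 wx'; last exact: H jE.
by apply: (H 0%N); rewrite E subrr.
Qed.

(* Pairing functionals on D with n = f^-1 v_s gives a map from D into a module
   on which f is injective. *)
Lemma verma_finj la (D : gmod L) (v : D) : vtop la v -> forall z : D, act f z = 0 -> z = 0.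
Proof.
move=> dv z0 fz0; pose s := srm hss hcart al (wid h); have ds := vtP s.
(* The highest weight for the simple reflection is [-al], so dividing its generator by [f] gives a
   singular vector of weight 0. *)
have lsE : dot b s 0 = 0 - al *+ 1.
  by rewrite dot_srm// dot1 /= (rho_simple hss hcart hb hhb sal) scale1r.
rewrite lsE in ds; have [v0 sv gv uv] := ds.
have fv k : iter k (act f) (vt s) != 0.
  elim: k => // k IH; apply/eqP => E.
  have := sl2_ED tr2 k (sv.1 (cor al)); rewrite E act0r (sing_e hss hcart hb hhb sal sv) iter_act0 addr0.
  move/esym/eqP; rewrite scaler_eq0 (negbTE IH) orbF mulf_eq0 pnatr_eq0 /= evD evN ev0 evMn (corr2 hss hcart ra).
  by rewrite sub0r mul1r -opprD oppr_eq0 -natrD pnatr_eq0.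
have [N [io [hio inj sj io0 _]]] := localization (Delta s) nilf.
have [n nE] := sj (io (vt s)).
have sn : sing (0 : hd) n.
  apply: (sing_up hb hhb sal (k := 0) inj); first by rewrite ev0.
  by rewrite /= nE; apply: hom_sing.
have n0 : n != 0.
  apply/eqP => n0; move/esym: nE; rewrite n0 act0r => /io0[k E].
  by move: (fv k); rewrite E eqxx.
have [N1 [sN1 gN1 nN1]] := triv_quot hss hcart hb hhb vt1P n0 sn.
have sZ := zero_sub D; have [_ [wv nv] gD uD] := dv.
pose W := @pairW F L f D _ N nilf sZ.
pose ps := @psi F L f D _ N n nilf sZ.
have spv : sing la (ps v).
  split=> [t|x xb].
    have tn : act (vsval t) n = 0 by rewrite (sn.1 t) ev0 scale0r.
    rewrite /ps psi_act// (wv t); apply: hval_eq => xi.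
    by rewrite hvalZ !psiE /pairing hvalZr scalerA.
  by rewrite /ps psi_act ?(sn.2 x xb)// (nv x xb) psi_Z.
have [th hth thv] := uD _ _ spv.
pose io2 (z : D) : gprod W D := (th z, z).
have hio2 : is_hom io2 by split=> [c u w|x u]; rewrite /io2 ?hth.1 ?hth.2.
have H := gD _ (submodule_pre hio2 (prel_sub nilf sZ sN1 gN1)).
have {}H : forall z, @prel F L f D _ N n N1 nilf sZ (th z) z.
  by apply: H; rewrite /io2 /= thv; apply: prel_psi.
(* As [f] is injective on [W], [th] kills [z], and then all [f]-nilpotent functionals vanish at [z].
   But [z] is not divisible by every power of [f], so one of them separates it. *)
have wz mu (z : D) : weight_vec mu z -> act f z = 0 -> z = 0.
  move=> wz fz; apply/eqP; apply: contrapT => /negP z00.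
  have [k kP] := vtop_no_fdiv dv wz z00.
  have thz : th z = 0.
    by apply: (@pairW_inj F L f D _ N nilf sZ inj); rewrite -(hom_act hth) fz (hom0 hth).
  have := H z; rewrite thz => /(prel0 sN1 nN1) Hz.
  have [|xi] := @anul_separate F L f D (fun z => z = 0) nilf sZ z k.
    by move=> de w -> E; apply: (kP w); rewrite {1}E add0r.
  by rewrite Hz => /eqP; rewrite eq_sym oner_eq0.
have sK : subspace (fun z : D => act f z = 0).
  by split=> [|c u w fu fw]; rewrite ?act0r// actDr actZr fu fw scaler0 addr0.
have hK (t : subvs_of h) (u : D) : act f u = 0 -> act f (act (vsval t) u) = 0.
  by move=> fu; rewrite act_comm fu act0r add0r (root_vec_h t rf1) actNl actZl fu scaler0 oppr0.
have [l wl lE] := vtop_wmod hss hcart hb hhb dv z0.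
have [l' [_ wl' kl' -> _]] := wdec_in sK hK wl lE fz0.
by rewrite big_seq big1// => p pl; apply: (wz p.1); [exact: wl'|exact: kl'].
Qed.

(** Followed by the map sending [v] to $f^{-k-1}v'$ in the localization of [D'], the homomorphism
    becomes the localization map, which is injective by [verma_finj]. *)
Lemma verma_embed la (D D' : gmod L) (v : D) (v' : D') k : vtop la v -> (la (cor al) : F) = k%:R ->
  vtop (la - al *+ k.+1) v' -> exists j : D' -> D, [/\ is_hom j, injective j, j v' = iter k.+1 (act f) v
    & forall z, exists N de, iter N (act f) z = j de].
Proof.
move=> dv lak dv'; have [_ sv gv uv] := dv; have [_ sv' gv' uv'] := dv'.
have [j hj jv] := uv' _ _ (sing_down hb hhb sal sv lak); exists j; split=> //; last first.
  have sI : submodule (fun z => exists de, j de = z) := submodule_im hj.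
  have S := satur_sub nilf sI.
  suff H : forall z : D, exists N de, j de = iter N (act f) z.
    by move=> z; have [N [de E]] := H z; exists N, de.
  by apply: (gv _ S); exists k.+1, v'.
have [N [io [hio inj sj io0 _]]] := localization D' nilf.
have [n nE] := iter_surj k.+1 (io v') sj.
have sn : sing la n.
  by apply: (sing_up hb hhb sal inj lak); rewrite nE; apply: hom_sing.
have [g hg gvE] := uv _ _ sn.
have gj z : g (j z) = io z.
  apply: (gv' (fun z => g (j z) = io z)).
  - split=> [|c u w E E'|x u E]; first by rewrite (hom0 hj) (hom0 hg) (hom0 hio).
      by rewrite hj.1 hg.1 hio.1 E E'.
    by rewrite (hom_act hj) (hom_act hg) (hom_act hio) E.
  - by rewrite jv (hom_iter _ _ _ hg) gvE.
apply: (hom_inj hj) => u ju; have : io u = 0 by rewrite -gj ju (hom0 hg).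
by move=> /io0[m]; apply: (finj_iter (verma_finj dv')).
Qed.

(** Otherwise a functional killed by [e] is nonzero at [u]. But an [e]-nilpotent functional vanishes
    at the generator: its component of weight [-la] has sl2-weight $m+1$, so it is $e^{m+1}$ of a
    functional, and [e] kills [v]. These functionals form a submodule, so they vanish everywhere. *)
Lemma verma_esurj la (D : gmod L) (v : D) m nu (u : D) : vtop la v -> (la (cor al) : F) = - m.+1%:R ->
  weight_vec nu u -> exists2 u', weight_vec (nu - al) u' & act e u' = u.
Proof.
move=> dv lam wu; have [_ sv gv _] := dv; have wD := vtop_wmod hss hcart hb hhb dv.
apply: contrapT => nex.
have sI : subspace (fun w : D => exists x : D, act e x = w).
  split; first by exists 0; rewrite act0r.
  by move=> c _ _ [x <-] [y <-]; exists (c *: x + y); rewrite actDr actZr.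
(* Annihilating the other weight spaces as well makes the separating functional a weight vector. *)
pose Q (w : D) := exists2 s : seq (hd * D), wdec s /\ (forall p, p \in s -> p.1 != nu) & w = \sum_(p <- s) p.2.
have sQ : subspace Q.
  split; first by exists [::]; rewrite ?big_nil.
  move=> c _ _ [s [ws ns] ->] [s' [ws' ns'] ->].
  exists ([seq (p.1, c *: p.2) | p <- s] ++ s'); last by rewrite big_cat big_map scaler_sumr.
  split=> p; rewrite mem_cat => /orP[/mapP[q qs ->]|ps].
  - exact: (subZ (weight_sub _ _) _ (ws _ qs)).
  - exact: (ws' _ ps).
  - exact: (ns _ qs).
  - exact: (ns' _ ps).
have nP : ~ exists p q : D, [/\ exists x : D, act e x = p, Q q & u = p + q].
  move=> [_ [_ [[x <-] [s [ws ns] ->] uE]]].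
  have [l wl lE] := wD x; apply: nex.
  exists (\sum_(p <- l | p.1 == nu - al) p.2).
    rewrite big_seq_cond; apply: (sub_sum (weight_sub _ _)) => p /andP[pl /eqP <-]; exact: wl.
  have wl' : wdec ([seq (al + p.1, act e p.2) | p <- l] ++ s).
    move=> p; rewrite mem_cat => /orP[/mapP[q /wl wq ->]|/ws//]; exact: weight_act.
  rewrite act_sumr (wdec_wv wl' wu); last by rewrite uE lE act_sumr big_cat big_map.
  rewrite big_cat big_map /=.
  have -> : \sum_(p <- s | p.1 == nu) p.2 = 0.
    by rewrite big_seq_cond big_pred0// => p; apply/negP => /andP[/ns n /eqP E]; rewrite E eqxx in n.
  rewrite addr0; apply: eq_bigl => p /=; by rewrite eq_sym subr_eq eq_sym addrC.
have [xi [lxi xi0 xi1]] := separate (subspaceD sI sQ) nP.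
pose et : homg (antihom_opp L) D (trivg L) := hmk (antihom_opp L) (N := trivg L) lxi.
have wet : weight_vec (- nu) et.
  move=> t; apply: hval_eq => w; rewrite dual_act hvalZ hmkE /=; have [s ws ->] := wD w.
  rewrite evN scaleNr; congr (- _).
  have lin0 : xi 0 = 0 by apply: xi0; exists 0, 0; split; rewrite ?addr0//; [exists 0; rewrite act0r|exact: sub0 sQ].
  have linD u1 u2 : xi (u1 + u2) = xi u1 + xi u2 by have := lxi 1 u1 u2; rewrite scale1r mul1r.
  have linZ c u1 : xi (c *: u1) = c * xi u1 by have := lxi c u1 0; rewrite addr0 lin0 addr0.
  have linS (I : Type) (r : seq I) (g : I -> D) : xi (\sum_(i <- r) g i) = \sum_(i <- r) xi (g i).
    by apply: (big_morph xi).
  rewrite act_sumr !linS scaler_sumr big_seq [RHS]big_seq; apply: eq_bigr => p ps.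
  have [<-|ne] := eqVneq p.1 nu; first by rewrite (ws p ps t) linZ.
  have xp : xi p.2 = 0.
    apply: xi0; exists 0, p.2; split; rewrite ?add0r//; first by exists 0; rewrite act0r.
    by exists [:: p]; rewrite ?big_seq1//; split=> q; rewrite inE => /eqP ->//; apply: ws.
  by rewrite (ws p ps t) linZ xp mulr0 scaler0.
have eet : act e et = 0.
  apply: hval_eq => w; rewrite dual_act hmkE xi0 ?oppr0//.
  by exists (act e w), 0; split; rewrite ?addr0//; [exists w|exact: sub0 sQ].
pose X := homg (antihom_opp L) D (trivg L).
pose B (et : X) := (exists N, iter N (act e) et = 0) /\ exists2 s : seq (hd * X), wdec s & et = \sum_(p <- s) p.2.
have sN : submodule (fun et : X => exists N, iter N (act e) et = 0) := nil_sub _ nile.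
have sB : submodule B by apply: submoduleI => //; apply: wsum_weights_sub.
have Bv et' : B et' -> hval et' v = 0.
  move=> [nk [s ws sE]]; have [s' [_ ws' ns' -> _]] := wdec_in (submodule_sub sN) (submodule_h sN) ws sE nk.
  have sv0 : subspace (fun et : X => hval et v = 0).
    by split=> [|c x y hx hy]; rewrite ?hval0// hvalZD hx hy scaler0 addr0.
  apply: (sub_sum_seq sv0) => p /[dup] /ws' wp /ns' [N Np].
  have [E|] := eqVneq p.1 (- la); last first.
    move=> /hd_neq[t tE]; have := congr1 (fun et : X => hval et v) (wp t).
    rewrite dual_act hvalZ (sv.1 t) hvalZr -scaleNr => /eqP; rewrite -subr_eq0 -scalerBl scaler_eq0.
    by rewrite subr_eq0 eq_sym -evN (negbTE tE) => /eqP.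
  have [|et2 _ <-] := @sl2_surjE F L X _ _ _ tr2 m.+1 N p.2 _ Np; first by rewrite (wp (cor al)) E evN lam opprK.
  by rewrite dual_iter iterSr (sing_e hss hcart hb hhb sal sv) iter_act0 hval0r scaler0.
have : hval et u = 0.
  suff H : forall w : D, forall et, B et -> hval et w = 0.
    by apply: H; split; [exists 1%N|exists [:: (- nu, et)]; rewrite ?big_seq1// => p; rewrite inE => /eqP ->].
  apply: gv => //; split=> [et' _|c x y hx hy et' Be|x w hw et' Be]; first exact: hval0r.
    by rewrite hvalDr hvalZr hx// hy// scaler0 addr0.
  by apply/eqP; rewrite -oppr_eq0 -dual_act; apply/eqP/hw; apply: (submodule_act _ sB).
by rewrite hmkE xi1 => /eqP; rewrite oner_eq0.
Qed.
End SimpleRoot.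
End Family.
End VermaTools.

(** * Verma modules localized at a lowering operator *)

Section Localized.
Variables (F : numClosedFieldType) (L : lieAlgebra F) (h b : {vspace L}).
Local Notation hd := 'Hom(subvs_of h, F^o).
Hypotheses (hss : semisimple L) (hcart : cartan h) (hb : borel b) (hhb : (h <= b)%VS).
Implicit Types (be ga la mu : hd).
Local Notation cor := (cor hss hcart).
Local Notation re := (re hss hcart).
Local Notation rf := (rf hss hcart).
Local Notation pos := (pos_root b).
Local Notation simple := (simple_root b).
Local Notation tt0 := (tt0 b hss hcart).
Local Notation sing := (singular_vec b).
Local Notation vtop := (@vtop F L h b).
Let pos_tt0 := @pos_tt0 F L h b hss hcart hb hhb.
Variable Delta : weyl h -> gmod L.
Hypothesis hD : forall w : weyl h, is_verma b (dot b w 0) (Delta w).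
Variable al : hd.
Hypothesis sal : simple al.
Local Notation e := (re al).
Local Notation f := (rf al).
Local Notation hh := (vsval (cor al)).
Local Notation ms := (@msum F L h b al).
Let ra : is_root al := sal.1.1.
Let tr := rtriple hss hcart ra.
Let tr2 := rsl2 hss hcart ra.
Let nile : adnil e. Proof. by case: (rnil hss hcart ra). Qed.
Let nilf : adnil f. Proof. by case: (rnil hss hcart ra). Qed.
Let mse := @msum_e F L h b hss hcart hb hhb al.
Let msf := @msum_f F L h b hss hcart hb hhb al.
Let re1 : root_vec al e. Proof. by case: tr. Qed.
Let rf1 : root_vec (- al) f. Proof. by case: tr. Qed.

(** The scalars for which $f^j$ sends $\mathrm{divc}(k,j)\,e^jy$ back to $y$, when $y$ has
    sl2-weight $k+2$ and $efy=0$. They express formal negative powers of [f] by powers of [e]. *)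
Fixpoint divc (k j : nat) : F := if j is j'.+1 then - divc k j' / (j'.+1%:R * (k.+2 + j')%:R) else 1.

Lemma divc_rec (M : gmod L) (w : M) k j : act hh w = k.+2%:R *: w ->
  act f (divc k j.+1 *: iter j.+1 (act e) w) = divc k j *: iter j (act e) w + divc k j.+1 *: iter j.+1 (act e) (act f w).
Proof.
move=> wt; rewrite actZr (sl2_DE tr2 j wt) scalerDr scalerA; congr (_ *: _ + _) => /=.
have j0 : (j.+1%:R : F) != 0 by rewrite pnatr_eq0.
have k0 : (k.+2%:R + j%:R : F) != 0 by rewrite -natrD pnatr_eq0.
by rewrite natrD; move: (j.+1%:R : F) (k.+2%:R + j%:R : F) j0 k0 => A B A0 B0; field; rewrite A0 B0.
Qed.

(* X is the localization at f of the Verma module D; X / D is generated by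
   y = f^-1 v, which is a highest weight vector for the reflected Borel. *)
Section Saturated.
Variables (la : hd) (D X : gmod L) (v : D) (k : nat) (i : D -> X) (y : X).
Hypotheses (dv : vtop la v) (lak : (la (cor al) : F) = k%:R) (hi : is_hom i).
Hypothesis fi : forall x : X, act f x = 0 -> x = 0.
Hypothesis fs : forall x : X, exists x', act f x' = x.
Hypothesis hsat : forall x : X, exists N de, iter N (act f) x = i de.
Hypothesis yE : act f y = i v.

Lemma sat_wt : weight_vec (la + al) y.
Proof.
apply: (root_inj_wt rf1 fi); rewrite yE addrK; apply: (hom_weight hi); case: dv => _ [].
by [].
Qed.
Lemma sat_hh : act hh y = k.+2%:R *: y.
Proof. by rewrite (sat_wt (cor al)) evD lak (corr2 hss hcart ra) -natrD addn2. Qed.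
Lemma sat_m x : ms x -> act x y = 0.
Proof.
move: x; apply: (ainj_m nilf (fun x => msf sal) fi) => x mx.
by rewrite yE -(hom_act hi); have [_ sv _ _] := dv; rewrite (sing_m hss hcart hb hhb sv mx) (hom0 hi).
Qed.
Lemma sat_div j : iter j.+1 (act f) (divc k j *: iter j (act e) y) = i v.
Proof.
elim: j => [|j IH]; first by rewrite /= scale1r.
rewrite iterSr (divc_rec j sat_hh) yE.
have [_ sv _ _] := dv.
rewrite [iter j.+1 (act e) (i v)]iterSr -(hom_act hi) (sing_e hss hcart hb hhb sal sv) (hom0 hi).
by rewrite iter_act0 scaler0 addr0.
Qed.
Lemma sat_gen (S : X -> Prop) : submodule S -> S y -> forall x, S x.
Proof.
move=> sS Sy x; have [N [de E]] := hsat x; have [_ _ gv _] := dv.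
apply: (saturation_gen nilf gv hi fi fs sS _ E) => -[|j] z zE.
  by rewrite -[z]/(iter 0 (act f) z) zE -yE; apply: (submodule_act _ sS).
have -> : z = divc k j *: iter j (act e) y by apply: (iter_inj (N := j.+1) fi); rewrite zE sat_div.
by apply: (subZ (submodule_sub sS)); apply: iter_act_sub.
Qed.
Lemma sat_wmod : wmod h X.
Proof. exact: (gen_wmod hcart sat_wt sat_gen). Qed.

Let sI : submodule (fun x => exists de, i de = x) := submodule_im hi.
Definition satq : gmod L := quog sI.
Definition satp : X -> satq := qpi sI.
Let tw := crefl hss hcart al tt0.

Lemma tw_al a : (al tt0 : F) = a -> (al tw : F) = - a.
Proof. by move=> aE; rewrite -crefl_pair reflection_neg// evN aE. Qed.

(** For the reflected Borel subalgebra the quotient is a highest weight module generated by the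
    class of [y], so [cyclic_level] applies with levels taken at [tw]. *)
Lemma satq_level mu (u : satq) : u != 0 -> weight_vec mu u ->
  mu = la + al \/ exists j : nat, ((la + al) tw : F) - (mu tw : F) = j.+1%:R.
Proof.
have reg be : is_root be -> exists2 m : int, (be tw : F) = m%:~R & m != 0.
  move=> rb; rewrite -crefl_pair; apply: (pos_reg hss hcart hb hhb); exact: root_refl.
have gq (P : satq -> Prop) : submodule P -> P (satp y) -> forall u, P u.
  move=> sP Py w; have [x <-] := qpi_surj w.
  by apply: (sat_gen (S := fun x => P (satp x))) => //; apply: submodule_pre => //; apply: qpi_hom.
have topq be x : is_root be -> root_vec be x -> 0 < (be tw : F) -> act x (satp y) = 0.
  move=> rb rx; rewrite -crefl_pair => p0; rewrite /satp -(qpi_hom sI).2; apply/qpi0P.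
  have rr := root_refl hss hcart ra rb; have K := reflectionK (corr2 hss hcart ra).
  have pr : pos (reflection al (cor al) be).
    have [//|/pos_tt0[j]] := pos_or hss hcart hb hhb rr; rewrite evN => E.
    by move: p0; rewrite -oppr_lt0 E ltrn0.
  have [E|ne] := eqVneq (reflection al (cor al) be) al.
    have bE : be = - al by rewrite -[be]K E reflection_neg.
    rewrite bE in rx; have rn := root_opp hss hcart ra.
    have [c ->] := root_line hss hcart rn rx; have [c' fE] := root_line hss hcart rn rf1.
    have c'0 : c' != 0.
      by apply/eqP => c'0; have [_] := triple_ne tr; rewrite fE c'0 scale0r eqxx.
    exists ((c / c') *: v); rewrite (homZ hi) -yE fE !actZl scalerA divfK//.
  exists 0; rewrite (hom0 hi) sat_m//; apply: wsum1 rx.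
  have pb := simple_refl hss hcart hb hhb sal pr ne; rewrite K in pb; split=> //.
  apply/eqP => E; apply: (pos_opp hss hcart hb hhb sal.1).
  by move: pr; rewrite E reflection_neg.
move=> u0 wu.
have wq : weight_vec (la + al) (satp y) by apply: (hom_weight (qpi_hom sI)); apply: sat_wt.
by have [[-> _]|H] := cyclic_level hcart reg wq gq topq u0 wu; [left|right].
Qed.

(** Subtracting [al] raises the reflected level, so $\mu-K\alpha$ finally exceeds the top weight of
    the quotient. *)
Lemma sat_big mu : exists K, forall x : X, weight_vec (mu - al *+ K) x -> exists de, i de = x.
Proof.
have [a aE] := pos_tt0 sal.1; pose d := ((la + al) tw : F) - (mu tw : F).
have lev K (x : X) : weight_vec (mu - al *+ K) x -> (forall j : nat, d - (K * a.+1)%:R <> j%:R) -> exists de, i de = x.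
  move=> wx H; apply/(qpi0P sI); apply/eqP; apply: contrapT => /negP x0.
  have wq : weight_vec (mu - al *+ K) (satp x) := hom_weight (qpi_hom sI) wx.
  have dE : ((la + al) tw : F) - ((mu - al *+ K) tw : F) = d - (K * a.+1)%:R.
    rewrite [X in _ - X]evD evN evMn (tw_al aE) natrM /d; ring.
  have [E|[j jE]] := satq_level x0 wq; last by apply: (H j.+1); rewrite -jE dE.
  by apply: (H 0%N); rewrite -dE E subrr.
have [[n nE]|nex] := pselect (exists n : nat, d = n%:R).
  exists n.+1 => x wx; apply: lev wx _ => j; rewrite nE => /eqP; rewrite subr_eq -natrD eqr_nat; lia.
by exists 0%N => x wx; apply: lev wx _ => j; rewrite subr0 => E; apply: nex; exists j.
Qed.
End Saturated.

(** The counterpart, for [e], of the vector $f^{-1}v_s$ used in [verma_finj]. Take $f^{-1}v$ in the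
    localized Verma module of weight 0; its class [yb] in the quotient has weight [al] and is killed
    by [f]. After localizing at [e], the vector $n=e^{-1}yb$ has weight 0, and [triv_quot] applies
    to it modulo the image of [Y]. *)
Lemma e_model : exists (N : gmod L) (n : N) (N1 : N -> Prop),
  [/\ [/\ submodule N1, forall x, N1 (act x n) & ~ N1 n], forall u : N, act e u = 0 -> u = 0,
      act f n = 0, forall x, ms x -> act x n = 0 & weight_vec (0 : hd) n].
Proof.
have dv := vt1P hD; set v := vt hD (wid h) in dv; have [v0 sv gv _] := dv.
have [X [io [hio fi fs io0 ios]]] := localization (Delta (wid h)) nilf.
have ioi u : io u = 0 -> u = 0.
  by move=> /io0[k]; apply: (finj_iter (@verma_finj F L h b hss hcart hb hhb Delta hD al sal _ _ _ dv)).
have hsat (x : X) : exists N de, iter N (act f) x = io de by have [N [m E]] := ios x; exists N, m.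
have [y yE] := fs (io v).
have la0 : ((0 : hd) (cor al) : F) = 0%:R by rewrite ev0.
have [a aE] := pos_tt0 sal.1.
have lev := satq_level (hi := hio) dv la0 fi fs hsat yE.
pose Y := satq hio; pose yb : Y := satp hio y.
have hp : is_hom (satp hio : X -> Y) := qpi_hom _.
have eyn j : iter j (act e) yb != 0.
  rewrite /yb -(hom_iter _ _ _ hp); apply/eqP => /qpi0P[de dE].
  have wy := weight_root_iter j re1 (sat_wt dv hio fi yE).
  have de0 : de != 0.
    apply/eqP => de0; have := sat_div dv la0 hio fi yE j.
    rewrite -dE de0 (hom0 hio) scaler0 iter_act0 => /esym /ioi v00.
    by move: v0; rewrite v00 eqxx.
  rewrite -dE in wy; have wd := hom_inj_weight hio (hom_inj hio ioi) wy.
  have H l : ((0 : hd) tt0 : F) - ((0 + al + al *+ j) tt0 : F) <> l%:R.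
    rewrite !evD ev0 evMn aE => /eqP; rewrite !add0r eq_sym -subr_eq0 opprK -natrM -!natrD pnatr_eq0; lia.
  have [[E _]|[l lE]] := vtop_level hss hcart hb hhb dv de0 wd; last exact: H lE.
  by apply: (H 0%N); rewrite E subrr.
have [N [jo [hjo ei es jo0 _]]] := localization Y nile.
have [n nE] := es (jo yb).
have wyb : weight_vec (0 + al) yb := hom_weight hp (sat_wt dv hio fi yE).
have wn : weight_vec (0 : hd) n.
  by apply: (root_inj_wt re1 ei); rewrite nE; apply: hom_weight wyb.
have fyb : act f yb = 0 by rewrite /yb -(hom_act hp) yE; apply/qpi0P; exists v.
have fn : act f n = 0.
  apply: ei; rewrite act_comm nE -(hom_act hjo) fyb (hom0 hjo) add0r.
  by have [-> _ _] := tr2; rewrite (wn (cor al)) ev0 scale0r.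
have mn : forall x, ms x -> act x n = 0.
  apply: (ainj_m nile (fun x => mse sal) ei) => x mx; rewrite nE -(hom_act hjo) /yb -(hom_act hp).
  by rewrite (sat_m dv hio fi yE mx) (hom0 hp) (hom0 hjo).
have sG : submodule (fun u => exists w, jo w = u) := submodule_im hjo.
have n0 : n != 0.
  apply/eqP => n0; move/esym: nE; rewrite n0 act0r => /jo0[j E].
  by move: (eyn j); rewrite E eqxx.
have wY : wmod h Y.
  move=> w; have [x <-] := qpi_surj w; have [s ws ->] := sat_wmod dv la0 hio fi fs hsat yE x.
  exists [seq (p.1, satp hio p.2) | p <- s]; last by rewrite big_map; exact: (hom_sum hp).
  by move=> _ /mapP[p /ws wp ->]; apply: hom_weight wp.
(* At the reflected level, weight 0 lies above [al], the top weight of [Y]. *)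
have nG : ~ exists w, jo w = n.
  move=> [w wE]; have [s ws sE] := wY w.
  have wl : wdec [seq (p.1, jo p.2) | p <- s].
    by move=> _ /mapP[p /ws wp ->]; apply: hom_weight wp.
  have := wdec_wv wl wn; rewrite !big_map -wE sE (hom_sum hjo) => /(_ erefl) /= E.
  have [E0|w0] := eqVneq (\sum_(p <- s | p.1 == 0) p.2) 0.
    by move: n0; rewrite -wE sE (hom_sum hjo) E -(hom_sum hjo) E0 (hom0 hjo) eqxx.
  have ww : weight_vec (0 : hd) (\sum_(p <- s | p.1 == 0) p.2).
    rewrite big_seq_cond; apply: (sub_sum (weight_sub _ _)) => p /andP[ps /eqP <-]; exact: ws.
  have H l : ((0 + al) (crefl hss hcart al tt0) : F) - ((0 : hd) (crefl hss hcart al tt0) : F) <> l%:R.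
    rewrite evD ev0 (tw_al aE) => /eqP; rewrite add0r subr0 eq_sym -subr_eq0 opprK -natrD pnatr_eq0; lia.
  have [E2|[l lE]] := lev _ _ w0 ww; last exact: H lE.
  by apply: (H 0%N); rewrite -E2 subrr.
pose q := qpi sG; have hq : is_hom q := qpi_hom sG.
have sn : sing (0 : hd) (q n).
  apply: (@sing_em F L h b hss hcart hb hhb al _ _ _ (hom_weight hq wn)).
    by rewrite -(hom_act hq) nE; apply/qpi0P; exists yb.
  by move=> x mx; rewrite -(hom_act hq) mn ?(hom0 hq).
have qn0 : q n != 0 by apply/eqP => /qpi0P.
have [N1 [s1 g1 n1]] := triv_quot hss hcart hb hhb dv qn0 sn.
exists N, n, (fun u => N1 (q u)); split=> //; split=> //; first exact: submodule_pre.
by move=> x; rewrite (hom_act hq).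
Qed.

Lemma sq_act3 (a : L) (D : nat) (M : gmod L) (x : L) (z : int -> M) (K : int) : brk a (brk a (brk a x)) = 0 ->
  sq_act a D.+3 x z K = act x (z K) + K%:~R *: act (brk a x) (z (K - 1)) + gbin F K 2 *: act (brk a (brk a x)) (z (K - 2%:Z)).
Proof.
move=> x3; rewrite /sq_act 3!big_ord_recl big1 => [|j _]; last first.
  rewrite !lift0 !iterSr x3 (_ : iter j (brk a) 0 = 0) ?act0l ?scaler0//.
  by elim: (nat_of_ord j) => //= l ->; rewrite brk0r.
change (gbin F K 0 *: act x (z (K - 0%:Z)) + (gbin F K 1 *: act (brk a x) (z (K - 1)) +
  (gbin F K 2 *: act (brk a (brk a x)) (z (K - 2%:Z)) + 0)) = act x (z K) + K%:~R *: act (brk a x) (z (K - 1)) +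
  gbin F K 2 *: act (brk a (brk a x)) (z (K - 2%:Z))).
by rewrite gbin0 gbin1 scale1r subr0 addr0 addrA.
Qed.

Lemma hom_swap (X C W : gmod L) (g : C -> W) : is_hom g -> is_hom (fun p : gprod X C => (g p.2, p.1) : gprod W X).
Proof. by move=> hg; split=> [c p q|x p]; congr pair; [exact: hg.1|exact: hg.2]. Qed.

(** The [e]-nilpotent functionals vanishing on [D] are paired with the vector of [e_model], giving a
    module [W] on which [e] is injective. A homomorphism from [D] into compatible sequences over [W]
    follows this pairing modulo [N1]. The value belonging to [z] is killed by [e], hence zero, so
    all these functionals vanish at [z]; by [sat_big] there are enough of them to force [z] into
    [D]. *)
Lemma sat_e_closed la (D X : gmod L) (v : D) k (i : D -> X) mu (z : X) : vtop la v -> (la (cor al) : F) = k%:R ->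
  is_hom i -> injective i -> (forall x : X, act f x = 0 -> x = 0) -> (forall x : X, exists x', act f x' = x) ->
  (forall x : X, exists N de, iter N (act f) x = i de) -> weight_vec mu z ->
  (exists de, i de = act e z) -> exists de, i de = z.
Proof.
move=> dv lak hi ii fi fs hsat wz [de1 de1E].
have [y yE] := fs (i v).
have [N [n [N1 [[sN1 gN1 nN1] ei fn mn wn]]]] := e_model.
have sI : submodule (fun x => exists de, i de = x) := submodule_im hi.
pose W := @pairW F L e X _ N nile sI; pose ps : X -> W := @psi F L e X _ N n nile sI.
have [_ sv gv uv] := dv.
have tn (t : subvs_of h) : act (vsval t) n = 0 by rewrite (wn t) ev0 scale0r.
have psZ (u : X) c : ps (c *: u) = c *: ps u.
  by apply: hval_eq => xi; rewrite hvalZ !psiE /pairing hvalZr scalerA.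
have wps : weight_vec (la + al) (ps y).
  by move=> t; rewrite /ps psi_act// (sat_wt dv hi fi yE t) -psZ.
have fps : act f (ps y) = 0 by rewrite /ps psi_act// yE; apply: psi_Z; exists v.
have mps x : ms x -> act x (ps y) = 0.
  by move=> mx; rewrite /ps psi_act ?mn// (sat_m dv hi fi yE mx); apply: psi_Z; exists 0; rewrite (hom0 hi).
have hps : act hh (ps y) = k.+2%:R *: ps y.
  by rewrite (wps (cor al)) evD lak (corr2 hss hcart ra) -natrD addn2.
(* Entry $K$ is the image of $f^Kv$ in [W]: zero for $K\ge0$, where $f^Kv$ lies in [D], while
   $f^{-j-1}v$ is written with [divc]. *)
pose zz (K : int) : W := if K is Negz j then divc k j *: iter j (act e) (ps y) else 0.
have zzS K : zz (K + 1) = act f (zz K).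
  case: K => [K|[|j]]; first by rewrite -PoszD addn1; apply/esym/act0r.
    by rewrite -[RHS]/(act f (1 *: ps y)) scale1r fps.
  have -> : Negz j.+1 + 1 = Negz j by rewrite !NegzE; lia.
  by rewrite /zz (divc_rec j hps) fps iter_act0 scaler0 addr0.
have [d' fD'] := adnil_unif nilf.
(* The bound has the form $d'+3$ because [sq_act3] splits off three terms; $(\mathrm{ad}\,f)^3$
   kills [e]. *)
have fD (x : L) : iter d'.+3 (brk f) x = 0 by rewrite !iterS fD' !brk0r.
pose C := compg fD W; pose zc : C := cmk fD zzS.
have cE x K : cval (act x zc) K = \sum_(j < d'.+3) gbin F K j *: act (iter j (brk f) x) (zz (K - j%:Z)) by [].
have wzz j : weight_vec (la + al + al *+ j) (iter j (act e) (ps y)) by apply: weight_root_iter.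
have sz : sing la zc.
  apply: (@sing_em F L h b hss hcart hb hhb al).
  - move=> t; apply: (cval_eq (aD := fD)) => K.
    have ft : brk f (vsval t) = (al t : F) *: f by rewrite (root_vec_h t rf1) evN scaleNr opprK.
    have ft2 : brk f (brk f (vsval t)) = 0 :> L by rewrite ft brkZr brk_alt scaler0.
    rewrite cE -/(sq_act f d'.+3 (vsval t) zz K) sq_act3 ft2 ?brk0r// act0l scaler0 addr0 ft actZl -zzS subrK.
    rewrite -[RHS]/((la t : F) *: zz K) scalerA -[X in _ + X]scalerA.
    case: K => [K|j]; first by rewrite /zz !act0r !scaler0 addr0.
    rewrite /zz actZr (wzz j t) !evD evMn !scalerA -!scalerDl; congr (_ *: _).
    by rewrite NegzE mulrNz -pmulrn -natr1; ring.
  - apply: (cval_eq (aD := fD)) => K.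
    have fe1 : brk f e = - hh by have [E _ _] := tr2; rewrite brkC E.
    have fe2 : brk f (- hh) = - (2%:R *: f) by have [_ _ E] := tr2; rewrite brkNr -brkC E.
    have fe3 : brk f (- (2%:R *: f)) = 0 :> L by rewrite brkNr brkZr brk_alt scaler0 oppr0.
    rewrite cE -/(sq_act f d'.+3 e zz K) sq_act3 fe1 fe2 ?fe3// !actNl actZl.
    have -> : act f (zz (K - 2%:Z)) = zz (K - 1) by rewrite -zzS; congr zz; lia.
    have -> : gbin F K 2 = K%:~R * (K%:~R - 1) / 2%:R by rewrite /gbin big_ord_recl big_ord1 /= subr0.
    case: K => [[|K]|j].
    + by rewrite (_ : (0%:Z)%:~R = 0 :> F)// !mul0r !scale0r act0r !addr0.
    + have -> : K.+1%:Z - 1 = K%:Z by lia.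
      rewrite (_ : zz K.+1%:Z = 0)// (_ : zz K%:Z = 0)//.
      by rewrite !act0r oppr0 !scaler0 oppr0 scaler0 !addr0.
    have -> : Negz j - 1 = Negz j.+1 by rewrite !NegzE; lia.
    rewrite /zz [act hh _]actZr (wzz j.+1 (cor al)) !evD evMn (corr2 hss hcart ra) lak.
    rewrite [act e _]actZr -[act e (iter j (act e) (ps y))]/(iter j.+1 (act e) (ps y)).
    rewrite -[cval 0 _]/(0 : W) !scalerA -!scaleNr !scalerA -!scalerDl.
    apply/eqP; rewrite scaler_eq0; apply/orP; left; apply/eqP => /=.
    have j0 : (j.+1%:R : F) != 0 by rewrite pnatr_eq0.
    have k0 : (k.+2%:R + j%:R : F) != 0 by rewrite -natrD pnatr_eq0.
    rewrite NegzE mulrNz -pmulrn natrD.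
    have -> : (k.+2%:R : F) = k%:R + 2%:R by rewrite -natrD addn2.
    have -> : (j.+1%:R : F) = j%:R + 1 by rewrite -natr1.
    rewrite -natr1 in j0; rewrite -addn2 natrD in k0.
    by field; rewrite j0 k0.
  - move=> x mx; apply: (cval_eq (aD := fD)) => K; rewrite cE big1// => j _.
    have mj : ms (iter j (brk f) x) by elim: (nat_of_ord j) => //= l; apply: (msf sal).
    suff -> : act (iter j (brk f) x) (zz (K - j%:Z)) = 0 by rewrite scaler0.
    case: (K - _) => [K'|j']; rewrite /zz ?act0r// actZr.
    by rewrite (m_iter j' (fun x => mse sal) mps mj) scaler0.
have [th hth thv] := uv _ _ sz.
pose Z := gprod X C; pose io (de : D) : Z := (i de, th de).
have hio : is_hom io by split=> [c u w|x u]; rewrite /io ?hi.1 ?hth.1 ?hi.2 ?hth.2.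
have Zi (p : Z) : act f p = 0 -> p = 0.
  case: p => x c E; congr pair; [apply: fi; exact: (congr1 fst E)|apply: (comp_inj (aD := fD)); exact: (congr1 snd E)].
have Zs (p : Z) : exists p', act f p' = p.
  case: p => x c; have [x' xE] := fs x; have [c' cE'] := comp_surj (aD := fD) c.
  by exists (x', c'); congr pair.
pose S (p : Z) := @prel F L e X _ N n N1 nile sI (cev0 p.2) p.1.
have sS : submodule S := submodule_pre (@hom_swap X C W _ (cev0_hom fD W)) (prel_sub nile sI sN1 gN1).
have Sv M p : iter M (act f) p = io v -> S p.
  case: p => x c; rewrite iter_pair => -[xE cE'].
  have cvE : cev0 c = zz (- M%:Z).
    have cS m K : cval (iter m (act f) c) K = cval c (K + m%:Z).
      elim: m K => [|m IH] K; first by rewrite addr0.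
      by rewrite iterS cval_a IH; congr (cval c); lia.
    by rewrite /cev0 -[0](addNr M%:Z) -cS cE' thv.
  rewrite /S /= cvE; case: M xE {cE' cvE} => [|j] /= xE.
    rewrite xE; have -> : (0 : W) = ps (i v) by rewrite /ps psi_Z//; exists v.
    exact: prel_psi.
  have -> : x = divc k j *: iter j (act e) y.
    by apply: (iter_inj (N := j.+1) fi); rewrite (sat_div dv lak hi fi yE); exact: xE.
  have := prel_sub nile sI sN1 gN1 => sP.
  have P0 := prel_psi n (nila := nile) (sZ := sI) sN1 y.
  have := subZ (submodule_sub sP) (divc k j) (@iter_act_sub F L (gprod W X) e _ j (ps y, y) sP P0).
  by rewrite iter_pair.
have [M [de deE]] := hsat z; have [c cE'] := iter_surj M (th de) (@comp_surj F L f _ fD W).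
have Szc : S (z, c).
  by apply: (saturation_gen nilf gv hio Zi Zs sS Sv (N := M) (de := de)); rewrite iter_pair /= deE cE'.
(* Since $ez$ is the image of [de1], both sides agree after applying a power of [f], which is
   injective on sequences. *)
have ec : act e c = th de1.
  have sT := satur_sub nilf (submodule_im hio).
  have [M' [de2]] : exists M', exists de2, io de2 = iter M' (act f) (act e ((z, c) : Z)).
    by apply: (submodule_act e sT); exists M, de; rewrite iter_pair /= deE cE'.
  rewrite iter_pair => -[E1 E2]; apply: (iter_inj (N := M') (@comp_inj F L f _ fD W)).
  rewrite -E2 -(hom_iter _ _ _ hth); congr th; apply: ii; rewrite E1 (hom_iter _ _ _ hi) de1E //.
(* The entry at 0 vanishes for the generator, hence on the whole image of [th]; so [e] kills the
   entry of [c]. *)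
have c0 : cev0 c = 0.
  apply: (@pairW_inj F L e X _ N nile sI ei); rewrite -(hom_act (cev0_hom fD W)) ec.
  apply: (gv (fun w => cev0 (th w) = 0)); last by rewrite thv.
  exact: (submodule_ker (hom_comp hth (cev0_hom fD W))).
move: Szc; rewrite /S /= c0 => /(prel0 sN1 nN1) Hz.
have [K KP] := sat_big dv lak hi fi fs hsat yE mu.
apply: contrapT => nz; have [|xi] := @anul_separate F L e X _ nile sI z K.
  move=> de' w [de2 de2E] E.
  have zw : exists de, i de = z - iter K (act e) w by exists de2; rewrite E de2E addrK.
  have [x' wx' [de3 de3E]] := weight_preimage re1 sI (sat_wmod dv lak hi fi fs hsat yE) wz zw.
  have [de4 de4E] := KP _ wx'; apply: nz; exists (de3 + iter K (act e) de4).
  by rewrite (homD hi) de3E (hom_iter _ _ _ hi) de4E subrK.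
by rewrite Hz => /eqP; rewrite eq_sym oner_eq0.
Qed.
End Localized.

(** * Linkage *)

Lemma direct_proj (F : fieldType) (V : lmodType F) (P Q : V -> Prop) : subspace P -> subspace Q ->
  (forall v, P v -> Q v -> v = 0) -> (forall v, exists p q, [/\ P p, Q q & v = p + q]) ->
  exists pr : V -> V, [/\ linear pr, forall v, P (pr v), forall v, Q (v - pr v)
    & forall p q, P p -> Q q -> pr (p + q) = p].
Proof.
move=> sP sQ PQ0 PQ.
have /choice[pr prP] v : exists p, P p /\ Q (v - p).
  by have [p [q [Pp Qq ->]]] := PQ v; exists p; rewrite addrC addKr.
have uniq v p : P p -> Q (v - p) -> pr v = p.
  move=> Pp Qp; have [Ppr Qpr] := prP v; apply/eqP; rewrite -subr_eq0; apply/eqP; apply: PQ0.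
    exact: (subB sP).
  by have := subB sQ Qp Qpr; congr Q; lmod F.
exists pr; split=> [a u v|v|v|p q Pp Qq]; [|by case: (prP v)|by case: (prP v)|].
  have [[Pu Qu] [Pv Qv]] := (prP u, prP v); apply: uniq; first exact: (subZD sP).
  by have := subZD sQ a Qu Qv; congr Q; lmod F.
by apply: uniq => //; rewrite addrC addKr.
Qed.

Section Linkage.
Variables (F : numClosedFieldType) (L : lieAlgebra F) (h b : {vspace L}).
Local Notation hd := 'Hom(subvs_of h, F^o).
Hypotheses (hss : semisimple L) (hcart : cartan h) (hb : borel b) (hhb : (h <= b)%VS).
Implicit Types (be ga la mu : hd) (w c d : weyl h).
Local Notation cor := (cor hss hcart).
Local Notation re := (re hss hcart).
Local Notation rf := (rf hss hcart).
Local Notation pos := (pos_root b).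
Local Notation simple := (simple_root b).
Local Notation tt0 := (tt0 b hss hcart).
Local Notation sing := (singular_vec b).
Local Notation srm := (srm hss hcart).
Local Notation Br := (Br b hss hcart).
Local Notation "'wt0' w" := (dot b (weyl_fun w) 0) (at level 10, w at level 9).
Let pos_tt0 := @pos_tt0 F L h b hss hcart hb hhb.
Variable Delta : weyl h -> gmod L.
Hypothesis hD : forall w : weyl h, is_verma b (dot b w 0) (Delta w).
Local Notation vt := (vt hD).
Let vtP := vtP hD.

(* Every extension of the Verma module of weight la by N splits. *)
Definition LP la (N : gmod L) := forall (E : gmod L) (j : N -> E), is_hom j -> injective j ->
  forall u : E, weight_vec la u -> (forall x, x \in brkv b b -> exists n, j n = act x u) ->
  exists2 m, weight_vec la m & sing la (u - j m).

(** All weights $c\cdot0$ have level at most 0, with equality only for the identity, so [Delta c]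
    has no weight of positive level. *)
Lemma linkage_id : (forall c (v : Delta c), v != 0 -> sing (wt0 (wid h)) v -> Br c (wid h)) /\
  (forall c, LP (wt0 (wid h)) (Delta c)).
Proof.
rewrite dot1; split=> [c v v0 [wv _]|c E j hj ji u wu nu].
  have [k [kE kw]] := dot_level hss hcart hb hhb c.
  have [[E _]|[l lE]] := vtop_level hss hcart hb hhb (vtP c) v0 wv.
    rewrite -kw; first exact: Br0.
    by apply/eqP; rewrite -(eqr_nat F) -[_%:R]opprK -kE -E ev0 oppr0.
  by move/eqP: lE; rewrite ev0 subr0 kE eq_sym -subr_eq0 opprK -natrD pnatr_eq0.
exists 0; first exact: weight0.
rewrite (hom0 hj) subr0; apply: (singularP hss hcart hb hhb wu) => be x pb rx.
have [n nE] : exists n, j n = act x u.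
  by apply: nu; apply/(nplusP hss hcart hb hhb); apply: wsum1 pb rx.
have wn : weight_vec (be + 0) n by apply: (hom_inj_weight hj ji); rewrite nE; apply: weight_act.
rewrite -nE; have [->|n0] := eqVneq n 0; first exact: (hom0 hj).
have [k [kE _]] := dot_level hss hcart hb hhb c; have [m mE] := pos_tt0 pb.
have H l : (wt0 c tt0 : F) - ((be + 0) tt0 : F) <> l%:R.
  by rewrite addr0 kE mE -opprD => /eqP; rewrite eq_sym -subr_eq0 opprK -!natrD pnatr_eq0 !addnS.
have [[E2 _]|[l lE]] := vtop_level hss hcart hb hhb (vtP c) n0 wn; last by case: (H _ lE).
by case: (H 0%N); rewrite E2 subrr.
Qed.

Section Step.
Variables (al : hd) (sal : simple al).
Local Notation e := (re al).
Local Notation f := (rf al).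
Local Notation hh := (vsval (cor al)).
Local Notation ms := (@msum F L h b al).
Let ra : is_root al := sal.1.1.
Let tr := rtriple hss hcart ra.
Let tr2 := rsl2 hss hcart ra.
Let nile : adnil e. Proof. by case: (rnil hss hcart ra). Qed.
Let nilf : adnil f. Proof. by case: (rnil hss hcart ra). Qed.
Let mse := @msum_e F L h b hss hcart hb hhb al.
Let msf := @msum_f F L h b hss hcart hb hhb al.
Let re1 : root_vec al e. Proof. by case: tr. Qed.
Let rf1 : root_vec (- al) f. Proof. by case: tr. Qed.

Lemma up_data c : up b al c -> exists k : nat,
  (wt0 c (cor al) : F) = k%:R /\ wt0 (srm al c) = wt0 c - al *+ k.+1.
Proof.
move=> uc; have [k kE] := up_rho hss hcart hb hhb sal uc; exists k.
rewrite (dot_cor hss hcart hb hhb _ sal) kE dot_srm// kE scaler_nat -natr1 addrK; split=> //.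
Qed.
Lemma dn_data c : dn b al c -> exists k : nat,
  (wt0 (srm al c) (cor al) : F) = k%:R /\ wt0 c = wt0 (srm al c) - al *+ k.+1.
Proof. by move=> /(dn_srm hss hcart ra)/up_data[k [kE E]]; exists k; rewrite -E srmK. Qed.

Lemma up_embed c : up b al c -> exists (k : nat) (j : Delta (srm al c) -> Delta c),
  [/\ is_hom j, injective j, (wt0 c (cor al) : F) = k%:R, wt0 (srm al c) = wt0 c - al *+ k.+1 /\
      j (vt (srm al c)) = iter k.+1 (act f) (vt c) & forall z, exists N de, iter N (act f) z = j de].
Proof.
move=> uc; have [k [kE E]] := up_data uc; have dv' := vtP (srm al c); rewrite E in dv'.
by have [j [hj ji jv jn]] := verma_embed hb hhb hD sal (vtP c) kE dv'; exists k, j.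
Qed.
Lemma dn_embed c : dn b al c -> exists (k : nat) (j : Delta c -> Delta (srm al c)),
  [/\ is_hom j, injective j, (wt0 (srm al c) (cor al) : F) = k%:R, wt0 c = wt0 (srm al c) - al *+ k.+1 /\
      j (vt c) = iter k.+1 (act f) (vt (srm al c)) & forall z, exists N de, iter N (act f) z = j de].
Proof.
move=> dc; have [k [kE E]] := dn_data dc; have dv' := vtP c; rewrite E in dv'.
by have [j [hj ji jv jn]] := verma_embed hb hhb hD sal (vtP (srm al c)) kE dv'; exists k, j.
Qed.

Let finj c (z : Delta c) : act f z = 0 -> z = 0.
Proof. exact: (verma_finj hb hhb hD sal (vtP c)). Qed.

Variables (w : weyl h) (k : nat).
Hypotheses (dw : dn b al w) (sk : (wt0 (srm al w) (cor al) : F) = k%:R)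
  (wE : wt0 w = wt0 (srm al w) - al *+ k.+1).
Let us : up b al (srm al w) := dn_srm hss hcart ra dw.
Hypothesis IHH : forall c (v : Delta c), v != 0 -> sing (wt0 (srm al w)) v -> Br c (srm al w).
Hypothesis IHL : forall c, ~ Br c (srm al w) -> LP (wt0 (srm al w)) (Delta c).

Let wk : (wt0 w (cor al) : F) = - k.+2%:R.
Proof.
rewrite wE evD evN evMn sk (corr2 hss hcart ra).
have -> : (k.+2%:R : F) = k%:R + 2%:R by rewrite -natrD addn2.
by rewrite -natr1; ring.
Qed.
Let sw_w : Br (srm al w) w.
Proof.
apply: Br1; rewrite -{2}[w](srmK hss hcart w ra); apply: up_garrow => //; exact: sal.1.
Qed.

(** In the localization of the larger module [Delta d], division by $f^{k+1}$ gives a singular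
    vector of the reflected weight. Being killed by [e], it lies in [Delta d] by [sat_e_closed], and
    the induction hypothesis applies; [Br_lift] returns to [c] and [w]. *)
Lemma step_sing_dn c (v : Delta c) : dn b al c -> v != 0 -> sing (wt0 w) v -> Br c w.
Proof.
move=> dc v0 sv; have [kd [j [hj ji kdE [dE jv] jn]]] := dn_embed dc.
pose d := srm al c; have ud : up b al d := dn_srm hss hcart ra dc.
have [X [io [hio fi fs io0 ios]]] := localization (Delta d) nilf.
have ioi : injective io.
  by apply: (hom_inj hio) => u /io0[m]; apply: finj_iter; apply: finj.
have [v' v'E] := iter_surj k.+1 (io (j v)) fs.
have sv' : sing (wt0 (srm al w)) v'.
  apply: (sing_up hb hhb sal fi sk); rewrite v'E -wE; apply: hom_sing => //; exact: hom_sing.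
have hsat (x : X) : exists N de, iter N (act f) x = io de by have [N [m E]] := ios x; exists N, m.
have [|de deE] := sat_e_closed hb hhb hD sal (vtP d) kdE hio ioi fi fs hsat sv'.1.
  by exists 0; rewrite (hom0 hio) (sing_e hss hcart hb hhb sal sv').
have de0 : de != 0.
  apply: contra_neq v0 => de0; apply: ji; apply: ioi.
  by rewrite -v'E -deE de0 (hom0 hio) iter_act0 (hom0 hj) (hom0 hio).
have sde : sing (wt0 (srm al w)) de by apply: (hom_inj_sing hio ioi); rewrite deE.
have := Br_lift hb hhb sal (IHH de0 sde) ud us.
by rewrite !srmK.
Qed.

(** For [up], the class of [v] modulo the smaller Verma module is killed by [e], nilpotent for [f]
    and of negative sl2-weight, hence zero. This reduces to the other case. *)
Lemma step_sing c (v : Delta c) : v != 0 -> sing (wt0 w) v -> Br c w.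
Proof.
move=> v0 sv; have [uc|dc] := up_or_dn hss hcart hb hhb c ra; last exact: step_sing_dn dc v0 sv.
have [kc [j [hj ji kcE [cE jv] jn]]] := up_embed uc.
have sI : submodule (fun z => exists de, j de = z) := submodule_im hj.
have hq := qpi_hom sI.
have [v1 v1E] : exists v1, j v1 = v.
  apply/(qpi0P sI); have [N [de E]] := jn v.
  apply: (@sl2_injE F L _ e f hh tr2 k.+2 N).
  - by rewrite (hom_weight hq sv.1 (cor al)) wk.
  - by rewrite iterSr -(hom_act hq) (sing_e hss hcart hb hhb sal sv) (hom0 hq) iter_act0.
  - by rewrite -(hom_iter _ _ _ hq) E; apply/qpi0P; exists de.
have s1 : sing (wt0 w) v1 by apply: (hom_inj_sing hj ji); rewrite v1E.
have v10 : v1 != 0 by apply: contra_neq v0 => E; rewrite -v1E E (hom0 hj).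
apply: Br_trans (step_sing_dn (up_srm hss hcart ra uc) v10 s1).
by apply: Br1; apply: up_garrow uc; exact: sal.1.
Qed.

Lemma act_killed (X : gmod L) (a x : L) (u : X) j : act a u = 0 ->
  iter j (act a) (act x u) = act (iter j (brk a) x) u.
Proof. by move=> au; elim: j => //= j ->; rewrite act_comm au act0r add0r. Qed.

(** With [verma_esurj] arrange that [e] kills [u], divide by $f^{k+1}$ in the localization of [E],
    and correct there by an element of [Delta d], using the induction hypothesis. Multiplied by
    $f^{k+1}$, the correction falls into [Delta c]. *)
Lemma step_lift_dn c : dn b al c -> ~ Br c w -> LP (wt0 w) (Delta c).
Proof.
move=> dc ncw E j0 hj0 ij0 u wu nu.
have [kd [jj [hjj ijj kdE [dE jv] jn]]] := dn_embed dc.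
pose d := srm al c; have ud : up b al d := dn_srm hss hcart ra dc.
have ndw : ~ Br d (srm al w) by move=> H; apply: ncw; have := Br_lift hb hhb sal H ud us; rewrite !srmK.
have [n1 n1E] := nu e (re_nplus hss hcart hb hhb sal.1).
have wn1 : weight_vec (wt0 w + al) n1.
  by apply: (hom_inj_weight hj0 ij0); rewrite n1E addrC; apply: weight_act.
have ck : (wt0 c (cor al) : F) = - kd.+2%:R.
  rewrite dE evD evN evMn kdE (corr2 hss hcart ra).
  have -> : (kd.+2%:R : F) = kd%:R + 2%:R by rewrite -natrD addn2.
  by rewrite -natr1; ring.
have [u1 wu1 u1E] := verma_esurj hb hhb sal (vtP c) ck wn1; rewrite addrK in wu1.
pose u2 := u - j0 u1.
have wu2 : weight_vec (wt0 w) u2 by apply: (subB (weight_sub _ _)) => //; apply: hom_weight wu1.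
have eu2 : act e u2 = 0 by rewrite actBr -n1E -(hom_act hj0) u1E subrr.
have nu2 x : x \in brkv b b -> exists n, j0 n = act x u2.
  by move=> /nu[n nE]; exists (n - act x u1); rewrite (homB hj0) nE (hom_act hj0) actBr.
have [X [io [hio fi fs io0 ios]]] := localization E nilf.
have ioj0 z : io (j0 z) = 0 -> z = 0.
  move=> /io0[m]; rewrite -(hom_iter _ _ _ hj0) => H; apply: (finj_iter (k := m) (@finj c)).
  by apply: ij0; rewrite H (hom0 hj0).
have [u' u'E] := iter_surj k.+1 (io u2) fs.
have wu' : weight_vec (wt0 (srm al w)) u'.
  by apply: (@finj_wt F L h b hss hcart al sal X _ u' k.+1 fi); rewrite u'E -wE; apply: hom_weight.
have eu' : act e u' = 0.
  by apply: (finj_e sal fi wu' sk); rewrite u'E -(hom_act hio) eu2 (hom0 hio).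
have [v' v'E] := iter_surj kd.+1 (io (j0 (vt c))) fs.
have [_ svc gvc uvc] := vtP c; have [_ svd gvd uvd] := vtP d.
have sv' : sing (wt0 d) v'.
  by apply: (sing_up hb hhb sal fi kdE); rewrite v'E -dE; do 2! apply: hom_sing => //.
have [i hi ivE] := uvd _ _ sv'.
have ijjE z : i (jj z) = io (j0 z).
  apply: (gvc (fun z => i (jj z) = io (j0 z))).
  - split=> [|a z1 z2 E1 E2|x z1 E1]; first by rewrite (hom0 hjj) (hom0 hi) (hom0 hj0) (hom0 hio).
      by rewrite hjj.1 hi.1 hj0.1 hio.1 E1 E2.
    by rewrite (hom_act hjj) (hom_act hi) (hom_act hj0) (hom_act hio) E1.
  - by rewrite jv (hom_iter _ _ _ hi) ivE.
have ii : injective i.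
  apply: (hom_inj hi) => z iz; have [N [de E1]] := jn z; apply: (finj_iter (k := N) (@finj d)); rewrite E1.
  by rewrite [de]ioj0 ?(hom0 hjj)// -ijjE -E1 (hom_iter _ _ _ hi) iz iter_act0.
(* The [f]-saturation of the image of [Delta d]: it has the shape that [sat_e_closed] requires. *)
pose S (x : X) := exists N, exists de, i de = iter N (act f) x.
have sS : submodule S := satur_sub nilf (submodule_im hi).
have fq (x : quog sS) : act f x = 0 -> x = 0.
  have [z <-] := qpi_surj x; rewrite -(hom_act (qpi_hom sS)) => /qpi0P[N [de E1]].
  by apply/qpi0P; exists N.+1, de; rewrite iterSr.
have mS x : ms x -> S (act x u').
  move=> mx; apply/(qpi0P sS); rewrite (hom_act (qpi_hom sS)).
  apply: (finj_m hb hhb sal (k := k.+1) fq) => // y my.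
  rewrite -(hom_iter _ _ _ (qpi_hom sS)) u'E -(hom_act (qpi_hom sS)) -(hom_act hio); apply/qpi0P.
  have [n <-] := nu2 y (msum_nplus hss hcart hb hhb my).
  by exists 0%N, (jj n); rewrite ijjE.
have iS z : S (i z) by exists 0%N, z.
have [i' hi' i'E] := @sub_corestr F L X S sS _ i hi iS.
have ii' : injective i' by move=> z1 z2 E1; apply: ii; rewrite -!i'E E1.
have fiS (x : subg sS) : act f x = 0 -> x = 0.
  move=> /(congr1 (@sinc F L X S sS)); rewrite (hom_act (sinc_hom sS)) (hom0 (sinc_hom sS)) => /fi E1.
  by apply: (@sinc_inj F L X S sS); rewrite E1 (hom0 (sinc_hom sS)).
have fsS (x : subg sS) : exists x', act f x' = x.
  have [x' x'E] := fs (sinc x); have [N [de E1]] := sincP x.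
  have Sx' : S x' by exists N.+1, de; rewrite iterSr x'E.
  by exists (smk sS Sx'); apply: (@sinc_inj F L X S sS); rewrite (hom_act (sinc_hom sS)).
have satS (x : subg sS) : exists N de, iter N (act f) x = i' de.
  have [N [de E1]] := sincP x; exists N, de; apply: (@sinc_inj F L X S sS).
  by rewrite (hom_iter _ _ _ (sinc_hom sS)) i'E.
have clos D mu (z : X) : weight_vec mu z -> S z -> iter D (act e) z = 0 -> exists de, i de = z.
  elim: D mu z => [|D IH] mu z wz Sz; first by move=> /= ->; exists 0; rewrite (hom0 hi).
  rewrite iterSr => Dz; have [de deE] := IH _ _ (weight_act re1 wz) (submodule_act e sS Sz) Dz.
  have wz' : weight_vec mu (smk sS Sz) by apply: (hom_inj_weight (sinc_hom sS) (@sinc_inj F L X S sS)).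
  have [|de' de'E] := sat_e_closed hb hhb hD sal (vtP d) kdE hi' ii' fiS fsS satS wz'.
    exists de; apply: (@sinc_inj F L X S sS); by rewrite i'E (hom_act (sinc_hom sS)).
  by exists de'; rewrite -i'E de'E.
have nu' x : x \in brkv b b -> exists n, i n = act x u'.
  move=> /(nplus_split hss hcart hb hhb al)[a [y [s sP ->] ->]].
  rewrite actDl actZl eu' scaler0 add0r act_suml; have sI := submodule_sub (submodule_im hi).
  apply: (sub_sum_seq sI) => p /sP[pp rp]; have [D pD] := nile p.2.
  apply: (clos D _ _ (weight_act rp wu')); first by apply: mS; apply: wsum1 rp.
  by rewrite act_killed// pD act0l.
have [m0 wm0 sm0] := IHL ndw hi ii wu' nu'.
have em0 : act e m0 = 0.
  apply: ii; rewrite (hom0 hi) (hom_act hi); have := sing_e hss hcart hb hhb sal sm0.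
  by rewrite actBr eu' sub0r => /eqP; rewrite oppr_eq0 => /eqP.
have sJ := submodule_im hjj; have hq := qpi_hom sJ.
(* Modulo [Delta c] the vector [m0] is killed by [e], nilpotent for [f] and of sl2-weight [k], so
   $f^{k+1}$ kills it. *)
have [m1 m1E] : exists m1, jj m1 = iter k.+1 (act f) m0.
  apply/(qpi0P sJ); rewrite (hom_iter _ _ _ hq).
  have [->|m00] := eqVneq (qpi sJ m0) 0; first exact: iter_act0.
  have [N [de E1]] := jn m0.
  have Nz : iter N (act f) (qpi sJ m0) = 0 by rewrite -(hom_iter _ _ _ hq) E1; apply/qpi0P; exists de.
  have ez : act e (qpi sJ m0) = 0 by rewrite -(hom_act hq) em0 (hom0 hq).
  have [k' ] := sl2_hw_nat tr2 m00 (hom_weight hq wm0 (cor al)) ez Nz.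
  by rewrite sk => /eqP; rewrite eqr_nat => /eqP <-.
have wm1 : weight_vec (wt0 w) m1.
  by apply: (hom_inj_weight hjj ijj); rewrite m1E wE; apply: (wt_fn hss hcart sal).
exists (u1 + m1); first exact: (subD (weight_sub _ _)).
have -> : u - j0 (u1 + m1) = u2 - j0 m1 by rewrite (homD hj0) /u2; lmod F.
split; first by apply: (subB (weight_sub _ _)) => //; apply: hom_weight wm1.
move=> x xn; have [n nE] : exists n, j0 n = act x (u2 - j0 m1).
  by have [n nE] := nu2 x xn; exists (n - act x m1); rewrite (homB hj0) nE (hom_act hj0) actBr.
rewrite -nE [n]ioj0 ?(hom0 hj0)// nE (hom_act hio) (homB hio) -ijjE m1E (hom_iter _ _ _ hi) -u'E.
rewrite -scaleN1r -iter_actZ -iter_actD scaleN1r.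
by have [_] := sing_down hb hhb sal sm0 sk; apply.
Qed.

Lemma loc_nil c (z : Delta c) : exists N, iter N (act e) z = 0.
Proof.
have [_ sv gv _] := vtP c; apply: (gv _ (nil_sub _ nile)).
exists 1%N; exact: (sing_e hss hcart hb hhb sal sv).
Qed.

(** That is zero, [al] and the negative roots; for simple [al] their weight spaces span a complement
    of [msum] stable under the sl2 of [al]. *)
Definition oth be := (be = 0 \/ is_root be) /\ ~ (pos be /\ be != al).

Lemma wsum_h (Q : hd -> Prop) (t : subvs_of h) (x : L) : wsum Q x -> wsum Q (brk (vsval t) x).
Proof.
move=> [s sP ->]; have := @act_sumr F L (adj L) (vsval t) _ s xpredT snd => /= ->.
apply: (sub_sum_seq (wsum_sub _)) => p /sP[qp rp]; rewrite rp; apply: wsum1 qp _; exact: root_vecZ.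
Qed.

Lemma oth_e (x : L) : wsum oth x -> wsum oth (brk e x).
Proof.
apply: (@wsum_brk F L h (eq al)) => [_ be u v <- [rb nb] ru rv|]; last exact: wsum1 re1.
have [->|uv0] := eqVneq (brk u v) 0; [by left|right].
have ruv := root_vec_brk ru rv; split.
  by have [->|n0] := eqVneq (al + be) 0; [left|right; split=> //; exists (brk u v)].
move=> [pab]; rewrite -subr_eq0 addrC addKr => be0; case: rb => [E|rb]; first by rewrite E eqxx in be0.
have [pb|pb] := pos_or hss hcart hb hhb rb.
  have [E|ne] := eqVneq be al; last by apply: nb.
  by apply: (root_nmul hss hcart ra (isT : 1 < 2)%N); rewrite mulr2n -{2}E; exact: pab.1.
by case: sal.2; exists (al + be), (- be); split=> //; rewrite addrK.
Qed.

Lemma oth_f (x : L) : wsum oth x -> wsum oth (brk f x).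
Proof.
apply: (@wsum_brk F L h (eq (- al))) => [_ be u v <- [rb nb] ru rv|]; last exact: wsum1 rf1.
have [->|uv0] := eqVneq (brk u v) 0; [by left|right].
have ruv := root_vec_brk ru rv; rewrite addrC in ruv *; split.
  by have [->|n0] := eqVneq (be - al) 0; [left|right; split=> //; exists (brk u v)].
move=> [pab _]; have [n nE] := pos_tt0 pab; have [m mE] := pos_tt0 sal.1.
case: rb => [E|rb]; first by apply: (pos_opp hss hcart hb hhb sal.1); rewrite -[- al]add0r -E.
have [pb|/pos_tt0[l lE]] := pos_or hss hcart hb hhb rb.
  have [E|ne] := eqVneq be al; last by apply: nb.
  by move: pab.1 => [+ _]; rewrite E subrr eqxx.
have : (n.+1%:R + l.+1%:R + m.+1%:R : F) == 0 by rewrite -nE -lE -mE evD !evN; apply/eqP; ring.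
by rewrite -!natrD pnatr_eq0.
Qed.

Lemma ms_proj : exists pr : L -> L, [/\ linear pr, forall x, ms (pr x), forall x, ms x -> pr x = x
  & forall y x, y \in [:: e; f; hh] -> pr (brk y x) = brk y (pr x)].
Proof.
have [x [s sP ->] [s' sP' E]|x|pr [lpr mpr opr uniq]] := @direct_proj F L ms (wsum oth) (wsum_sub _) (wsum_sub _).
- have ws : @wdec F L h (adj L) s by move=> p /sP[].
  have wss : @wdec F L h (adj L) (s ++ [seq (p.1, - p.2) | p <- s']).
    move=> p; rewrite mem_cat => /orP[/ws//|/mapP[q /sP'[_ wq] ->]].
    by apply: (subN (@weight_sub F L h (adj L) _)).
  rewrite (big_fst_undup s) big_seq big1// => la; rewrite mem_undup => /mapP[p /sP[qp _] ->].
  have := wdec_comp0 p.1 wss; rewrite !big_cat !big_map /= sumrN E subrr => /(_ erefl).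
  rewrite sumrN => /subr0_eq ->; rewrite big_seq_cond big1// => q /andP[/sP'[[_ nq] _] /eqP E1].
  by case: nq; rewrite E1.
- have [s sP ->] := root_decl hcart x.
  have sD := subspaceD (P := ms) (Q := wsum oth) (wsum_sub _) (wsum_sub _).
  have [p [q [mp oq E]]] : exists p q : L, [/\ ms p, wsum oth q & \sum_(r <- s) r.2 = p + q]; last by exists p, q.
  apply: (sub_sum_seq sD) => p /sP[rp rt]; have [pp|np] := pselect (pos p.1 /\ p.1 != al).
    by exists p.2, 0; split; [exact: wsum1 rp|exact: sub0 (wsum_sub _)|rewrite addr0].
  by exists 0, p.2; split; [exact: sub0 (wsum_sub _)|apply: wsum1 rp|rewrite add0r].
exists pr; split=> // [x mx|y x yi].
  by rewrite -{1}[x]addr0; apply: uniq => //; exact: sub0 (wsum_sub _).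
rewrite -{1}[x](subrK (pr x)) addrC brkDr; apply: uniq.
  by move: yi; rewrite !inE => /or3P[] /eqP ->; [exact: mse sal (mpr x)|exact: msf sal (mpr x)|exact: (wsum_h (cor al) (mpr x))].
by move: yi; rewrite !inE => /or3P[] /eqP ->; [exact: (oth_e (opr x))|exact: (oth_f (opr x))|exact: (wsum_h (cor al) (opr x))].
Qed.

(** Leibniz again, now for linear maps: [a] is nilpotent on [L] and on the values, with a uniform
    exponent on values because [L] has finite dimension. *)
Lemma homg_nil (M : gmod L) (a : L) (ps : homg (antihom_opp L) (adj L) M) : adnil a ->
  (forall x, exists N, iter N (act a) (hval ps x) = 0) -> exists N, iter N (act a) ps = 0.
Proof.
move=> nil psn; have [D aD] := adnil_unif nil.
have [N NE] : exists N, forall x, iter N (act a) (hval ps x) = 0.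
  have [N NP] : exists N, forall x, x \in (vbasis {:L} : seq L) -> iter N (act a) (hval ps x) = 0.
    elim: (vbasis {:L} : seq L) => [|x s [N NP]]; first by exists 0%N.
    have [N' xN] := psn x; exists (N + N')%N => y; rewrite inE => /predU1P[->|/NP yN].
      by rewrite iterD xN iter_act0.
    by rewrite addnC iterD yN iter_act0.
  exists N => x; have sN : subspace (fun x : L => iter N (act a) (hval ps x) = 0).
    split=> [|c y z hy hz]; first by rewrite hval0r iter_act0.
    by rewrite (hval_lin ps) iter_actD iter_actZ hy hz scaler0 addr0.
  rewrite (coord_vbasis (memvf x)); apply: (sub_sum sN) => i _; apply: (subZ sN); apply: NP.
  by apply: mem_nth; rewrite size_tuple.
have : forall x, hval ps (iter D (brk a) x) = 0 by move=> x; rewrite aD hval0r.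
exists (N + D)%N; move: {2}(N + D)%N (leqnn (N + D)) => s.
elim: s N D ps NE H {psn aD} => [|s IH] N D ps NE DE; last case: N NE => [|N] NE;
  last case: D DE => [|D] DE.
- by rewrite leqn0 addn_eq0 => /andP[/eqP N0 /eqP ->]; apply: hval_eq => x; have := NE x; rewrite N0.
- by move=> _; rewrite (_ : ps = 0) ?iter_act0//; apply: hval_eq => x; apply: NE.
- by move=> _; rewrite (_ : ps = 0) ?iter_act0//; apply: hval_eq => x; apply: DE.
have lA : linear (fun x : adj L => act a (hval ps x)) by move=> c x y; rewrite (hval_lin ps) actDr actZr.
have lB : linear (fun x : adj L => hval ps (brk a x)) by move=> c x y; rewrite brk_linr (hval_lin ps).
pose A := hmk (antihom_opp L) lA; pose B := hmk (antihom_opp L) lB => le.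
have E : act a ps = A + (-1) *: B.
  apply: hval_eq => x; rewrite hval_act hvalD hvalZ !hmkE; congr (_ + _).
  by rewrite (_ : act (- a) (x : adj L) = (-1) *: brk a x) ?hvalZr// scaleN1r -brkNl.
rewrite addSn iterSr E iter_actD iter_actZ.
rewrite (IH N D.+1 A) ?add0r; [|by move=> x; rewrite hmkE -iterSr; apply: NE|by move=> x; rewrite hmkE DE act0r|lia].
rewrite addnS -addSn (IH N.+1 D B) ?scaler0//; last by lia.
by move=> x; rewrite hmkE; apply: NE.
Qed.

(* The projection of L onto the span of the positive root spaces other than al
   commutes with the sl2 of al, so x |-> pr x u generates an sl2-module of linear maps. *)
Lemma ms_kill (M : gmod L) (u : M) : weight_vec (wt0 w) u -> iter k.+2 (act e) u = 0 ->
  (forall x, ms x -> exists N, iter N (act f) (act x u) = 0) -> forall x, ms x -> act x u = 0.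
Proof.
move=> wu eu fu; have [pr [lpr mpr prE prC]] := ms_proj.
have pr0 : pr 0 = 0 by apply: prE; exact: sub0 (wsum_sub _).
have lin (v : M) : linear (fun x : adj L => act (pr x) v) by move=> c x y; rewrite lpr actDl actZl.
pose ps v := hmk (antihom_opp L) (lin v).
have psa y v : y \in [:: e; f; hh] -> act y (ps v) = ps (act y v).
  move=> yi; apply: hval_eq => x; rewrite hval_act !hmkE.
  have -> : act (- y) (x : adj L) = - brk y x by rewrite -brkNl.
  have -> : pr (- brk y x) = - brk y (pr x).
    by rewrite -prC// -scaleN1r -[_ *: _]addr0 lpr pr0 addr0 scaleN1r.
  by rewrite actNl [act y (act _ _)]act_comm addrK.
have psi n v y : y \in [:: e; f; hh] -> iter n (act y) (ps v) = ps (iter n (act y) v).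
  by move=> yi; elim: n => // n IH; rewrite !iterS IH psa.
have [|N Nps] := @homg_nil M f (ps u) nilf; first by move=> x; rewrite hmkE; apply: fu.
have ps0 : ps u = 0.
  apply: (@sl2_injE F L _ e f hh tr2 k.+2 N) => //.
    rewrite psa ?inE ?eqxx ?orbT// (wu (cor al)) wk; apply: hval_eq => x.
    by rewrite hvalZ !hmkE actZr.
  rewrite psi ?inE ?eqxx// eu; apply: hval_eq => x; rewrite hmkE; exact: act0r.
by move=> x mx; have : hval (ps u) x = 0 :> M; [by rewrite ps0|rewrite hmkE prE].
Qed.

(** First make $e^{k+2}$ kill [u]. Modulo [Delta d], [ms_kill] disposes of the other positive root
    vectors, and $e^{k+1}u$ becomes singular of the weight of [srm al w]. It lifts to a singular
    vector of [Delta c], zero by induction; so $eu$ vanishes modulo [Delta d], and [step_lift_dn]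
    for [d] finishes. *)
Lemma step_lift_up c : up b al c -> ~ Br c w -> LP (wt0 w) (Delta c).
Proof.
move=> uc ncw E j0 hj0 ij0 u wu nu.
have [kc [jj [hjj ijj kcE [cE jv] jn]]] := up_embed uc.
pose d := srm al c; have dd : dn b al d := up_srm hss hcart ra uc.
have cd : Br c d by apply: Br1; apply: up_garrow uc; exact: sal.1.
have nds : ~ Br d (srm al w) by move=> H; apply: ncw; apply: Br_trans (Br_trans cd H) sw_w.
have ncs : ~ Br c (srm al w) by move=> H; apply: ncw; apply: Br_trans H sw_w.
have ndw : ~ Br d w by move=> H; apply: ncw; apply: Br_trans H.
have [n1 n1E] := nu e (re_nplus hss hcart hb hhb sal.1).
have wn1 : weight_vec (wt0 w + al) n1.
  by apply: (hom_inj_weight hj0 ij0); rewrite n1E addrC; apply: weight_act.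
(* This is $e^{k+2}u$, of sl2-weight $k+2$; by [sl2_surjE] it is $e^{k+2}$ of a vector of [Delta c],
   which is then subtracted from [u]. *)
pose y := iter k.+1 (act e) n1.
have wy : weight_vec (wt0 w + al *+ k.+2) y.
  by have := wt_en hss hcart sal k.+1 wn1; rewrite -addrA -mulrS.
have yk : ((wt0 w + al *+ k.+2) (cor al) : F) = k.+2%:R.
  by rewrite evD evMn (corr2 hss hcart ra) wk; ring.
have [N Ny] := loc_nil y.
have [|z1 _ z1E] := @sl2_surjE F L _ _ _ _ tr2 k.+2 N y _ Ny; first by rewrite (wy (cor al)) yk.
have y0 : y - iter k.+2 (act e) z1 = 0 by rewrite z1E subrr.
have [z2 wz2 /subr0_eq z2E] := weight_preimage re1 (zero_sub _) (vtop_wmod hss hcart hb hhb (vtP c)) wy y0.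
rewrite addrK in wz2.
pose u1 := u - j0 z2.
have wu1 : weight_vec (wt0 w) u1 by apply: (subB (weight_sub _ _)) => //; apply: hom_weight wz2.
have eu1 : iter k.+2 (act e) u1 = 0.
  rewrite /u1 -scaleN1r iter_actD iter_actZ -(hom_iter _ _ _ hj0) -z2E /y (hom_iter _ _ _ hj0) n1E -iterSr.
  by rewrite scaleN1r subrr.
have nu1 x : x \in brkv b b -> exists n, j0 n = act x u1.
  by move=> /nu[n nE]; exists (n - act x z2); rewrite (homB hj0) nE (hom_act hj0) actBr.
have hjj0 := hom_comp hjj hj0; have sI := submodule_im hjj0; have hq := qpi_hom sI.
have fq n : exists N, iter N (act f) (qpi sI (j0 n)) = 0.
  have [M [de deE]] := jn n; exists M; rewrite -(hom_iter _ _ _ hq) -(hom_iter _ _ _ hj0) deE.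
  by apply/qpi0P; exists de.
have mq x : ms x -> act x (qpi sI u1) = 0.
  apply: ms_kill => [||y' my]; first exact: hom_weight wu1.
    by rewrite -(hom_iter _ _ _ hq) eu1 (hom0 hq).
  have [n nE] := nu1 y' (msum_nplus hss hcart hb hhb my).
  by rewrite -(hom_act hq) -nE.
have [n1' n1'E] := nu1 e (re_nplus hss hcart hb hhb sal.1).
have wn1' : weight_vec (wt0 w + al) n1'.
  by apply: (hom_inj_weight hj0 ij0); rewrite n1'E addrC; apply: weight_act.
pose n2 := iter k (act e) n1'.
have n2E : qpi sI (j0 n2) = iter k.+1 (act e) (qpi sI u1).
  by rewrite iterSr -(hom_act hq) -n1'E -(hom_iter _ _ _ hq) -(hom_iter _ _ _ hj0).
have wn2 : weight_vec (wt0 (srm al w)) n2.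
  have := wt_en hss hcart sal k wn1'; rewrite -addrA -mulrS; congr weight_vec.
  by rewrite wE subrK.
have s2 : sing (wt0 (srm al w)) (qpi sI (j0 n2)).
  apply: (@sing_em F L h b hss hcart hb hhb al); first by do 2! apply: (hom_weight _) => //.
    by rewrite n2E -iterS -(hom_iter _ _ _ hq) eu1 (hom0 hq).
  by rewrite n2E; apply: m_iter => // x; apply: mse.
have nn2 x : x \in brkv b b -> exists m, jj m = act x n2.
  move=> /s2.2; rewrite -(hom_act hq) => /qpi0P[m mE]; exists m; apply: ij0.
  by rewrite (hom_act hj0) -mE.
have [m2 wm2 sm2] := IHL nds hjj ijj wn2 nn2.
have n20 : n2 = jj m2.
  apply/eqP; rewrite -subr_eq0; apply: contrapT => /negP nz; exact: ncs (IHH nz sm2).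
have eq1 : act e (qpi sI u1) = 0.
  have [M Mn] := fq n1'; have E1 : qpi sI (j0 n1') = act e (qpi sI u1) by rewrite -(hom_act hq) n1'E.
  rewrite -E1 in Mn *; apply: (@sl2_injE F L _ e f hh tr2 k M) => //.
    have := hom_weight hq (hom_weight hj0 wn1') (cor al); rewrite evD wk (corr2 hss hcart ra) => ->.
    by congr (_ *: _); rewrite -addn2 natrD; ring.
  by rewrite E1 -iterSr -n2E n20; apply/qpi0P; exists m2.
have nu1' x : x \in brkv b b -> exists n, j0 (jj n) = act x u1.
  move=> /(nplus_split hss hcart hb hhb al)[a [y' my ->]]; apply/(qpi0P sI).
  by rewrite (hom_act hq) actDl actZl eq1 mq// scaler0 addr0.
have [m3 wm3 sm3] := step_lift_dn dd ndw hjj0 (inj_comp ij0 ijj) wu1 nu1'.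
exists (z2 + jj m3); first by apply: (subD (weight_sub _ _)) => //; apply: hom_weight wm3.
by have := sm3; congr (sing _ _); rewrite (homD hj0) /u1 /=; lmod F.
Qed.

Lemma step_lift c : ~ Br c w -> LP (wt0 w) (Delta c).
Proof.
by have [u|d] := up_or_dn hss hcart hb hhb c ra; [apply: step_lift_up|apply: step_lift_dn].
Qed.
End Step.

Theorem linkage w : (forall c (v : Delta c), v != 0 -> sing (wt0 w) v -> Br c w) /\
  (forall c, ~ Br c w -> LP (wt0 w) (Delta c)).
Proof.
move: w; apply: (@weyl_ind F L h b hss hcart hb hhb) => [|al w sal dw [IHH IHL]].
  by have [H1 H2] := linkage_id; split=> // c _; apply: H2.
have [k [sk wE]] := dn_data sal dw.
by split=> c; [apply: (step_sing sal dw sk wE IHH)|apply: (step_lift sal dw sk wE IHH IHL)].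
Qed.
End Linkage.

(** * Extensions and duality *)

Section SpanLists.
Variables (F : fieldType) (L : lieAlgebra F) (M : gmod L).
Implicit Types (l : seq M) (u v : M).

Lemma in_span_sub l : subspace (in_span l).
Proof.
split; first by exists (fun=> 0); rewrite big1// => i _; rewrite scale0r.
move=> a _ _ [c ->] [c' ->]; exists (fun i => a * c i + c' i).
by rewrite scaler_sumr -big_split /=; apply: eq_bigr => i _; rewrite scalerDl scalerA.
Qed.
Lemma in_span_mem l u : u \in l -> in_span l u.
Proof.
move=> ul; have il : (index u l < size l)%N by rewrite index_mem.
exists (fun i => (i == index u l)%:R); rewrite (bigD1 (Ordinal il)) //= eqxx scale1r nth_index// big1 ?addr0// => i ne.
by rewrite (_ : (_ == _) = false) ?scale0r//; apply: contra_neqF ne => /eqP E; apply: val_inj.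
Qed.
Lemma in_span_min (P : M -> Prop) l v : subspace P -> (forall u, u \in l -> P u) -> in_span l v -> P v.
Proof.
by move=> sP lP [c ->]; apply: (sub_sum sP) => i _; apply: (subZ sP); apply: lP; apply: mem_nth.
Qed.
End SpanLists.

Section WeightModules.
Variables (F : numClosedFieldType) (L : lieAlgebra F) (h b : {vspace L}).
Local Notation hd := 'Hom(subvs_of h, F^o).
Implicit Types (la mu nu : hd) (M N A B : gmod L).

Lemma wmod_emb A M (i : A -> M) : is_hom i -> injective i ->
  (forall a, exists2 s : seq (hd * M), wdec s & i a = \sum_(p <- s) p.2) -> wmod h A.
Proof.
move=> hi ii wM a; have sI := submodule_im hi; have [s ws sE] := wM a.
have [s' [_ ws' ims' s'E _]] := wdec_in (submodule_sub sI) (submodule_h sI) ws sE (ex_intro _ a erefl).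
have /choice[r rP] (m : M) : exists a : A, (exists a', i a' = m) -> i a = m.
  by have [[a' <-]|n] := pselect (exists a', i a' = m); [exists a'|exists 0].
exists [seq (p.1, r p.2) | p <- s'].
  move=> _ /mapP[p ps ->]; apply: (hom_inj_weight hi ii); rewrite rP; first exact: ws'.
  exact: ims'.
apply: ii; rewrite s'E (hom_sum hi) big_map big_seq [RHS]big_seq; apply: eq_bigr => p ps.
by rewrite rP//; apply: ims'.
Qed.

Lemma wmod_sub A M (i : A -> M) : is_hom i -> injective i -> wmod h M -> wmod h A.
Proof. by move=> hi ii wM; apply: (wmod_emb hi ii) => a; apply: wM. Qed.

Lemma wmod_quot M B (p : M -> B) : is_hom p -> (forall v, exists u, p u = v) -> wmod h M -> wmod h B.
Proof.
move=> hp sp wM y; have [m <-] := sp y; have [s ws ->] := wM m.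
exists [seq (q.1, p q.2) | q <- s]; last by rewrite (hom_sum hp) big_map.
by move=> _ /mapP[q /ws wq ->]; apply: hom_weight.
Qed.

Lemma wmod_ind M (P : M -> Prop) : wmod h M -> subspace P -> (forall la v, weight_vec la v -> P v) -> forall v, P v.
Proof. by move=> wM sP H v; have [s ws ->] := wM v; apply: (sub_sum_seq sP) => p /ws; apply: H. Qed.

Lemma in_O_wmod M : in_O h b M -> wmod h M.
Proof.
move=> [_ H _] v; have [s sP ->] := H v; elim: s sP => [|u s IH] sP; first by exists [::]; rewrite ?big_nil.
have [la wu] := sP u (mem_head _ _); have [|s' ws' E] := IH.
  by move=> u' u's; apply: sP; rewrite inE u's orbT.
exists ((la, u) :: s'); last by rewrite !big_cons E.
by move=> p; rewrite inE => /predU1P[->|/ws'].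
Qed.

Lemma wproj_ex M mu : wmod h M -> exists cp : M -> M, [/\ linear cp, forall v, weight_vec mu (cp v),
  forall la v, weight_vec la v -> cp v = if la == mu then v else 0
  & forall P : M -> Prop, submodule P -> forall v, P v -> P (cp v)].
Proof.
move=> wM; have /choice[d dP] (v : M) : exists s : seq (hd * M), wdec s /\ v = \sum_(p <- s) p.2.
  by have [s ws sE] := wM v; exists s.
pose cp v := \sum_(p <- d v | p.1 == mu) p.2.
have uniq v s : wdec s -> v = \sum_(p <- s) p.2 -> cp v = \sum_(p <- s | p.1 == mu) p.2.
  move=> ws sE; have [wd dE] := dP v.
  have wds : wdec (d v ++ [seq (p.1, - p.2) | p <- s]).
    move=> p; rewrite mem_cat => /orP[/wd//|/mapP[q /ws wq ->]].
    exact: (subN (weight_sub _ _)).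
  have := wdec_comp0 mu wds; rewrite !big_cat !big_map /= !sumrN -sE -dE subrr => /(_ erefl).
  by move/eqP; rewrite subr_eq0 => /eqP.
exists cp; split=> [a u v|v|la v wv|P sP v Pv].
- have [[wu uE] [wv vE]] := (dP u, dP v).
  rewrite (uniq _ ([seq (p.1, a *: p.2) | p <- d u] ++ d v)).
  + by rewrite big_cat big_map /= -scaler_sumr.
  + move=> p; rewrite mem_cat => /orP[/mapP[q /wu wq ->]|/wv//]; exact: (subZ (weight_sub _ _)).
  + by rewrite big_cat big_map /= -scaler_sumr -uE -vE.
- rewrite /cp big_seq_cond; apply: (sub_sum (weight_sub _ _)) => p /andP[pd /eqP <-].
  exact: (dP v).1.
- rewrite (uniq v [:: (la, v)]) ?big_seq1// => [|p].
    by rewrite big_mkcond big_seq1.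
  by rewrite inE => /eqP ->.
- have [wv vE] := dP v; have := @wcomp F L h M P _ mu (submodule_sub sP) (submodule_h sP) wv.
  by rewrite -vE; apply.
Qed.

Section Projection.
Variables (M : gmod L) (wM : wmod h M) (mu : hd).
Definition wproj : M -> M := sval (cid (wproj_ex mu wM)).
Lemma wproj_lin : linear wproj. Proof. by have [] := svalP (cid (wproj_ex mu wM)). Qed.
Lemma wproj0 : wproj 0 = 0.
Proof. by apply: (addrI (wproj 0)); have := wproj_lin 1 0 0; rewrite !scale1r !addr0. Qed.
Lemma wproj_wt v : weight_vec mu (wproj v). Proof. by have [] := svalP (cid (wproj_ex mu wM)). Qed.
Lemma wprojE la v : weight_vec la v -> wproj v = if la == mu then v else 0.
Proof. by have [_ _ + _] := svalP (cid (wproj_ex mu wM)); apply. Qed.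
Lemma wproj_id v : weight_vec mu v -> wproj v = v.
Proof. by move=> /wprojE ->; rewrite eqxx. Qed.
Lemma wproj_sub (P : M -> Prop) v : submodule P -> P v -> P (wproj v).
Proof. by move=> sP; have [_ _ _ H] := svalP (cid (wproj_ex mu wM)); apply: H sP v. Qed.
End Projection.

Lemma wproj_h M (wM : wmod h M) mu (t : subvs_of h) v : wproj wM mu (act (vsval t) v) = (mu t : F) *: wproj wM mu v.
Proof.
have lp := wproj_lin wM mu; move: v; apply: (wmod_ind wM) => [|la v wv].
  split=> [|a u v E1 E2]; first by rewrite act0r wproj0 scaler0.
  by rewrite actDr actZr !lp E1 E2 scalerDr !scalerA mulrC.
rewrite (wv t) -[_ *: v]addr0 lp wproj0 addr0 (wprojE _ _ wv).
by case: eqP => [->|]; rewrite ?scaler0.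
Qed.

Lemma wproj_hom M N (f : M -> N) (wM : wmod h M) (wN : wmod h N) mu v : is_hom f ->
  f (wproj wM mu v) = wproj wN mu (f v).
Proof.
move=> hf; have [s ws ->] := wM v.
have lp := wproj_lin wM mu; have ln := wproj_lin wN mu.
have l0 (V W : lmodType F) (g : V -> W) : linear g -> g 0 = 0.
  by move=> lg; apply: (addrI (g 0)); have := lg 1 0 0; rewrite !scale1r !addr0.
have lS (V W : lmodType F) (g : V -> W) (r : seq (hd * V)) : linear g -> g (\sum_(p <- r) p.2) = \sum_(p <- r) g p.2.
  by move=> lg; apply: (big_morph g) => [u w|]; [have := lg 1 u w; rewrite !scale1r|exact: l0].
rewrite (lS _ _ _ _ lp) (hom_sum hf) (hom_sum hf).
have := lS _ _ _ [seq (p.1, f p.2) | p <- s] ln; rewrite !big_map => ->.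
rewrite big_seq [RHS]big_seq; apply: eq_bigr => p /ws wp.
by rewrite (wprojE _ _ wp) (wprojE _ _ (hom_weight hf wp)); case: eqP => // _; apply: (hom0 hf).
Qed.

Lemma weight_lift M B (p : M -> B) mu y : is_hom p -> (forall v, exists u, p u = v) -> wmod h M ->
  weight_vec mu y -> exists2 x, weight_vec mu x & p x = y.
Proof.
move=> hp sp wM wy; have wB := wmod_quot hp sp wM; have [x xE] := sp y.
exists (wproj wM mu x); first exact: wproj_wt.
by rewrite (wproj_hom _ wB _ _ hp) xE wproj_id.
Qed.

Definition wfin M := forall mu, exists l : seq M, forall u, weight_vec mu u -> in_span l u.

Lemma wfin_ext A M B (i : A -> M) (p : M -> B) : short_exact i p -> wmod h M -> wfin A -> wfin B -> wfin M.
Proof.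
move=> [[hi ii] hp sp ker] wM fA fB mu; have wB := wmod_quot hp sp wM.
have [la laP] := fA mu; have [lb lbP] := fB mu.
have /choice[r rP] (y : B) : exists m : M, weight_vec mu m /\ p m = wproj wB mu y.
  by have [m wm mE] := weight_lift hp sp wM (wproj_wt wB mu y); exists m.
exists (map i la ++ map r lb) => u wu; set l := _ ++ _.
have sl := in_span_sub l.
pose P (y : B) := exists2 m, in_span l m /\ weight_vec mu m & p m = wproj wB mu y.
have lp := wproj_lin wB mu.
have sP : subspace P.
  split; first exists 0; first by split; [exact: sub0 sl|exact: weight0].
    by rewrite (hom0 hp) wproj0.
  move=> a y y' [m [lm wm] mE] [m' [lm' wm'] m'E]; exists (a *: m + m').
    by split; [exact: (subZD sl)|exact: (subZD (weight_sub _ _))].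
  by rewrite hp.1 mE m'E lp.
have [|m [lm wm] mE] := in_span_min sP _ (lbP _ (hom_weight hp wu)).
  move=> y yl; exists (r y); last by case: (rP y).
  by split; [apply: in_span_mem; rewrite mem_cat map_f ?orbT|case: (rP y)].
rewrite wproj_id in mE; last exact: hom_weight.
have /ker[a aE] : p (u - m) = 0 by rewrite (homB hp) mE subrr.
have wa : weight_vec mu a by apply: (hom_inj_weight hi ii); rewrite aE; apply: (subB (weight_sub _ _)).
rewrite -(subrK m u) -aE; apply: (subD sl) => //.
have sQ : subspace (fun a : A => in_span l (i a)).
  by split; [rewrite (hom0 hi); exact: sub0 sl|move=> c x y Hx Hy; rewrite hi.1; exact: (subZD sl)].
apply: (in_span_min sQ) (laP _ wa) => y yl; apply: in_span_mem.
by rewrite mem_cat map_f.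
Qed.

Lemma corestr_inj M N A (j : A -> N) (f : M -> N) : is_hom j -> injective j -> is_hom f ->
  (forall m, exists a, j a = f m) -> exists2 r : M -> A, is_hom r & forall m, j (r m) = f m.
Proof.
move=> hj ij hf /choice[r rP]; exists r => //; split=> [c u v|x v]; apply: ij.
  by rewrite hj.1 !rP hf.1.
by rewrite (hom_act hj) !rP (hom_act hf).
Qed.

Lemma LP0 N la : (forall n : N, n = 0) -> LP b la N.
Proof.
move=> N0 E j hj ij u wu nu; exists 0; first exact: weight0.
rewrite (hom0 hj) subr0; split=> // x /nu[n <-]; by rewrite (N0 n) (hom0 hj).
Qed.

(** The extension of [A] is enlarged to one of [M] by adding the kernel of the retraction. *)
Lemma LP_retract A M (i : A -> M) (r : M -> A) la : is_hom i -> is_hom r -> cancel i r ->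
  LP b la M -> LP b la A.
Proof.
move=> hi hr ri H E j hj ij u wu nu.
pose j' (m : M) : gprod E M := (j (r m), m - i (r m)).
have hj' : is_hom j'.
  split=> [c x y|x y]; congr pair => /=.
  - by rewrite hr.1 hj.1.
  - by rewrite hr.1 hi.1; lmod F.
  - by rewrite (hom_act hr) (hom_act hj).
  - by rewrite (hom_act hr) (hom_act hi) actBr.
have ij' : injective j'.
  apply: (hom_inj hj') => m [jr mr].
  have r0 : r m = 0 by apply: ij; rewrite (hom0 hj).
  by move: mr; rewrite r0 (hom0 hi) subr0.
have wu' : weight_vec la ((u, 0) : gprod E M) by move=> t; congr pair; rewrite ?wu ?act0r ?scaler0.
have [|m wm [sm nm]] := H _ _ hj' ij' _ wu'.
  move=> x /nu[a aE]; exists (i a); congr pair; rewrite ?ri ?aE// subrr/=.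
  exact/esym/act0r.
exists (r m); first exact: hom_weight.
split=> [t|x /nm E1]; first exact: (congr1 fst (sm t)).
exact: (congr1 fst E1).
Qed.

(** Solve the problem for [B] modulo the image of [A], lift the solution to a weight vector of [M],
    and correct it by an element of [A]. *)
Lemma LP_ext A M B (i : A -> M) (p : M -> B) la : short_exact i p -> wmod h M ->
  LP b la A -> LP b la B -> LP b la M.
Proof.
move=> [[hi ii] hp sp ker] wM HA HB E j hj ij u wu nu.
have hji := hom_comp hi hj; have sI := submodule_im hji; have hq := qpi_hom sI.
have [|jb hjb jbE] := factor_surj hp sp (hom_comp hj hq).
  by move=> m /ker[a <-]; apply/(qpi0P sI); exists a.
have ijb : injective jb.
  apply: (hom_inj hjb) => y; have [m <-] := sp y; rewrite jbE => /(qpi0P sI)[a /ij <-].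
  by apply/ker; exists a.
have [|y wy sy] := HB _ _ hjb ijb _ (hom_weight hq wu).
  by move=> x /nu[m mE]; exists (p m); rewrite jbE /= mE (hom_act hq).
have [m wm mE] := weight_lift hp sp wM wy.
have [|||a wa sa] := HA _ _ hji _ (u - j m).
- exact: (inj_comp ij ii).
- by apply: (subB (weight_sub _ _)) => //; apply: hom_weight.
- move=> x xn; apply/(qpi0P sI); rewrite (hom_act hq) (homB hq).
  by rewrite (_ : qpi sI (j m) = jb y) ?sy.2// -mE jbE.
exists (m + i a); first by apply: (subD (weight_sub _ _)) => //; apply: hom_weight.
by have := sa; congr singular_vec; rewrite (homD hj) /=; lmod F.
Qed.

(* The extension problem is solved in the pushout of M and N over A. *)
Lemma LP_extend A M B (i : A -> M) (p : M -> B) mu (vB : B) N (f : A -> N) : short_exact i p -> wmod h M ->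
  vtop b mu vB -> LP b mu N -> is_hom f -> exists2 g : M -> N, is_hom g & forall a, g (i a) = f a.
Proof.
move=> [[hi ii] hp sp ker] wM [_ sv gv uv] H hf.
pose U (x : gprod N M) := exists a, (f a, - i a) = x.
have hU : is_hom (fun a => (f a, - i a) : gprod N M).
  split=> [c x y|x y]; congr pair => /=; rewrite ?hf.1 ?(hom_act hf)//.
    by rewrite hi.1; lmod F.
  by rewrite (hom_act hi) actNr.
have sU : submodule U := submodule_im hU.
pose E := quog sU; have hq := qpi_hom sU.
pose j (n : N) : E := qpi sU (n, 0); pose k (m : M) : E := qpi sU (0, m).
have hj : is_hom j.
  apply: (@hom_comp F L N (gprod N M) E (fun n => (n, 0)) _ _ hq).
  by split=> [c x y|x y]; congr pair; rewrite /= ?scaler0 ?addr0 ?act0r.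
have hk : is_hom k.
  apply: (@hom_comp F L M (gprod N M) E (fun m => (0, m)) _ _ hq).
  by split=> [c x y|x y]; congr pair; rewrite /= ?scaler0 ?addr0 ?act0r.
have ij : injective j.
  apply: (hom_inj hj) => n /(qpi0P sU)[a [<- /eqP]]; rewrite oppr_eq0 => /eqP a0.
  by rewrite (_ : a = 0) ?(hom0 hf)//; apply: ii; rewrite a0 (hom0 hi).
have kj a : k (i a) = j (f a).
  apply/(qpi_eq sU); exists (- a); rewrite (homN hf) (homN hi) opprK; congr pair.
    exact/esym/sub0r.
  exact/esym/subr0.
have [m0 wm0 m0E] := weight_lift hp sp wM sv.1.
have [|n wn sn] := H E j hj ij (k m0) (hom_weight hk wm0).
  move=> x xn; have [a aE] : exists a, i a = act x m0.
    by apply/ker; rewrite (hom_act hp) m0E sv.2.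
  by exists (f a); rewrite -kj aE (hom_act hk).
have [s hs sE] := uv _ _ sn.
have hg : is_hom (fun m => (-1) *: s (p m) + k m) by apply: hom_lin => //; exact: hom_comp.
have [|g hg' gE] := corestr_inj hj ij hg; last first.
  exists g => // a; apply: ij; rewrite gE kj.
  by rewrite (_ : p (i a) = 0) ?(hom0 hs) ?scaler0 ?add0r//; apply/ker; exists a.
pose S m := exists n', j n' = (-1) *: s (p m) + k m.
have sS : submodule S.
  split=> [|c m m' [n1 E1] [n2 E2]|x m [n1 E1]].
  - by exists 0; rewrite (hom0 hj) (hom0 hp) (hom0 hs) (hom0 hk) scaler0 addr0.
  - by exists (c *: n1 + n2); rewrite hj.1 E1 E2 hg.1.
  - by exists (act x n1); rewrite (hom_act hj) E1 hg.2.
have s0 := submodule_sub sS.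
have Si m m' : p m = p m' -> S m -> S m'.
  move=> E1; have /ker[a aE] : p (m' - m) = 0 by rewrite (homB hp) E1 subrr.
  move=> Sm; rewrite -(subrK m m') -aE; apply: (subD s0) => //; exists (f a).
  by rewrite -kj (_ : p (i a) = 0) ?(hom0 hs) ?scaler0 ?add0r//; apply/ker; exists a.
suff H' y : forall m, p m = y -> S m by move=> m; exact: H'.
apply: (gv (fun y => forall m, p m = y -> S m)).
  split=> [m pm|c y1 y' Hy Hy' m pm|x y1 Hy m pm].
  - by apply: (Si 0); [rewrite (hom0 hp) pm|exact: sub0 s0].
  - have [[m1 E1] [m2 E2]] := (sp y1, sp y'); apply: (Si (c *: m1 + m2)); first by rewrite hp.1 E1 E2.
    by apply: (subZD s0); [apply: Hy|apply: Hy'].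
  - have [m1 E1] := sp y1; apply: (Si (act x m1)); first by rewrite (hom_act hp) E1.
    by apply: (submodule_act _ sS); apply: Hy.
move=> m pm; apply: (Si m0); first by rewrite m0E pm.
by exists n; rewrite m0E sE; lmod F.
Qed.
End WeightModules.

Section TopWeight.
Variables (F : numClosedFieldType) (L : lieAlgebra F) (h b : {vspace L}).
Local Notation hd := 'Hom(subvs_of h, F^o).
Hypotheses (hss : semisimple L) (hcart : cartan h) (hb : borel b) (hhb : (h <= b)%VS).
Implicit Types (be la mu nu : hd) (M N A B D : gmod L).
Local Notation pos := (pos_root b).
Local Notation tt0 := (tt0 b hss hcart).
Local Notation sing := (singular_vec b).
Let pos_tt0 := @pos_tt0 F L h b hss hcart hb hhb.

Definition toplev la M := forall nu (v : M), v != 0 -> weight_vec nu v ->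
  nu = la \/ exists k : nat, (la tt0 : F) - (nu tt0 : F) = k.+1%:R.

Lemma toplev_sub la A M (i : A -> M) : is_hom i -> injective i -> toplev la M -> toplev la A.
Proof.
move=> hi ii H nu v v0 wv; apply: (H nu (i v)); last exact: hom_weight.
by apply: contra_neq v0 => E; apply: ii; rewrite E (hom0 hi).
Qed.

Lemma highest_toplev la M : has_highest_weight b M la -> toplev la M.
Proof.
move=> [_ H] nu v v0 wv; have [s sP /eqP] := H _ _ v0 wv; rewrite subr_eq => /eqP ->.
suff [->|[k kE]] : \sum_(be <- s) be = 0 \/ exists k : nat, ((\sum_(be <- s) be) tt0 : F) = k.+1%:R.
- by left; rewrite add0r.
- by right; exists k; rewrite evD kE addrK.
elim: s sP => [|be s IH] sP; first by left; rewrite big_nil.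
right; have [k kE] := pos_tt0 (sP be (mem_head _ _)); rewrite big_cons evD kE.
have [|->|[m ->]] := IH; first by move=> ga gs; apply: sP; rewrite inE gs orbT.
  by exists k; rewrite ev0 addr0.
by exists (k.+1 + m)%N; rewrite -natrD addnS.
Qed.

Lemma vtop_toplev la D (v : D) : vtop b la v -> toplev la D.
Proof. by move=> dv nu u u0 wu; have [[-> _]|H] := vtop_level hss hcart hb hhb dv u0 wu; [left|right]. Qed.

Lemma toplev_above la M be (v : M) : toplev la M -> pos be -> weight_vec (be + la) v -> v = 0.
Proof.
move=> H pb wv; apply/eqP; apply: contrapT => /negP v0; have [k kE] := pos_tt0 pb.
have [E|[m]] := H _ _ v0 wv.
  by have := pb.1.1; rewrite -(inj_eq (addIr la)) E add0r eqxx.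
have -> : ((be + la) tt0 : F) = be tt0 + la tt0 := evD _ _ _.
move/eqP; rewrite opprD addrCA subrr addr0 kE eq_sym -subr_eq0 opprK -natrD pnatr_eq0.
by rewrite addSn.
Qed.

Lemma toplev_sing la M (v : M) : toplev la M -> weight_vec la v -> sing la v.
Proof.
move=> H wv; apply: (singularP hss hcart hb hhb wv) => be x pb rx.
exact: (toplev_above H pb (weight_act rx wv)).
Qed.

(** Induction on the flag. A layer of weight other than [la] does not touch the top weight space,
    and the map extends over it by [LP_extend]. A layer of weight [la] splits off, because its
    generator lifts to a singular vector. *)
Lemma top_hom M s : flag (is_verma (h := h) b) M s -> forall la N (g : M -> N), wmod h M -> toplev la M ->
  (forall mu, LP b mu N) -> linear g -> (forall v, weight_vec la v -> sing la (g v)) ->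
  exists2 f : M -> N, is_hom f & forall v, weight_vec la v -> f v = g v.
Proof.
elim=> {M s} [M M0|A M B i p mu s ex _ IH /verma_top[vB dv]] la N g wM tM lp lg sg.
  exists (fun=> 0); first exact: hom_zero.
  by move=> v wv; rewrite (M0 v); apply: (addrI (g 0)); have := lg 1 0 0; rewrite !scale1r !addr0.
have [[hi ii] hp sp ker] := ex; have [vB0 svB gv uv] := dv.
have [|||||fA hfA fAE] := IH la N (g \o i) => //.
- exact: wmod_sub hi ii wM.
- exact: toplev_sub hi ii tM.
- by move=> c x y; rewrite /= hi.1 lg.
- by move=> v wv; apply: sg; apply: hom_weight.
have [m0 wm0 m0E] := weight_lift hp sp wM svB.1.
have m00 : m0 != 0 by apply: contra_neq vB0 => E; rewrite -m0E E (hom0 hp).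
have [E|ne] := eqVneq mu la; last first.
  have [f hf fE] := LP_extend ex wM dv (lp mu) hfA; exists f => // v wv.
  have [v' v'E] : exists a, i a = v.
    apply/ker/eqP; apply: contrapT => /negP pv0.
    have [[E _]|[k kE]] := vtop_level hss hcart hb hhb dv pv0 (hom_weight hp wv).
      by rewrite E eqxx in ne.
    have [E|[l lE]] := tM _ _ m00 wm0; first by rewrite E eqxx in ne.
    have /eqP : (k.+1%:R + l.+1%:R : F) = 0 by rewrite -kE -lE; ring.
    by rewrite -natrD pnatr_eq0.
  by rewrite -v'E fE fAE//; apply: (hom_inj_weight hi ii); rewrite v'E.
rewrite E in svB uv wm0 dv => {E}; have sm0 := toplev_sing tM wm0.
have [s1 hs1 s1E] := uv _ _ sm0; have [hB hhB hBE] := uv _ _ (sg _ wm0).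
have ps1 y : p (s1 y) = y.
  apply: (gv (fun y => p (s1 y) = y)); last by rewrite s1E.
  split=> [|c y1 y2 E1 E2|x y1 E1]; first by rewrite (hom0 hs1) (hom0 hp).
    by rewrite hs1.1 hp.1 E1 E2.
  by rewrite (hom_act hs1) (hom_act hp) E1.
have hr : is_hom (fun m => (-1) *: s1 (p m) + m) by apply: (hom_lin _ (hom_comp hp hs1) (hom_id _)).
have [|r hr' rE] := corestr_inj hi ii hr.
  by move=> m; apply/ker; rewrite (homD hp) (homZ hp) ps1; lmod F.
exists (fun m => 1 *: fA (r m) + hB (p m)).
  by apply: hom_lin; [exact: hom_comp hr' hfA|exact: hom_comp hp hhB].
move=> v wv; have wr : weight_vec la (r v).
  apply: (hom_inj_weight hi ii); rewrite rE; apply: (subZD (weight_sub _ _)) => //.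
  by apply: hom_weight hs1 _; apply: hom_weight.
have [c pE] : exists c, p v = c *: vB.
  have [->|pv0] := eqVneq (p v) 0; first by exists 0; rewrite scale0r.
  have [[_ //]|[k /eqP]] := vtop_level hss hcart hb hhb dv pv0 (hom_weight hp wv).
  by rewrite subrr eq_sym pnatr_eq0.
rewrite fAE// pE (homZ hhB) hBE scale1r /=.
have vE : v = c *: m0 + i (r v) by rewrite rE pE (homZ hs1) s1E; lmod F.
by rewrite [in RHS]vE lg addrC.
Qed.
End TopWeight.

Section GeneratedSubmodules.
Variables (F : numClosedFieldType) (L : lieAlgebra F) (h b : {vspace L}).
Local Notation hd := 'Hom(subvs_of h, F^o).
Hypotheses (hss : semisimple L) (hcart : cartan h) (hb : borel b) (hhb : (h <= b)%VS).
Implicit Types (be la mu nu : hd) (M N A B D : gmod L).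
Local Notation tt0 := (tt0 b hss hcart).
Local Notation sing := (singular_vec b).
Let pos_tt0 := @pos_tt0 F L h b hss hcart hb hhb.

Lemma gen_subg M (v : M) (P : subg (gen_sub (eq v)) -> Prop) : submodule P ->
  P (smk (gen_sub (eq v)) (gen_in (erefl v))) -> forall u, P u.
Proof.
move=> sP Pv u; have sQ : submodule (fun m => exists2 k : subg (gen_sub (eq v)), P k & sinc k = m).
  split.
  - by exists 0 => //; exact: sub0 (submodule_sub sP).
  - by move=> c _ _ [k Pk <-] [k' Pk' <-]; exists (c *: k + k') => //; exact: (subZD (submodule_sub sP)).
  - by move=> x _ [k Pk <-]; exists (act x k) => //; exact: (submodule_act _ sP).
have [|k Pk /sinc_inj <- //] := sincP u _ sQ.
by move=> m <-; exists (smk (gen_sub (eq v)) (gen_in (erefl v))).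
Qed.

Lemma gen_level M la (v u : M) nu : sing la v -> gen (eq v) u -> u != 0 -> weight_vec nu u ->
  (nu = la /\ exists c, u = c *: v) \/ exists k : nat, (la tt0 : F) - (nu tt0 : F) = k.+1%:R.
Proof.
move=> [wv nv] gu u0 wu; pose K := subg (gen_sub (eq v)).
pose vK : K := smk (gen_sub (eq v)) (gen_in (erefl v)); pose uK : K := smk (gen_sub (eq v)) gu.
have hK := sinc_hom (gen_sub (eq v)); have iK := @sinc_inj F L M _ (gen_sub (eq v)).
have wvK : weight_vec la vK by apply: (hom_inj_weight hK iK).
have wuK : weight_vec nu uK by apply: (hom_inj_weight hK iK).
have uK0 : uK != 0 by apply: contra_neq u0 => /(congr1 (@sinc F L M _ (gen_sub (eq v)))).
have top be x : is_root be -> root_vec be x -> 0 < (be tt0 : F) -> act x vK = 0.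
  move=> rb rx p0; apply: iK; rewrite (hom_act hK) (hom0 hK); apply: nv; apply/(nplusP hss hcart hb hhb).
  apply: wsum1 rx; have [//|/pos_tt0[k]] := pos_or hss hcart hb hhb rb; rewrite evN => E.
  by move: p0; rewrite -oppr_lt0 E ltrn0.
have [[-> [c E]]|H] := cyclic_level hcart (pos_reg hss hcart hb hhb) wvK (@gen_subg M v) top uK0 wuK; [left|by right].
by split=> //; exists c; rewrite -[u]/(sinc uK) E (homZ hK).
Qed.
End GeneratedSubmodules.

(** * The contravariant dual *)

Section Duality.
Variables (F : numClosedFieldType) (L : lieAlgebra F) (h b : {vspace L}) (tau : L -> L).
Local Notation hd := 'Hom(subvs_of h, F^o).
Hypotheses (hss : semisimple L) (hcart : cartan h) (hb : borel b) (hhb : (h <= b)%VS).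
Hypothesis htau : transposition h tau.
Implicit Types (be la mu nu : hd) (M N A B D : gmod L).
Local Notation tt0 := (tt0 b hss hcart).
Local Notation sing := (singular_vec b).
Local Notation vtop := (@vtop F L h b).
Let pos_tt0 := @pos_tt0 F L h b hss hcart hb hhb.

Lemma antihom_tau : antihom tau. Proof. by case: htau. Qed.
Lemma tauK : involutive tau. Proof. by case: htau. Qed.
Lemma tau_h (t : subvs_of h) : tau (vsval t) = vsval t.
Proof. by case: htau => _ _ _; apply; apply: subvsP. Qed.
Lemma tau_root (be : hd) (x : L) : root_vec be x -> root_vec (- be) (tau x).
Proof.
move=> rx t; have [lt at' _ _] := htau.
have t0 : tau 0 = 0 by apply: (addrI (tau 0)); have := lt 1 0 0; rewrite !scale1r !addr0.
have tZ c y : tau (c *: y) = c *: tau y by have := lt c y 0; rewrite t0 !addr0.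
have -> : brk (vsval t) (tau x) = tau (brk x (vsval t)) by rewrite at' tau_h.
have -> : brk x (vsval t) = - (be t : F) *: x by rewrite brkC (rx t) scaleNr.
by rewrite tZ; congr (_ *: _); rewrite evN.
Qed.

Section Pairing.
Variables (N M : gmod L) (phi : N -> M -> F).
Hypothesis lr : forall n, linear_for *%R (phi n).
Hypothesis ll : forall m, linear_for *%R (fun n => phi n m).
Hypothesis pa : forall x n m, phi (act x n) m = phi n (act (tau x) m).
Lemma pair0r n : phi n 0 = 0.
Proof. by apply: (addrI (phi n 0)); have := lr n 1 0 0; rewrite scale1r mul1r !addr0. Qed.
Lemma pair0l m : phi 0 m = 0.
Proof. by apply: (addrI (phi 0 m)); have := ll m 1 0 0; rewrite scale1r mul1r !addr0. Qed.
Lemma pairZr n c m : phi n (c *: m) = c * phi n m.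
Proof. by have := lr n c m 0; rewrite pair0r !addr0. Qed.
Lemma pairZl n c m : phi (c *: n) m = c * phi n m.
Proof. by have := ll m c n 0; rewrite pair0l !addr0. Qed.
Lemma pairDr n m m' : phi n (m + m') = phi n m + phi n m'.
Proof. by have := lr n 1 m m'; rewrite scale1r mul1r. Qed.
Lemma pair_orth la mu n m : weight_vec la n -> weight_vec mu m -> la != mu -> phi n m = 0.
Proof.
move=> wn wm /hd_neq[t ne]; have := pa (vsval t) n m.
rewrite tau_h (wn t) (wm t) pairZl pairZr => /eqP; rewrite -subr_eq0 -mulrBl mulf_eq0 subr_eq0 (negbTE ne).
by move/eqP.
Qed.
Lemma pair_sub n : subspace (fun m => phi n m = 0).
Proof. by split=> [|c u v E E']; rewrite ?pair0r// lr E E' mulr0 addr0. Qed.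
End Pairing.

Definition fsup M (f : homg antihom_tau M (trivg L)) :=
  exists S : seq hd, forall la (v : M), weight_vec la v -> la \notin S -> hval f v = 0.
Lemma fsup_sub M : submodule (@fsup M).
Proof.
split=> [|a f g [S SP] [S' SP']|x f [S SP]]; first by exists [::].
- exists (S ++ S') => la v wv; rewrite mem_cat negb_or => /andP[n n'].
  by rewrite hvalZD (SP la)// (SP' la)// scaler0 addr0.
have [s sP sE] := root_decl hcart (tau x).
exists [seq mu - p.1 | mu <- S, p <- s] => la v wv nS.
rewrite hval_act add0r sE act_suml hval_sum big_seq big1// => p ps.
apply: (SP (p.1 + la)); first by apply: weight_act wv; case: (sP p ps).
apply: contra nS => pS; apply/allpairsP; exists (p.1 + la, p); split=> //=.
by rewrite addrC addKr.
Qed.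
Definition Dual M : gmod L := subg (fsup_sub M).
Definition dval M (f : Dual M) (v : M) : F := hval (sinc f) v.

Lemma dval_lin M (f : Dual M) : linear_for *%R (dval f).
Proof. by move=> c u v; rewrite /dval hval_lin. Qed.
Lemma dval_linl M (v : M) : linear_for *%R (fun f : Dual M => dval f v).
Proof. by move=> c f g; rewrite /dval (sinc_hom (fsup_sub M)).1 hvalZD. Qed.
Lemma dval_sum M I (r : seq I) (f : I -> Dual M) v : dval (\sum_(i <- r) f i) v = \sum_(i <- r) dval (f i) v.
Proof.
apply: (big_morph (fun f : Dual M => dval f v)) => [x y|]; last exact: (pair0l (@dval_linl M)).
by have := dval_linl v 1 x y; rewrite scale1r mul1r.
Qed.
Lemma dval_act M x (f : Dual M) v : dval (act x f) v = dval f (act (tau x) v).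
Proof. by rewrite /dval (hom_act (sinc_hom _)) hval_act add0r. Qed.
Lemma dval_eq M (f g : Dual M) : dval f =1 dval g -> f = g.
Proof. by move=> fg; apply: (@sinc_inj F L _ _ (fsup_sub M)); apply: hval_eq. Qed.
Lemma dval_mk M (f : M -> F) : in_dual h f -> exists g : Dual M, dval g =1 f.
Proof.
move=> [lf [S SP]]; have lf' : linear (f : M -> trivg L) by exact: lf.
have P : fsup (hmk antihom_tau lf') by exists S.
by exists (smk (fsup_sub M) P).
Qed.
Lemma dval_in M (f : Dual M) : in_dual h (dval f).
Proof. by split; [exact: dval_lin|exact: (sincP f)]. Qed.
Lemma dual_iso_Dual M : dual_iso h tau (@dval M).
Proof.
split; [exact: dval_in|exact: dval_linl|exact: dval_act|exact: dval_eq|exact: dval_mk].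
Qed.

Lemma in_dual_proj M (wM : wmod h M) (f : M -> F) mu : linear_for *%R f -> in_dual h (fun v => f (wproj wM mu v)).
Proof.
move=> lf; have f0 : f 0 = 0 by apply: (addrI (f 0)); have := lf 1 0 0; rewrite scale1r mul1r !addr0.
split; first by move=> c u v; rewrite wproj_lin lf.
by exists [:: mu] => la v wv; rewrite inE (wprojE _ _ wv) => /negbTE ->.
Qed.

Lemma in_dual_sum M (wM : wmod h M) (f : M -> F) : linear_for *%R f -> forall S : seq hd, uniq S ->
  (forall la v, weight_vec la v -> la \notin S -> f v = 0) -> forall v, f v = \sum_(la <- S) f (wproj wM la v).
Proof.
move=> lf S uS SP; have f0 : f 0 = 0 by apply: (addrI (f 0)); have := lf 1 0 0; rewrite scale1r mul1r !addr0.
apply: (wmod_ind wM) => [|la v wv].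
  split=> [|c u v E E']; first by rewrite f0 big1// => la _; rewrite wproj0.
  by rewrite lf E E' mulr_sumr -big_split; apply: eq_bigr => la _; rewrite wproj_lin lf.
have [laS|n] := boolP (la \in S); last first.
  rewrite (SP la)// big_seq big1// => mu muS; rewrite (wprojE _ _ wv).
  by case: eqP => // E; rewrite E muS in n.
rewrite (bigD1_seq la) //= wproj_id// big1 ?addr0// => mu ne.
by rewrite (wprojE _ _ wv) eq_sym (negbTE ne).
Qed.

Lemma Dual_wmod M : wmod h M -> wmod h (Dual M).
Proof.
move=> wM f; have [lf [S SP]] := dval_in f.
have /choice[g gP] (mu : hd) : exists g : Dual M, dval g =1 (fun v => dval f (wproj wM mu v)).
  by apply: dval_mk; apply: in_dual_proj.
have wg mu : weight_vec mu (g mu).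
  move=> t; apply: dval_eq => v; rewrite dval_act tau_h !gP wproj_h.
  by rewrite (pairZr (@dval_lin M)) (pairZl (@dval_linl M)) gP.
exists [seq (mu, g mu) | mu <- undup S]; first by move=> _ /mapP[mu _ ->]; exact: wg.
rewrite big_map; apply: dval_eq => v.
rewrite (in_dual_sum wM lf (undup_uniq S)); last by move=> la u wu; rewrite mem_undup; apply: SP wu.
by rewrite dval_sum; apply: eq_bigr => mu _; rewrite gP.
Qed.

Lemma dual_iso_wmod N M (phi : N -> M -> F) : dual_iso h tau phi -> wmod h M -> wmod h N.
Proof.
move=> [p1 p2 p3 p4 p5] wM.
have /choice[g gP] (n : N) : exists g : Dual M, dval g =1 phi n by apply: dval_mk.
apply: (wmod_sub _ _ (Dual_wmod wM) (i := g)).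
  split=> [c x y|x y]; apply: dval_eq => v; first by rewrite dval_linl !gP p2.
  by rewrite dval_act !gP p3.
by move=> x y E; apply: p4 => v; rewrite -!gP E.
Qed.

Lemma dual_iso_toplev N M (phi : N -> M -> F) la : dual_iso h tau phi -> wmod h M ->
  toplev b hss hcart la M -> toplev b hss hcart la N.
Proof.
move=> [p1 p2 p3 p4 p5] wM tM nu n n0 wn.
apply: contrapT => nex; move/eqP: n0; apply; apply: p4 => m; rewrite (pair0l p2).
have lr n' := (p1 n').1; move: m; apply: (wmod_ind wM (pair_sub lr n)) => mu m wm.
have [E|ne] := eqVneq nu mu; last exact: (pair_orth lr p2 p3 wn wm ne).
have [->|m0] := eqVneq m 0; first exact: (pair0r lr).
by case: nex; rewrite E; apply: tM m0 wm.
Qed.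

Lemma dual_map M N (f : M -> N) : is_hom f -> exists2 f' : Dual N -> Dual M, is_hom f' &
  forall g v, dval (f' g) v = dval g (f v).
Proof.
move=> hf; have /choice[f' f'P] (g : Dual N) : exists g' : Dual M, dval g' =1 (fun v => dval g (f v)).
  apply: dval_mk; split; first by move=> c u v; rewrite hf.1 dval_lin.
  by have [_ [S SP]] := dval_in g; exists S => la v /(hom_weight hf); apply: SP.
exists f' => //; split=> [c g g'|x g]; apply: dval_eq => v; first by rewrite dval_linl !f'P dval_linl.
by rewrite dval_act !f'P dval_act (hom_act hf).
Qed.

Lemma linear_extend A M (i : A -> M) (g : A -> F) : is_hom i -> injective i -> linear_for *%R g ->
  exists2 f : M -> F, linear_for *%R f & forall a, f (i a) = g a.
Proof.
move=> hi ii lg; have sI := submodule_sub (submodule_im hi); have [Q [sQ Q0 QE]] := complement_ex sI.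
have [pr [lpr prI _ prE]] := direct_proj sI sQ Q0 QE; have [r rP] := choice prI.
exists (fun m => g (r m)) => [c u v|a].
  by rewrite -lg; congr g; apply: ii; rewrite hi.1 !rP lpr.
by congr g; apply: ii; rewrite rP -[i a]addr0 prE ?addr0//; [exists a|exact: sub0 sQ].
Qed.

Lemma dual_exact A M B (i : A -> M) (p : M -> B) : short_exact i p -> wmod h M ->
  exists (p' : Dual B -> Dual M) (i' : Dual M -> Dual A), short_exact p' i'.
Proof.
move=> [[hi ii] hp sp ker] wM; have [p' hp' pE] := dual_map hp; have [i' hi' iE] := dual_map hi.
have wA := wmod_sub hi ii wM.
exists p', i'; split=> //.
- split=> //; move=> f g E; apply: dval_eq => y; have [m <-] := sp y.
  by rewrite -!pE E.
(* A linear extension of [g] may have infinite weight support, so it is cut down to the weights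
   supporting [g]. *)
- move=> g; have [lg [S SP]] := dval_in g; have [f0 lf0 f0E] := linear_extend hi ii lg.
  have fE mu : exists f : Dual M, dval f =1 fun v => f0 (wproj wM mu v).
    by apply: dval_mk; apply: in_dual_proj.
  have [f fP] := choice fE; exists (\sum_(mu <- undup S) f mu); apply: dval_eq => a; rewrite iE.
  rewrite (in_dual_sum wA lg (undup_uniq S)); last by move=> la u wu; rewrite mem_undup; apply: SP wu.
  by rewrite dval_sum; apply: eq_bigr => mu _; rewrite fP -(wproj_hom wA wM mu a hi) f0E.
move=> f; split=> [f0|[g <-]]; last first.
  apply: dval_eq => a; rewrite iE pE (_ : p (i a) = 0); last by apply/ker; exists a.
  by rewrite (pair0r (@dval_lin B)) (pair0l (@dval_linl A)).
have [r rP] := choice sp; have [lf [S SP]] := dval_in f.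
have fr m m' : p m = p m' -> dval f m = dval f m'.
  move=> E; have /ker[a aE] : p (m - m') = 0 by rewrite (homB hp) E subrr.
  have -> : m = m' + i a by rewrite aE addrC subrK.
  by rewrite (pairDr (@dval_lin M)) -iE f0 (pair0l (@dval_linl A)) addr0.
have [g gP] : exists g : Dual B, dval g =1 fun y => dval f (r y).
  apply: dval_mk; split=> [c y y'|].
    by rewrite -lf; apply: fr; rewrite hp.1 !rP.
  exists S => la y wy; have [x wx xE] := weight_lift hp sp wM wy.
  by rewrite (fr _ x) ?rP//; apply: SP.
by exists g; apply: dval_eq => m; rewrite pE gP; apply: fr; rewrite rP.
Qed.

(** The functional $z\mapsto R(z)(e)$ has finite support because [e] has finitely many weight
    components, so [N] contains a vector representing it. *)
Lemma dual_transpose D E N (R : D -> Dual E) (phi : N -> D -> F) : dual_iso h tau phi -> wmod h E -> is_hom R ->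
  exists2 r : E -> N, is_hom r & forall e z, phi (r e) z = dval (R z) e.
Proof.
move=> [p1 p2 p3 p4 p5] wE hR.
have /choice[r rP] (e : E) : exists n, phi n =1 fun z => dval (R z) e.
  apply: p5; split; first by move=> c y z; rewrite hR.1 dval_linl.
  have [s ws sE] := wE e; exists (map fst s) => nu' z wz ns.
  rewrite sE; apply: (sub_sum_seq (pair_sub (@dval_lin E) (R z))) => p ps.
  apply: (pair_orth (@dval_lin E) (@dval_linl E) (@dval_act E) (hom_weight hR wz) (ws _ ps)).
  by apply: contra ns => /eqP ->; apply: map_f.
exists r => //; split=> [c x y|x e]; apply: p4 => z; first by rewrite p2 !rP (dval_lin (R z)).
by rewrite p3 !rP (hom_act hR) dval_act tauK.
Qed.

(** Positive root vectors act on functionals through their transposes, which lower weights; so only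
    weights [be + mu] could contribute, and these are absent. *)
Lemma dual_top M (wM : wmod h M) mu (xi : M -> F) : linear_for *%R xi ->
  (forall be (v : M), pos_root b be -> weight_vec (be + mu) v -> v = 0) ->
  exists2 et : Dual M, sing mu et & forall v, dval et v = xi (wproj wM mu v).
Proof.
move=> lxi top; have [et etP] := dval_mk (in_dual_proj wM mu lxi); exists et => //.
have wet : weight_vec mu et.
  move=> t; apply: dval_eq => e; rewrite dval_act tau_h (pairZl (@dval_linl M)) !etP wproj_h.
  have xi0 : xi 0 = 0 by apply: (addrI (xi 0)); have := lxi 1 0 0; rewrite scale1r mul1r !addr0.
  by have := lxi (mu t) (wproj wM mu e) 0; rewrite xi0 !addr0.
apply: (singularP hss hcart hb hhb wet) => be x pb rx; apply: dval_eq => e.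
rewrite dval_act (pair0l (@dval_linl M)); move: e; apply: (wmod_ind wM) => [|nu e we].
  by split=> [|c y y' E2 E3]; rewrite ?act0r ?(pair0r (@dval_lin M))// actDr actZr (dval_lin et) E2 E3 mulr0 addr0.
rewrite etP (wprojE _ _ (weight_act (tau_root rx) we)); case: eqP => [muE|_]; last first.
  by have := pair0r (@dval_lin M) et; rewrite etP wproj0.
rewrite (top be e) ?act0r//; last by rewrite -muE addrA subrr add0r.
by have := pair0r (@dval_lin M) et; rewrite etP wproj0.
Qed.

(** If the level of [la] exceeds that of [mu] by a natural number, [u] is already singular.
    Otherwise the vectors of weight [mu] in the module generated by [N] and [u] lie in [N], so
    pairing them with the generator gives a singular functional. The universal property of [D],
    transposed, turns it into a retraction onto [N]. *)
Lemma LP_dual mu D (vD : D) N (phi : N -> D -> F) : vtop mu vD -> dual_iso h tau phi -> forall la, LP b la N.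
Proof.
move=> dv dph la E j hj ij u wu nu; have [p1 p2 p3 p4 p5] := dph; have lr n := (p1 n).1.
have wD := vtop_wmod hss hcart hb hhb dv; have [_ svD gvD uvD] := dv.
have tD : toplev b hss hcart mu D.
  by move=> nu' v v0 wv; have [[-> _]|H] := vtop_level hss hcart hb hhb dv v0 wv; [left|right].
have wN := dual_iso_wmod dph wD; have tN := dual_iso_toplev dph wD tD.
have [[k kE]|nex] := pselect (exists k : nat, (la tt0 : F) - (mu tt0 : F) = k%:R).
  exists 0; first exact: weight0.
  rewrite (hom0 hj) subr0; apply: (singularP hss hcart hb hhb wu) => be x pb rx.
  have [n nE] : exists n, j n = act x u by apply: nu; apply/(nplusP hss hcart hb hhb); apply: wsum1 rx.
  rewrite -nE; have [->|n0] := eqVneq n 0; first exact: hom0.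
  have wn : weight_vec (be + la) n by apply: (hom_inj_weight hj ij); rewrite nE; apply: weight_act.
  have [m mE] := pos_tt0 pb; have laE : (la tt0 : F) = k%:R + (mu tt0 : F) by rewrite -kE subrK.
  have : ((be + la) tt0 : F) - (mu tt0 : F) = (m.+1 + k)%:R by rewrite evD laE mE natrD addrA addrK.
  have [->|[l lE]] := tN _ _ n0 wn; first by move/eqP; rewrite subrr eq_sym pnatr_eq0.
  by rewrite -opprB lE => /eqP; rewrite eq_sym -subr_eq0 opprK -natrD pnatr_eq0.
have sJ := submodule_im hj; pose G e := exists n g, gen (eq u) g /\ e = j n + g.
have sG : submodule G.
  have sg := submodule_sub (gen_sub (eq u)); split.
  - by exists 0, 0; split; [exact: sub0 sg|rewrite (hom0 hj) addr0].
  - move=> c _ _ [n [g [Gg ->]]] [n' [g' [Gg' ->]]]; exists (c *: n + n'), (c *: g + g').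
    by split; [exact: (subZD sg)|rewrite hj.1; lmod F].
  - move=> x _ [n [g [Gg ->]]]; exists (act x n), (act x g).
    by split; [exact: (submodule_act _ (gen_sub _))|rewrite (hom_act hj) actDr].
have Gj n : G (j n).
  by exists n, 0; split; [exact: sub0 (submodule_sub (gen_sub _))|rewrite addr0].
have Gu : G u by exists 0, u; split; [exact: gen_in|rewrite (hom0 hj) add0r].
(* Passing to the submodule generated by [N] and [u] ensures a weight decomposition, which [E]
   itself may lack. *)
pose E1 := subg sG; have hs := sinc_hom sG; have si := @sinc_inj F L E G sG.
have wE1 : wmod h E1.
  apply: (wmod_emb hs si) => e; have sW := wsum_weights_sub hcart E; have := sincP e.
  move=> [n [g [Gg ->]]]; apply: (subD (submodule_sub sW)).
    have [s ws sE] := wN n; exists [seq (p.1, j p.2) | p <- s].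
      by move=> _ /mapP[p /ws wp ->]; apply: hom_weight.
    by rewrite sE (hom_sum hj) big_map.
  apply: (Gg _ sW) => _ <-; exists [:: (la, u)]; last by rewrite big_seq1.
  by move=> p; rewrite inE => /eqP ->.
have low nu' e : G e -> weight_vec nu' e -> (forall k : nat, (la tt0 : F) - (nu' tt0 : F) <> k%:R) -> exists n, j n = e.
  move=> [n [g [Gg eE]]] we H; have hq := qpi_hom sJ; apply/(qpi0P sJ)/eqP; apply: contrapT => /negP q0.
  have sq : sing la (qpi sJ u).
    by split=> [|x xn]; [exact: hom_weight|rewrite -(hom_act hq); apply/(qpi0P sJ); apply: nu].
  have gq : gen (eq (qpi sJ u)) (qpi sJ e).
    rewrite eE (homD hq) (_ : qpi sJ (j n) = 0) ?add0r; last by apply/qpi0P; exists n.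
    by apply: (Gg _ (submodule_pre hq (gen_sub _))) => _ <-; apply: gen_in.
  have [[E2 _]|[k kE]] := gen_level hss hcart hb hhb sq gq q0 (hom_weight hq we); last exact: (H k.+1).
  by apply: (H 0%N); rewrite E2 subrr.
have /choice[r rP] (e : E1) : exists n, j n = sinc (wproj wE1 mu e).
  apply: (low mu) => [||k kE]; [exact: sincP|exact: hom_weight hs (wproj_wt _ _ _)|by apply: nex; exists k].
have lin_r : linear r by move=> c x y; apply: ij; rewrite hj.1 !rP wproj_lin hs.1.
have [et etP] : exists et : Dual E1, dval et =1 fun e => phi (r e) vD.
  apply: dval_mk; split=> [c x y|]; first by rewrite lin_r p2.
  exists [:: mu] => nu' e we; rewrite inE => /negbTE ne; rewrite (_ : r e = 0) ?(pair0l p2)//.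
  by apply: ij; rewrite rP (wprojE _ _ we) ne (hom0 hj) (hom0 hs).
have r0 e : wproj wE1 mu e = 0 -> dval et e = 0.
  by move=> E2; rewrite etP (_ : r e = 0) ?(pair0l p2)//; apply: ij; rewrite rP E2 (hom0 hj) (hom0 hs).
have set : sing mu et.
  have wet : weight_vec mu et.
    move=> t; apply: dval_eq => e; rewrite dval_act tau_h (pairZl (@dval_linl E1)) !etP.
    rewrite -(pairZl p2); congr (phi _ vD); apply: ij; rewrite (homZ hj) !rP wproj_h.
    exact: (homZ hs).
  apply: (singularP hss hcart hb hhb wet) => be x pb rx; apply: dval_eq => e.
  rewrite dval_act (pair0l (@dval_linl E1)); move: e.
  apply: (wmod_ind wE1) => [|nu' e we].
    by split=> [|c y y' E2 E3]; rewrite ?act0r ?(pair0r (@dval_lin E1))// actDr actZr (dval_lin et) E2 E3 mulr0 addr0.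
  have wxe := weight_act (tau_root rx) we; apply: r0; rewrite (wprojE _ _ wxe).
  case: eqP => // muE; have [m mE] := pos_tt0 pb.
  have [n nE] : exists n, j n = sinc e.
    apply: (low nu') => [||k kE]; [exact: sincP|exact: hom_weight hs we|apply: nex; exists (k + m.+1)%N].
    by rewrite natrD -kE -mE -muE evD evN; ring.
  rewrite (_ : e = 0) ?act0r//; apply: si; rewrite -nE (hom0 hs).
  have wn : weight_vec nu' n by apply: (hom_inj_weight hj ij); rewrite nE; apply: hom_weight hs we.
  have [->|n0] := eqVneq n 0; first exact: hom0.
  have : (nu' tt0 : F) - (mu tt0 : F) = m.+1%:R by rewrite -muE evD evN mE; ring.
  have [->|[l lE]] := tN _ _ n0 wn; first by move/eqP; rewrite subrr eq_sym pnatr_eq0.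
  by rewrite -opprB lE => /eqP; rewrite eq_sym -subr_eq0 opprK -natrD pnatr_eq0.
have [R hR RE] := uvD _ _ set.
have [ro hro roP] := dual_transpose dph wE1 hR.
have [jE hjE jEE] := sub_corestr sG hj Gj.
have projD n : phi (wproj wN mu n) vD = phi n vD.
  move: n; apply: (wmod_ind wN) => [|nu' n wn].
    split=> [|c x y E2 E3]; first by rewrite wproj0.
    by rewrite wproj_lin !p2 E2 E3.
  rewrite (wprojE _ _ wn); case: eqP => // /eqP ne.
  by rewrite (pair0l p2) (pair_orth lr p2 p3 wn svD.1 ne).
have roj n e : sinc e = j n -> ro e = n.
  move=> eE; apply: p4 => z; rewrite roP; move: n e eE.
  apply: (gvD (fun z => forall n e, sinc e = j n -> dval (R z) e = phi n z)).
    split=> [n e _|c x y Hx Hy n e E2|x z' Hz n e E2].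
    - by rewrite (hom0 hR) (pair0l (@dval_linl E1)) (pair0r lr).
    - by rewrite hR.1 dval_linl lr (Hx n e) // (Hy n e).
    - rewrite (hom_act hR) dval_act (Hz (act (tau x) n)); last by rewrite (hom_act hs) E2 (hom_act hj).
      by rewrite p3 tauK.
  move=> n e E2; rewrite RE etP.
  rewrite -[RHS]projD; congr (phi _ vD); apply: ij; rewrite rP -jEE; congr sinc.
  rewrite (wproj_hom _ wE1 _ _ hjE); congr wproj; apply: si; by rewrite E2 jEE.
exists (ro (smk sG Gu)).
  by apply: hom_weight hro _; apply: (hom_inj_weight hs si).
split.
  apply: (subB (weight_sub _ _)) => //; apply: hom_weight hj _; apply: hom_weight hro _.
  exact: (hom_inj_weight hs si).
move=> x xn; have [n nE] := nu x xn; rewrite actBr -nE -(hom_act hj) -(hom_act hro).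
by rewrite (roj n) ?subrr// (hom_act hs).
Qed.
End Duality.

(** * Tilting modules *)

Section Fitting.
Variables (F : numClosedFieldType) (L : lieAlgebra F) (h : {vspace L}).
Local Notation hd := 'Hom(subvs_of h, F^o).
Implicit Types (mu : hd) (M : gmod L).

Lemma hom_pow M (e : M -> M) k : is_hom e -> is_hom (iter k e).
Proof. by move=> he; elim: k => [|k IH]; [exact: hom_id|exact: (hom_comp IH he)]. Qed.

(* Cayley-Hamilton for an endomorphism of a finite-dimensional weight space. *)
Lemma fitting_weight M (e : M -> M) mu : is_hom e -> wmod h M -> wfin h M -> exists a, forall v, weight_vec mu v ->
  (iter a.+1 e v = 0 -> iter a e v = 0) /\ exists2 w, weight_vec mu w & iter a e v = iter a.+1 e w.
Proof.
move=> he wM fM; have [l lP] := fM mu; pose n := size l.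
(* The leading 0 keeps the matrix size positive. The vectors span but may be dependent, so the
   matrix of [e] is a choice and relations have to be carried along ([horn]). *)
pose b (i : 'I_n.+1) := wproj wM mu (nth 0 (0 :: l) i).
pose Lc (c : 'rV[F]_n.+1) := \sum_i c 0 i *: b i.
have LcD c x y : Lc (c *: x + y) = c *: Lc x + Lc y.
  rewrite /Lc scaler_sumr -big_split; apply: eq_bigr => i _.
  by rewrite !mxE scalerDl scalerA.
have Lc0 : Lc 0 = 0 by rewrite /Lc big1// => i _; rewrite mxE scale0r.
have LcW c : weight_vec mu (Lc c).
  by apply: (sub_sum (weight_sub _ _)) => i _; apply: (subZ (weight_sub _ _)); apply: wproj_wt.
have span v : weight_vec mu v -> exists c, v = Lc c.
  move=> wv; rewrite -(wproj_id wM wv); have sP : subspace (fun v => exists c, wproj wM mu v = Lc c).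
    split; first by exists 0; rewrite Lc0 wproj0.
    by move=> a x y [c E] [c' E']; exists (a *: c + c'); rewrite wproj_lin E E' LcD.
  apply: (in_span_min sP) (lP _ wv) => y yl; have il : ((index y l).+1 < n.+1)%N by rewrite ltnS index_mem.
  exists (delta_mx 0 (Ordinal il)); rewrite /Lc (bigD1 (Ordinal il)) //= mxE !eqxx scale1r big1 ?addr0.
    by rewrite /b /= nth_index.
  by move=> i ne; rewrite mxE (negbTE ne) andbF scale0r.
have /choice[m mP] (i : 'I_n.+1) : exists c, e (b i) = Lc c.
  by apply: span; apply: hom_weight => //; apply: wproj_wt.
pose A := \matrix_i m i.
have eL c : e (Lc c) = Lc (c *m A).
  have LcS (I : Type) (r : seq I) (g : I -> 'rV[F]_n.+1) : Lc (\sum_(i <- r) g i) = \sum_(i <- r) Lc (g i).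
    by apply: (big_morph Lc) => // x y; have := LcD 1 x y; rewrite !scale1r.
  rewrite mulmx_sum_row LcS (hom_sum he); apply: eq_bigr => i _.
  rewrite rowK (homZ he) mP; have := LcD (c 0 i) (m i) 0; rewrite Lc0 !addr0 => ->; by [].
have iL k c : iter k e (Lc c) = Lc (c *m A ^+ k).
  by elim: k => [|k IH]; rewrite ?expr0 ?mulmx1// iterS IH eL exprSr mulmxA.
have horn p c : Lc c = 0 -> Lc (c *m horner_mx A p) = 0.
  move=> c0; elim/poly_ind: p => [|p d IH]; first by rewrite rmorph0 mulmx0.
  have -> : c *m horner_mx A (p * 'X + d%:P) = d *: c + (c *m horner_mx A p) *m A.
    by rewrite rmorphD rmorphM /= horner_mx_X horner_mx_C mulmxDr mul_mx_scalar addrC mulmxA.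
  by rewrite LcD c0 scaler0 add0r -eL IH (hom0 he).
(* Write the characteristic polynomial as $X^aq$ with $q(0)\neq0$. Then $X^a$ is congruent to a
   multiple of $X^{a+1}$ modulo it, so $A^a=A^{a+1}s(A)$. *)
have [a [q /implyP q0 pE]] := multiplicity_XsubC (char_poly A) 0.
have {}q0 := q0 (monic_neq0 (char_poly_monic A)); pose d := q.[0]; have d0 : d != 0 := q0.
have /factor_theorem[r rE] : root (q - d%:P) 0 by rewrite /root !hornerE subrr.
have qE : q = r * 'X + d%:P by rewrite -(subrK d%:P q) rE subr0.
pose s : {poly F} := - (d^-1)%:P * r; have hX k : horner_mx A 'X^k = A ^+ k by rewrite rmorphXn /= horner_mx_X.
have XE : 'X^a = 'X^(a.+1) * s + (d^-1)%:P * char_poly A :> {poly F}.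
  have dd : (d^-1)%:P * d%:P = 1 :> {poly F} by rewrite -polyCM mulVf.
  by rewrite -['X^a]mul1r -dd pE subr0 qE /s exprS; ring.
have AE : A ^+ a = horner_mx A ('X^(a.+1) * s).
  by rewrite -hX {1}XE rmorphD (rmorphM _ _ (char_poly A)) /= Cayley_Hamilton mulr0 addr0.
exists a => v /span[c ->]; split=> [E|].
  by rewrite iL AE rmorphM /= hX -mulmxE mulmxA horn// -iL.
exists (Lc (c *m horner_mx A s)); first exact: LcW.
by rewrite !iL AE mulrC rmorphM /= hX -mulmxE mulmxA.
Qed.

(** The generalized kernel and the stable image decompose [M], weight space by weight space. The
    fixed vector lies in the image, so the kernel is the summand that vanishes. *)
Lemma fitting M (e : M -> M) x : indecomposable M -> wmod h M -> wfin h M -> is_hom e -> x != 0 -> e x = x ->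
  bijective e.
Proof.
move=> [_ ind] wM fM he x0 ex.
pose A v := exists k, iter k e v = 0; pose B v := forall k, exists w, iter k e w = v.
have hk k := hom_pow k he.
have eA k k' v : (k <= k')%N -> iter k e v = 0 -> iter k' e v = 0.
  by move=> /subnK <- E; rewrite iterD E (hom0 (hk _)).
have sA : submodule A.
  split=> [|c u v [k E] [k' E']|y v [k E]]; first by exists 0%N.
    exists (maxn k k'); rewrite (hk _).1 (eA k) ?leq_maxl// (eA k') ?leq_maxr// scaler0 addr0 //.
  by exists k; rewrite (hom_act (hk _)) E act0r.
have sB : submodule B.
  split=> [k|c u v Bu Bv k|y v Bv k]; first by exists 0; rewrite (hom0 (hk _)).
    by have [[u' <-] [v' <-]] := (Bu k, Bv k); exists (c *: u' + v'); rewrite (hk _).1.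
  by have [v' <-] := Bv k; exists (act y v'); rewrite (hom_act (hk _)).
have stab mu : exists a, forall v, weight_vec mu v -> (forall k, iter (k + a) e v = 0 -> iter a e v = 0) /\
    forall k, exists2 w, weight_vec mu w & iter a e v = iter (k + a) e w.
  have [a aP] := fitting_weight mu he wM fM; exists a => v wv; split.
    elim=> // k IH E; apply: IH; rewrite iterD.
    have wk : weight_vec mu (iter k e v) by apply: hom_weight.
    have : iter a e (iter k e v) = 0 by apply: (aP _ wk).1; rewrite -iterD addSn addnC.
    by rewrite -!iterD addnC.
  elim=> [|k [w ww ->]]; first by exists v.
  have [w' ww' E] := (aP _ ww).2; exists w' => //.
  by rewrite iterD E -iterD addnS.
have AB0 v : A v -> B v -> v = 0.
  move=> Av Bv; have sAB := submoduleI sA sB; have [s ws vE] := wM v.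
  have [s' [_ ws' sP -> _]] := wdec_in (submodule_sub sAB) (submodule_h sAB) ws vE (conj Av Bv).
  rewrite big_seq big1// => p ps; have [[k kE] Bp] := sP p ps; have wp := ws' p ps.
  have [a aP] := stab p.1; have [w wE] := Bp a.
  have pE : p.2 = iter a e (wproj wM p.1 w) by rewrite (wproj_hom _ wM _ _ (hk a)) wE wproj_id.
  rewrite pE; apply: ((aP _ (wproj_wt _ _ _)).1 k); rewrite iterD -pE //.
have AB v : exists u w, [/\ A u, B w & v = u + w].
  move: v; apply: (wmod_ind wM) => [|mu v wv]; first exact: (subspaceD (submodule_sub sA) (submodule_sub sB)).
  have [a aP] := stab mu; have [w ww E] := (aP _ wv).2 a.
  exists (v - iter a e w), (iter a e w); split; last by rewrite subrK.
    by exists a; rewrite (homB (hk a)) E iterD subrr.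
  move=> k; have [w' _ ->] := (aP _ ww).2 k; exists (iter a e w'); by rewrite -iterD.
have Bx : B x by move=> k; exists x; elim: k => //= k ->.
have [A0|B0] := ind A B sA sB AB0 AB; last by move: x0; rewrite (B0 _ Bx) eqxx.
have ei : injective e by apply: (hom_inj he) => u eu; apply: A0; exists 1%N.
have /choice[r rP] v : exists u, e u = v.
  by have [u [w [/A0 -> Bw ->]]] := AB v; rewrite add0r; apply: (Bw 1%N).
by exists r => u; [apply: ei|]; rewrite rP.
Qed.
End Fitting.

Section Flags.
Variables (F : numClosedFieldType) (L : lieAlgebra F) (h b : {vspace L}) (tau : L -> L).
Local Notation hd := 'Hom(subvs_of h, F^o).
Hypotheses (hss : semisimple L) (hcart : cartan h) (hb : borel b) (hhb : (h <= b)%VS).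
Implicit Types (be la mu nu : hd) (M N A B D : gmod L).
Local Notation tt0 := (tt0 b hss hcart).
Local Notation sing := (singular_vec b).
Local Notation "'wt0' w" := (dot b (weyl_fun w) 0) (at level 10, w at level 9).
Let pos_tt0 := @pos_tt0 F L h b hss hcart hb hhb.

Lemma flag_LP (P : hd -> gmod L -> Prop) M s : flag P M s -> wmod h M ->
  (forall la B, P la B -> forall mu, LP b mu B) -> forall mu, LP b mu M.
Proof.
elim=> {M s} [M M0|A M B i p la s ex _ IH PB] wM H mu; first exact: LP0.
have [[hi ii] _ _ _] := ex.
by apply: (LP_ext ex wM); [apply: IH => //; exact: wmod_sub hi ii wM|apply: H PB _].
Qed.

Lemma tilting_LP M : transposition h tau -> tilting h b tau M -> forall mu, LP b mu M.
Proof.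
move=> htau [/in_O_wmod wM _ [s fs]]; apply: (flag_LP fs wM) => la B [D [/verma_top[v dv] [phi dphi]]].
exact: (LP_dual hss hcart hb hhb htau dv dphi).
Qed.

Lemma flag_LP_Dual (htau : transposition h tau) M s : flag (is_verma (h := h) b) M s -> wmod h M ->
  forall mu, LP b mu (Dual hcart htau M).
Proof.
elim=> {M s} [M M0|A M B i p la s ex _ IH /verma_top[v dv]] wM mu.
  apply: LP0 => f; apply: dval_eq => v.
  by rewrite (M0 v) (pair0r (@dval_lin _ _ _ _ hcart htau M)) (pair0l (@dval_linl _ _ _ _ hcart htau M)).
have [p' [i' ex']] := dual_exact hcart htau ex wM; have [[hi ii] _ _ _] := ex.
apply: (LP_ext ex'); first exact: Dual_wmod.
  exact: (LP_dual hss hcart hb hhb htau dv (dual_iso_Dual _ _ _)).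
exact: IH (wmod_sub hi ii wM) _.
Qed.

Lemma flag_wfin M s : flag (is_verma (h := h) b) M s -> wmod h M -> wfin h M.
Proof.
elim=> {M s} [M M0|A M B i p la s ex _ IH /verma_top[v dv]] wM.
  by move=> mu; exists [::] => u _; rewrite (M0 u); exact: sub0 (in_span_sub _).
have [[hi ii] _ _ _] := ex; apply: (wfin_ext ex wM); first exact: IH (wmod_sub hi ii wM).
exact: (vtop_finite hss hcart hb hhb dv).
Qed.

Lemma flag_level M s : flag (is_verma (h := h) b) M s -> forall nu (v : M), v != 0 -> weight_vec nu v ->
  exists2 la, la \in s & exists k : nat, (la tt0 : F) - (nu tt0 : F) = k%:R.
Proof.
elim=> {M s} [M M0|A M B i p la s [[hi ii] hp sp ker] _ IH /verma_top[v dv]] nu u u0 wu.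
  by rewrite (M0 u) eqxx in u0.
have [/ker[a aE]|/eqP pu0] := pselect (p u = 0).
  have a0 : a != 0 by apply: contra_neq u0 => a0; rewrite -aE a0 (hom0 hi).
  have wa : weight_vec nu a by apply: (hom_inj_weight hi ii); rewrite aE.
  by have [mu ms H] := IH _ _ a0 wa; exists mu; rewrite ?inE ?ms ?orbT.
exists la; first exact: mem_head.
have [[-> _]|[k kE]] := vtop_level hss hcart hb hhb dv pu0 (hom_weight hp wu); last by exists k.+1.
by exists 0%N; rewrite subrr.
Qed.

Definition blk M := forall N, simple_mod N -> subquotient N M ->
  exists w : weyl h, highest_weight_module b N (wt0 w).

Lemma blk_sub A M (i : A -> M) : is_hom i -> injective i -> blk M -> blk A.
Proof.
move=> hi ii H N sN [X [j [p [hj ij hp sp]]]]; apply: H => //.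
by exists X, (i \o j), p; split=> //; [exact: hom_comp|exact: inj_comp].
Qed.

Lemma blk_quot M B (q : M -> B) : is_hom q -> (forall v, exists u, q u = v) -> blk M -> blk B.
Proof.
move=> hq sq H N sN [X [j [p [hj ij hp sp]]]]; apply: H => //.
have sI := submodule_im hj; have sQ := submodule_pre hq sI; have hs := sinc_hom sQ.
have [|r hr rE] := corestr_inj hj ij (hom_comp hs hq); first by move=> m; exact: (sincP m).
exists (subg sQ), (@sinc F L M _ sQ), (p \o r); split=> //; [exact: sinc_inj|exact: hom_comp|].
move=> n; have [x <-] := sp n; have [m mE] := sq (j x).
have Qm : exists u, j u = q m by exists x.
by exists (smk sQ Qm); congr p; apply: ij; rewrite rE -mE.
Qed.

(** The module generated by [v], modulo its largest submodule without vectors of weight [la], is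
    simple of highest weight [la]; the block condition applies to this subquotient. *)
Lemma blk_sing M la (v : M) : blk M -> v != 0 -> sing la v -> exists w : weyl h, la = wt0 w.
Proof.
move=> bM v0 sv; have [wv nv] := sv; pose sK := gen_sub (eq v); pose K := subg sK.
have hK := sinc_hom sK; have iK := @sinc_inj F L M _ sK.
pose vK : K := smk sK (gen_in (erefl v)).
have wvK : weight_vec la vK by apply: (hom_inj_weight hK iK).
have wK : wmod h K by apply: (gen_wmod hcart wvK); exact: gen_subg.
have line (u : K) : weight_vec la u -> exists c, u = c *: vK.
  move=> wu; have [->|u0] := eqVneq u 0; first by exists 0; rewrite scale0r.
  have su0 : sinc u != 0 by apply: contra_neq u0 => E; apply: iK; rewrite E (hom0 hK).
  have [[_ [c E]]|[k /eqP]] := gen_level hss hcart hb hhb sv (sincP u) su0 (hom_weight hK wu).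
    by exists c; apply: iK; rewrite (homZ hK).
  by rewrite subrr eq_sym pnatr_eq0.
pose R (u : K) := forall w, gen (eq u) w -> wproj wK la w = 0.
have sR : submodule R.
  split=> [w gw|c u1 u2 R1 R2 w gw|x u Ru w gw].
  - by rewrite (gw _ (zero_sub K)) ?wproj0// => _ <-.
  - have sD := subspaceD (submodule_sub (gen_sub (eq u1))) (submodule_sub (gen_sub (eq u2))).
    have [w1 [w2 [g1 g2 ->]]] : exists w1 w2, [/\ gen (eq u1) w1, gen (eq u2) w2 & w = w1 + w2].
      apply: (gw (fun w => exists w1 w2, [/\ gen (eq u1) w1, gen (eq u2) w2 & w = w1 + w2])).
        split; [exact: sub0 sD|exact: sD.2|].
        move=> x _ [w1 [w2 [g1 g2 ->]]]; exists (act x w1), (act x w2).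
        by split; rewrite ?actDr//; apply: (submodule_act _ (gen_sub _)).
      move=> _ <-; exists (c *: u1), u2; split=> //; last exact: gen_in.
      by apply: (subZ (submodule_sub (gen_sub _))); exact: gen_in.
    have := wproj_lin wK la 1 w1 w2; rewrite !scale1r (R1 _ g1) (R2 _ g2) addr0 //.
  - apply: Ru; apply: gw; first exact: gen_sub.
    by move=> _ <-; apply: (submodule_act _ (gen_sub _)); exact: gen_in.
have hq := qpi_hom sR; pose Q := quog sR.
have qv0 : qpi sR vK != 0.
  apply/eqP => /(qpi0P sR) /(_ vK (gen_in erefl)); rewrite wproj_id// => E.
  by move: v0; rewrite -[v]/(sinc vK) E (hom0 hK) eqxx.
have smp : simple_mod Q.
  split=> [|A sA]; first by exists (qpi sR vK).
  have [H|/existsNP[u /not_implyP[Au nR]]] := pselect (forall u, A (qpi sR u) -> R u).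
    by left=> y; have [u <-] := qpi_surj y => /H; apply: (qpi0P sR _).2.
  right; have [w /not_implyP[gw /eqP w0]] : exists w, ~ (gen (eq u) w -> wproj wK la w = 0).
    by apply/existsNP.
  have sP := submodule_pre hq sA.
  have Aw : A (qpi sR (wproj wK la w)).
    apply: (wproj_sub wK la (P := fun k => A (qpi sR k)) sP).
    by apply: (gw _ sP) => _ <-.
  have [c cE] := line _ (wproj_wt wK la w).
  have c0 : c != 0 by apply: contra_neq w0 => c0; rewrite cE c0 scale0r.
  have Av : A (qpi sR vK).
    by apply: (subZ_inv (submodule_sub sA) c0); rewrite -(homZ hq) -cE.
  by move=> y; have [k <-] := qpi_surj y; apply: (gen_subg sP Av).
have sub : subquotient Q M.
  by exists K, (@sinc F L M _ sK), (qpi sR); split=> //; exact: qpi_surj.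
have [w [v' [v'0 sv' gv']]] := bM Q smp sub; exists w.
have gq : gen (eq (qpi sR vK)) v'.
  have [k <-] := qpi_surj v'; have sP := submodule_pre hq (gen_sub (eq (qpi sR vK))).
  by apply: (gen_subg sP); exact: gen_in.
have gq' : gen (eq v') (qpi sR vK).
  by move=> P sP H; apply: gv' => // u; rewrite inE => /eqP ->; apply: H.
have sq : sing la (qpi sR vK).
  apply: (hom_sing hq); split=> // x xb; apply: iK; rewrite (hom_act hK) (hom0 hK); exact: nv.
have [[//]|[k kE]] := gen_level hss hcart hb hhb sv' gq' qv0 sq.1.
have [[//]|[l lE]] := gen_level hss hcart hb hhb sq gq v'0 sv'.1.
have /eqP : (k.+1%:R + l.+1%:R : F) = 0 by rewrite -kE -lE; ring.
by rewrite -natrD pnatr_eq0.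
Qed.

Lemma flag_blk M s : flag (is_verma (h := h) b) M s -> blk M -> forall la, la \in s -> exists w : weyl h, la = wt0 w.
Proof.
elim=> {M s} [//|A M B i p mu s [[hi ii] hp sp ker] _ IH /verma_top[v [v0 sv _ _]]] bM la.
rewrite inE => /predU1P[->|]; last by apply: IH; exact: blk_sub hi ii bM.
exact: blk_sing (blk_quot hp sp bM) v0 sv.
Qed.

(** Depths below [C] are natural numbers, so [P] has a nonzero weight vector of least depth, and
    positive root vectors would decrease it further. *)
Lemma top_singular M (P : M -> Prop) C : submodule P -> wmod h M ->
  (forall nu (v : M), v != 0 -> weight_vec nu v -> exists k : nat, (C : F) - (nu tt0 : F) = k%:R) ->
  (exists2 u, P u & u != 0) -> exists nu (u : M) (k : nat), [/\ P u, u != 0, sing nu u, C - (nu tt0 : F) = k%:R &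
    forall nu' (u' : M) (k' : nat), P u' -> u' != 0 -> weight_vec nu' u' -> C - (nu' tt0 : F) = k'%:R -> (k <= k')%N].
Proof.
move=> sP wM lev [u Pu u0].
pose q (k : nat) := `[< exists nu (v : M), [/\ P v, v != 0, weight_vec nu v & C - (nu tt0 : F) = k%:R] >].
have ex : exists k, q k.
  have [s ws sE] := wM u; have [s' [_ ws' Ps uE _]] := wdec_in (submodule_sub sP) (submodule_h sP) ws sE Pu.
  have [p ps p0] : exists2 p, p \in s' & p.2 != 0.
    apply: contrapT => nex; move/eqP: u0; apply; rewrite uE big_seq big1// => p ps.
    by apply/eqP; apply: contraT => p0; case: nex; exists p.
  have [k kE] := lev _ _ p0 (ws' p ps); exists k; apply/asboolP; exists p.1, p.2.
  by split=> //; [exact: Ps|exact: ws'].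
case: (ex_minnP ex) => k /asboolP[nu [v [Pv v0 wv kE]]] mn.
exists nu, v, k; split=> //; last first.
  by move=> nu' u' k' Pu' u'0 wu' E; apply: mn; apply/asboolP; exists nu', u'.
apply: (singularP hss hcart hb hhb wv) => be x pb rx; apply/eqP; apply: contraT => x0.
have wx := weight_act rx wv; have [l lE] := lev _ _ x0 wx; have [m mE] := pos_tt0 pb.
have /mn : q l by apply/asboolP; exists (be + nu), (act x v); split=> //; exact: submodule_act.
have E : (k%:R : F) = (l + m.+1)%:R by rewrite natrD -lE -kE -mE evD; ring.
by move/eqP: E; rewrite eqr_nat => /eqP ->; lia.
Qed.
End Flags.

Section TiltingModules.
Variables (F : numClosedFieldType) (L : lieAlgebra F) (h b : {vspace L}) (tau : L -> L).
Local Notation hd := 'Hom(subvs_of h, F^o).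
Variables (Delta T : weyl h -> gmod L) (iota : forall w, Delta w -> T w) (phi : forall w, T w -> T w -> F).
Hypotheses (hss : semisimple L) (hcart : cartan h) (hb : borel b) (hhb : (h <= b)%VS).
Hypothesis htau : transposition h tau.
Hypothesis hD : forall w : weyl h, is_verma b (dot b w 0) (Delta w).
Hypothesis hT : forall w : weyl h, [/\ tilting h b tau (T w), indecomposable (T w)
  & has_highest_weight b (T w) (dot b w 0)].
Hypothesis hiota : forall w, is_hom (@iota w) /\ injective (@iota w).
Hypothesis hphi : forall w, dual_iso h tau (@phi w).
Implicit Types (be la mu nu : hd) (M N A B D Q : gmod L) (w : weyl h).
Local Notation tt0 := (tt0 b hss hcart).
Local Notation sing := (singular_vec b).
Local Notation "'wt0' w" := (dot b (weyl_fun w) 0) (at level 10, w at level 9).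
Local Notation Dual := (Dual hcart htau).
Local Notation dlin := (@dval_lin F L h tau hcart htau _).
Local Notation dlinl := (@dval_linl F L h tau hcart htau _).
Local Notation dact := (@dval_act F L h tau hcart htau _).
Let pos_tt0 := @pos_tt0 F L h b hss hcart hb hhb.

Definition vT w : T w := iota (vt hD w).

Lemma T_wmod w : wmod h (T w). Proof. by case: (hT w) => [[/in_O_wmod]]. Qed.
Lemma T_LP w mu : LP b mu (T w).
Proof. by case: (hT w) => tw _ _; apply: (tilting_LP hss hcart hb hhb htau tw). Qed.
Lemma T_toplev w : toplev b hss hcart (wt0 w) (T w).
Proof. by case: (hT w) => _ _; apply: highest_toplev. Qed.
Lemma T_flag w : exists s, flag (is_verma (h := h) b) (T w) s. Proof. by case: (hT w) => [[]]. Qed.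
Lemma T_wfin w : wfin h (T w).
Proof. by have [s fs] := T_flag w; exact: (flag_wfin hss hcart hb hhb fs (@T_wmod w)). Qed.
Lemma vT0 w : vT w != 0.
Proof.
have [hi ii] := hiota w; have [v0 _ _ _] := vtP hD w; apply: contra_neq v0 => E.
by apply: ii; rewrite (hom0 hi).
Qed.
Lemma vT_sing w : sing (wt0 w) (vT w).
Proof. by have [_ sv _ _] := vtP hD w; apply: hom_sing sv; exact: (hiota w).1. Qed.

Lemma T_functional w : exists2 xi : T w -> F, linear_for *%R xi & xi (vT w) = 1.
Proof.
have sP := submodule_sub (zero_sub (T w)).
by have [|xi [lx _ x1]] := separate sP (v := vT w); [move/eqP: (vT0 w)|exists xi].
Qed.

(** At this point the top weight space may be larger than a line, so a functional equal to 1 at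
    [vT w] prescribes the values on all of it. *)
Lemma T_hom w N (u : N) : (forall mu, LP b mu N) -> sing (wt0 w) u ->
  exists2 f : T w -> N, is_hom f & f (vT w) = u.
Proof.
move=> lpN su; have [s fs] := T_flag w; have [xi lx x1] := T_functional w.
have [|v _|f hf fE] := top_hom hb hhb fs (g := fun v => xi v *: u) (@T_wmod w) (@T_toplev w) lpN.
- by move=> c v v'; rewrite lx scalerDl scalerA.
- by split=> [|y yn]; [apply: (subZ (weight_sub _ _)); case: su|rewrite actZr su.2// scaler0].
by exists f => //; rewrite fE ?x1 ?scale1r//; case: (vT_sing w).
Qed.

(** The endomorphism extending $v\mapsto\xi(v)v_T$ fixes $v_T$, hence is bijective by Fitting's
    lemma. It takes the same value at $v$ and at $\xi(v)v_T$. *)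
Lemma T_top w (v : T w) : weight_vec (wt0 w) v -> exists c, v = c *: vT w.
Proof.
move=> wv; have [s fs] := T_flag w; have [xi lx x1] := T_functional w; have sv := vT_sing w.
have [|v' _|f hf fE] := top_hom hb hhb fs (g := fun v => xi v *: vT w) (@T_wmod w) (@T_toplev w) (@T_LP w).
- by move=> c u u'; rewrite lx scalerDl scalerA.
- by split=> [|y yn]; [apply: (subZ (weight_sub _ _)); case: sv|rewrite actZr sv.2// scaler0].
have fv : f (vT w) = vT w by rewrite fE ?x1 ?scale1r//; case: sv.
have [_ ind _] := hT w; have [g gK _] := fitting ind (@T_wmod w) (@T_wfin w) hf (vT0 w) fv.
by exists (xi v); apply: (can_inj gK); rewrite fE// (homZ hf) fv.
Qed.

Lemma T_split w Q (f : T w -> Q) (p : Q -> T w) : is_hom f -> is_hom p -> p (f (vT w)) != 0 ->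
  exists2 r : Q -> T w, is_hom r & cancel f r.
Proof.
move=> hf hp n0; have wp : weight_vec (wt0 w) (p (f (vT w))).
  by do 2! apply: hom_weight => //; case: (vT_sing w).
have [c cE] := T_top wp; have c0 : c != 0 by apply: contra_neq n0 => c0; rewrite cE c0 scale0r.
pose e u := c^-1 *: p (f u).
have hz := hom_zero (T w) (T w); have he' := hom_lin c^-1 (hom_comp hf hp) hz.
have he : is_hom e by split=> [a u v|a u]; [have := he'.1 a u v|have := he'.2 a u]; rewrite /= !addr0.
have ev : e (vT w) = vT w by rewrite /e cE scalerA mulVf// scale1r.
have [_ ind _] := hT w; have [g gK gK'] := fitting ind (@T_wmod w) (@T_wfin w) he (vT0 w) ev.
have hg : is_hom g.
  split=> [a u v|a u]; apply: (can_inj gK); first by rewrite he.1 !gK'.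
  by rewrite (hom_act he) !gK'.
exists (fun q => g (c^-1 *: p q)); last by move=> u; rewrite -[_ *: _]/(e u) gK.
split=> [a u v|a u]; first by rewrite hp.1 scalerDr scalerA mulrC -scalerA hg.1.
by rewrite (hom_act hp) -actZr (hom_act hg).
Qed.

(** * Splitting off indecomposable tilting modules *)

Section Peeling.
(** Consequences of being tilting in the block that suffice for splitting and pass directly to
    summands, as [cls_retract] shows; for filtrations this would be less direct. *)
Definition cls Q := [/\ wmod h Q, forall mu, LP b mu Q, forall mu, LP b mu (Dual Q), @blk F L h b Q
  & forall nu (v : Q), v != 0 -> weight_vec nu v -> exists k : nat, (0 : F) - (nu tt0 : F) = k%:R].

(** A singular [u] of maximal level extends to a map from [T w]. A functional detecting [u] is
    singular, so it extends to a map from [T w] to the dual, which self-duality of [T w] transposes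
    to a map back. The composite is nonzero on the top. *)
Lemma cls_peel Q (u0 : Q) : cls Q -> u0 != 0 -> exists w (f : T w -> Q) (r : Q -> T w), [/\ is_hom f, is_hom r & cancel f r].
Proof.
move=> [wQ lpQ lpD bQ lev] u00; have sT : submodule (fun _ : Q => True) by [].
have [|nu [u [k [_ un0 su kE kmin]]]] := top_singular hb hhb sT wQ lev; first by exists u0.
have [w wE] := blk_sing hss hcart hb hhb bQ un0 su; rewrite wE in su kE.
have [f hf fE] := T_hom lpQ su; have sP := submodule_sub (zero_sub Q).
have [|xi [lx _ x1]] := separate sP (v := u); first exact/eqP.
have [|et set etE] := dual_top hss hcart hb hhb htau wQ lx (mu := wt0 w).
  move=> be v pb wv; apply/eqP; apply: contraT => v0; have [l lE] := lev _ _ v0 wv.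
  have := kmin _ _ _ I v0 wv lE; have [m mE] := pos_tt0 pb.
  have wtE : ((be + wt0 w) tt0 : F) = be tt0 + (wt0 w) tt0 := evD _ _ _.
  have E : (k%:R : F) = (l + m.+1)%:R by rewrite natrD -lE -kE -mE wtE; ring.
  by move/eqP: E; rewrite eqr_nat => /eqP ->; lia.
have [g hg gE] := T_hom lpD set.
have [p hp pE] := dual_transpose (hphi w) wQ hg.
have [|r hr rK] := T_split hf hp; last by exists w, f, r.
apply/eqP => E; have := pE (f (vT w)) (vT w); have [p1 p2 _ _ _] := hphi w.
rewrite E (pair0l p2) gE etE fE wproj_id ?x1; last by case: su.
by move/eqP; rewrite eq_sym oner_eq0.
Qed.

Lemma cls_retract A Q (i : A -> Q) (p : Q -> A) : is_hom i -> is_hom p -> cancel i p -> cls Q -> cls A.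
Proof.
move=> hi hp ipK [wQ lpQ lpD bQ lev]; have ii := can_inj ipK; split.
- exact: wmod_sub hi ii wQ.
- by move=> mu; apply: (LP_retract hi hp ipK).
- move=> mu; have [p' hp' pE] := dual_map hcart htau hp; have [i' hi' iE] := dual_map hcart htau hi.
  by apply: (LP_retract hp' hi' _ (lpD mu)) => f; apply: dval_eq => v; rewrite iE pE ipK.
- exact: blk_sub hi ii bQ.
- move=> nu v v0 wv; apply: (lev nu (i v)); last exact: hom_weight.
  by apply: contra_neq v0 => E; apply: ii; rewrite E (hom0 hi).
Qed.

Lemma span_drop M (l : seq M) v : v != 0 -> in_span l v -> exists2 l', size l = (size l').+1 &
  forall u, in_span l u -> exists c, in_span l' (u - c *: v).
Proof.
move=> v0 [c vE]; have [i ci] : exists i : 'I_(size l), c i *: l`_i != 0.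
  apply: contrapT => nex; move/eqP: v0; apply; rewrite vE big1// => i _.
  by apply/eqP; apply: contraT => n; case: nex; exists i.
have ci0 : c i != 0 by apply: contra_neq ci => ->; rewrite scale0r.
pose l' := take i l ++ drop i.+1 l; have sl' := in_span_sub l'.
have il := ltn_ord i; have mem j : (j < size l)%N -> j != i -> l`_j \in l'.
  move=> jl ne; rewrite mem_cat; have [ji|ij] := ltnP j i.
    by rewrite -(nth_take 0 ji) mem_nth// size_take il.
  apply/orP; right; have {}ij : (i.+1 <= j)%N by rewrite ltn_neqAle eq_sym ne.
  by rewrite -(subnKC ij) -nth_drop mem_nth// size_drop ltn_sub2r// (leq_ltn_trans ij).
exists l'; first by rewrite size_cat size_take il size_drop; lia.
move=> u; have sP : subspace (fun u => exists c, in_span l' (u - c *: v)).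
  split; first by exists 0; rewrite scale0r subr0; exact: sub0 sl'.
  move=> a x y [d dP] [d' dP']; exists (a * d + d').
  by have := subZD sl' a dP dP'; congr in_span; lmod F.
apply: (in_span_min sP) => y /(nthP 0)[j jl <-]; have [->|ne] := eqVneq j i; last first.
  by exists 0; rewrite scale0r subr0; apply: in_span_mem; apply: mem.
exists (c i)^-1; rewrite vE (bigD1 i) //= scalerDr scalerA mulVf// scale1r opprD addrA subrr sub0r.
apply: (subN sl'); apply: (subZ sl'); apply: (sub_sum sl') => k ki; apply: (subZ sl').
by apply: in_span_mem; apply: mem.
Qed.

(** Each removed summand has its top vector in one of the weight spaces listed in [l], and
    [span_drop] then spares one spanning vector there. *)
Lemma cls_dsum (l : seq hd) : (forall w, wt0 w \in l) -> uniq l -> forall m Q (f : hd -> seq Q), cls Q ->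
  (forall mu u, mu \in l -> weight_vec mu u -> in_span (f mu) u) -> (\sum_(mu <- l) size (f mu) <= m)%N ->
  exists s (a : Q -> dsum T s), is_iso a.
Proof.
move=> lP ul; elim=> [|m IH] Q f cQ fP fm.
all: have [Q0|] := pselect (forall u : Q, u = 0).
1, 3: exists [::], (fun=> 0); split; [exact: hom_zero|exists (fun=> 0) => u; [exact/esym/Q0|]].
1, 2: by apply/matrixP => i [].
all: move=> /existsNP[u0 /eqP u00]; have [w [g [r [hg hr rK]]]] := cls_peel cQ u00.
all: have [wv _] := vT_sing w; have wgv := hom_weight hg wv.
all: have gv0 : g (vT w) != 0 by apply: contra_neq (vT0 w) => E; rewrite -(rK (vT w)) E (hom0 hr).
all: have [l' l'E l'P] := span_drop gv0 (fP _ _ (lP w) wgv).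
  by move: fm; rewrite (bigD1_seq (wt0 w)) //= l'E.
have sK : submodule (fun q => r q = 0) := submodule_ker hr.
have hK := sinc_hom sK; pose K := subg sK.
have hp : is_hom (fun q => (-1) *: g (r q) + q) by apply: (hom_lin _ (hom_comp hr hg) (hom_id _)).
have [|p hp' pE] := sub_corestr sK hp.
  by move=> q; rewrite hr.1 rK; lmod F.
have pK : cancel (@sinc F L Q _ sK) p.
  by move=> k; apply: (@sinc_inj F L Q _ sK); rewrite pE (sincP k) (hom0 hg) scaler0 add0r.
have pg v : p (g v) = 0 by apply: (@sinc_inj F L Q _ sK); rewrite pE rK (hom0 hK); lmod F.
pose f' mu : seq K := if mu == wt0 w then map p l' else map p (f mu).
have spanp (t : seq Q) u : in_span t u -> in_span (map p t) (p u).
  have st := in_span_sub (map p t); apply: (in_span_min (P := fun u => in_span (map p t) (p u))) => [|y yt].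
    by split=> [|c x y Hx Hy]; rewrite ?(hom0 hp') ?hp'.1; [exact: sub0 st|exact: (subZD st)].
  by apply: in_span_mem; apply: map_f.
have [||s [a [ha [a' aK a'K]]]] := IH K f' (cls_retract hK hp' pK cQ).
- move=> mu u mul wu; rewrite -(pK u); have := fP mu (sinc u) mul (hom_weight hK wu).
  rewrite /f'; case: eqP => [->|_]; last exact: spanp.
  by move=> /l'P[c /spanp]; rewrite (homB hp') (homZ hp') pg scaler0 subr0.
- move: fm; rewrite (bigD1_seq (wt0 w)) //= l'E [in X in _ -> X](bigD1_seq (wt0 w)) //= /f' eqxx size_map.
  rewrite addSn ltnS; congr (_ + _ <= _)%N; apply: eq_bigr => mu /negbTE ->; by rewrite size_map.
exists (w :: s), (fun q => (r q, a (p q))); split.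
  split=> [c x y|x q]; congr pair; rewrite /= ?hr.1 ?(hom_act hr)//.
    by rewrite hp'.1 ha.1.
  by rewrite (hom_act hp') (hom_act ha).
exists (fun u => g u.1 + sinc (a' u.2)) => [q|[u1 u2]] /=; first by rewrite aK pE; lmod F.
by rewrite (homD hr) rK (sincP (a' u2)) addr0 (homD hp') pg add0r pK a'K.
Qed.
End Peeling.

Lemma tilting0_cls Q : tilting0 h b tau Q -> cls Q.
Proof.
move=> [tQ [oQ bQ]]; have wQ := in_O_wmod oQ; have [_ [s fs] _] := tQ; split=> //.
- exact: (tilting_LP hss hcart hb hhb htau tQ).
- exact: (@flag_LP_Dual F L h b tau hss hcart hb hhb htau Q s fs wQ).
- move=> nu v v0 wv; have [la las [k kE]] := flag_level hss hcart hb hhb fs v0 wv.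
  have [w wE] := flag_blk hss hcart hb hhb fs bQ las; have [m [mE _]] := dot_level hss hcart hb hhb w.
  by exists (k + m)%N; rewrite natrD -kE wE mE; ring.
Qed.

Theorem tilting0_dsum Q : tilting0 h b tau Q -> exists s (a : Q -> dsum T s), is_iso a.
Proof.
move=> tQ; have cQ := tilting0_cls tQ; have [l lP] := dot_finite hss hcart hb hhb.
have [[oQ [s fs] _] _] := tQ; have fin := flag_wfin hss hcart hb hhb fs (in_O_wmod oQ).
have [f fP] := choice fin; apply: (@cls_dsum (undup l) _ _ _ Q f cQ) => [w||mu u _ wu|//].
- by rewrite mem_undup; apply: lP.
- exact: undup_uniq.
- exact: fP.
Qed.

Lemma dual_emb N M (ph : N -> M -> F) : dual_iso h tau ph -> exists2 e : N -> Dual M, is_hom e & forall n, dval (e n) =1 ph n.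
Proof.
move=> [p1 p2 p3 p4 p5].
have /choice[e eP] (n : N) : exists f : Dual M, dval f =1 ph n by apply: dval_mk.
exists e => //; split=> [c x y|x y]; apply: dval_eq => v; first by rewrite dval_linl !eP p2.
by rewrite dval_act !eP p3.
Qed.

Lemma dagger x y (f : T x -> T y) : is_hom f -> exists2 f' : T y -> T x, is_hom f' & forall u v, phi (f' u) v = phi u (f v).
Proof.
move=> hf; have [p1 p2 p3 p4 p5] := hphi x; have [q1 q2 q3 q4 q5] := hphi y.
have /choice[r rP] (u : T y) : exists n, phi n =1 fun v => phi u (f v).
  apply: p5; have [lu [S SP]] := q1 u; split; first by move=> c v v'; rewrite hf.1 lu.
  by exists S => la v /(hom_weight hf); apply: SP.
exists r => //; split=> [c u u'|a u]; apply: p4 => v; first by rewrite p2 !rP q2.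
by rewrite p3 !rP q3 (hom_act hf).
Qed.

(* Functionals singular of weight mu vanish on n^- M, hence are determined by
   their values on lifts of the generators of weight mu of the layers. *)
Lemma dual_sing_determined M s mu : flag (is_verma (h := h) b) M s -> wmod h M -> exists t : seq M,
  size t = count_mem mu s /\ forall et : Dual M, sing mu et -> (forall y, y \in t -> dval et y = 0) -> et = 0.
Proof.
elim=> {M s} [M M0|A M B i p la s ex _ IH /verma_top[vB dv]] wM.
  exists [::]; split=> // et _ _; apply: dval_eq => v; rewrite (M0 v).
  by rewrite (pair0r dlin) (pair0l dlinl).
have [[hi ii] hp sp ker] := ex; have [t [tE tP]] := IH (wmod_sub hi ii wM).
have [_ svB gvB _] := dv; have [m0 wm0 m0E] := weight_lift hp sp wM svB.1.
exists (if la == mu then m0 :: map i t else map i t); split.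
  by rewrite /= -tE; case: eqP => _ /=; rewrite size_map.
move=> et set H; have [i' hi' iE] := dual_map hcart htau hi.
have i0 a : dval et (i a) = 0.
  rewrite -iE (tP (i' et)) ?(pair0l dlinl)//; first exact: hom_sing.
  move=> y yt; rewrite iE; apply: H; case: eqP => _; rewrite ?inE map_f ?orbT//.
have fr m m' : p m = p m' -> dval et m' = 0 -> dval et m = 0.
  move=> E E'; have /ker[a aE] : p (m - m') = 0 by rewrite (homB hp) E subrr.
  by rewrite -(subrK m' m) -aE (pairDr dlin) i0 E' addr0.
suff Q y : forall m, p m = y -> dval et m = 0.
  by apply: dval_eq => m; rewrite (pair0l dlinl); apply: Q.
have [wv nv] := svB.
have top be x : is_root be -> root_vec be x -> 0 < (be tt0 : F) -> act x vB = 0.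
  move=> rb rx p0; apply: nv; apply/(nplusP hss hcart hb hhb).
  apply: wsum1 rx; have [//|/pos_tt0[k]] := pos_or hss hcart hb hhb rb; rewrite evN => E.
  by move: p0; rewrite -oppr_lt0 E ltrn0.
apply: (neg_generation hcart (pos_reg hss hcart hb hhb) gvB top (P := fun y => forall m, p m = y -> dval et m = 0)).
- split=> [m pm|c y1 y2 H1 H2 m pm]; first by apply: (fr m 0); rewrite ?(hom0 hp)// (pair0r dlin).
  have [[m1 E1] [m2 E2]] := (sp y1, sp y2); apply: (fr m (c *: m1 + m2)); first by rewrite hp.1 E1 E2.
  by rewrite (dval_lin et) (H1 _ E1) (H2 _ E2) mulr0 addr0.
- move=> m pm; apply: (fr m m0); rewrite ?m0E//; have [E|ne] := eqVneq la mu.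
    by apply: H; rewrite E eqxx mem_head.
  by rewrite eq_sym in ne; apply: (pair_orth htau dlin dlinl dact set.1 wm0 ne).
- move=> t' y1 Hy m pm; have [m1 E1] := sp y1; apply: (fr m (act (vsval t') m1)); first by rewrite (hom_act hp) E1.
  by rewrite -[vsval t'](tau_h htau) -dval_act (set.1 t') (pairZl dlinl) (Hy _ E1) mulr0.
move=> be x y1 rb rx neg Hy m pm; have [m1 E1] := sp y1; apply: (fr m (act x m1)); first by rewrite (hom_act hp) E1.
rewrite -[x](tauK htau) -dval_act set.2 ?(pair0l dlinl)//.
apply/(nplusP hss hcart hb hhb); apply: (wsum1 (al := - be)) (tau_root htau rx).
have [/pos_tt0[k E]|//] := pos_or hss hcart hb hhb rb.
by move: neg; rewrite E ltrn0.
Qed.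
Lemma Br_length x y m n : Br b hss hcart x y -> has_length b x m -> has_length b y n -> x = y \/ (m < n)%N.
Proof.
move=> H; elim: H m n => {x y} [x|x y z xy IH yz] m n lx lz; first by left.
have [_ [m' [n' [ly lz' mn]]]] := garrow_bruhat hb hhb yz.
have nE : n' = n.
  by apply/eqP; rewrite eqn_leq (lz'.2 _ lz.1) (lz.2 _ lz'.1).
right; rewrite -nE; have [E|lt] := IH _ _ lx ly; last exact: ltn_trans mn.
by rewrite E in lx; apply: leq_ltn_trans mn; apply: lx.2; case: ly.
Qed.

Lemma verma_LP w la B : is_verma b (wt0 w) B -> LP b la (Delta w) -> LP b la B.
Proof.
move=> /verma_top[v [_ sv gv uv]]; have [_ sv' gv' uv'] := vtP hD w.
have [i hi iE] := uv _ _ sv'; have [r hr rE] := uv' _ _ sv.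
apply: (LP_retract hi hr) => y; apply: (gv (fun y => r (i y) = y)); last by rewrite iE rE.
split=> [|c y1 y2 E1 E2|x y1 E1]; first by rewrite (hom0 hi) (hom0 hr).
  by rewrite hi.1 hr.1 E1 E2.
by rewrite (hom_act hi) (hom_act hr) E1.
Qed.

Lemma verma_LP_top la B : is_verma b la B -> LP b la B.
Proof.
move=> /verma_top[v dv] E j hj ij u wu nu; exists 0; first exact: weight0.
rewrite (hom0 hj) subr0; apply: (singularP hss hcart hb hhb wu) => be x pb rx.
have [n nE] : exists n, j n = act x u by apply: nu; apply/(nplusP hss hcart hb hhb); apply: wsum1 rx.
have wn : weight_vec (be + la) n by apply: (hom_inj_weight hj ij); rewrite nE; apply: weight_act.
by rewrite -nE (toplev_above hb hhb (vtop_toplev hss hcart hb hhb dv) pb wn) (hom0 hj).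
Qed.

(** If the top layer has weight [wt0 z], its generator lifts over the lower layers. Otherwise keep
    the pair found in the submodule: its functional amounts to a map into the dual of [Delta z],
    which extends over the next layer since dual Verma modules have the lifting property for every
    weight. *)
Lemma flag_split_pair z M s : flag (is_verma (h := h) b) M s -> wmod h M -> wt0 z \in s ->
  (forall la B, la \in s -> is_verma b la B -> LP b (wt0 z) B) ->
  exists (a : M) (xi : Dual M), [/\ sing (wt0 z) a, sing (wt0 z) xi & dval xi a = 1].
Proof.
elim=> {M s} [//|A M B i p mu s ex fA IH vB] wM zs H.
have [[hi ii] hp sp ker] := ex; have wA := wmod_sub hi ii wM.
have [v dv] := verma_top vB; have [v0 sv gv uv] := dv.
have [E|ne] := eqVneq mu (wt0 z).
  rewrite E in sv dv; have [m0 wm0 m0E] := weight_lift hp sp wM sv.1.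
  have lpA : LP b (wt0 z) A.
    elim: fA wA H => {vB zs E ex hi ii ker i IH} {A s} [A A0|A A' A'' i' p' la s ex _ IH PB] wA H; first exact: LP0.
    have [[hi ii] _ _ _] := ex; apply: (LP_ext ex wA).
      apply: IH; [exact: wmod_sub hi ii wA|].
      by move=> la' B' H'; apply: H; move: H'; rewrite !inE => /predU1P[->|->]; rewrite ?eqxx ?orbT.
    by apply: H PB; rewrite !inE eqxx orbT.
  have [|a0 wa0 sa] := lpA M i hi ii m0 wm0.
    by move=> x xn; apply/ker; rewrite (hom_act hp) m0E sv.2.
  have wB := vtop_wmod hss hcart hb hhb dv; have sP := submodule_sub (zero_sub B).
  have [|xi [lx _ x1]] := separate sP (v := v); first exact/eqP.
  have [|et set etE] := dual_top hss hcart hb hhb htau wB lx (mu := wt0 z).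
    by move=> be u; apply: (toplev_above hb hhb); exact: (vtop_toplev hss hcart hb hhb dv).
  have [p' hp' pE] := dual_map hcart htau hp; exists (m0 - i a0), (p' et); split=> //; first exact: hom_sing.
  rewrite pE (homB hp) m0E (_ : p (i a0) = 0) ?subr0; last by apply/ker; exists a0.
  by rewrite etE wproj_id//; case: sv.
have [|la B' ls|a [xi [sa sxi xia]]] := IH wA; first by move: zs; rewrite inE eq_sym (negbTE ne).
  by apply: H; rewrite inE ls orbT.
have [_ svz _ uvz] := vtP hD z; have [R hR RE] := uvz _ _ sxi.
have [ro hro roE] := dual_transpose (dual_iso_Dual hcart htau (Delta z)) wA hR.
have lpD := LP_dual hss hcart hb hhb htau (vtP hD z) (dual_iso_Dual hcart htau (Delta z)).
have [g hg gE] := LP_extend ex wM dv (lpD mu) hro.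
have [et etE] : exists et : Dual M, dval et =1 fun m => dval (g m) (vt hD z).
  apply: dval_mk; split=> [c x y|]; first by rewrite hg.1 dval_linl.
  exists [:: wt0 z] => nu m wm; rewrite inE => nn.
  exact: (pair_orth htau dlin dlinl dact (hom_weight hg wm) svz.1 nn).
exists (i a), et; split; first exact: hom_sing.
  split=> [t|x xn]; apply: dval_eq => m; rewrite dval_act !etE (hom_act hg) dval_act (tauK htau).
    by rewrite (svz.1 t) (pairZr dlin) (pairZl dlinl) etE.
  by rewrite svz.2// (pair0r dlin) (pair0l dlinl).
by rewrite etE gE roE RE.
Qed.

(* If no other generator c of the flag satisfies c < z then the generator of weight
   z lifts to a singular vector detected by a singular functional, so T z splits
   off T y; otherwise induct on the length of z. *)
Lemma flag_Br y s : flag (is_verma (h := h) b) (T y) s -> @blk F L h b (T y) -> forall z, wt0 z \in s -> Br b hss hcart y z.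
Proof.
move=> fs by' z zs; have [n ln] := has_len hss hcart hb hhb z.
elim/ltn_ind: n z zs ln => n IH z zs ln.
have [[c [cs cz Bcz]]|nex] := pselect (exists c, [/\ wt0 c \in s, c <> z & Br b hss hcart c z]).
  have [m lm] := has_len hss hcart hb hhb c; have [E|lt] := Br_length Bcz lm ln; first by case: cz.
  exact: Br_trans (IH m lt c cs lm) Bcz.
have H la B : la \in s -> is_verma b la B -> LP b (wt0 z) B.
  move=> las vB; have [c cE] := flag_blk hss hcart hb hhb fs by' las; rewrite cE in las vB.
  have [E|ne] := pselect (c = z); first by rewrite -E; apply: verma_LP_top.
  by apply: (verma_LP vB); apply: (linkage hss hcart hb hhb hD z).2 => Bcz; apply: nex; exists c.
have [a [xi [sa sxi xia]]] := flag_split_pair fs (@T_wmod y) zs H.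
have [f hf fE] := T_hom (@T_LP y) sa.
have lpD := @flag_LP_Dual F L h b tau hss hcart hb hhb htau _ _ fs (@T_wmod y).
have [g hg gE] := T_hom lpD sxi; have [p hp pE] := dual_transpose (hphi z) (@T_wmod y) hg.
have [p1 p2 _ _ _] := hphi z.
have [|r hr rK] := T_split hf hp.
  by apply/eqP => E; have := pE (f (vT z)) (vT z); rewrite E (pair0l p2) gE fE xia => /eqP; rewrite eq_sym oner_eq0.
have [_ [_ ind] _] := hT y.
have sA : submodule (fun v => exists u, f u = v) := submodule_im hf.
have sB : submodule (fun v => r v = 0) := submodule_ker hr.
have rv : r (vT y) != 0.
  have [|v|A0|B0] := ind _ _ sA sB.
  - by move=> _ [u <-]; rewrite rK => ->; rewrite (hom0 hf).
  - exists (f (r v)), (v - f (r v)); split; [by exists (r v)|by rewrite (homB hr) rK subrr|by rewrite addrC subrK].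
  - by have := vT0 z; rewrite -(rK (vT z)) (A0 (f (vT z))) ?(hom0 hr) ?eqxx//; exists (vT z).
  - by apply: contra_neq (vT0 y); apply: B0.
have fv : f (vT z) != 0 by apply: contra_neq (vT0 z) => E; rewrite -(rK (vT z)) E (hom0 hr).
have [[wy _] [wz _]] := (vT_sing y, vT_sing z).
suff -> : y = z by exact: Br0.
apply: (dot_inj hss hcart hb hhb).
have [//|[k kE]] := T_toplev rv (hom_weight hr wy); have [//|[l lE]] := T_toplev fv (hom_weight hf wz).
have /eqP : (k.+1%:R + l.+1%:R : F) = 0 by rewrite -kE -lE; ring.
by rewrite -natrD pnatr_eq0.
Qed.

(** * Generation of the homomorphisms *)

Variables (d : weyl h -> weyl h -> nat) (g : forall x y, 'I_(d x y) -> Delta x -> T y).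
Variable gbar : forall x y, 'I_(d x y) -> T x -> T y.
Hypothesis hsym : forall w (u v : T w), phi u v = phi v u.
Hypothesis hg : forall x y, hom_basis (@g x y).
Hypothesis hgbar : forall x y (i : 'I_(d x y)), is_hom (gbar i) /\ forall v, gbar i (iota v) = g i v.

Lemma comb_ext x y (a : T y) : sing (wt0 x) a -> exists c : 'I_(d x y) -> F, \sum_i c i *: gbar i (vT x) = a.
Proof.
move=> sa; have [_ _ _ uv] := vtP hD x; have [f hf fE] := uv _ _ sa.
have [c [cE _]] := (hg x y).2 f hf; exists c; rewrite -fE cE.
by apply: eq_bigr => i _; rewrite /vT (hgbar i).2.
Qed.

Lemma comb_free x y (c : 'I_(d x y) -> F) : \sum_i c i *: gbar i (vT x) = 0 -> forall i, c i = 0.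
Proof.
move=> c0 i; have [_ _ gv _] := vtP hD x; have [c1 [_ uq]] := (hg x y).2 _ (hom_zero (Delta x) (T y)).
have /(congr1 (fun c : {ffun 'I_(d x y) -> F} => c i)) : [ffun i => c i] = [ffun=> 0].
  rewrite -(uq [ffun=> 0]) ?(uq [ffun i => c i])//; apply/funext => v; last first.
    by rewrite big1// => j _; rewrite ffunE scale0r.
  have hs : is_hom (fun v => \sum_i c i *: g i v).
    apply: hom_sumf => j _; have hz := hom_zero (Delta x) (T y).
    by have := hom_lin (c j) ((hg x y).1 j) hz; congr is_hom; apply/funext => u; rewrite addr0.
  have := gv _ (submodule_ker hs) _ v => H.
  under eq_bigr do rewrite ffunE; apply/esym/H.
  by transitivity (\sum_i c i *: gbar i (vT x)) => //; apply: eq_bigr => j _; rewrite /vT (hgbar j).2.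
by rewrite !ffunE.
Qed.

Lemma gbar_sum_hom x y (c : 'I_(d x y) -> F) : is_hom (fun v => \sum_i c i *: gbar i v).
Proof.
apply: hom_sumf => j _; have hz := hom_zero (T x) (T y).
by have := hom_lin (c j) (hgbar j).1 hz; congr is_hom; apply/funext => u; rewrite addr0.
Qed.

(** With more independent singular vectors than test vectors from [dual_sing_determined], a nonzero
    combination would pair to zero with all of these. Self-duality makes it a singular functional,
    hence zero. *)
Lemma mult_bound x y s : flag (is_verma (h := h) b) (T y) s -> (d x y <= count_mem (wt0 x) s)%N.
Proof.
move=> fs; have [t [<- tP]] := dual_sing_determined (wt0 x) fs (@T_wmod y).
have [e he eE] := dual_emb (hphi y); have [p1 p2 _ p4 _] := hphi y.
have ag i : sing (wt0 x) (gbar i (vT x) : T y) by apply: hom_sing (vT_sing x); exact: (hgbar i).1.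
pose A := \matrix_(i < d x y, j < size t) phi (gbar i (vT x)) t`_j.
rewrite leqNgt; apply/negP => lt.
have : kermx A != 0.
  by rewrite kermx_eq0 /row_free neq_ltn (leq_ltn_trans (rank_leq_col A) lt).
case/rowV0Pn => c /sub_kermxP cA c0; move/eqP: c0; apply; apply/rowP => i; rewrite mxE.
apply: (comb_free (c := fun i => c 0 i)); pose a := \sum_i c 0 i *: gbar i (vT x).
have sa : sing (wt0 x) (a : T y).
  split=> [|z zn]; first by apply: (sub_sum (weight_sub _ _)) => j _; apply: (subZ (weight_sub _ _)); case: (ag j).
  by rewrite act_sumr big1// => j _; rewrite actZr (ag j).2// scaler0.
have ea : e a = 0.
  apply: tP; first exact: hom_sing.
  move=> _ /(nthP 0)[j jt <-]; rewrite eE /a.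
  have -> : phi (\sum_i c 0 i *: gbar i (vT x)) t`_j = \sum_i c 0 i * phi (gbar i (vT x)) t`_j.
    rewrite (big_morph (fun n => phi n t`_j) (id1 := 0) (op1 := +%R)).
    - by apply: eq_bigr => k _; rewrite (pairZl p2).
    - by move=> u v; have := p2 t`_j 1 u v; rewrite scale1r mul1r.
    - exact: (pair0l p2).
  have /rowP/(_ (Ordinal jt)) := cA; rewrite !mxE => cj; rewrite -[RHS]cj.
  by apply: eq_bigr => k _; rewrite mxE.
by apply: p4 => v; rewrite -eE ea (pair0l dlinl) (pair0l p2).
Qed.

Lemma gbar_B0 x y (i : 'I_(d x y)) : @blk F L h b (T y) -> @B0 F L h b T d gbar x y (gbar i).
Proof.
move=> by_; have [s fs] := T_flag y; have le := leq_trans (ltn_ord i) (mult_bound x fs).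
split; last by exists (count_mem (wt0 x) s), i; split=> //; exists s.
apply: (Br_bruhat hb hhb (hss := hss) (hcart := hcart)); apply: (flag_Br fs by_).
by rewrite -has_pred1 has_count (leq_ltn_trans (leq0n i)).
Qed.

Local Notation gen := (generated phi (@B0 F L h b T d gbar)).
Definition lift1 x y (f : T x -> T y) : dsum T [:: x] -> dsum T [:: y] := fun u => (f u.1, 0).
Definition gen1 x y (f : T x -> T y) := gen (lift1 f).

Lemma gen1_zero x y : gen1 (fun _ : T x => 0 : T y).
Proof. exact: (GenZero phi (@B0 F L h b T d gbar) [:: x] [:: y]). Qed.
Lemma gen1_lin x y a (f f' : T x -> T y) : gen1 f -> gen1 f' -> gen1 (fun v => a *: f v + f' v).
Proof.
move=> H H'; have := GenLin a H H'; congr generated; apply/funext => u; congr pair.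
by rewrite -[LHS]/(a *: (0 : @gzero F L) + 0) scaler0 addr0.
Qed.
Lemma gen1_sum x y n (f : 'I_n -> T x -> T y) (c : 'I_n -> F) : (forall i, gen1 (f i)) ->
  gen1 (fun v => \sum_i c i *: f i v).
Proof.
move=> H; suff : forall r : seq 'I_n, gen1 (fun v => \sum_(i <- r) c i *: f i v) by apply.
elim=> [|i r IH]; first by have := gen1_zero x y; congr gen1; apply/funext => v; rewrite big_nil.
by have := gen1_lin (c i) (H i) IH; congr gen1; apply/funext => v; rewrite big_cons.
Qed.
Lemma gen1_comp x y z (f : T x -> T y) (f' : T y -> T z) : gen1 f -> gen1 f' -> gen1 (f' \o f).
Proof. by move=> H H'; exact: (GenComp H H'). Qed.
Lemma gen1_gbar x y (i : 'I_(d x y)) : @blk F L h b (T y) -> gen1 (gbar i).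
Proof. by move=> H; apply: GenBase; apply: gbar_B0. Qed.
Lemma gen1_dual x y (f : T x -> T y) (f' : T y -> T x) : is_hom f' -> (forall u v, phi (f' u) v = phi u (f v)) ->
  gen1 f -> gen1 f'.
Proof.
move=> hf' E H; apply: (GenDual _ _ H).
  by split=> [c u v|a u]; congr pair; rewrite /= ?hf'.1 ?(hom_act hf')// scaler0 addr0.
by move=> u v; congr (_ + _); exact: E.
Qed.

Section Homs.
Variables (x y : weyl h) (kk : weyl h -> nat).
Hypotheses (bx : @blk F L h b (T x)) (by_ : @blk F L h b (T y)).
Hypothesis kkE : forall w, (wt0 w tt0 : F) = - (kk w)%:R.
Definition vanish (f : T x -> T y) (z : weyl h) := forall q, weight_vec (wt0 z) q -> f q = 0.

(** A weight vector of maximal level in the image is singular, so the block condition identifies its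
    weight. This is why vanishing on the weights $z\cdot0$ is enough. *)
Lemma hom_top (f : T x -> T y) q0 : is_hom f -> f q0 != 0 -> exists z, ~ vanish f z /\
  forall nu q, weight_vec nu q -> f q != 0 -> exists k : nat, (wt0 z tt0 : F) - (nu tt0 : F) = k%:R.
Proof.
move=> hf f0; have lev nu (v : T y) : v != 0 -> weight_vec nu v -> exists k : nat, (wt0 y tt0 : F) - (nu tt0 : F) = k%:R.
  by move=> v0 wv; have [->|[k kE]] := T_toplev v0 wv; [exists 0%N; rewrite subrr|exists k.+1].
have [|nu [u [k [[q qE] u0 su kE kmin]]]] := top_singular hb hhb (submodule_im hf) (@T_wmod y) lev.
  by exists (f q0) => //; exists q0.
have [z zE] := blk_sing hss hcart hb hhb by_ u0 su; rewrite zE in su; exists z; split.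
  move=> vz; move: u0; rewrite -(wproj_id (@T_wmod y) su.1) -qE -(wproj_hom (@T_wmod x) _ _ _ hf).
  by rewrite vz ?eqxx//; apply: wproj_wt.
move=> nu' q' wq' f'0; have wf := hom_weight hf wq'; have [k' k'E] := lev _ _ f'0 wf.
have le := kmin _ _ _ (ex_intro _ q' erefl) f'0 wf k'E; exists (k' - k)%N.
by rewrite natrB// -kE -k'E zE; ring.
Qed.

(* On the weight space of z the map f is q |-> sum_i phi q a_i (g_i v) for singular
   vectors a_i, and q |-> phi q a_i is realised by the dual of the extension of a_i. *)
Lemma hom_reduce (f : T x -> T y) z : is_hom f -> (forall z', (kk z' < kk z)%N -> vanish f z') ->
  exists f0 : T x -> T y, [/\ is_hom f0, gen1 f0, vanish (fun q => f q - f0 q) z &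
    forall z', (kk z' <= kk z)%N -> z' <> z -> vanish f0 z'].
Proof.
move=> hf low; have [p1 p2 p3 p4 p5] := hphi x; have lr n := (p1 n).1.
(* The hypothesis speaks only of weights $z'\cdot0$; [hom_top] extends the vanishing to
   $z\cdot0+\beta$ for every positive root. *)
have above be q : pos_root b be -> weight_vec (be + wt0 z) q -> f q = 0.
  move=> pb wq; apply/eqP; apply: contrapT => /negP f0.
  have [z' [nv H]] := hom_top hf f0; have [k] := H _ _ wq f0; have [m mE] := pos_tt0 pb.
  have -> : ((be + wt0 z) tt0 : F) = be tt0 + (wt0 z) tt0 := evD _ _ _.
  rewrite !kkE mE => E; apply: nv; apply: low.
  have : ((kk z)%:R : F) = (k + m.+1 + kk z')%:R by rewrite !natrD -E; ring.
  by move/eqP; rewrite eqr_nat => /eqP ->; lia.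
have sf q : weight_vec (wt0 z) q -> sing (wt0 z) (f q).
  move=> wq; apply: (singularP hss hcart hb hhb (hom_weight hf wq)) => be a pb ra.
  by rewrite -(hom_act hf); apply: (above be) => //; apply: weight_act.
pose wz := wproj (@T_wmod x) (wt0 z).
have /choice[c cP] q : exists c : 'I_(d z y) -> F, \sum_i c i *: gbar i (vT z) = f (wz q).
  by apply: comb_ext; apply: sf; apply: wproj_wt.
have clin i : linear_for *%R (fun q => c q i).
  move=> e q q'; apply/eqP; rewrite -subr_eq0; apply/eqP.
  apply: (comb_free (c := fun i => c (e *: q + q') i - (e * c q i + c q' i))).
  under eq_bigr do rewrite scalerBl scalerDl -scalerA.
  by rewrite sumrB big_split -scaler_sumr /= !cP /wz wproj_lin hf.1 subrr.
have c0 q : f (wz q) = 0 -> forall i, c q i = 0 by move=> E; apply: comb_free; rewrite cP.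
have cwz q i : c (wz q) i = c q i.
  apply/eqP; rewrite -subr_eq0; apply/eqP.
  apply: (comb_free (c := fun i => c (wz q) i - c q i)); under eq_bigr do rewrite scalerBl.
  by rewrite sumrB !cP /wz (wproj_id _ (wproj_wt _ _ _)) subrr.
have c00 i : c 0 i = 0 by apply: (addrI (c 0 i)); have := clin i 1 0 0; rewrite scale1r mul1r !addr0.
have cZ e q i : c (e *: q) i = e * c q i by have := clin i e q 0; rewrite c00 !addr0.
have wz0 nu q : weight_vec nu q -> nu != wt0 z -> forall i, c q i = 0.
  by move=> wq ne; apply: c0; rewrite /wz (wprojE _ _ wq) (negbTE ne) (hom0 hf).
have /choice[a aP] i : exists a, phi a =1 fun q => c q i.
  by apply: p5; split=> //; exists [:: wt0 z] => nu q wq; rewrite inE => ne; apply: wz0 wq ne i.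
have sa i : sing (wt0 z) (a i).
  have wa : weight_vec (wt0 z) (a i).
    move=> t; apply: p4 => q; rewrite p3 (tau_h htau) (pairZl p2) !aP.
    by rewrite -cwz /wz wproj_h cZ -/wz cwz.
  apply: (singularP hss hcart hb hhb wa) => be r pb rr; apply: p4 => q.
  rewrite p3 (pair0l p2); move: q; apply: (wmod_ind (@T_wmod x)) => [|nu q wq].
    by split=> [|e q q' E E']; rewrite ?act0r ?(pair0r lr)// actDr actZr lr E E' mulr0 addr0.
  rewrite aP; have wq' := weight_act (tau_root htau rr) wq.
  have [E|ne] := eqVneq (- be + nu) (wt0 z); last exact: wz0 wq' ne i.
  apply: c0; rewrite /wz wproj_id ?(hom_act hf); last by rewrite -E.
  by rewrite (above be q) ?act0r// -E addrA subrr add0r.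
have /choice[e eP] i : exists e : 'I_(d z x) -> F, \sum_j e j *: gbar j (vT z) = a i by apply: comb_ext.
pose G i v := \sum_j e i j *: gbar j v.
have hG i : is_hom (G i) by apply: gbar_sum_hom.
have gG i : gen1 (G i) by apply: gen1_sum => j; apply: gen1_gbar.
have /choice[D DP] i : exists D : T x -> T z, is_hom D /\ forall u v, phi (D u) v = phi u (G i v).
  by have [D hD' DE] := dagger (hG i); exists D.
(* Multiplying by $\phi(v_z,v_z)$, instead of dividing somewhere, avoids having to know that this
   scalar is nonzero. *)
pose f0 q := \sum_i phi (vT z) (vT z) *: gbar i (D i q).
exists f0; split.
- apply: hom_sumf => i _; have hz := hom_zero (T x) (T y).
  have := hom_lin (phi (vT z) (vT z)) (hom_comp (DP i).1 (hgbar i).1) hz; congr is_hom.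
  by apply/funext => u; rewrite addr0.
- apply: gen1_sum => i; apply: (@gen1_comp x z y (D i) (gbar i)); last exact: gen1_gbar.
  by apply: gen1_dual (gG i); case: (DP i).
- move=> q wq; rewrite -[q in f q](wproj_id (@T_wmod x) wq) -cP -sumrB big1// => i _.
  have [k kE] := T_top (hom_weight (DP i).1 wq); rewrite kE (homZ (hgbar i).1) scalerA -scalerBl.
  suff -> : c q i = phi (vT z) (vT z) * k by rewrite subrr scale0r.
  have [q1 q2 _ _ _] := hphi z.
  by rewrite -aP hsym -(eP i) -/(G i (vT z)) -(DP i).2 kE (pairZl q2) mulrC.
(* The map passes through [T z], whose weights are [wt0 z] and weights of strictly lower level. *)
move=> z' le ne q wq; rewrite /f0 big1// => i _; rewrite (_ : D i q = 0) ?(hom0 (hgbar i).1) ?scaler0//.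
apply/eqP; apply: contraT => D0; have wD := hom_weight (DP i).1 wq.
have [E|[k]] := T_toplev D0 wD; first by case: ne; apply: (dot_inj hss hcart hb hhb).
rewrite !kkE opprK addrC => /eqP; rewrite subr_eq -natrD eqr_nat => /eqP E.
by move: le; rewrite E; lia.
Qed.
(** The outer induction raises the depth [n] above which [f] vanishes, up to a bound for the
    finitely many weights $z\cdot0$. The inner one runs through the weights of depth [n]; treating
    one of them leaves the others of depth at most [n] unchanged. *)
Lemma hom_generated (f : T x -> T y) : is_hom f -> gen1 f.
Proof.
have [l lP] := dot_finite hss hcart hb hhb.
have [n0 NP] : exists n0, forall z : weyl h, (kk z < n0)%N.
  suff [n0 NP] : exists n0, forall z : weyl h, wt0 z \in l -> (kk z < n0)%N by exists n0 => z; apply: NP.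
  elim: {lP} l => [|la l [n0 NP]]; first by exists 0%N.
  have [[z zE]|nex] := pselect (exists z : weyl h, wt0 z = la); last first.
    by exists n0 => z; rewrite inE => /predU1P[E|/NP//]; case: nex; exists z.
  exists (maxn n0 (kk z).+1) => z'; rewrite leq_max inE -zE => /predU1P[/(dot_inj hss hcart hb hhb) ->|/NP ->//].
  by rewrite ltnSn orbT.
suff H j n : (n + j)%N = n0 -> forall f, is_hom f -> (forall z, (kk z < n)%N -> vanish f z) -> gen1 f.
  by move=> hf; apply: (H n0 0%N) => // z; rewrite ltn0.
elim: j n {f} => [|j IH] n nj f hf low.
  have f0 q : f q = 0.
    apply/eqP; apply: contrapT => /negP fq; have [z [nv _]] := hom_top hf fq.
    by apply: nv; apply: low; rewrite -nj addn0 in NP; apply: NP.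
  by have := gen1_zero x y; congr gen1; apply/funext => q; rewrite f0.
suff K (r : seq hd) : forall f, is_hom f -> (forall z, (kk z < n)%N -> vanish f z) ->
    (forall z, kk z = n -> wt0 z \notin r -> vanish f z) -> gen1 f.
  by apply: (K l) => // z _; rewrite lP.
elim: r {f hf low} => [|la r IHr] f hf low Hr.
  apply: (IH n.+1) => //; first by rewrite addSnnS.
  by move=> z; rewrite ltnS leq_eqVlt => /predU1P[E|]; [apply: Hr|apply: low].
have [[z zn zE]|nex] := pselect (exists2 z : weyl h, kk z = n & wt0 z = la); last first.
  apply: IHr => // z zn zr; apply: Hr => //; rewrite inE negb_or zr andbT.
  by apply/eqP => E; apply: nex; exists z.
have [|f0 [hf0 gf0 v0 vz]] := hom_reduce hf (z := z); first by move=> z'; rewrite zn; apply: low.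
have hf1 := hom_lin (-1) hf0 hf.
have gf1 : gen1 (fun v => (-1) *: f0 v + f v).
  apply: IHr => // [z' lt q wq|z' E nr q wq].
    have zz : z' <> z by move=> zz; rewrite zz zn ltnn in lt.
    rewrite (low z' lt q wq) (vz z' _ zz q wq) ?scaler0 ?addr0//; rewrite zn; exact: ltnW.
  have [zz|zz] := pselect (z' = z).
    by rewrite zz in wq; have := v0 q wq; rewrite scaleN1r addrC.
  rewrite (vz z' _ zz q wq) ?zn ?E// scaler0 add0r; apply: (Hr z') => //.
  rewrite inE negb_or nr andbT; apply/eqP => E2; apply: zz; apply: (dot_inj hss hcart hb hhb).
  by rewrite E2.
have := gen1_lin 1 gf0 gf1; congr gen1; apply/funext => v; lmod F.
Qed.
End Homs.

Local Notation dblk s := (@blk F L h b (dsum T s)).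

Lemma inl_hom M N : is_hom (fun u : M => (u, 0) : gprod M N).
Proof. by split=> [c u v|a u]; congr pair; rewrite /= ?scaler0 ?addr0 ?act0r. Qed.
Lemma inr_hom M N : is_hom (fun u : N => (0, u) : gprod M N).
Proof. by split=> [c u v|a u]; congr pair; rewrite /= ?scaler0 ?addr0 ?act0r. Qed.
Lemma fst_hom M N : is_hom (fun u : gprod M N => u.1). Proof. by []. Qed.
Lemma snd_hom M N : is_hom (fun u : gprod M N => u.2). Proof. by []. Qed.

Lemma dblk_cons x s : dblk (x :: s) -> @blk F L h b (T x) /\ dblk s.
Proof.
move=> H; split.
  by apply: (@blk_sub F L h b _ _ _ (inl_hom (T x) (dsum T s)) _ H) => u v [].
by apply: (@blk_sub F L h b _ _ _ (inr_hom (T x) (dsum T s)) _ H) => u v [].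
Qed.

Lemma gzero0 (u : @gzero F L) : u = 0. Proof. by apply/matrixP => i []. Qed.

Lemma hom_gen1 x y (f : T x -> T y) : @blk F L h b (T x) -> @blk F L h b (T y) -> is_hom f -> gen1 f.
Proof.
move=> bx by_ hf; have /choice[kk kkE] w : exists k : nat, (wt0 w tt0 : F) = - k%:R.
  by have [k [kE _]] := dot_level hss hcart hb hhb w; exists k.
exact: hom_generated bx by_ kkE _ hf.
Qed.

Lemma gen_id1 x : @blk F L h b (T x) -> gen (fun u : dsum T [:: x] => u).
Proof.
move=> bx; have := hom_gen1 bx bx (hom_id (T x)); congr generated; apply/funext => -[u1 u2].
by rewrite (gzero0 u2).
Qed.

(** Identities are not among the constructors of [generated]. They are needed to build the
    inclusions and projections of direct sums. *)
Lemma gen_id s : dblk s -> gen (fun u : dsum T s => u).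
Proof.
elim: s => [_|x s IH /dblk_cons[bx bs]].
  by have := GenZero phi (@B0 F L h b T d gbar) [::] [::]; congr generated; apply/funext => u; rewrite (gzero0 u).
by have := GenSum (gen_id1 bx) (IH bs); congr generated; apply/funext => -[u1 u2].
Qed.

(** The inclusion of a summand is an identity summed with the zero map out of the empty sum. *)
Lemma gen_col x t (f : dsum T [:: x] -> dsum T t) : @blk F L h b (T x) -> dblk t -> is_hom f -> gen f.
Proof.
move=> bx; elim: t f => [|y t IH] f; first move=> _ hf.
  by have := GenZero phi (@B0 F L h b T d gbar) [:: x] [::]; congr generated; apply/funext => u; rewrite (gzero0 (f u)).
move=> /dblk_cons[by_ bt] hf.
have hf1 := hom_comp (hom_comp (inl_hom (T x) gzero) hf) (fst_hom (T y) (dsum T t)).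
have hf2 := hom_comp hf (snd_hom (T y) (dsum T t)).
have in1 := GenSum (gen_id1 by_) (GenZero phi (@B0 F L h b T d gbar) [::] t).
have in2 := GenSum (GenZero phi (@B0 F L h b T d gbar) [::] [:: y]) (gen_id bt).
have := GenLin 1 (GenComp (hom_gen1 bx by_ hf1) in1) (GenComp (IH _ bt hf2) in2).
congr generated; apply/funext => -[u1 u2]; rewrite (gzero0 u2) scale1r.
rewrite [RHS]surjective_pairing; congr pair; [exact: addr0|exact: add0r].
Qed.

Lemma gen_hom s t (f : dsum T s -> dsum T t) : dblk s -> dblk t -> is_hom f -> gen f.
Proof.
elim: s f => [|x s IH] f; first move=> _ _ hf.
  by have := GenZero phi (@B0 F L h b T d gbar) [::] t; congr generated; apply/funext => u; rewrite (gzero0 u) (hom0 hf).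
move=> /dblk_cons[bx bs] bt hf.
have pr1 := GenSum (gen_id1 bx) (GenZero phi (@B0 F L h b T d gbar) s [::]).
have pr2 := GenSum (GenZero phi (@B0 F L h b T d gbar) [:: x] [::]) (gen_id bs).
have hf1 := hom_comp (hom_comp (fst_hom (T x) gzero) (inl_hom (T x) (dsum T s))) hf.
have hf2 := hom_comp (inr_hom (T x) (dsum T s)) hf.
have := GenLin 1 (GenComp pr1 (gen_col bx bt hf1)) (GenComp pr2 (IH _ bs bt hf2)).
congr generated; apply/funext => -[u1 u2]; rewrite scale1r -(homD hf); congr f.
by congr pair; [exact: addr0|exact: add0r].
Qed.

(** The block condition reaches the summands [T w] through the isomorphisms [a] and [c]. *)
Theorem tilting0_generated (Q P : gmod L) (f : Q -> P) : tilting0 h b tau Q -> tilting0 h b tau P -> is_hom f ->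
  forall s t (a : Q -> dsum T s) (c : P -> dsum T t), is_iso a -> is_iso c ->
  exists2 f' : dsum T s -> dsum T t, gen f' & forall v, c (f v) = f' (a v).
Proof.
move=> [_ [_ bQ]] [_ [_ bP]] hf s t a c [ha [a' aK a'K]] [hc [c' cK c'K]].
have ha' : is_hom a'.
  split=> [e u v|x u]; apply: (can_inj aK); first by rewrite ha.1 !a'K.
  by rewrite (hom_act ha) !a'K.
have hc' : is_hom c'.
  split=> [e u v|x u]; apply: (can_inj cK); first by rewrite hc.1 !c'K.
  by rewrite (hom_act hc) !c'K.
exists (c \o (f \o a')); last by move=> v; rewrite /= aK.
apply: gen_hom; last exact: hom_comp (hom_comp ha' hf) hc.
  exact: blk_sub ha' (can_inj a'K) bQ.
exact: blk_sub hc' (can_inj c'K) bP.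
Qed.
End TiltingModules.

Theorem theorem3p1 (R : realType) (L : lieAlgebra R[i]) (h b : {vspace L})
  (tau : L -> L)
  (Delta T : weyl h -> gmod L)
  (iota : forall w, Delta w -> T w)
  (phi : forall w, T w -> T w -> R[i])
  (d : weyl h -> weyl h -> nat)
  (g : forall x y, 'I_(d x y) -> Delta x -> T y)
  (gbar : forall x y, 'I_(d x y) -> T x -> T y) :
  semisimple L -> cartan h -> borel b -> (h <= b)%VS -> transposition h tau ->
  (forall w : weyl h, is_verma b (dot b w 0) (Delta w)) ->
  (forall w : weyl h, [/\ tilting h b tau (T w), indecomposable (T w)
               & has_highest_weight b (T w) (dot b w 0)]) ->
  (forall w, is_hom (iota w) /\ injective (iota w)) ->
  (forall w, dual_iso h tau (phi w)) ->
  (forall w (u v : T w), phi w u v = phi w v u) ->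
  (forall x y, hom_basis (g x y)) ->
  (forall x y (i : 'I_(d x y)), is_hom (gbar x y i) /\
     forall v, gbar x y i (iota x v) = g x y i v) ->
  (forall x (i : 'I_(d x x)), gbar x x i = id) ->
  (forall Q, tilting0 h b tau Q ->
     exists s (a : Q -> dsum T s), is_iso a) /\
  (forall (Q P : gmod L) (f : Q -> P),
     tilting0 h b tau Q -> tilting0 h b tau P -> is_hom f ->
     forall s t (a : Q -> dsum T s) (c : P -> dsum T t), is_iso a -> is_iso c ->
     exists2 f' : dsum T s -> dsum T t,
       generated phi (@B0 _ _ _ b T d gbar) f' &
       forall v, c (f v) = f' (a v)).
Proof.
move=> hss hcart hb hhb htau hD hT hiota hphi hsym hg hgbar _; split.
  exact: (@tilting0_dsum R[i] L h b tau Delta T iota phi hss hcart hb hhb htau hD hT hiota hphi).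
exact: (@tilting0_generated R[i] L h b tau Delta T iota phi hss hcart hb hhb htau hD hT hiota hphi d g gbar hsym hg hgbar).
Qed.
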